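(* Let $(\mathcal{X},\rho,\mu)$, $L$, $(\lambda_j,u_j)_{j\ge1}$ and $d$ be as in the compact Dirichlet space setting described in the context. Let $\mu_0$ be a probability measure on $\mathcal{X}$ with density $p_0$ w.r.t. $\mu$ such that for every $J\ge1$, $p_-\|v\|^2\le v^T\Sigma^{(J)}v\le p_+\|v\|^2$ for all $v\in\mathbb{R}^J$, where $\Sigma^{(J)}_{jk}=\int u_ju_kp_0\,d\mu$ and $0<p_-\le p_+$ are fixed (e.g. $p_0$ bounded above and below by positive constants). Let $f_0$ be uniformly continuous, bounded, and in $B^s_{\infty\infty}$ for some $s>0$. Data: $Y_i=f_0(X_i)+\varepsilon_i$, $i\le n$, $X_i$ i.i.d. $\mu_0$, $\varepsilon_i$ i.i.d. $\mathcal{N}(0,\sigma^2)$ independent; law $\mathbb{P}_0$, expectation $\mathbb{E}_0$. Prior $\Pi$: $t\sim\pi_1$ on $(0,\infty)$ with Lebesgue density satisfying $c_1t^{-a}e^{-t^{-d/2}\ln^{1+d/2}(1/t)}\le\pi_1(t)\le c_2t^{-a}e^{-t^{-d/2}\ln^{1+d/2}(1/t)}$ for some $c_1,c_2,a>0$; given $t$, $f$ is a centered Gaussian process on $\mathcal{X}$ with covariance kernel $k_t(x,y)=\sum_{j\ge1}e^{-t\lambda_j}u_j(x)u_j(y)$. Posterior: $\Pi[df\mid\mathbb{X}^n]\propto\prod_i\exp(-(Y_i-f(X_i))^2/2\sigma^2)\Pi[df]$. Then for $M>0$ large enough, \[\mathbb{E}_0\Pi\big[\|f-f_0\|_{L^2(\mu_0)}>M\varepsilon_n\mid\mathbb{X}^n\big]\to0,\qquad\varepsilon_n=\Big(\frac{\ln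 n}{n}\Big)^{\frac{s}{2s+d}}.\]
   Context: Compact Dirichlet space setting: $(\mathcal{X},\rho)$ compact metric space, $\mu$ a Borel measure, $C,c,d>0$ with $cr^d\le\mu(B(x,r))\le Cr^d$ for $x\in\mathcal{X}$, $0<r\le1$; $L$ self-adjoint positive on a dense domain of $L^2(\mu)$ with $e^{-tL}f=\int p_t(\cdot,y)f(y)\mu(dy)$, kernels satisfying for $0<t\le1$: $p_t(x,y)\le C e^{-c\rho(x,y)^2/t}/\sqrt{\mu(B(x,\sqrt t))\mu(B(y,\sqrt t))}$; for some $\eta>0$ and $\rho(y,y')\le\sqrt t$, $|p_t(x,y)-p_t(x,y')|\le C(\rho(y,y')/\sqrt t)^\eta e^{-c\rho(x,y)^2/t}/\sqrt{\mu(B(x,\sqrt t))\mu(B(y,\sqrt t))}$; and $\int p_t(x,y)\mu(dy)=1$ for all $x$, $t>0$. Then $L$ has discrete spectrum $0\le\lambda_1\le\lambda_2\le\cdots$ (with multiplicity) with an orthonormal eigenbasis $(u_j)$ of $L^2(\mu)$. Besov space $B^s_{\infty\infty}$: fix $\varphi_0,\varphi\in C^\infty([0,\infty))$ with $\mathrm{supp}\,\varphi_0\subset[0,2]$, $\varphi_0^{(\nu)}(0)=0$ for $\nu\ge1$, $|\varphi_0|\ge c>0$ on $[0,2^{3/4}]$, $\mathrm{supp}\,\varphi\subset[1/2,2]$, $|\varphi|\ge c>0$ on $[2^{-3/4},2^{3/4}]$; set $\varphi_j=\varphi(2^{-j}\cdot)$ for $j\ge1$ and $\varphi_j(\sqrt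 L)f=\sum_k\varphi_j(\sqrt{\lambda_k})\langle u_k,f\rangle u_k$. $B^s_{\infty\infty}$ is the space of uniformly continuous bounded $f$ with $\sup_{j\ge0}2^{sj}\|\varphi_j(\sqrt L)f\|_\infty<\infty$ (independent of the choice of $\varphi_0,\varphi$ up to norm equivalence). *)

(* Defs.v *)
From HB Require Import structures.
From mathcomp Require Import all_boot all_order all_algebra.
From mathcomp Require Import all_classical all_reals all_analysis.
Set Implicit Arguments. Unset Strict Implicit. Unset Printing Implicit Defensive.
Import Order.TTheory GRing.Theory Num.Theory.
Import numFieldNormedType.Exports.
Local Open Scope classical_set_scope.
Local Open Scope ring_scope.

Section Defs.
Context {R : realType} {dX : measure_display} {X : measurableType dX}.
Implicit Types (rho : X -> X -> R) (mu : {measure set X -> \bar R}).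

Definition is_metric rho : Prop :=
  [/\ forall x y, 0 <= rho x y, forall x y, rho x y = 0 <-> x = y,
      forall x y, rho x y = rho y x
    & forall x y z, rho x z <= rho x y + rho y z].

Definition rball rho (x : X) (r : R) : set X := [set y | rho x y < r].

Definition ropen rho (A : set X) : Prop :=
  forall x, A x -> exists2 r : R, 0 < r & rball rho x r `<=` A.

Definition rcompact rho : Prop :=
  forall u : nat -> X, exists phi : nat -> nat,
    (forall n, (phi n < phi n.+1)%N) /\
    exists x, (fun n => rho (u (phi n)) x) @ \oo --> (0 : R).

Definition rborel rho : Prop :=
  (@measurable _ X) = smallest (sigma_algebra setT) (ropen rho).

Definition ip mu (f g : X -> R) : \bar R := (\int[mu]_x (f x * g x)%:E)%E.

Definition L2 mu (f : X -> R) : Prop :=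
  measurable_fun setT f /\ mu.-integrable setT (fun x => (f x ^+ 2)%:E).

(** (lam_j, u_j)_j : nondecreasing nonnegative eigenvalues with an
    orthonormal eigenbasis of L^2(mu) (index j = 0 is the paper's j = 1) *)
Definition eigen_system mu (lam : nat -> R) (u : nat -> X -> R) : Prop :=
  [/\ forall j, 0 <= lam j,
      forall j, lam j <= lam j.+1,
      forall j, L2 mu (u j),
      forall j k, ip mu (u j) (u k) = (j == k)%:R%:E
    & forall f, L2 mu f ->
        (fun N => \int[mu]_x ((f x - \sum_(j < N) fine (ip mu (u j) f) * u j x) ^+ 2)%:E)%E
          @ \oo --> 0%E].

Definition ahlfors rho mu (C c d : R) : Prop :=
  forall x r, 0 < r <= 1 ->
    ((c * r `^ d)%:E <= mu (rball rho x r) <= (C * r `^ d)%:E)%E.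

Definition vol2 rho mu (t : R) (x y : X) : R :=
  Num.sqrt (fine (mu (rball rho x (Num.sqrt t))) * fine (mu (rball rho y (Num.sqrt t)))).

(** p is the kernel of the heat semigroup e^{-tL} = sum_j e^{-t lam_j} <u_j,.> u_j,
    with Gaussian upper bound, Hoelder continuity and conservativeness *)
Definition heat_kernel rho mu (lam : nat -> R) (u : nat -> X -> R)
    (p : R -> X -> X -> R) (C c eta : R) : Prop :=
  [/\ forall t x, 0 < t -> measurable_fun setT (p t x),
      forall t j, 0 < t ->
        ({ae mu, forall x, (\int[mu]_y (p t x y * u j y)%:E = (expR (- (t * lam j)) * u j x)%:E)%E}),
      forall t x y, 0 < t <= 1 ->
        p t x y <= C * expR (- (c * rho x y ^+ 2 / t)) / vol2 rho mu t x y,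
      forall t x y y', 0 < t <= 1 -> rho y y' <= Num.sqrt t ->
        `|p t x y - p t x y'| <=
          C * (rho y y' / Num.sqrt t) `^ eta * expR (- (c * rho x y ^+ 2 / t)) / vol2 rho mu t x y
    & forall t x, 0 < t -> (\int[mu]_y (p t x y)%:E = 1)%E].

Definition dirichlet_setting rho mu (C c d : R) (lam : nat -> R) (u : nat -> X -> R)
    (p : R -> X -> X -> R) (eta : R) : Prop :=
  [/\ [/\ is_metric rho, rcompact rho & rborel rho],
      [/\ 0 < C, 0 < c, 0 < d & 0 < eta],
      ahlfors rho mu C c d,
      eigen_system mu lam u
    & heat_kernel rho mu lam u p C c eta].

Definition unif_cont rho (f : X -> R) : Prop :=
  forall e : R, 0 < e -> exists2 del : R, 0 < del &
    forall x y, rho x y < del -> `|f x - f y| < e.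

Definition bounded_fun (f : X -> R) : Prop := exists B : R, forall x, `|f x| <= B.

End Defs.

Definition smooth {R : realType} (g : R -> R) : Prop :=
  forall n x, derivable (derive1n n g) x 1.

Definition LP_admissible {R : realType} (phi0 phi : R -> R) : Prop :=
  [/\ smooth phi0 /\ smooth phi,
      (forall x, 0 <= x -> 2 < x -> phi0 x = 0) /\
      (forall nu, (0 < nu)%N -> derive1n nu phi0 0 = 0),
      (exists2 c : R, 0 < c & forall x, 0 <= x <= 2 `^ (3 / 4) -> c <= `|phi0 x|),
      (forall x, 0 <= x -> x < 2^-1 \/ 2 < x -> phi x = 0)
    & (exists2 c : R, 0 < c &
         forall x, 2 `^ (- (3 / 4)) <= x <= 2 `^ (3 / 4) -> c <= `|phi x|)].

Definition LP_fun {R : realType} (phi0 phi : R -> R) (j : nat) : R -> R :=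
  if j is 0 then phi0 else fun x => phi (x / 2 ^+ j).

(** partial sums of phi(sqrt L) f = sum_k phi(sqrt lam_k) <u_k, f> u_k *)
Definition spec_partial {R : realType} {dX} {X : measurableType dX}
    (mu : {measure set X -> \bar R}) (lam : nat -> R) (u : nat -> X -> R)
    (g : R -> R) (f : X -> R) (x : X) (N : nat) : R :=
  \sum_(k < N) g (Num.sqrt (lam k)) * fine (ip mu (u k) f) * u k x.

Definition besov {R : realType} {dX} {X : measurableType dX} (rho : X -> X -> R)
    (mu : {measure set X -> \bar R}) (lam : nat -> R) (u : nat -> X -> R)
    (s : R) (f : X -> R) : Prop :=
  [/\ unif_cont rho f, bounded_fun f &
    exists phi0 phi, LP_admissible phi0 phi /\
    exists B : R, forall j : nat, {ae mu, forall x, exists v : R,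
      spec_partial mu lam u (LP_fun phi0 phi j) f x @ \oo --> v /\
      `|v| <= B * 2 `^ (- (s * j%:R))}].

Definition gauss_law {R : realType} (v : R) (A : set R) : \bar R :=
  if v == 0 then (\1_A 0 : R)%:E else normal_prob 0 (Num.sqrt v) A.

Definition heat_cov {R : realType} {X : Type} (lam : nat -> R) (u : nat -> X -> R)
    (t : R) (x y : X) : R :=
  limn (fun N => \sum_(j < N) expR (- (t * lam j)) * u j x * u j y).

Definition centered_GP {R : realType} {dO dX} {Om : measurableType dO}
    {X : measurableType dX} (P : probability Om R) (W : Om -> X -> R)
    (k : X -> X -> R) : Prop :=
  measurable_fun setT (fun z : Om * X => W z.1 z.2) /\
  forall (m : nat) (xs : 'I_m -> X) (a : 'I_m -> R) (A : set R), measurable A ->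
    P [set om | A (\sum_(i < m) a i * W om (xs i))] =
    gauss_law (\sum_(i < m) \sum_(l < m) a i * a l * k (xs i) (xs l)) A.

Definition lik {R : realType} {X : Type} (sigma : R) (f : X -> R) (data : seq (X * R)) : R :=
  \prod_(z <- data) expR (- ((z.2 - f z.1) ^+ 2 / (2 * sigma ^+ 2))).

Definition prior_int {R : realType} {dO} {Om : measurableType dO} {X : Type}
    (pi1 : R -> R) (P : probability Om R) (W : R -> Om -> X -> R)
    (G : (X -> R) -> \bar R) : \bar R :=
  (\int[@lebesgue_measure R]_(t in [set t : R | (0 < t)%R]) ((pi1 t)%:E * \int[P]_om G (W t om)))%E.

Definition posterior {R : realType} {dO} {Om : measurableType dO} {X : Type}
    (pi1 : R -> R) (P : probability Om R) (W : R -> Om -> X -> R) (sigma : R)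
    (B : (X -> R) -> Prop) (data : seq (X * R)) : R :=
  fine (prior_int pi1 P W (fun f => ((\1_B f : R) * lik sigma f data)%:E)) /
  fine (prior_int pi1 P W (fun f => (lik sigma f data)%:E)).

Fixpoint E0 {R : realType} {dX} {X : measurableType dX} (mu0 : probability X R)
    (f0 : X -> R) (sigma : R) (n : nat) (G : seq (X * R) -> R) : \bar R :=
  match n with
  | 0 => (G [::])%:E
  | n'.+1 => (\int[mu0]_x \int[@lebesgue_measure R]_e
      ((normal_pdf 0 sigma e)%:E *
        E0 mu0 f0 sigma n' (fun s => G ((x, (f0 x + e)%R) :: s))))%E
  end.

Definition design_density {R : realType} {dX} {X : measurableType dX}
    (mu : {measure set X -> \bar R}) (u : nat -> X -> R) (mu0 : probability X R)
    (p0 : X -> R) (pm pp : R) : Prop :=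
  [/\ measurable_fun setT p0, forall x, 0 <= p0 x,
      forall A, measurable A -> mu0 A = (\int[mu]_(x in A) (p0 x)%:E)%E,
      0 < pm <= pp
    & forall (J : nat) (v : 'I_J -> R),
        pm * \sum_(j < J) v j ^+ 2 <=
          \sum_(j < J) \sum_(k < J) v j * v k *
            fine (\int[mu]_x (u j x * u k x * p0 x)%:E)%E
        <= pp * \sum_(j < J) v j ^+ 2].

Definition prior_density {R : realType} (d : R) (pi1 : R -> R) (c1 c2 a : R) : Prop :=
  [/\ measurable_fun setT pi1, forall t, 0 < t -> 0 <= pi1 t,
      (\int[@lebesgue_measure R]_(t in [set t : R | (0 < t)%R]) (pi1 t)%:E = 1)%E,
      0 < c1 /\ 0 < c2 /\ 0 < a
    & forall t, 0 < t < 1 ->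
        let w := t `^ (- a) * expR (- (t `^ (- (d / 2)) * (ln (t^-1)) `^ (1 + d / 2))) in
        c1 * w <= pi1 t <= c2 * w].

Definition rate {R : realType} (s d : R) (n : nat) : R :=
  (ln (n%:R : R) / n%:R) `^ (s / (2 * s + d)).

(* Main.v *)
Require Import Defs.
From HB Require Import structures.
From mathcomp Require Import all_boot all_order all_algebra.
From mathcomp Require Import all_classical all_reals all_analysis.
From mathcomp Require Import measurable_realfun lebesgue_measure numfun ring lra.
Set Implicit Arguments. Unset Strict Implicit. Unset Printing Implicit Defensive.
Import Order.TTheory GRing.Theory Num.Theory.
Import numFieldNormedType.Exports.
Local Open Scope classical_set_scope.
Local Open Scope ring_scope.

(** Write Lam = (n / ln n)^(2/(2s+d)), so that eps_n^2 = Lam^-s and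
    n eps_n^2 = Lam^(d/2) ln n.  The eigenfunctions below the cutoff Lam carry
    f0 up to a squared L2 error of order eps_n^2, and by the heat kernel bounds
    there are O(Lam^(d/2)) of them.

    Evidence.  For t Lam of order ln n, recentring the low coordinates of the
    prior at those of f0 (Jensen for the Gaussian shift) bounds the integrated
    likelihood ratio below by exp(-A n eps_n^2), and the hyperprior charges such
    t with mass at least exp(-A' n eps_n^2).

    Small scales t < delta ln n / Lam have prior mass at most
    exp(-(A + A' + 1) n eps_n^2) for delta small; since the likelihood ratio has
    expectation one under the law of the data, they do not matter.

    Larger scales.  The part of the field above frequency K2 Lam is a Gaussian
    functional of variance at most n^-7, hence negligible outside an event of
    probability exp(-n^3).  What remains is a least-squares comparison in the
    span of the eigenfunctions below K2 Lam, with random but Chebyshev-controlled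
    noise; there the empirical Gram matrix is bounded below, because Hoelder
    continuity of the heat kernel makes such functions nearly constant on balls
    of radius a small multiple of Lam^(-1/2), each of which contains its share of
    the design points.  Functions at distance M eps_n thus have likelihood ratio
    at most exp(-c M^2 n eps_n^2). *)

(** * Inner products on L2 *)

(** Three obstacles shape the argument. (1) Measurability: nothing relates the fields [W t] for
    different [t], and the posterior is never shown to be a measurable function of the data. The
    integral of a nonnegative function is a supremum over simple functions below it, hence monotone
    for arbitrary functions, so every non-measurable quantity is bounded by a measurable one before
    Tonelli or linearity is applied. (2) Laws: the prior is known through its finite-dimensional
    distributions, not as a random series. Since a Gaussian likelihood is a mixture of cosines of
    linear functionals, its expectation depends on the covariance alone, and the field can be
    compared with truncated eigenfunction series. (3) Null sets: the eigenfunctions are fixed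
    representatives of L2 classes, and pointwise bounds hold off a null set [N] that is fixed once
    and for all and that the design avoids almost surely. The data events are controlled by second
    moments, which gives a risk of order 1 / ln n; this suffices for convergence to 0. *)

Section lower_integral.
Context {R : realType} {d} {T : measurableType d} (m : {measure set T -> \bar R}).

(** No measurability is asked of [f] or [g]: a simple function below [f] is also below [g]. This is
    the tool for bounding posterior integrals. *)
Lemma le_lower_integral (D : set T) (f g : T -> \bar R) :
  (forall x, D x -> 0 <= f x)%E -> (forall x, D x -> f x <= g x)%E ->
  (\int[m]_(x in D) f x <= \int[m]_(x in D) g x)%E.
Proof.
move=> f0 fg; rewrite (integral_mkcond D f) (integral_mkcond D g).
have h0 x : (0 <= (f \_ D) x)%E by apply: erestrict_ge0.
have hg x : ((f \_ D) x <= (g \_ D) x)%E by apply: lee_restrict.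
rewrite !ge0_integralTE//; last by move=> x; apply: le_trans (hg x).
apply: le_ereal_sup => _ [h /= hh <-]; exists h => // x.
exact: le_trans (hh x) (hg x).
Qed.

Lemma L2_mul_integrable (f g : T -> R) : L2 m f -> L2 m g ->
  m.-integrable setT (fun x => (f x * g x)%:E).
Proof.
move=> [mf f2] [mg g2].
apply: (@le_integrable _ _ _ m setT measurableT _
  (fun x => (f x ^+ 2)%:E + (g x ^+ 2)%:E)%E).
- by apply/measurable_EFinP; exact: measurable_funM.
- move=> x _; rewrite -EFinD !abse_EFin lee_fin.
  have h0 : 0 <= f x ^+ 2 + g x ^+ 2 by rewrite addr_ge0// sqr_ge0.
  rewrite (ger0_norm h0) normrM.
  have := sqr_ge0 (`|f x| - `|g x|); rewrite sqrrB !real_normK ?num_real//.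
  have : 0 <= `|f x| * `|g x| by rewrite mulr_ge0.
  lra.
- exact: integrableD.
Qed.

Lemma L2D (f g : T -> R) : L2 m f -> L2 m g -> L2 m (fun x => f x + g x).
Proof.
move=> Lf Lg; have fg := L2_mul_integrable Lf Lg.
case: Lf Lg => mf f2 [mg g2]; split; first exact: measurable_funD.
apply: (@eq_integrable _ _ _ m setT measurableT
  (fun x => (f x ^+ 2)%:E + ((g x ^+ 2)%:E + 2%:E * (f x * g x)%:E))%E).
  by move=> x _; rewrite -EFinM -!EFinD sqrrD; congr EFin; lra.
by apply: integrableD => //; apply: integrableD => //; exact: integrableZl.
Qed.

Lemma L2Z (k : R) (f : T -> R) : L2 m f -> L2 m (fun x => k * f x).
Proof.
move=> [mf f2]; split; first exact: measurable_funM.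
apply: (@eq_integrable _ _ _ m setT measurableT
  (fun x => (k ^+ 2)%:E * (f x ^+ 2)%:E)%E).
  by move=> x _; rewrite -EFinM exprMn.
exact: integrableZl.
Qed.

Lemma L2B (f g : T -> R) : L2 m f -> L2 m g -> L2 m (fun x => f x - g x).
Proof.
move=> Lf /(@L2Z (-1)) Lg.
by have := L2D Lf Lg; congr L2; apply/funext => x; rewrite mulN1r.
Qed.

Lemma L20 : L2 m (fun=> 0).
Proof.
split; first exact: measurable_cst.
by under eq_fun do rewrite expr0n; exact: integrable0.
Qed.

Lemma L2_sum I (r : seq I) (P : pred I) (F : I -> T -> R) : (forall i, L2 m (F i)) ->
  L2 m (fun x => \sum_(i <- r | P i) F i x).
Proof.
move=> LF; elim: r => [|i r ih].
  by under eq_fun do rewrite big_nil; exact: L20.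
under eq_fun do rewrite big_cons.
by case: (P i) => //; exact: L2D.
Qed.

(** Real-valued, so an infinite integral would be read as 0; the algebraic rules below therefore
    carry [L2] hypotheses. *)
Definition dot (f g : T -> R) : R := (\int[m]_x (f x * g x))%R.

Lemma dot_ip f g : dot f g = fine (ip m f g). Proof. by []. Qed.

Lemma dotC f g : dot f g = dot g f.
Proof. by apply: eq_Rintegral => x _; rewrite mulrC. Qed.

Lemma dotDl f g h : L2 m f -> L2 m g -> L2 m h ->
  dot (fun x => f x + g x) h = dot f h + dot g h.
Proof.
move=> Lf Lg Lh; rewrite /dot -RintegralD//; try exact: L2_mul_integrable.
by apply: eq_Rintegral => x _; rewrite mulrDl.
Qed.

Lemma dotZl k f h : L2 m f -> L2 m h -> dot (fun x => k * f x) h = k * dot f h.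
Proof.
move=> Lf Lh; rewrite /dot -RintegralZl//; last exact: L2_mul_integrable.
by apply: eq_Rintegral => x _; rewrite mulrA.
Qed.

Lemma dotBl f g h : L2 m f -> L2 m g -> L2 m h ->
  dot (fun x => f x - g x) h = dot f h - dot g h.
Proof.
move=> Lf Lg Lh; rewrite /dot -RintegralB//; try exact: L2_mul_integrable.
by apply: eq_Rintegral => x _; rewrite mulrBl.
Qed.

Lemma dotBr f g h : L2 m f -> L2 m g -> L2 m h ->
  dot h (fun x => f x - g x) = dot h f - dot h g.
Proof. by move=> *; rewrite !(dotC h) dotBl. Qed.

Lemma dotDr f g h : L2 m f -> L2 m g -> L2 m h ->
  dot h (fun x => f x + g x) = dot h f + dot h g.
Proof. by move=> *; rewrite !(dotC h) dotDl. Qed.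

Lemma dotZr k f h : L2 m f -> L2 m h -> dot h (fun x => k * f x) = k * dot h f.
Proof. by move=> *; rewrite !(dotC h) dotZl. Qed.

Lemma dot0l h : dot (fun=> 0) h = 0.
Proof.
rewrite /dot; under eq_Rintegral do rewrite mul0r.
by rewrite Rintegral_cst// mul0r.
Qed.

Lemma dot_suml I (r : seq I) (P : pred I) (F : I -> T -> R) h :
  (forall i, L2 m (F i)) -> L2 m h ->
  dot (fun x => \sum_(i <- r | P i) F i x) h = \sum_(i <- r | P i) dot (F i) h.
Proof.
move=> LF Lh; elim: r => [|i r ih].
  by rewrite big_nil -[RHS](dot0l h); congr dot; apply/funext => x; rewrite big_nil.
rewrite big_cons; have -> : (fun x => \sum_(j <- i :: r | P j) F j x) =
    (fun x => if P i then F i x + \sum_(j <- r | P j) F j x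
              else \sum_(j <- r | P j) F j x).
  by apply/funext => x; rewrite big_cons.
case: (P i) => //; rewrite dotDl ?ih//; exact: L2_sum.
Qed.

Lemma dot_ge0 f : 0 <= dot f f.
Proof. by apply: Rintegral_ge0 => x _; rewrite -expr2 sqr_ge0. Qed.

Lemma dotE f g : L2 m f -> L2 m g -> (\int[m]_x (f x * g x)%:E = (dot f g)%:E)%E.
Proof.
move=> Lf Lg; rewrite /dot /Rintegral fineK//.
by apply: integrable_fin_num => //; exact: L2_mul_integrable.
Qed.

Lemma dot2E f : L2 m f -> (\int[m]_x (f x ^+ 2)%:E = (dot f f)%:E)%E.
Proof. by move=> Lf; rewrite -dotE//. Qed.

Lemma dotD2 f g : L2 m f -> L2 m g ->
  dot (fun x => f x + g x) (fun x => f x + g x) = dot f f + 2 * dot f g + dot g g.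
Proof.
by move=> Lf Lg; have L := L2D Lf Lg; rewrite dotDl// !dotDr// (dotC g f); lra.
Qed.

Lemma dotB2 f g : L2 m f -> L2 m g ->
  dot (fun x => f x - g x) (fun x => f x - g x) = dot f f - 2 * dot f g + dot g g.
Proof.
by move=> Lf Lg; have L := L2B Lf Lg; rewrite dotBl// !dotBr// (dotC g f); lra.
Qed.

Lemma dot_CS f g : L2 m f -> L2 m g -> dot f g ^+ 2 <= dot f f * dot g g.
Proof.
move=> Lf Lg.
have key x : 0 <= dot f f + 2 * x * dot f g + x ^+ 2 * dot g g.
  have Lxg := L2Z x Lg.
  have := dot_ge0 (fun y => f y + x * g y).
  by rewrite dotD2// !dotZr// dotZl//; nra.
have [g0|g0] := eqVneq (dot g g) 0.
  rewrite g0 mulr0; have [->|fg0] := eqVneq (dot f g) 0; first by rewrite expr0n.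
  (* When [g] has norm 0 the quadratic is affine in x; this x brings it to -1. *)
  have := key (- (dot f f + 1) / (2 * dot f g)); rewrite g0 mulr0 addr0.
  have -> : 2 * (- (dot f f + 1) / (2 * dot f g)) * dot f g = - (dot f f + 1) by field.
  by lra.
have gp : 0 < dot g g by rewrite lt_neqAle eq_sym g0 dot_ge0.
have := key (- dot f g / dot g g).
have -> : dot f f + 2 * (- dot f g / dot g g) * dot f g + (- dot f g / dot g g) ^+ 2 * dot g g
   = (dot f f * dot g g - dot f g ^+ 2) / dot g g by field.
by rewrite pmulr_lge0 ?invr_gt0// subr_ge0.
Qed.

Lemma dotD2_le f g : L2 m f -> L2 m g ->
  dot (fun x => f x + g x) (fun x => f x + g x) <= 2 * dot f f + 2 * dot g g.
Proof.
move=> Lf Lg; have := dot_ge0 (fun y => f y - g y).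
by rewrite dotB2// dotD2//; lra.
Qed.

Lemma dotB2_le f g : L2 m f -> L2 m g ->
  dot (fun x => f x - g x) (fun x => f x - g x) <= 2 * dot f f + 2 * dot g g.
Proof.
move=> Lf Lg; have := dot_ge0 (fun y => f y + g y).
by rewrite dotB2// dotD2//; lra.
Qed.

End lower_integral.

(** * Eigenfunction expansions *)

Lemma cvgr_EFin {R : realType} {I : Type} {F : set_system I} {FF : Filter F} (f : I -> R) (a : R) :
  f @ F --> a -> (fun i => (f i)%:E) @ F --> a%:E.
Proof. by move=> fa; apply: cvg_EFin => //; exact: nearW. Qed.

Section L2_limit.
Context {R : realType} {d} {T : measurableType d} (m : {measure set T -> \bar R}).

Lemma ge0_integral_eq0_ae (f : T -> \bar R) : measurable_fun setT f ->
  (forall x, 0 <= f x)%E -> (\int[m]_x f x <= 0)%E -> {ae m, forall x, f x = 0%E}.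
Proof.
move=> mf f0 le0.
have /ae_eq_integral_abs : (\int[m]_x `|f x| = 0)%E.
  apply/eqP; rewrite eq_le; apply/andP; split; last by apply: integral_ge0.
  by under eq_integral do rewrite gee0_abs//.
by move=> /(_ measurableT mf); apply: filterS => x /(_ I).
Qed.

(** Fatou's lemma for the squares of [f - F N] identifies the two limits without extracting a
    subsequence. *)
Lemma L2_cvg_ae_eq (f g : T -> R) (F : nat -> T -> R) : L2 m f ->
  (forall N, L2 m (F N)) ->
  (fun N => dot m (fun x => f x - F N x) (fun x => f x - F N x)) @ \oo --> 0 ->
  {ae m, forall x, (fun N => F N x) @ \oo --> g x} -> {ae m, forall x, f x = g x}.
Proof.
move=> Lf LF F0 Fg.
have mf : measurable_fun setT f by case: Lf.
have mF N : measurable_fun setT (F N) by case: (LF N).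
pose h N x := ((f x - F N x) ^+ 2)%:E.
have mh N : measurable_fun setT (h N).
  by apply/measurable_EFinP/measurable_funX/measurable_funB.
have h0 N x : setT x -> (0 <= h N x)%E by rewrite lee_fin sqr_ge0.
have := fatou m measurableT mh h0.
have hE N : (\int[m]_x h N x)%E = (dot m (fun x => f x - F N x) (fun x => f x - F N x))%:E.
  by rewrite -dot2E//; exact: L2B.
have -> : limn_einf (fun N => \int[m]_x h N x)%E = 0%E.
  under eq_fun do rewrite hE.
  by rewrite (cvg_limn_einf_sup (cvgr_EFin F0)).1.
move=> /ge0_integral_eq0_ae H.
have {}H : {ae m, forall x, limn_einf (h ^~ x) = 0%E}.
  apply: H => [|x].
    apply: measurableT_comp => //; apply: measurable_fun_limn_esup => N.
    exact: measurableT_comp.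
  rewrite limn_einf_lim; apply: lime_ge; first exact: is_cvg_einfs.
  apply: nearW => N; apply: le_ereal_inf_tmp => _ [k _ <-]; exact: h0.
near=> x.
have Fgx : (fun N => F N x) @ \oo --> g x by near: x.
have hx : limn_einf (h ^~ x) = 0%E by near: x.
have : limn_einf (h ^~ x) = ((f x - g x) ^+ 2)%:E.
  have c : (fun N => (f x - F N x) ^+ 2) @ \oo --> (f x - g x) ^+ 2.
    rewrite expr2; under eq_fun do rewrite expr2.
    by apply: cvgM; apply: cvgB => //; exact: cvg_cst.
  by rewrite (cvg_limn_einf_sup (cvgr_EFin c)).1.
by rewrite hx => -[] /esym/eqP; rewrite sqrf_eq0 subr_eq0 => /eqP.
Unshelve. all: by end_near. Qed.

End L2_limit.

Section eigen.
Context {R : realType} {d} {T : measurableType d} (m : {measure set T -> \bar R}).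
Variables (lam : nat -> R) (u : nat -> T -> R).
Hypothesis E : eigen_system m lam u.

Definition lcomb (c : nat -> R) (N : nat) (x : T) : R := \sum_(j < N) c j * u j x.

Lemma eigen_L2 j : L2 m (u j). Proof. by case: E. Qed.
Hint Resolve eigen_L2 : core.

Lemma eigen_dot j k : dot m (u j) (u k) = (j == k)%:R.
Proof. by rewrite dot_ip; case: E => _ _ _ -> _. Qed.

Lemma eigen_lam_ge0 j : 0 <= lam j. Proof. by case: E. Qed.

Lemma eigen_lam_homo j k : (j <= k)%N -> lam j <= lam k.
Proof.
move=> jk; apply: (@homo_leq _ lam (fun x y => x <= y)) jk => //.
- by move=> y x z; exact: le_trans.
- by case: E.
Qed.

Lemma lcomb_L2 c N : L2 m (lcomb c N).
Proof. by apply: L2_sum => i; exact: L2Z. Qed.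
Hint Resolve lcomb_L2 : core.

Lemma lcomb_dotl c N f : L2 m f -> dot m (lcomb c N) f = \sum_(j < N) c j * dot m (u j) f.
Proof.
move=> Lf; rewrite dot_suml//; last by move=> i; exact: L2Z.
by apply: eq_bigr => i _; rewrite dotZl.
Qed.

Lemma lcomb_dot_u c N j : dot m (u j) (lcomb c N) = if (j < N)%N then c j else 0.
Proof.
rewrite dotC lcomb_dotl//; under eq_bigr do rewrite eigen_dot.
case: ltnP => jN.
  rewrite (bigD1 (Ordinal jN))//= eqxx mulr1 big1 ?addr0// => i ij.
  by rewrite (_ : (i == j :> nat) = false) ?mulr0//; apply/negbTE.
rewrite big1// => i _; rewrite (_ : (i == j :> nat) = false) ?mulr0//.
by apply/negbTE; rewrite neq_ltn (leq_trans (ltn_ord i) jN).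
Qed.

Lemma lcomb_dot c c' N : dot m (lcomb c N) (lcomb c' N) = \sum_(j < N) c j * c' j.
Proof.
by rewrite lcomb_dotl//; apply: eq_bigr => i _; rewrite lcomb_dot_u ltn_ord.
Qed.

Definition coef (f : T -> R) (j : nat) : R := dot m (u j) f.

Lemma dot_proj f N : L2 m f ->
  dot m (fun x => f x - lcomb (coef f) N x) (fun x => f x - lcomb (coef f) N x)
  = dot m f f - \sum_(j < N) coef f j ^+ 2.
Proof.
move=> Lf; rewrite dotB2// lcomb_dot dotC lcomb_dotl//.
by rewrite (eq_bigr (fun j : 'I_N => coef f j ^+ 2))//; lra.
Qed.

Lemma bessel f N : L2 m f -> \sum_(j < N) coef f j ^+ 2 <= dot m f f.
Proof. by move=> Lf; rewrite -subr_ge0 -dot_proj// dot_ge0. Qed.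

Lemma cvg_dot_proj f : L2 m f ->
  (fun N => dot m (fun x => f x - lcomb (coef f) N x) (fun x => f x - lcomb (coef f) N x))
    @ \oo --> 0.
Proof.
move=> Lf; case: E => _ _ _ _ /(_ f Lf) /fine_cvg.
apply: cvg_trans; apply: near_eq_cvg; apply: nearW => N /=.
by rewrite -[RHS]/(fine (_%:E)) -dot2E//; exact: L2B.
Qed.

Lemma parseval f : L2 m f ->
  (fun N => \sum_(j < N) coef f j ^+ 2) @ \oo --> dot m f f.
Proof.
move=> Lf; have /cvgN := cvg_dot_proj Lf; rewrite oppr0.
move=> /(cvgD (cvg_cst (dot m f f))); rewrite addr0.
apply: cvg_trans; apply: near_eq_cvg; apply: nearW => N /=.
by rewrite !fctE dot_proj//; lra.
Qed.

Lemma dot_proj_le f N B : L2 m f ->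
  (forall N', (N <= N')%N -> \sum_(N <= j < N') coef f j ^+ 2 <= B) ->
  dot m (fun x => f x - lcomb (coef f) N x) (fun x => f x - lcomb (coef f) N x) <= B.
Proof.
move=> Lf HB; rewrite dot_proj// lerBlDr.
have /cvg_lim <- := parseval Lf => //; apply: limr_le; first by apply/cvg_ex; eexists; exact: parseval.
near=> N'; have NN' : (N <= N')%N by near: N'; exact: nbhs_infty_ge.
rewrite -(big_mkord xpredT (fun j => coef f j ^+ 2)) (big_cat_nat (n := N))//=.
by rewrite big_mkord addrC lerD2r HB.
Unshelve. all: by end_near. Qed.

Lemma L2_eq_lim f g : L2 m f ->
  {ae m, forall x, (fun N => lcomb (coef f) N x) @ \oo --> g x} ->
  {ae m, forall x, f x = g x}.
Proof. by move=> Lf; apply: L2_cvg_ae_eq => //; exact: cvg_dot_proj. Qed.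

End eigen.

(** * Volume and heat kernel estimates *)

Section metric_measure.
Context {R : realType} {dX : measure_display} {X : measurableType dX}.
Variable rho : X -> X -> R.
Hypothesis rho_metric : is_metric rho.

Lemma rho_ge0 x y : 0 <= rho x y. Proof. by case: rho_metric. Qed.
Lemma rhoC x y : rho x y = rho y x. Proof. by case: rho_metric. Qed.
Lemma rho_tri y x z : rho x z <= rho x y + rho y z. Proof. by case: rho_metric. Qed.

(** Without a finite net, points at mutual distance at least r could be chosen greedily forever, and
    such a sequence has no convergent subsequence. *)
Lemma rcompact_cover (r : R) : rcompact rho -> 0 < r ->
  exists s : seq X, forall x, exists2 y, y \in s & rho y x < r.
Proof.
move=> rc r0; apply: contrapT => /forallNP nc.
have {}nc (s : seq X) : exists x, forall y, y \in s -> r <= rho y x.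
  have /existsNP[x h] := nc s; exists x => y ys.
  by rewrite leNgt; apply/negP => yx; apply: h; exists y.
have [g Hg] := choice nc.
pose fix s n := if n is k.+1 then g (s k) :: s k else [::].
pose v n := g (s n).
have vs m n : (m < n)%N -> v m \in s n.
  elim: n => // n ih; rewrite ltnS leq_eqVlt => /orP[/eqP->|/ih vn] /=.
    by rewrite mem_head.
  by rewrite in_cons vn orbT.
have vr m n : (m < n)%N -> r <= rho (v m) (v n) by move=> /vs; exact: Hg.
have [phi [phiS [x /cvgr0_norm_lt /(_ (r / 2))]]] := rc v.
have r20 : 0 < r / 2 by rewrite divr_gt0.
move=> /(_ r20) [N _ HN].
have := HN N (leqnn _); have := HN N.+1 (leqnSn _) => /=.
rewrite !ger0_norm ?rho_ge0// => h1 h2.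
have := vr _ _ (phiS N); have := rho_tri x (v (phi N)) (v (phi N.+1)).
by rewrite (rhoC x); lra.
Qed.

Hypothesis rho_borel : rborel rho.

Lemma ropen_measurable (A : set X) : ropen rho A -> measurable A.
Proof. by move=> oA; rewrite rho_borel; apply: sub_sigma_algebra. Qed.

Lemma rball_open x r : ropen rho (rball rho x r).
Proof.
move=> y xy; exists (r - rho x y); first by rewrite subr_gt0.
by move=> z; rewrite /rball/= => yz; apply: (le_lt_trans (rho_tri y _ _)); lra.
Qed.

Lemma measurable_rball x r : measurable (rball rho x r).
Proof. exact/ropen_measurable/rball_open. Qed.

Lemma measurable_rho x : measurable_fun setT (rho x).
Proof.
apply: (measurability (@RGenInftyO.G R)) => [|_ [_ [r ->] <-]]; first exact: RGenInftyO.measurableE.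
rewrite setTI (_ : _ @^-1` _ = rball rho x r); first exact: measurable_rball.
by apply/seteqP; split => y /=; rewrite in_itv.
Qed.

Lemma unif_cont_measurable f : unif_cont rho f -> measurable_fun setT f.
Proof.
move=> uf; apply: (measurability (@RGenInftyO.G R)) => [|_ [_ [r ->] <-]]; first exact: RGenInftyO.measurableE.
rewrite setTI; apply: ropen_measurable => x /=; rewrite in_itv/= => fx.
have [|del d0 Hd] := uf (r - f x); first by rewrite subr_gt0.
exists del => // y /Hd; rewrite /= in_itv/= ltr_norml => /andP[h1 h2]; lra.
Qed.

Variable mu : {measure set X -> \bar R}.

Lemma ahlfors_finite (C c d : R) : rcompact rho -> ahlfors rho mu C c d ->
  (mu setT < +oo)%E.
Proof.
move=> rc ah; have [s hs] := rcompact_cover rc ltr01.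
have -> : [set: X] = \big[setU/set0]_(y <- s) rball rho y 1.
  apply/seteqP; split=> x // _; have [y ys xy] := hs x.
  by rewrite -bigcup_seq; exists y.
elim: s {hs} => [|y s ih]; first by rewrite big_nil measure0.
rewrite big_cons.
have mS : measurable (\big[setU/set0]_(y <- s) rball rho y 1).
  by apply: bigsetU_measurable => z _; exact: measurable_rball.
apply: (le_lt_trans (measureU2 _ (measurable_rball y 1) mS)).
have /andP[_ h] : ((c * 1 `^ d)%:E <= mu (rball rho y 1) <= (C * 1 `^ d)%:E)%E.
  by apply: ah; rewrite lexx ltr01.
by apply: lte_add_pinfty => //; apply: (le_lt_trans h); rewrite ltry.
Qed.

End metric_measure.

Lemma pow2_archi {R : realType} (r : R) : exists k : nat, r < 2 ^+ k.
Proof.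
have [n rn] : exists n : nat, r < n%:R.
  by exists (Num.bound `|r|); apply: (le_lt_trans (ler_norm r)); apply: archi_boundP.
exists n; rewrite (lt_trans rn)// -natrX ltr_nat; exact: ltn_expl.
Qed.

Lemma powR_expn {R : realType} (a e : R) k : 0 <= a -> (a `^ e) ^+ k = (a ^+ k) `^ e.
Proof.
move=> a0; elim: k => [|k ih]; first by rewrite !expr0 powR1.
by rewrite !exprS ih powRM// exprn_ge0.
Qed.

(* Completing the square in the exponent: [(2r)^e = exp(e ln(2r)) <= exp(2er)]. *)
Lemma powR_gauss_le {R : realType} (b e r : R) : 0 < b -> 0 < e -> 0 < r ->
  (2 * r) `^ e * expR (- (b * r ^+ 2)) <= expR (e ^+ 2 / b).
Proof.
move=> b0 e0 r0; rewrite /powR gt_eqF ?mulr_gt0// -expRD ler_expR.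
have h : ln (2 * r) <= 2 * r by rewrite ltW// ln_sublinear// mulr_gt0.
have : e * ln (2 * r) <= e * (2 * r) by rewrite ler_pM2l.
have : 0 <= b * (r - e / b) ^+ 2 by rewrite mulr_ge0 ?sqr_ge0// ltW.
have -> : b * (r - e / b) ^+ 2 = b * r ^+ 2 - 2 * r * e + e ^+ 2 / b.
  by field; rewrite gt_eqF.
by lra.
Qed.

(** The decay exponent is d + 1 rather than d: against a ball volume of order (2^k)^d a factor 2^-k
    remains, so the sum over dyadic balls converges. *)
Lemma gauss_dyadic {R : realType} (b d r : R) : 0 < b -> 0 < d -> 0 <= r ->
  exists k : nat, r < 2 ^+ k /\
    expR (- (b * r ^+ 2)) <= expR ((d + 1) ^+ 2 / b) * (2 `^ (- (d + 1))) ^+ k.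
Proof.
move=> b0 d0 r0; have d1 : 0 < d + 1 by lra.
have /ex_minnP[k rk kmin] := pow2_archi r; exists k; split => //.
case: k rk kmin => [|k] rk kmin.
  rewrite expr0 mulr1 ler_expR; apply: (@le_trans _ _ 0).
    by rewrite oppr_le0 mulr_ge0 ?sqr_ge0// ltW.
  by rewrite divr_ge0 ?sqr_ge0// ltW.
have kr : 2 ^+ k <= r.
  by rewrite leNgt; apply/negP => /kmin; rewrite ltnn.
have rp : 0 < r by apply: lt_le_trans kr; rewrite exprn_gt0.
have := powR_gauss_le b0 d1 rp.
rewrite mulrC -ler_pdivlMr ?powR_gt0 ?mulr_gt0// => /le_trans; apply.
rewrite ler_pM2l ?expR_gt0//.
have -> : (2 `^ (- (d + 1))) ^+ k.+1 = ((2 ^+ k.+1) `^ (d + 1))^-1 :> R.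
  by rewrite powRN exprVn powR_expn.
rewrite mulrC.
rewrite lef_pV2 ?posrE ?powR_gt0 ?mulr_gt0 ?exprn_gt0//.
apply: ge0_ler_powR; rewrite ?nnegrE ?exprn_ge0 ?mulr_ge0//; first lra.
by rewrite exprSr ler_pM2r.
Qed.

Lemma powR_ge1 {R : realType} (x e : R) : 1 <= x -> 0 <= e -> 1 <= x `^ e.
Proof.
move=> x1 e0; have <- : 1 `^ e = 1 :> R by rewrite powR1.
by apply: ge0_ler_powR => //; rewrite nnegrE ?ler01// (le_trans ler01).
Qed.

Section volume.
Context {R : realType} {dX : measure_display} {X : measurableType dX}.
Variables (rho : X -> X -> R) (mu : {finite_measure set X -> \bar R}) (C c d : R).
Hypothesis rho_metric : is_metric rho.
Hypothesis rho_borel : rborel rho.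
Hypotheses (C0 : 0 < C) (c0 : 0 < c) (d0 : 0 < d).
Hypothesis ah : ahlfors rho mu C c d.
Let mT := fine (mu setT).

Lemma mu_fin (A : set X) : measurable A -> mu A = (fine (mu A))%:E.
Proof. by move=> mA; rewrite fineK// fin_num_measure. Qed.

Lemma mu_total_ge0 : 0 <= mT. Proof. exact: fine_ge0. Qed.

Lemma volume_le x r : 0 < r -> (mu (rball rho x r) <= ((C + mT) * r `^ d)%:E)%E.
Proof.
move=> r0; have m0 := mu_total_ge0; have [r1|r1] := leP r 1.
  have /andP[_] : ((c * r `^ d)%:E <= mu (rball rho x r) <= (C * r `^ d)%:E)%E.
    by apply: ah; rewrite r0.
  move=> /le_trans; apply; rewrite lee_fin ler_pM2r ?powR_gt0//; lra.
apply: (@le_trans _ _ (mu setT)).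
  by apply: le_measure; rewrite ?inE//; exact: measurable_rball.
rewrite mu_fin// lee_fin -/mT.
have rd : 1 <= r `^ d by exact: powR_ge1 (ltW r1) (ltW d0).
apply: (@le_trans _ _ (C + mT)); first by rewrite lerDr ltW.
by rewrite ler_peMr// addr_ge0// ltW.
Qed.

(** The Gaussian is dominated by a series of indicators of dyadic balls, integrated term by term;
    the terms are halved at each step, whence the factor 2 in the constant. *)
Lemma gauss_integral_le (b : R) : 0 < b -> exists2 K, 0 < K & forall (t : R) x, 0 < t ->
  (\int[mu]_y (expR (- (b * rho x y ^+ 2 / t)))%:E <= (K * Num.sqrt t `^ d)%:E)%E.
Proof.
move=> b0; pose A := expR ((d + 1) ^+ 2 / b); pose q : R := 2 `^ (- (d + 1)).
have m0 := mu_total_ge0.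
exists (2 * A * (C + mT)) => [|t x t0].
  by rewrite !mulr_gt0 ?expR_gt0// ltr_pwDl.
have q0 : 0 < q by rewrite powR_gt0.
have s0 : 0 < Num.sqrt t by rewrite sqrtr_gt0.
pose f k y := ((A * q ^+ k)%:E * (\1_(rball rho x (2 ^+ k * Num.sqrt t)) y)%:E)%E.
have mf k : measurable_fun setT (f k).
  apply: measurable_funeM; apply/measurable_EFinP/measurable_indic.
  exact: measurable_rball.
have Aq k : 0 <= A * q ^+ k by rewrite mulr_ge0 ?expR_ge0 ?exprn_ge0// ltW.
have f0 k y : (0 <= f k y)%E by rewrite mule_ge0// lee_fin// ltW.
apply: (@le_trans _ _ (\int[mu]_y (\sum_(k <oo) f k y))%E).
  apply: ge0_le_integral => //.
  - apply/measurable_EFinP/measurableT_comp => //; apply: measurableT_comp => //.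
    apply: measurable_funM => //; apply: measurable_funM => //.
    by apply: measurable_funX; exact: measurable_rho.
  - apply: (emeasurable_fun_cvg (fun n y => \sum_(0 <= k < n) f k y)%E) => [n|y _].
      by apply: emeasurable_sum.
    by apply: is_cvg_nneseries.
  - move=> y _; have ry : 0 <= rho x y / Num.sqrt t by rewrite divr_ge0 ?rho_ge0.
    have [k [rk hk]] := gauss_dyadic b0 d0 ry.
    apply: (@le_trans _ _ (f k y)); last first.
      apply: le_trans (nneseries_lim_ge k.+1 _) => //=.
      rewrite big_nat_recr//= leeDr//; exact: sume_ge0.
    rewrite /f indicE mem_set ?mule1 /=; last by rewrite /rball/= -ltr_pdivrMr.
    rewrite lee_fin; apply: le_trans hk.
    by rewrite ler_expR lerN2 expr_div_n (sqr_sqrtr (ltW t0)) mulrA.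
rewrite integral_nneseries//.
apply: (@le_trans _ _ (\sum_(k <oo) ((2 * A * (C + mT) * Num.sqrt t `^ d) / (2 ^ k.+1)%:R)%:E)%E);
  last first.
  by apply: epsilon_trick0; rewrite !mulr_ge0 ?expR_ge0 ?powR_ge0// addr_ge0// ltW.
apply: lee_nneseries => [k _ _|k _]; first exact: integral_ge0.
rewrite /f ge0_integralZl_EFin//; last first.
  by apply/measurable_EFinP/measurable_indic; exact: measurable_rball.
rewrite integral_indic ?setIT//; last exact: measurable_rball.
apply: (le_trans (lee_wpmul2l _ (volume_le x _))); rewrite ?lee_fin ?mulr_gt0 ?exprn_gt0//.
rewrite -?EFinM ?lee_fin powRM ?exprn_ge0 ?sqrtr_ge0// natrX.
have -> : q ^+ k = (2 ^+ k)^-1 * ((2 ^+ k) `^ d)^-1.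
  rewrite -powR_mulrn ?powR_ge0// -powRrM mulNr powRN -invfM mulrDl mul1r; congr (_^-1).
  rewrite powRD; last by apply/implyP => _; rewrite pnatr_eq0.
  by rewrite mulrC powR_mulrn// (mulrC d) powRrM powR_mulrn.
set P := _ `^ d; have P0 : P != 0 by rewrite gt_eqF// powR_gt0// exprn_gt0.
have T0 : 2 ^+ k != 0 :> R by rewrite expf_neq0.
by rewrite exprS le_eqVlt; apply/orP; left; apply/eqP; field; rewrite P0 T0.
Qed.

End volume.
(** Identities for the heat kernel will hold off one null set only at countably many times. The
    dyadic time stays below t / 2 because squaring the coefficients of the kernel doubles its
    time. *)
Lemma dyadic_scale {R : realType} (t : R) : 0 < t <= 1 ->
  exists m : nat, (2^-1) ^+ m <= t / 2 /\ t / 4 <= (2^-1) ^+ m.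
Proof.
move=> /andP[t0 t1].
have ex : exists m, (2^-1 : R) ^+ m <= t / 2.
  have [k kt] := pow2_archi (2 / t); exists k.
  rewrite exprVn -[leRHS]invrK lef_pV2 ?posrE ?exprn_gt0 ?invr_gt0 ?divr_gt0//.
  by rewrite invf_div ltW.
case: (ex_minnP ex) => m hm mmin; exists m; split => //.
case: m hm mmin => [|m] hm mmin; first by move: hm; rewrite expr0; lra.
have h : t / 2 < 2^-1 ^+ m by rewrite ltNge; apply/negP => /mmin; rewrite ltnn.
by rewrite exprS; lra.
Qed.

Lemma ratio_le {R : realType} (C c V v a : R) : 0 < C -> 0 < c -> 0 < V -> c * V <= v ->
  0 <= a -> C * a / v <= C / c * a / V.
Proof.
move=> C0 c0 V0 cV a0; have cV0 : 0 < c * V by rewrite mulr_gt0.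
apply: (@le_trans _ _ (C * a / (c * V))).
  apply: ler_wpM2l; first by rewrite mulr_ge0// ltW.
  by rewrite lef_pV2 ?posrE// (lt_le_trans cV0).
by rewrite le_eqVlt; apply/orP; left; apply/eqP; field; rewrite !gt_eqF.
Qed.

(** * Two-sided bounds for the heat kernel *)

Section heat.
Context {R : realType} {dX : measure_display} {X : measurableType dX}.
Variables (rho : X -> X -> R) (mu : {finite_measure set X -> \bar R}) (C c d : R).
Variables (lam : nat -> R) (u : nat -> X -> R) (p : R -> X -> X -> R) (eta : R).
Hypothesis DS : dirichlet_setting rho mu C c d lam u p eta.
Let mT := fine (mu setT).

Let rho_metric : is_metric rho. Proof. by case: DS => -[]. Qed.
Let rho_borel : rborel rho. Proof. by case: DS => -[]. Qed.
Let C0 : 0 < C. Proof. by case: DS => _ []. Qed.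
Let c0 : 0 < c. Proof. by case: DS => _ []. Qed.
Let d0 : 0 < d. Proof. by case: DS => _ []. Qed.
Let eta0 : 0 < eta. Proof. by case: DS => _ []. Qed.
Let ah : ahlfors rho mu C c d. Proof. by case: DS. Qed.
Let ES : eigen_system mu lam u. Proof. by case: DS. Qed.

Lemma sqrt_le1 (t : R) : 0 < t <= 1 -> 0 < Num.sqrt t <= 1.
Proof.
by move=> /andP[t0 t1]; rewrite sqrtr_gt0 t0 -sqrtr1 ler_wsqrtr.
Qed.

Lemma vol2_ge t x y : 0 < t <= 1 -> c * Num.sqrt t `^ d <= vol2 rho mu t x y.
Proof.
move=> t01; have s01 := sqrt_le1 t01; rewrite /vol2.
have V0 : 0 <= c * Num.sqrt t `^ d by rewrite mulr_ge0 ?powR_ge0// ltW.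
have h z : c * Num.sqrt t `^ d <= fine (mu (rball rho z (Num.sqrt t))).
  have mB := measurable_rball rho_metric rho_borel z (Num.sqrt t).
  by have /andP[h1 _] := ah z s01; rewrite -lee_fin -(mu_fin _ mB).
by rewrite -[leLHS](ger0_norm V0) -sqrtr_sqr ler_wsqrtr// expr2; apply: ler_pM => //; exact: h.
Qed.

Lemma heat_le t x y : 0 < t <= 1 ->
  p t x y <= C / c * expR (- (c * rho x y ^+ 2 / t)) / Num.sqrt t `^ d.
Proof.
move=> t01; case: DS => _ _ _ _ [_ _ /(_ t x y t01) + _ _]; move/le_trans; apply.
have /andP[s0 _] := sqrt_le1 t01.
have V0 : 0 < Num.sqrt t `^ d by rewrite powR_gt0.
have h := vol2_ge x y t01.
by apply: ratio_le => //; rewrite expR_ge0.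
Qed.

Lemma heat_holder t x y y' : 0 < t <= 1 -> rho y y' <= Num.sqrt t ->
  `|p t x y - p t x y'| <=
    C / c * (rho y y' / Num.sqrt t) `^ eta * expR (- (c * rho x y ^+ 2 / t)) / Num.sqrt t `^ d.
Proof.
move=> t01 ry; case: DS => _ _ _ _ [_ _ _ /(_ t x y y' t01 ry) + _].
move/le_trans; apply.
have /andP[s0 _] := sqrt_le1 t01.
have V0 : 0 < Num.sqrt t `^ d by rewrite powR_gt0.
have h := vol2_ge x y t01.
rewrite -(mulrA C) -(mulrA (C / c)).
by apply: ratio_le => //; rewrite mulr_ge0 ?expR_ge0 ?powR_ge0.
Qed.

Lemma heat_measurable t x : 0 < t -> measurable_fun setT (p t x).
Proof. by case: DS => _ _ _ _ [+ _ _ _ _]; exact. Qed.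

Lemma measurable_gauss_rho (b t : R) x :
  measurable_fun setT (fun y => (expR (- (b * rho x y ^+ 2 / t)))%:E).
Proof.
apply/measurable_EFinP/measurableT_comp => //.
apply: measurableT_comp => //; apply: measurable_funM => //; apply: measurable_funM => //.
by apply: measurable_funX; exact: measurable_rho.
Qed.

Lemma heat_bounds : exists2 K, 0 < K & forall t x, 0 < t <= 1 ->
  (forall y, `|p t x y| <= K / Num.sqrt t `^ d) /\
  (\int[mu]_y (`|p t x y|)%:E <= K%:E)%E.
Proof.
have [Kg Kg0 HKg] := gauss_integral_le rho_metric rho_borel C0 d0 ah c0.
pose a := C / c * Kg; have a0 : 0 < a by rewrite mulr_gt0// divr_gt0.
exists (C / c + 2 * a + a / c) => [|t x t01].
  by rewrite !addr_gt0 ?mulr_gt0 ?invr_gt0.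
have t0 : 0 < t by case/andP: t01.
have /andP[s0 s1] := sqrt_le1 t01.
set V := Num.sqrt t `^ d; have V0 : 0 < V by rewrite powR_gt0.
have mp := heat_measurable x t0.
have mpE : measurable_fun setT (EFin \o p t x) by exact/measurable_EFinP.
set Pp := (\int[mu]_y ((EFin \o p t x)^\+ y))%E; set Pn := (\int[mu]_y ((EFin \o p t x)^\- y))%E.
have Cc : 0 < C / c by rewrite divr_gt0.
have hp : (Pp <= a%:E)%E.
  apply: (@le_trans _ _ (\int[mu]_y ((C / c / V)%:E * (expR (- (c * rho x y ^+ 2 / t)))%:E))%E).
    apply: ge0_le_integral => //.
    - exact: measurable_funepos.
    - by apply: measurable_funeM; exact: measurable_gauss_rho.
    - move=> y _; rewrite funeposE /= -EFinM -EFin_max lee_fin ge_max.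
      have := heat_le x y t01; rewrite -/V => h; apply/andP; split.
        by apply: (le_trans h); rewrite mulrAC.
      by rewrite mulr_ge0 ?expR_ge0// divr_ge0// ltW.
  have CcV : 0 <= C / c / V by rewrite divr_ge0// ltW.
  rewrite (ge0_integralZl_EFin mu measurableT _ (measurable_gauss_rho c t x) CcV); last first.
    by move=> y _; rewrite lee_fin expR_ge0.
  apply: (le_trans (lee_wpmul2l _ (HKg t x t0))); first by rewrite lee_fin divr_ge0// ltW.
  rewrite -EFinM lee_fin -/V /a le_eqVlt; apply/orP; left; apply/eqP; field.
  by rewrite !gt_eqF.
have Pp0 : (0 <= Pp)%E by exact: integral_ge0.
have Pn0 : (0 <= Pn)%E by exact: integral_ge0.
have PE : (Pp - Pn = 1)%E.
  by rewrite -integralE; case: DS => _ _ _ _ [_ _ _ _ /(_ t x t0)].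
have hn : (Pn <= a%:E)%E.
  move: hp Pp0 Pn0 PE; case: Pp => [r| |]//; case: Pn => [r'| |]//=.
  by rewrite !lee_fin => h1 h2 h3 [] h4; lra.
have Pab : (\int[mu]_y (`|p t x y|)%:E <= (2 * a)%:E)%E.
  rewrite (eq_integral (fun y => (EFin \o p t x)^\+ y + (EFin \o p t x)^\- y)%E); last first.
    by move=> y _; have := congr1 (fun h => h y) (fune_abse (EFin \o p t x)).
  rewrite ge0_integralD//; [|exact: measurable_funepos|exact: measurable_funeneg].
  by apply: (le_trans (leeD hp hn)); rewrite -EFinD lee_fin; lra.
split; last first.
  apply: (le_trans Pab); rewrite lee_fin.
  have : 0 < a / c by rewrite divr_gt0.
  lra.
move=> y.
have up : p t x y <= C / c / V.
  apply: (le_trans (heat_le x y t01)); rewrite -/V mulrAC ler_piMr//.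
    by rewrite divr_ge0// ltW.
  by rewrite -expR0 ler_expR oppr_le0 mulr_ge0 ?invr_ge0 ?(ltW t0)// mulr_ge0 ?sqr_ge0// ltW.
have ac0 : 0 < a / c / V by rewrite !divr_gt0.
have CcV : 0 < C / c / V by rewrite !divr_gt0.
rewrite !mulrDl ler_norml; apply/andP; split; last first.
  have : 0 < 2 * a / V by rewrite divr_gt0// mulr_gt0.
  lra.
rewrite lerNl; have [pn|pn] := leP (- p t x y) (C / c / V).
  have : 0 < 2 * a / V by rewrite divr_gt0// mulr_gt0.
  lra.
set B := rball rho y (Num.sqrt t).
have mB : measurable B by exact: measurable_rball.
(* Within distance sqrt t the kernel varies by at most C / c / V, so on [B] its negative part is at
   least [N]. *)
pose N := - p t x y - C / c / V; have N0 : 0 < N by rewrite subr_gt0.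
have : (N%:E * mu B <= Pn)%E.
  rewrite -integral_cst//.
  apply: (@le_trans _ _ (\int[mu]_(z in B) (EFin \o p t x)^\- z)%E); last first.
    by apply: ge0_subset_integral => //; exact: measurable_funeneg.
  apply: ge0_le_integral => //.
  - by move=> z _; rewrite /= lee_fin ltW.
  - by apply: measurable_funTS; exact: measurable_funeneg.
  - move=> z Bz; rewrite funenegE /= -?EFinN -EFin_max lee_fin le_max; apply/orP; left.
    have := heat_holder x t01 (ltW Bz); rewrite -/V ler_norml => /andP[h _].
    have : C / c * (rho y z / Num.sqrt t) `^ eta * expR (- (c * rho x y ^+ 2 / t)) / V
        <= C / c / V.
      rewrite ler_pM2r ?invr_gt0// -mulrA ler_piMr ?(ltW Cc)//.
      apply: mulr_ile1; rewrite ?powR_ge0 ?expR_ge0//; last first.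
        rewrite -expR0 ler_expR oppr_le0 mulr_ge0 ?invr_ge0 ?(ltW t0)// mulr_ge0 ?sqr_ge0//.
        exact: ltW.
      have <- : 1 `^ eta = 1 :> R by rewrite powR1.
      apply: ge0_ler_powR; rewrite ?nnegrE ?divr_ge0 ?rho_ge0//; first exact: ltW.
      by rewrite ler_pdivrMr// mul1r ltW.
    by rewrite /N; lra.
have /andP[vB _] := ah y (sqrt_le1 t01).
have N0' : (0 <= N%:E)%E by rewrite lee_fin ltW.
move=> /(le_trans (lee_wpmul2l N0' vB)) /le_trans /(_ hn).
rewrite -EFinM lee_fin -/V => h.
have : N <= a / c / V.
  by rewrite -mulrA -invfM ler_pdivlMr// mulr_gt0.
have : 0 < 2 * a / V by rewrite divr_gt0// mulr_gt0.
by rewrite /N; lra.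
Qed.

End heat.

(** * Spectral bounds *)

Lemma powR_invl {R : realType} (a e : R) : 0 < a -> (a^-1) `^ e = (a `^ e)^-1.
Proof.
move=> a0; apply: (mulIf (x := a `^ e)); first by rewrite gt_eqF// powR_gt0.
rewrite mulVf; last by rewrite gt_eqF// powR_gt0.
by rewrite -powRM ?invr_ge0 ?ltW// mulVf ?gt_eqF// powR1.
Qed.

Lemma sqrt_powR {R : realType} (t d : R) : 0 <= t -> Num.sqrt t `^ d = t `^ (d / 2).
Proof. by move=> t0; rewrite -powR12_sqrt// -powRrM mulrC. Qed.

Section spectral_data.
Context {R : realType} {dX : measure_display} {X : measurableType dX}.
Variables (mu : {finite_measure set X -> \bar R}) (d : R).
Variables (lam : nat -> R) (u : nat -> X -> R).

(** Digest of the heat kernel estimates: the on-diagonal bound off one null set, for all times and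
    all truncations, together with its integrated form, the trace bound. *)
Definition spectral_data (N : set X) (K : R) : Prop :=
  [/\ measurable N, mu N = 0%E, 0 < K,
    forall x t n, ~ N x -> 0 < t <= 1 ->
      \sum_(j < n) expR (- (t * lam j)) * u j x ^+ 2 <= K / t `^ (d / 2)
  & forall t n, 0 < t <= 1 -> \sum_(j < n) expR (- (t * lam j)) <= K / t `^ (d / 2)].

Variables (N : set X) (K : R).
Hypothesis SD : spectral_data N K.
Hypothesis ES : eigen_system mu lam u.

Let lam0 j : 0 <= lam j. Proof. exact: (eigen_lam_ge0 ES). Qed.

Lemma spectral_sum_le x t n : ~ N x -> 0 < t ->
  \sum_(j < n) expR (- (t * lam j)) * u j x ^+ 2 <= K / (Num.min t 1) `^ (d / 2).
Proof.
move=> Nx t0; case: SD => _ _ K0 h _.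
have t1 : 0 < Num.min t 1 <= 1 by rewrite lt_min t0 ltr01 ge_min lexx orbT.
apply: le_trans (h x (Num.min t 1) n Nx t1); apply: ler_sum => j _.
by rewrite ler_wpM2r ?sqr_ge0// ler_expR lerN2 ler_wpM2r// ge_min lexx.
Qed.

(** [heat_cov] is a [limn], without meaning where the series diverges. Off [N] the diagonal bound
    gives absolute convergence. *)
Lemma heat_cov_cvg x y t : ~ N x -> ~ N y -> 0 < t ->
  (fun n => \sum_(j < n) expR (- (t * lam j)) * u j x * u j y) @ \oo --> heat_cov lam u t x y.
Proof.
move=> Nx Ny t0; rewrite /heat_cov.
suff : cvgn (fun n => \sum_(j < n) expR (- (t * lam j)) * u j x * u j y) by [].
pose a j := expR (- (t * lam j)) * u j x * u j y.
have -> : (fun n => \sum_(j < n) expR (- (t * lam j)) * u j x * u j y) = series a.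
  by apply/funext => n; rewrite /series/= big_mkord.
apply: normed_cvg; apply: nondecreasing_is_cvgn.
  by apply/nondecreasing_seqP => n /=; rewrite /series/= big_nat_recr//= lerDl.
exists (2 * (K / (Num.min t 1) `^ (d / 2))) => _ [n _ <-] /=.
rewrite /series/= big_mkord.
apply: (@le_trans _ _ (\sum_(j < n) expR (- (t * lam j)) * u j x ^+ 2 +
                       \sum_(j < n) expR (- (t * lam j)) * u j y ^+ 2)).
  rewrite -big_split; apply: ler_sum => j _ /=.
  rewrite /a -mulrA normrM (ger0_norm (expR_ge0 _)) -mulrDr ler_wpM2l ?expR_ge0// normrM.
  have := sqr_ge0 (`|u j x| - `|u j y|); rewrite sqrrB !real_normK ?num_real//.
  have : 0 <= `|u j x| * `|u j y| by rewrite mulr_ge0.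
  lra.
by rewrite mulr_natl mulr2n lerD// spectral_sum_le.
Qed.

(** Bounded eigenvalues would make the trace at time 1 infinite. *)
Lemma lam_unbounded L : exists j, L < lam j.
Proof.
apply: contrapT => /forallNP h.
have {}h j : lam j <= L by rewrite leNgt; apply/negP/h.
case: SD => _ _ K0 _ /(_ 1) hK.
pose n := (Num.bound (K * expR L)).+1.
have := hK n; rewrite ltr01 lexx => /(_ isT); rewrite powR1 divr1 leNgt => /negP; apply.
apply: (@lt_le_trans _ _ (\sum_(j < n) expR (- L))); last first.
  by apply: ler_sum => j _; rewrite ler_expR lerN2 mul1r.
rewrite sumr_const card_ord -mulr_natl expRN ltr_pdivlMr ?expR_gt0//.
apply: lt_trans (_ : (Num.bound (K * expR L))%:R < _); last by rewrite ltr_nat.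
by apply: archi_boundP; rewrite mulr_ge0 ?expR_ge0// ltW.
Qed.

Lemma eigen_count L : exists J : nat, forall j, (j < J)%N = (lam j <= L).
Proof.
have ex : exists j, L < lam j by exact: lam_unbounded.
case: (ex_minnP ex) => J hJ Jmin; exists J => j.
apply/idP/idP => [jJ|jL].
  by rewrite leNgt; apply/negP => /Jmin; rewrite leqNgt jJ.
rewrite ltnNge; apply/negP => Jj; have := eigen_lam_homo ES Jj.
by move=> /(lt_le_trans hJ); rewrite ltNge jL.
Qed.

(** In the trace at time 1 / L each eigenvalue up to L contributes at least 1 / e. The pointwise
    version below follows in the same way from the diagonal bound. *)
Lemma eigen_count_le L J : 1 <= L -> (forall j, (j < J)%N -> lam j <= L) ->
  J%:R <= expR 1 * K * L `^ (d / 2).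
Proof.
move=> L1 JL; have L0 : 0 < L by rewrite (lt_le_trans ltr01).
case: SD => _ _ K0 _ /(_ L^-1 J); rewrite invr_gt0 L0 invf_le1// => /(_ L1).
rewrite powR_invl// invrK => h; rewrite -mulrA mulrC -ler_pdivrMr ?expR_gt0//.
apply: le_trans h; rewrite -expRN.
apply: (@le_trans _ _ (\sum_(j < J) expR (- 1))).
  by rewrite sumr_const card_ord mulr_natl.
apply: ler_sum => j _; rewrite ler_expR lerN2 mulrC ler_pdivrMr// mul1r.
exact: JL.
Qed.

Lemma eigen_sup_le L J x : ~ N x -> 1 <= L -> (forall j, (j < J)%N -> lam j <= L) ->
  \sum_(j < J) u j x ^+ 2 <= expR 1 * K * L `^ (d / 2).
Proof.
move=> Nx L1 JL; have L0 : 0 < L by rewrite (lt_le_trans ltr01).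
case: SD => _ _ K0 /(_ x L^-1 J Nx) + _; rewrite invr_gt0 L0 invf_le1// => /(_ L1).
rewrite powR_invl// invrK => h; rewrite -mulrA mulrC -ler_pdivrMr ?expR_gt0//.
apply: le_trans h; rewrite -expRN mulr_suml; apply: ler_sum => j _.
rewrite mulrC ler_wpM2r ?sqr_ge0// ler_expR lerN2 mulrC ler_pdivrMr// mul1r.
exact: JL.
Qed.

End spectral_data.

Section heat_spectral.
Context {R : realType} {dX : measure_display} {X : measurableType dX}.
Variables (rho : X -> X -> R) (mu : {finite_measure set X -> \bar R}) (C c d : R).
Variables (lam : nat -> R) (u : nat -> X -> R) (p : R -> X -> X -> R) (eta : R).
Hypothesis DS : dirichlet_setting rho mu C c d lam u p eta.

Let d0 : 0 < d. Proof. by case: DS => _ []. Qed.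
Let ES : eigen_system mu lam u. Proof. by case: DS. Qed.

(** The squared norm is at most the supremum times the L1 norm. *)
Lemma heat_L2 : exists2 K, 0 < K & forall t x, 0 < t <= 1 ->
  L2 mu (p t x) /\ dot mu (p t x) (p t x) <= K / t `^ (d / 2).
Proof.
have [K K0 hK] := heat_bounds DS; exists (K * K); first by rewrite mulr_gt0.
move=> t x t01; have [pK iK] := hK t x t01; have t0 : 0 < t by case/andP: t01.
have mp := heat_measurable DS x t0.
rewrite sqrt_powR ?ltW// in pK.
have KV : 0 <= K / t `^ (d / 2) by rewrite divr_ge0 ?powR_ge0// ltW.
have le : (\int[mu]_y ((p t x y) ^+ 2)%:E <= (K * K / t `^ (d / 2))%:E)%E.
  apply: (@le_trans _ _ (\int[mu]_y ((K / t `^ (d / 2))%:E * (`|p t x y|)%:E))%E).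
    apply: ge0_le_integral => //.
    - by move=> y _; rewrite lee_fin sqr_ge0.
    - by apply/measurable_EFinP; exact: measurable_funX.
    - by apply: measurable_funeM; apply/measurable_EFinP; exact: measurableT_comp.
    - by move=> y _; rewrite -EFinM lee_fin -real_normK ?num_real// expr2 ler_wpM2r.
  rewrite ge0_integralZl_EFin//; last by apply/measurable_EFinP; exact: measurableT_comp.
  apply: (le_trans (lee_wpmul2l _ iK)); rewrite ?lee_fin//.
  by rewrite -?EFinM ?lee_fin mulrAC.
have L : L2 mu (p t x).
  split => //; apply/integrableP; split; first by apply/measurable_EFinP; exact: measurable_funX.
  under eq_integral do rewrite gee0_abs ?lee_fin ?sqr_ge0//.
  by apply: (le_lt_trans le); rewrite ltry.
by split => //; rewrite -lee_fin -dot2E.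
Qed.

(** At each time the eigenrelation holds for almost every x; the dyadic times being countable, one
    null set serves them all. *)
Lemma heat_coef : exists N : set X, [/\ measurable N, mu N = 0%E &
  forall x m j, ~ N x ->
    dot mu (u j) (p (2^-1 ^+ m) x) = expR (- (2^-1 ^+ m * lam j)) * u j x].
Proof.
have : {ae mu, forall x, forall m j,
    (\int[mu]_y (p (2^-1 ^+ m) x y * u j y)%:E = (expR (- (2^-1 ^+ m * lam j)) * u j x)%:E)%E}.
  apply: ae_foralln => m; apply: ae_foralln => j.
  by case: DS => _ _ _ _ [_ + _ _ _]; apply; rewrite exprn_gt0.
move=> [N [mN N0 h]]; exists N; split => // x m j Nx.
have {}h : (\int[mu]_y (p (2^-1 ^+ m) x y * u j y)%:E = (expR (- (2^-1 ^+ m * lam j)) * u j x)%:E)%E.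
  apply: contrapT => hn; apply/Nx/h => /= hx; exact/hn/hx.
by rewrite dotC /dot /Rintegral h.
Qed.

(** Bessel's inequality for the kernel at a dyadic time r <= t / 2 sums exp(-2 r lam) u^2, which
    dominates the diagonal at time t. Integrating over the finite space turns it into the trace
    bound. *)
Lemma heat_spectral_data (N : set X) : measurable N -> mu N = 0%E ->
  (forall x m j, ~ N x ->
    dot mu (u j) (p (2^-1 ^+ m) x) = expR (- (2^-1 ^+ m * lam j)) * u j x) ->
  exists K, spectral_data mu d lam u N K.
Proof.
move=> mN N0 hN; have [K K0 hK] := heat_L2.
pose K1 := K * 4 `^ (d / 2).
have K10 : 0 < K1 by rewrite mulr_gt0// powR_gt0.
have b x t n : ~ N x -> 0 < t <= 1 ->
    \sum_(j < n) expR (- (t * lam j)) * u j x ^+ 2 <= K1 / t `^ (d / 2).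
  move=> Nx t01; have /andP[t0 t1] := t01; have [m [mt1 mt2]] := dyadic_scale t01.
  set r : R := 2^-1 ^+ m in mt1 mt2.
  have r01 : 0 < r <= 1 by rewrite exprn_gt0//=; lra.
  have [Lp pK] := hK r x r01; have r0 : 0 < r by case/andP: r01.
  apply: (@le_trans _ _ (K / r `^ (d / 2))).
    apply: le_trans pK; apply: le_trans (bessel ES n Lp); apply: ler_sum => j _.
    rewrite /coef hN// exprMn ler_wpM2r ?sqr_ge0// -expRM_natl ler_expR mulrN lerN2.
    by rewrite mulrA ler_wpM2r ?(eigen_lam_ge0 ES)// -/r; lra.
  rewrite /K1 ler_pdivlMr ?powR_gt0// -!mulrA ler_pM2l// ler_pdivrMl ?powR_gt0//.
  rewrite -powRM ?(ltW r0)//; apply: ge0_ler_powR.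
  - by rewrite divr_ge0// ltW.
  - by rewrite nnegrE ltW.
  - by rewrite nnegrE mulr_ge0// ltW.
  - by lra.
have mT0 : 0 <= fine (mu setT) by exact: fine_ge0.
exists (K1 * (1 + fine (mu setT))); split => //.
- by rewrite mulr_gt0// ltr_pwDl.
- move=> x t n Nx t01; apply: le_trans (b x t n Nx t01) _.
  by rewrite ler_wpM2r ?invr_ge0 ?powR_ge0// ler_peMr ?lerDl// ltW.
- move=> t n t01; rewrite -lee_fin.
  have L2u j : L2 mu (u j) := eigen_L2 ES j.
  have mu2 j : measurable_fun setT (fun x => (expR (- (t * lam j)) * u j x ^+ 2)%:E).
    apply/measurable_EFinP; apply: measurable_funM => //; apply: measurable_funX.
    by case: (L2u j).
  have -> : ((\sum_(j < n) expR (- (t * lam j)))%:E =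
     \int[mu]_x (\sum_(j < n) expR (- (t * lam j)) * u j x ^+ 2)%:E)%E.
    under eq_integral do rewrite -sumEFin.
    rewrite ge0_integral_sum//; last first.
      by move=> j x _; rewrite lee_fin mulr_ge0 ?expR_ge0 ?sqr_ge0.
    rewrite -sumEFin; apply: eq_bigr => j _.
    under eq_integral do rewrite EFinM.
    rewrite ge0_integralZl_EFin ?expR_ge0//.
    + by rewrite dot2E// (eigen_dot ES) eqxx mule1.
    + by move=> x _; rewrite lee_fin sqr_ge0.
    + by apply/measurable_EFinP; apply: measurable_funX; case: (L2u j).
  apply: (@le_trans _ _ (\int[mu]_x (K1 / t `^ (d / 2))%:E)%E).
    apply: ae_ge0_le_integral => //.
    + by move=> x _; rewrite lee_fin sumr_ge0// => j _; rewrite mulr_ge0 ?expR_ge0 ?sqr_ge0.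
    + apply/measurable_EFinP; apply: measurable_sum => j; exact/measurable_EFinP/mu2.
    + by move=> x _; rewrite lee_fin divr_ge0 ?powR_ge0// ltW.
    + exists N; split => // x /= /not_implyP[_] /negP; rewrite lee_fin.
      by move=> /negP h; apply: contrapT => Nx; exact/h/b.
  have -> : (\int[mu]_x (K1 / t `^ (d / 2))%:E = (K1 / t `^ (d / 2))%:E * mu setT)%E.
    by rewrite -integral_cst.
  rewrite (mu_fin mu measurableT) -EFinM lee_fin mulrAC.
  rewrite ler_pM2r ?invr_gt0 ?powR_gt0//; last by case/andP: t01.
  by rewrite ler_pM2l// lerDr.
Qed.

End heat_spectral.

(** * The design density and Besov tails *)

Lemma cvg0_le {R : realType} (x A : R) (del : nat -> R) :
  (forall N, x <= A + del N) -> del @ \oo --> 0 -> x <= A.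
Proof.
move=> h d0; apply/ler_addgt0Pr => e e0.
have /cvgr0_norm_lt /(_ e e0) [N _ /(_ N (leqnn _))] := d0.
by rewrite /= ltr_norml => /andP[_ dN]; have := h N; lra.
Qed.

Lemma le_mul1eps {R : realType} (x y : R) : 0 <= y ->
  (forall e, 0 < e -> x <= (1 + e) * y) -> x <= y.
Proof.
move=> y0 h; apply/ler_addgt0Pr => e e0.
have y1 : 0 < y + 1 by rewrite ltr_wpDl.
have := h _ (divr_gt0 e0 y1); move/le_trans; apply.
rewrite mulrDl mul1r lerD2l -mulrA ler_piMr ?(ltW e0)//.
by rewrite ler_pdivrMl// mulr1 lerDl.
Qed.

Section L2_eps.
Context {R : realType} {d} {T : measurableType d} (m : {measure set T -> \bar R}).

(** Young's inequality with weight e: the main term keeps the factor 1 + e, so the bounds on squared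
    norms pass to L2 limits with the same constant. *)
Lemma dotD2_eps f g (e : R) : L2 m f -> L2 m g -> 0 < e ->
  dot m (fun x => f x + g x) (fun x => f x + g x) <=
  (1 + e) * dot m f f + (1 + e^-1) * dot m g g.
Proof.
move=> Lf Lg e0.
have Leg := L2Z e^-1 Lg.
have := dot_ge0 m (fun x => f x - e^-1 * g x).
rewrite dotB2// dotD2// !dotZr// dotZl// => h.
suff : 2 * dot m f g <= e * dot m f f + e^-1 * dot m g g by lra.
have := ler_wpM2l (ltW e0) h; rewrite mulr0.
have -> : e * (dot m f f - 2 * (e^-1 * dot m f g) + e^-1 * (e^-1 * dot m g g)) =
  e * dot m f f - 2 * dot m f g + e^-1 * dot m g g by field; rewrite gt_eqF.
by lra.
Qed.

Lemma dot_lim_le f (F : nat -> T -> R) B : L2 m f -> (forall N, L2 m (F N)) -> 0 <= B ->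
  (fun N => dot m (fun x => f x - F N x) (fun x => f x - F N x)) @ \oo --> 0 ->
  (forall N, dot m (F N) (F N) <= B) -> dot m f f <= B.
Proof.
move=> Lf LF B0 F0 FB; apply: le_mul1eps => // e e0.
apply: (@cvg0_le _ _ _ (fun N => (1 + e^-1) *
  dot m (fun x => f x - F N x) (fun x => f x - F N x))); last first.
  by rewrite -[X in _ --> X](mulr0 (1 + e^-1)); apply: cvgM => //; exact: cvg_cst.
move=> N; have := dotD2_eps (LF N) (L2B Lf (LF N)) e0.
have -> : (fun x => F N x + (f x - F N x)) = f by apply/funext => x; rewrite subrKC.
have : (1 + e) * dot m (F N) (F N) <= (1 + e) * B by rewrite ler_wpM2l// addr_ge0// ltW.
by lra.
Qed.

Lemma dot_lim_ge f (F : nat -> T -> R) (b : nat -> R) B : L2 m f -> (forall N, L2 m (F N)) ->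
  (fun N => dot m (fun x => f x - F N x) (fun x => f x - F N x)) @ \oo --> 0 ->
  b @ \oo --> B -> (forall N, b N <= dot m (F N) (F N)) -> B <= dot m f f.
Proof.
move=> Lf LF F0 bB FB; apply: le_mul1eps; first exact: dot_ge0.
move=> e e0.
apply: (@cvg0_le _ _ _ (fun N => (B - b N) + (1 + e^-1) *
  dot m (fun x => f x - F N x) (fun x => f x - F N x))); last first.
  rewrite -[X in _ --> X]addr0; apply: cvgD.
    by rewrite -(subrr B); apply: cvgB => //; exact: cvg_cst.
  by rewrite -[X in _ --> X](mulr0 (1 + e^-1)); apply: cvgM => //; exact: cvg_cst.
move=> N; have := dotD2_eps Lf (L2B (LF N) Lf) e0.
have -> : (fun x => f x + (F N x - f x)) = F N by apply/funext => x; rewrite subrKC.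
have -> : dot m (fun x => F N x - f x) (fun x => F N x - f x) =
  dot m (fun x => f x - F N x) (fun x => f x - F N x).
  by rewrite !dotB2// (dotC m (F N)); lra.
by have := FB N; lra.
Qed.

End L2_eps.

Lemma L2_weight {R : realType} {d} {T : measurableType d} (m : {measure set T -> \bar R})
    (w f : T -> R) (B : R) : measurable_fun setT w -> L2 m f -> 0 <= B ->
  {ae m, forall x, w x ^+ 2 <= B} ->
  L2 m (fun x => w x * f x) /\
  dot m (fun x => w x * f x) (fun x => w x * f x) <= B * dot m f f.
Proof.
move=> mw Lf B0 h; have mf : measurable_fun setT f by case: Lf.
have mwf : measurable_fun setT (fun x => w x * f x) by exact: measurable_funM.
have le : (\int[m]_x ((w x * f x) ^+ 2)%:E <= (B * dot m f f)%:E)%E.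
  rewrite EFinM -dot2E// -ge0_integralZl_EFin//; last 2 first.
    by move=> x _; rewrite lee_fin sqr_ge0.
    by apply/measurable_EFinP; exact: measurable_funX.
  apply: ae_ge0_le_integral => //.
  - by move=> x _; rewrite lee_fin sqr_ge0.
  - by apply/measurable_EFinP; exact: measurable_funX.
  - by move=> x _; rewrite -EFinM lee_fin mulr_ge0 ?sqr_ge0.
  - by apply: measurable_funeM; apply/measurable_EFinP; exact: measurable_funX.
  - by apply: filterS h => x hx _; rewrite -EFinM lee_fin exprMn ler_wpM2r ?sqr_ge0.
have L : L2 m (fun x => w x * f x).
  split => //; apply/integrableP; split.
    by apply/measurable_EFinP; exact: measurable_funX.
  under eq_integral do rewrite gee0_abs ?lee_fin ?sqr_ge0//.
  by apply: (le_lt_trans le); rewrite ltry.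
by split => //; rewrite -lee_fin -dot2E.
Qed.

(** * Comparison of the design law with the reference measure *)

Section design.
Context {R : realType} {d} {T : measurableType d}.
Variables (mu : {finite_measure set T -> \bar R}) (lam : nat -> R) (u : nat -> T -> R).
Variables (mu0 : probability T R) (p0 : T -> R) (pm pp : R).
Hypothesis ES : eigen_system mu lam u.
Hypothesis DD : design_density mu u mu0 p0 pm pp.

Let mp0 : measurable_fun setT p0. Proof. by case: DD. Qed.
Let p00 x : 0 <= p0 x. Proof. by case: DD. Qed.
Let pm0 : 0 < pm. Proof. by case: DD => _ _ _ /andP[]. Qed.
Let pp0 : 0 < pp. Proof. by case: DD => _ _ _ /andP[h /(lt_le_trans h)]. Qed.
(** Multiplication by the square root of the density turns the Gram form of the design into a
    squared norm for [mu]. *)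
Let q x : R := Num.sqrt (p0 x).
Let mq : measurable_fun setT q.
Proof.
apply: measurableT_comp => //; apply: continuous_measurable_fun; exact: sqrt_continuous.
Qed.
Let qq x : q x * q x = p0 x. Proof. by rewrite -expr2 sqr_sqrtr. Qed.
Let g j x : R := q x * u j x.

Let mu_ j : measurable_fun setT (u j). Proof. by case: (eigen_L2 ES j). Qed.

Lemma design_gramE j k :
  fine (\int[mu]_x (u j x * u k x * p0 x)%:E)%E = dot mu (g j) (g k).
Proof.
rewrite /dot /Rintegral; congr fine; apply: eq_integral => x _; congr EFin.
by rewrite /g mulrACA qq mulrC.
Qed.

Let gL2 j : L2 mu (g j).
Proof.
have mg : measurable_fun setT (g j) by exact: measurable_funM.
split => //; apply/integrableP; split.
  by apply/measurable_EFinP; exact: measurable_funX.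
under eq_integral do rewrite gee0_abs ?lee_fin ?sqr_ge0//.
(* The Gram entries are read through [fine], which sends an infinite integral to 0. The lower bound
   [pm] on the unit vector of index j rules this out. *)
have := DD => -[_ _ _ _ /(_ j.+1 (fun i => (i == ord_max)%:R)) /andP[+ _]].
rewrite (bigD1 ord_max)//= eqxx expr1n big1 ?addr0 ?mulr1; last first.
  by move=> i /negPf ->; rewrite expr0n.
rewrite (bigD1 ord_max)//= [X in _ + X]big1 ?addr0; last first.
  by move=> i /negPf ->; rewrite big1// => k _; rewrite !mul0r.
rewrite (bigD1 ord_max)//= [X in _ + X]big1 ?addr0; last first.
  by move=> i /negPf ->; rewrite mulr0 mul0r.
rewrite eqxx !mul1r.
have -> : (\int[mu]_x (u j x * u j x * p0 x)%:E = \int[mu]_x (g j x ^+ 2)%:E)%E.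
  by apply: eq_integral => x _; congr EFin; rewrite /g expr2 mulrACA qq mulrC.
case: (\int[mu]_x _)%E => [r| |] //=; first by rewrite ltry.
  by move=> h; move: pm0; rewrite ltNge h.
Qed.

Lemma design_gram_lcomb (c : nat -> R) N :
  pm * \sum_(j < N) c j ^+ 2 <=
    dot mu (fun x => q x * lcomb u c N x) (fun x => q x * lcomb u c N x) <=
  pp * \sum_(j < N) c j ^+ 2.
Proof.
have := DD => -[_ _ _ _ /(_ N (fun i => c i))].
suff -> : dot mu (fun x => q x * lcomb u c N x) (fun x => q x * lcomb u c N x) =
  \sum_(j < N) \sum_(k < N) c j * c k * fine (\int[mu]_x (u j x * u k x * p0 x)%:E)%E by [].
have -> : (fun x => q x * lcomb u c N x) = lcomb g c N.
  apply/funext => x; rewrite /lcomb mulr_sumr; apply: eq_bigr => i _.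
  by rewrite /g mulrCA.
have Lc j : L2 mu (fun x => c j * g j x) by exact: L2Z.
have Lg : L2 mu (lcomb g c N) by exact: L2_sum.
rewrite /lcomb dot_suml//; apply: eq_bigr => i _.
rewrite dotC dot_suml//; apply: eq_bigr => j _.
by rewrite dotZl// dotZr// design_gramE (dotC mu (g j)) mulrCA mulrA.
Qed.

Let L2indic A : measurable A -> L2 mu \1_A /\ dot mu \1_A \1_A = fine (mu A).
Proof.
move=> mA.
have E : (\int[mu]_x (\1_A x ^+ 2)%:E = mu A)%E.
  rewrite -[in RHS](setIT A) -integral_indic//; apply: eq_integral => x _.
  by rewrite indicE; case: (_ \in _); rewrite ?expr1n ?expr0n.
split.
  split; first exact: measurable_indic.
  apply/integrableP; split.
    by apply/measurable_EFinP; apply: measurable_funX; exact: measurable_indic.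
  under eq_integral do rewrite gee0_abs ?lee_fin ?sqr_ge0//.
  by rewrite E (mu_fin mu mA) ltry.
by rewrite -E.
Qed.

Let qproj (f : T -> R) N x := q x * lcomb u (coef mu u f) N x.

Let qproj_L2 f N : L2 mu (qproj f N).
Proof.
have -> : qproj f N = lcomb g (coef mu u f) N.
  apply/funext => x; rewrite /qproj /lcomb mulr_sumr; apply: eq_bigr => i _.
  by rewrite /g mulrCA.
by apply: L2_sum => i; exact: L2Z.
Qed.

Let mindic (A : set T) : measurable A -> measurable_fun setT (\1_A : T -> R).
Proof. exact: measurable_indic. Qed.

Let mu0q A : measurable A -> L2 mu (fun x => q x * \1_A x) /\
  (dot mu (fun x => q x * \1_A x) (fun x => q x * \1_A x))%:E = mu0 A.
Proof.
move=> mA.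
have mqA : measurable_fun setT (fun x => q x * \1_A x).
  by apply: measurable_funM => //; exact: mindic.
have E : (\int[mu]_x ((q x * \1_A x) ^+ 2)%:E = mu0 A)%E.
  case: DD => _ _ -> // _ _; rewrite integral_mkcond; apply: eq_integral => x _.
  by rewrite /patch indicE; case: (_ \in _); rewrite ?mulr1 ?mulr0 ?expr0n// expr2 qq.
have L : L2 mu (fun x => q x * \1_A x).
  split => //; apply/integrableP; split; first by apply/measurable_EFinP; exact: measurable_funX.
  under eq_integral do rewrite gee0_abs ?lee_fin ?sqr_ge0//.
  by rewrite E (mu_fin mu0 mA) ltry.
by split => //; rewrite -dot2E.
Qed.

Let Lproj A N : measurable A -> L2 mu (fun x => \1_A x - lcomb u (coef mu u \1_A) N x).
Proof.
by move=> mA; apply: L2B; [case: (L2indic mA)|exact: (lcomb_L2 ES)].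
Qed.

(* Truncating to [p0 <= n] makes multiplication by the square root of [p0] bounded on L2. *)
Let design_le_trunc (A : set T) (n : nat) : measurable A ->
  (mu0 (A `&` [set x | (p0 x <= n%:R)%R]) <= (pp * fine (mu A))%:E)%E.
Proof.
move=> mA; have [LA dA] := L2indic mA; set B := [set x | p0 x <= n%:R].
have mB : measurable B by rewrite -[B]setTI; exact: measurable_fun_le.
have mAB : measurable (A `&` B) by exact: measurableI.
have [LAB <-] := mu0q mAB; rewrite lee_fin.
pose F N x := \1_B x * qproj \1_A N x.
have B1 : {ae mu, forall x, (\1_B x : R) ^+ 2 <= 1}.
  by apply: aeW => x; rewrite indicE; case: (_ \in _); rewrite ?expr1n ?expr0n.
have Fle N : L2 mu (F N) /\ dot mu (F N) (F N) <= dot mu (qproj \1_A N) (qproj \1_A N).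
  by rewrite -[X in _ <= X]mul1r; apply: (L2_weight (mindic mB) (qproj_L2 _ N) ler01 B1).
apply: (@dot_lim_le _ _ _ mu _ F) => //.
- by move=> N; case: (Fle N).
- by rewrite mulr_ge0 ?(ltW pp0)// fine_ge0.
- apply: (@squeeze_cvgr _ _ _ _ (fun=> 0) (fun N => n%:R *
      dot mu (fun x => \1_A x - lcomb u (coef mu u \1_A) N x)
             (fun x => \1_A x - lcomb u (coef mu u \1_A) N x))).
  + apply: nearW => N; rewrite dot_ge0/=.
    have -> : (fun x => q x * \1_(A `&` B) x - F N x) =
        (fun x => (q x * \1_B x) * (\1_A x - lcomb u (coef mu u \1_A) N x)).
      apply/funext => x; have -> : \1_(A `&` B) x = \1_A x * \1_B x :> R by rewrite !indicE classical_sets.in_setI; case: (x \in A); rewrite ?mul1r ?mul0r.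
      by rewrite /F /qproj; ring.
    apply: (L2_weight _ (Lproj N mA) _ _).2 => //.
    * by apply: measurable_funM => //; exact: mindic.
    * apply: aeW => x; rewrite exprMn expr2 qq indicE; have [xB|] := boolP (x \in B).
        by rewrite expr1n mulr1; move: xB; rewrite inE.
      by rewrite expr0n mulr0.
  + exact: cvg_cst.
  + rewrite -[X in _ --> X](mulr0 n%:R); apply: cvgM; first exact: cvg_cst.
    exact: (cvg_dot_proj ES).
- move=> N; case: (Fle N) => _ /le_trans; apply.
  have /andP[_ /le_trans] := design_gram_lcomb (coef mu u \1_A) N; apply.
  by rewrite ler_pM2l// -dA; exact: (bessel ES).
Qed.

(** The sets where p0 <= n exhaust [A], and the truncated bound does not depend on n. *)
Lemma design_le A : measurable A -> (mu0 A <= (pp * fine (mu A))%:E)%E.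
Proof.
move=> mA; pose B n := A `&` [set x | p0 x <= n%:R].
have mB n : measurable (B n).
  by apply: measurableI => //; rewrite -[X in measurable X]setTI; exact: measurable_fun_le.
have AE : A = \bigcup_n B n.
  apply/seteqP; split => [x Ax|x [n _ []]//].
  exists (Num.bound (p0 x)) => //; split => //=.
  by apply/ltW/archi_boundP.
have ndB : nondecreasing_seq B.
  apply/nondecreasing_seqP => n; apply/subsetPset => x [Ax]/= h; split => //=.
  by apply: (le_trans h); rewrite ler_nat.
have := nondecreasing_cvg_mu (mu := mu0) mB _ ndB; rewrite -AE => /(_ mA) cv.
rewrite -(cvg_lim _ cv)//; apply: lime_le; first by apply/cvg_ex; eexists; exact: cv.
by apply: nearW => n; exact: design_le_trunc.
Qed.

(** Apply [design_le] to the set where p0 exceeds pp: the excess [f] has integral at most 0. *)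
Let p0_le : {ae mu, forall x, p0 x <= pp}.
Proof.
pose A := [set x | pp < p0 x].
have mA : measurable A.
  rewrite -[A]setTI; have := @measurable_fun_ltr _ _ _ setT (cst pp) p0 (@measurable_cst _ _ _ _ _ _) mp0.
  by move=> /(_ measurableT [set true] I); congr measurable; apply/seteqP; split => x /=.
pose f x := ((p0 x - pp) * \1_A x)%:E.
have f0 x : (0 <= f x)%E.
  rewrite lee_fin indicE; have [|] := boolP (x \in A); rewrite ?mulr0// inE /A/= mulr1 subr_ge0.
  exact: ltW.
have mf : measurable_fun setT f.
  apply/measurable_EFinP; apply: measurable_funM; last exact: mindic.
  by apply: measurable_funB.
have mA1 : measurable_fun setT (fun x => (pp * \1_A x)%:E).
  by apply/measurable_EFinP; apply: measurable_funM => //; exact: mindic.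
have pA : (\int[mu]_x (pp * \1_A x)%:E = (pp * fine (mu A))%:E)%E.
  under eq_integral do rewrite EFinM.
  rewrite ge0_integralZl_EFin ?(ltW pp0)//; last by apply/measurable_EFinP; exact: mindic.
  by rewrite integral_indic// setIT EFinM -(mu_fin mu mA).
have E : (\int[mu]_x f x + (pp * fine (mu A))%:E = mu0 A)%E.
  rewrite -pA -ge0_integralD//; last by move=> x _; rewrite lee_fin mulr_ge0// ltW.
  case: DD => _ _ -> // _ _; rewrite [RHS]integral_mkcond; apply: eq_integral => x _.
  rewrite /f -EFinD /patch indicE; case: (_ \in _); rewrite ?mulr1 ?mulr0 ?addr0//.
  by rewrite subrK.
have : (\int[mu]_x f x <= 0)%E.
  have := design_le mA; rewrite -E.
  have := integral_ge0 mu (D := setT) (fun x _ => f0 x).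
  case: (\int[mu]_x f x)%E => [r| |]//; rewrite -EFinD !lee_fin; lra.
move=> /(ge0_integral_eq0_ae mf f0); apply: filterS => x.
rewrite /f indicE; have [|] := boolP (x \in A); last by rewrite notin_setE /A/= => /negP; rewrite -leNgt.
by rewrite inE /A/= mulr1 => h -[] h2; lra.
Qed.

(** Now that p0 is almost everywhere bounded, multiplication by [q] is continuous on L2. The lower
    Gram bound passes to the limit along the eigenfunction expansion of the indicator of [A], and
    Parseval evaluates the other side. *)
Lemma design_ge A : measurable A -> ((pm * fine (mu A))%:E <= mu0 A)%E.
Proof.
move=> mA; have [LA dA] := L2indic mA; have [LqA <-] := mu0q mA; rewrite lee_fin.
apply: (@dot_lim_ge _ _ _ mu _ (qproj \1_A)
  (fun N => pm * \sum_(j < N) coef mu u \1_A j ^+ 2)) => //.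
- apply: (@squeeze_cvgr _ _ _ _ (fun=> 0) (fun N => pp *
      dot mu (fun x => \1_A x - lcomb u (coef mu u \1_A) N x)
             (fun x => \1_A x - lcomb u (coef mu u \1_A) N x))).
  + apply: nearW => N; rewrite dot_ge0/=.
    have -> : (fun x => q x * \1_A x - qproj \1_A N x) =
        (fun x => q x * (\1_A x - lcomb u (coef mu u \1_A) N x)).
      by apply/funext => x; rewrite /qproj mulrBr.
    apply: (L2_weight _ (Lproj N mA) _ _).2 => //; first exact: ltW.
    by apply: filterS p0_le => x; rewrite expr2 qq.
  + exact: cvg_cst.
  + rewrite -[X in _ --> X](mulr0 pp); apply: cvgM; first exact: cvg_cst.
    exact: (cvg_dot_proj ES).
- by rewrite -dA; apply: cvgM; [exact: cvg_cst|exact: (parseval ES)].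
- by move=> N; case/andP: (design_gram_lcomb (coef mu u \1_A) N).
Qed.
End design.

(** * Littlewood-Paley blocks and the tail of the expansion of f0 *)

Lemma geometric_tail_le {R : realType} (q : R) (m n : nat) : 0 <= q < 1 ->
  \sum_(m <= i < n) q ^+ i <= q ^+ m / (1 - q).
Proof.
move=> /andP[q0 q1]; have q1' : 0 < 1 - q by rewrite subr_gt0.
rewrite ler_pdivlMr//; have [mn|nm] := leqP m n; last first.
  by rewrite big_geq ?mul0r ?exprn_ge0// ltnW.
suff -> : (\sum_(m <= i < n) q ^+ i) * (1 - q) = q ^+ m - q ^+ n.
  by rewrite gerBl exprn_ge0.
rewrite -(subnKC mn); elim: (n - m)%N => [|k ih].
  by rewrite addn0 big_geq// mul0r subrr.
by rewrite addnS big_nat_recr ?leq_addr//= mulrDl ih exprS; ring.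
Qed.

(** The bands 2^i [2^(-3/4), 2^(3/4)] on which the blocks are bounded below overlap, hence cover the
    half-line. The least k with y <= 2^(3/4) 2^k selects the block. *)
Lemma LP_cover {R : realType} (phi0 phi : R -> R) : LP_admissible phi0 phi ->
  exists2 c : R, 0 < c & forall y, 0 <= y -> exists i,
    c <= `|LP_fun phi0 phi i y| /\ y <= 2 ^+ i.+1.
Proof.
case=> _ _ [c1 c10 h1] _ [c2 c20 h2]; exists (Num.min c1 c2).
  by rewrite lt_min c10.
move=> y y0; set a : R := 2 `^ (3 / 4).
have a1 : 1 <= a by apply: powR_ge1; lra.
have p1 : 2 `^ 1 = 2 :> R by rewrite powRr1.
have a2 : a <= 2.
  by rewrite -[leRHS]p1; apply: ler_powR; lra.
have ex : exists k, y <= a * 2 ^+ k.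
  have [k /ltW yk] := pow2_archi y; exists k; apply: (le_trans yk).
  by rewrite ler_peMl// exprn_ge0.
case: (ex_minnP ex) => -[|i] hi imin.
  rewrite expr0 mulr1 in hi; exists 0%N => /=; split; last by rewrite expr1; lra.
  by apply: (@le_trans _ _ c1); [rewrite ge_min lexx|apply: h1; rewrite y0].
exists i.+1 => /=; split; last first.
  by apply: (le_trans hi); rewrite [leRHS]exprS ler_wpM2r ?exprn_ge0.
apply: (@le_trans _ _ c2); [by rewrite ge_min lexx orbT|apply: h2].
have P : 0 < 2 ^+ i.+1 :> R by rewrite exprn_gt0.
rewrite ler_pdivrMr// ler_pdivlMr// hi andbT.
have h : a * 2 ^+ i < y by rewrite ltNge; apply/negP => /imin; rewrite ltnn.
apply: le_trans (ltW h); rewrite exprS mulrA ler_wpM2r ?exprn_ge0//.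
have a0 : 0 < a by lra.
rewrite powRN -/a ler_pdivrMl//.
rewrite /a -powRD ?pnatr_eq0 ?implybT//.
rewrite -[leLHS]p1; apply: ler_powR; lra.
Qed.

Lemma LP_fun_supp {R : realType} (phi0 phi : R -> R) (i : nat) (y : R) : LP_admissible phi0 phi ->
  2 ^+ i.+1 < y -> LP_fun phi0 phi i y = 0.
Proof.
case=> _ [h0 _] _ h _ hy; have y0 : 0 <= y by apply: ltW; apply: lt_trans hy; rewrite exprn_gt0.
case: i hy => [|i] hy /=; first by apply: h0.
apply: h; first by rewrite divr_ge0 ?exprn_ge0.
by right; rewrite ltr_pdivlMr ?exprn_gt0// -exprS.
Qed.

Section besov_tail.
Context {R : realType} {dX : measure_display} {X : measurableType dX}.
Variables (rho : X -> X -> R) (mu : {finite_measure set X -> \bar R}).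
Variables (lam : nat -> R) (u : nat -> X -> R) (s : R) (f0 : X -> R).
Hypothesis ES : eigen_system mu lam u.
Hypothesis lamoo : forall L, exists j, L < lam j.
Hypothesis s0 : 0 < s.
Hypothesis BS : besov rho mu lam u s f0.

(** A block has compact support and the eigenvalues are unbounded, so its partial sums are
    eventually constant and equal to one finite combination. The almost sure bound on the limit thus
    becomes an L2 bound on the coefficients. *)
Lemma besov_block (phi0 phi : R -> R) (B : R) (i n : nat) : LP_admissible phi0 phi ->
  {ae mu, forall x, exists v : R,
      spec_partial mu lam u (LP_fun phi0 phi i) f0 x @ \oo --> v /\
      `|v| <= B * 2 `^ (- (s * i%:R))} ->
  \sum_(k < n) LP_fun phi0 phi i (Num.sqrt (lam k)) ^+ 2 * coef mu u f0 k ^+ 2 <=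
    B ^+ 2 * (4 `^ (- s)) ^+ i * fine (mu setT).
Proof.
move=> LP H.
have [j0 hj0] := lamoo ((2 ^+ i.+1) ^+ 2).
pose N := maxn j0 n.
pose a k := LP_fun phi0 phi i (Num.sqrt (lam k)) * coef mu u f0 k.
have a0 k : (N <= k)%N -> a k = 0.
  move=> Nk; rewrite /a LP_fun_supp ?mul0r//.
  rewrite -[ltLHS](ger0_norm (exprn_ge0 _ _))// -sqrtr_sqr ltr_sqrt.
    by apply: (lt_le_trans hj0); apply: (eigen_lam_homo ES); rewrite (leq_trans _ Nk)// leq_maxl.
  by apply: le_lt_trans (lt_le_trans hj0 _); [exact: sqr_ge0|
     apply: (eigen_lam_homo ES); rewrite (leq_trans _ Nk)// leq_maxl].
have sp x m : (N <= m)%N ->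
    spec_partial mu lam u (LP_fun phi0 phi i) f0 x m = lcomb u a N x.
  move=> Nm; rewrite /spec_partial /lcomb -(subnKC Nm) big_split_ord/= [X in _ + X]big1 ?addr0//.
  by move=> k _; have := a0 (N + k)%N (leq_addr _ _); rewrite /a /coef dot_ip => ->; rewrite mul0r.
have bd : {ae mu, forall x, `|lcomb u a N x| <= B * 2 `^ (- (s * i%:R))}.
  apply: filterS H => x [v [cv]]; suff -> : v = lcomb u a N x by [].
  rewrite -(cvg_lim _ cv)//; apply: cvg_lim => //; apply: cvg_near_cst.
  by exists N => // m /= Nm; exact: sp.
have le : dot mu (lcomb u a N) (lcomb u a N) <= (B * 2 `^ (- (s * i%:R))) ^+ 2 * fine (mu setT).
  have ml : measurable_fun setT (lcomb u a N) by case: (lcomb_L2 ES a N).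
  rewrite -lee_fin -dot2E; last exact: (lcomb_L2 ES).
  rewrite EFinM -(mu_fin mu measurableT) -integral_cst//.
  apply: ae_ge0_le_integral => //.
  - by move=> x _; rewrite lee_fin sqr_ge0.
  - by apply/measurable_EFinP; exact: measurable_funX.
  - by move=> x _; rewrite /= lee_fin sqr_ge0.
  - apply: filterS bd => x h _; rewrite /= lee_fin -real_normK ?num_real//.
    by rewrite lerXn2r ?nnegrE//; apply: (le_trans _ h).
have E : (B * 2 `^ (- (s * i%:R))) ^+ 2 = B ^+ 2 * (4 `^ (- s)) ^+ i.
  rewrite exprMn; congr (_ * _).
  by rewrite powR_expn// -mulNr powRrM powR_mulrn ?powR_ge0// powR_expn// powR_expn// -!exprM mulnC exprM -natrX.
rewrite -E; apply: le_trans le; rewrite (lcomb_dot ES).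
apply: (@le_trans _ _ (\sum_(k < n) a k * a k)).
  by apply: ler_sum => k _; rewrite /a -expr2 exprMn.
rewrite -(big_mkord xpredT (fun k => a k * a k)) -[leRHS](big_mkord xpredT (fun k => a k * a k)).
rewrite [leRHS](big_cat_nat (n := n)) ?leq_maxr//= lerDl.
by apply: sumr_ge0 => k _; rewrite -expr2 sqr_ge0.
Qed.

(** Each frequency beyond L is charged to a block that is at least c there. Such a block has index
    at least [i0], the first one reaching beyond sqrt L; block energies decay like 4^(-s i), and L
    <= 4^(i0 + 1) converts the geometric tail into L^-s. *)
Lemma besov_tail : exists2 CB, 0 < CB & forall L J n, 1 <= L ->
  (forall j, (J <= j)%N -> L < lam j) ->
  \sum_(J <= j < n) coef mu u f0 j ^+ 2 <= CB * L `^ (- s).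
Proof.
case: BS => _ _ [phi0 [phi [LP [B HB]]]].
have [c c0 hc] := LP_cover LP.
pose q : R := 4 `^ (- s).
have q0 : 0 < q by rewrite powR_gt0.
have q1 : q < 1.
  rewrite /q powRN invf_lt1 ?powR_gt0//.
  by rewrite /powR pnatr_eq0/= -[ltLHS]expR0 ltr_expR mulr_gt0// ln_gt0// ltr1n.
pose A := B ^+ 2 * fine (mu setT) + 1.
have A0 : 0 < A by rewrite ltr_wpDl// mulr_ge0 ?sqr_ge0// fine_ge0.
exists (c ^- 2 * A * 4 `^ s / (1 - q)) => [|L J n L1 hJ].
  by rewrite !mulr_gt0 ?invr_gt0 ?exprn_gt0 ?powR_gt0 ?subr_gt0.
have L0 : 0 < L by rewrite (lt_le_trans ltr01).
have [f hf] := choice (fun k => hc (Num.sqrt (lam k)) (sqrtr_ge0 _)).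
pose I := (\max_(k < n) f k).+1.
have [i0 [hi0 i0min]] : exists i0, Num.sqrt L < 2 ^+ i0.+1 /\
    forall i, Num.sqrt L < 2 ^+ i.+1 -> (i0 <= i)%N.
  have ex : exists k, Num.sqrt L < 2 ^+ k.+1.
    have [k hk] := pow2_archi (Num.sqrt L); exists k; apply: (lt_le_trans hk).
    by rewrite exprS ler_peMl ?exprn_ge0// ler1n.
  by case: (ex_minnP ex) => i0 h1 h2; exists i0.
pose F k i := LP_fun phi0 phi i (Num.sqrt (lam k)) ^+ 2 * coef mu u f0 k ^+ 2.
have F0 k i : 0 <= F k i by rewrite mulr_ge0 ?sqr_ge0.
have key k : (J <= k < n)%N -> coef mu u f0 k ^+ 2 <= c ^- 2 * \sum_(i0 <= i < I) F k i.
  move=> /andP[Jk kn]; have [h1 h2] := hf k.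
  have fI : (i0 <= f k < I)%N.
    rewrite ltnS (leq_bigmax (Ordinal kn)) andbT; apply: i0min.
    by apply: lt_le_trans h2; rewrite ltr_sqrt ?hJ// (lt_trans L0)// hJ.
  rewrite (bigD1_seq (f k)) ?mem_index_iota ?iota_uniq//=.
  rewrite ler_pdivlMl ?exprn_gt0//; apply: ler_wpDr; first exact: sumr_ge0.
  rewrite /F ler_wpM2r ?sqr_ge0// -(real_normK (num_real (LP_fun _ _ _ _))).
  by rewrite lerXn2r ?nnegrE// ltW.
have bi i : \sum_(J <= k < n) F k i <= A * q ^+ i.
  apply: (@le_trans _ _ (\sum_(k < n) F k i)).
    rewrite -(big_mkord xpredT (F^~ i)); have [Jn|nJ] := leqP J n.
      by rewrite [leRHS](big_cat_nat (n := J))//= lerDr sumr_ge0.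
    by rewrite (big_geq (ltnW nJ)); exact: sumr_ge0.
  apply: (le_trans (besov_block n LP (HB i))).
  by rewrite -/q mulrAC ler_wpM2r ?exprn_ge0 ?(ltW q0)// lerDl.
apply: (@le_trans _ _ (c ^- 2 * \sum_(i0 <= i < I) A * q ^+ i)).
  apply: (@le_trans _ _ (\sum_(J <= k < n) c ^- 2 * \sum_(i0 <= i < I) F k i)).
    by apply: ler_sum_nat => k; exact: key.
  rewrite -mulr_sumr exchange_big/= ler_wpM2l ?invr_ge0 ?exprn_ge0 ?(ltW c0)//.
  by apply: ler_sum => i _; exact: bi.
rewrite -mulr_sumr.
have qb : 0 <= q < 1 by rewrite ltW.
have := geometric_tail_le i0 I qb => h.
rewrite -!mulrA ler_pM2l ?invr_gt0 ?exprn_gt0// ler_pM2l//.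
apply: (le_trans h); rewrite mulrCA mulrC ler_wpM2l ?invr_ge0 ?subr_ge0 ?(ltW q1)//.
have h4 : L <= 4 * 4 ^+ i0.
  have : Num.sqrt L ^+ 2 <= (2 ^+ i0.+1) ^+ 2.
    by rewrite lerXn2r ?nnegrE ?sqrtr_ge0 ?exprn_ge0// ltW.
  rewrite sqr_sqrtr ?(ltW L0)// -exprM mulnC exprM exprS.
  by rewrite (_ : 2 ^+ 2 = 4 :> R)// -natrX.
rewrite /q powR_expn// !powRN ler_pdivlMr ?powR_gt0// ler_pdivrMl ?powR_gt0 ?exprn_gt0//.
rewrite -powRM ?exprn_ge0//.
by apply: ge0_ler_powR; rewrite ?nnegrE ?mulr_ge0 ?exprn_ge0 ?(ltW s0) ?(ltW L0)// mulrC.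
Qed.

End besov_tail.

(** * Oscillation on small balls *)

Section L2_dom.
Context {R : realType} {d} {T : measurableType d} (m : {measure set T -> \bar R}).

Lemma L2_dom (f g : T -> R) : measurable_fun setT f -> L2 m g ->
  {ae m, forall x, `|f x| <= `|g x|} -> L2 m f.
Proof.
move=> mf [mg ig] h; split => //; apply/integrableP; split.
  by apply/measurable_EFinP; exact: measurable_funX.
case/integrableP: ig => mg2; apply: le_lt_trans; apply: ae_ge0_le_integral => //.
- by apply: measurableT_comp => //; apply/measurable_EFinP; exact: measurable_funX.
- by apply: measurableT_comp.
- apply: filterS h => x hx _; rewrite lee_fin !normrX.
  by rewrite lerXn2r ?nnegrE.
Qed.

Lemma L2_abs (f : T -> R) : L2 m f -> L2 m (fun x => `|f x|).
Proof.
move=> Lf; apply: (L2_dom _ Lf); first by case: Lf => mf _; exact: measurableT_comp.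
by apply: aeW => x; rewrite normr_id.
Qed.

Lemma dot_abs_le (f g w : T -> R) : L2 m f -> L2 m g -> L2 m w ->
  {ae m, forall x, `|f x| <= g x} -> `|dot m f w| <= dot m g (fun x => `|w x|).
Proof.
move=> Lf Lg Lw h; have Law := L2_abs Lw.
have Ifw := L2_mul_integrable Lf Lw; have Igw := L2_mul_integrable Lg Law.
rewrite -lee_fin EFin_normr_Rintegral// -dotE//.
have [mI _] := integrableP _ _ _ Ifw.
apply: (@le_trans _ _ (\int[m]_x `|(f x * w x)%:E|)%E); first exact: le_abse_integral.
apply: (@le_trans _ _ (\int[m]_x `|(g x * `|w x|)%:E|)%E).
  apply: ae_ge0_le_integral => //.
  - exact: measurableT_comp.
  - by case/integrableP: Igw => mg _; exact: measurableT_comp.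
  - apply: filterS h => x hx _; rewrite lee_fin !normrM normr_id.
    by rewrite ler_wpM2r// (le_trans hx)// ler_norm.
rewrite le_eqVlt; apply/orP; left; apply/eqP; apply: ae_eq_integral => //.
- by case/integrableP: Igw => mg _; exact: measurableT_comp.
- by case/integrableP: Igw.
- by apply: filterS h => x hx _; rewrite /= ger0_norm// mulr_ge0// (le_trans _ hx).
Qed.
End L2_dom.

Lemma L2_bounded {R : realType} {d} {T : measurableType d} (m : {finite_measure set T -> \bar R})
  (f : T -> R) (B : R) : measurable_fun setT f -> (forall x, `|f x| <= B) -> L2 m f.
Proof.
move=> mf fB; apply: (@L2_dom _ _ _ m f (cst B)) => //; last first.
  by apply: aeW => x; apply: (le_trans (fB x)); rewrite ler_norm.
split; first exact: measurable_cst.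
by have := finite_measure_integrable_cst m (B ^+ 2) (@measurableT _ T).
Qed.

(** * Separated sets and covers by small balls *)

Section separated.
Context {R : realType} {dX : measure_display} {X : measurableType dX}.
Variables (rho : X -> X -> R) (mu : {finite_measure set X -> \bar R}) (C c d : R).
Hypothesis rho_metric : is_metric rho.
Hypothesis rho_borel : rborel rho.
Hypotheses (C0 : 0 < C) (c0 : 0 < c) (d0 : 0 < d).
Hypothesis ah : ahlfors rho mu C c d.

Definition separated (r : R) (s : seq X) := pairwise (fun x y => r <= rho x y) s.

(** The balls of half the separation radius are disjoint, and each has volume at least c (r /
    2)^d. *)
Lemma separated_volume (r : R) (s : seq X) (A : set X) : 0 < r <= 1 -> measurable A ->
  separated r s -> (forall y, y \in s -> rball rho y (r / 2) `<=` A) ->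
  (size s)%:R * (c * (r / 2) `^ d) <= fine (mu A).
Proof.
move=> /andP[r0 r1] mA sep sA.
pose U (s : seq X) := \big[setU/set0]_(y <- s) rball rho y (r / 2).
have mB y : measurable (rball rho y (r / 2)) by exact: measurable_rball.
have mU s' : measurable (U s') by apply: bigsetU_measurable.
have UA : U s `<=` A by rewrite /U -bigcup_seq => x [y ys]; exact: sA.
apply: (@le_trans _ _ (fine (mu (U s)))); last first.
  by rewrite -lee_fin -!mu_fin//; apply: le_measure; rewrite ?inE.
rewrite -lee_fin -mu_fin//; elim: s sep {sA UA} => [|y s ih] /=.
  by rewrite mul0r.
move=> /andP[/allP ys sep]; rewrite /U big_cons measureU//.
  rewrite -nat1r mulrDl mul1r EFinD leeD//; last exact: ih.
  have r2 : 0 < r / 2 <= 1 by lra.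
  by have /andP[] := ah y r2.
  exact: mU.
apply/seteqP; split => x // -[/= yx]; rewrite -bigcup_seq => -[z /= zs zx].
have := ys _ zs; have := rho_tri rho_metric x y z.
move: yx zx; rewrite /rball/= (rhoC rho_metric z x); lra.
Qed.

Let sep_max (r : R) : 0 < r <= 1 -> exists s, separated r s /\
  forall x, exists2 y, y \in s & rho y x < r.
Proof.
move=> r01; have /andP[r0 r1] := r01.
pose P m := `[< exists s, separated r s /\ size s = m >].
have exP : exists m, P m by exists 0%N; apply/asboolP; exists [::].
have b0 : 0 < c * (r / 2) `^ d by rewrite mulr_gt0 ?powR_gt0 ?divr_gt0.
pose M := Num.bound (fine (mu setT) / (c * (r / 2) `^ d)).
have PM m : P m -> (m <= M)%N.
  move=> /asboolP[s [sep <-]]; have := separated_volume r01 measurableT sep (fun _ _ _ _ => I).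
  rewrite -ler_pdivlMr// => h; rewrite -(ler_nat R); apply: (le_trans h).
  by apply/ltW/archi_boundP; rewrite divr_ge0 ?(ltW b0)// fine_ge0.
case: (ex_maxnP exP PM) => m /asboolP[s [sep sm]] mmax; exists s; split => // x.
apply: contrapT => h.
have : P m.+1.
  apply/asboolP; exists (x :: s); split; last by rewrite /= sm.
  rewrite /separated/= -/(separated r s) sep andbT; apply/allP => y ys.
  by rewrite leNgt; apply/negP => yx; apply: h; exists y => //; rewrite rhoC.
by move=> /mmax; rewrite ltnn.
Qed.

(* A maximal r-separated set: its r-balls cover with bounded overlap. *)
Lemma ball_cover : exists2 D, 0 < D & forall r, 0 < r <= 1 -> exists s : seq X,
  [/\ (size s)%:R <= D / r `^ d,
      forall x, exists2 y, y \in s & rho y x < r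
    & forall x, \sum_(y <- s) (\1_(rball rho y r) x : R) <= D].
Proof.
pose mT := fine (mu setT); have mT0 : 0 <= mT by exact: fine_ge0.
exists ((C + mT) / c * 4 `^ d + mT / c * 2 `^ d).
  by rewrite ltr_pwDl ?mulr_ge0 ?powR_ge0 ?invr_ge0 ?(ltW c0)// mulr_gt0 ?powR_gt0// divr_gt0 ?ltr_pwDl.
move=> r r01; have /andP[r0 r1] := r01; have [s [sep cov]] := sep_max r01; exists s; split => //.
- have := separated_volume r01 measurableT sep (fun _ _ _ _ => I).
  rewrite -/mT powRM ?(ltW r0)// powR_invl// => h.
  rewrite ler_pdivlMr ?powR_gt0//; apply: (@le_trans _ _ (mT / c * 2 `^ d)).
    rewrite mulrAC ler_pdivlMr// mulrC mulrA.
    have p2 : 0 < 2 `^ d :> R by rewrite powR_gt0.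
    rewrite -ler_pdivrMr//; apply: le_trans h; rewrite le_eqVlt; apply/orP; left; apply/eqP; field.
    by rewrite gt_eqF.
  by rewrite lerDr mulr_ge0 ?powR_ge0// divr_ge0 ?addr_ge0// ltW.
- move=> x; pose s' := [seq y <- s | rho y x < r].
  have -> : \sum_(y <- s) (\1_(rball rho y r) x : R) = (size s')%:R.
    rewrite size_filter -sum1_count natr_sum [RHS]big_mkcond/=; apply: eq_bigr => y _.
    rewrite indicE; have [h|h] := ltP; first by rewrite mem_set.
    by rewrite memNset// /rball/= => h2; move: h; rewrite leNgt h2.
  have sep' : separated r s' by apply: pairwise_filter.
  have := separated_volume r01 (measurable_rball rho_metric rho_borel x (2 * r)) sep'.
  have h1 : forall y, y \in s' -> rball rho y (r / 2) `<=` rball rho x (2 * r).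
    move=> y; rewrite mem_filter => /andP[yx _] z; rewrite /rball/= => yz.
    by have := rho_tri rho_metric y x z; rewrite (rhoC rho_metric x y); lra.
  move=> /(_ h1) h.
  have r20 : 0 < 2 * r by rewrite mulr_gt0.
  have := volume_le rho_metric rho_borel C0 d0 ah x r20.
  rewrite mu_fin; last exact: measurable_rball.
  rewrite lee_fin => /(le_trans h); rewrite -/mT.
  have -> : 2 * r = 4 * (r / 2) by lra.
  have r2 : 0 < r / 2 by rewrite divr_gt0.
  clear h h1 sep' sep cov r20.
  move: (r / 2) r2 => z r2.
  rewrite powRM ?(ltW r2)// !mulrA ler_pM2r ?powR_gt0// -ler_pdivlMr// => /le_trans; apply.
  by rewrite [leLHS]mulrAC lerDl mulr_ge0 ?powR_ge0// divr_ge0// ltW.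
Qed.

End separated.
Section ae_prod.
Context {R : realType} {d1 d2} {T1 : measurableType d1} {T2 : measurableType d2}.
Variables (m1 : {finite_measure set T1 -> \bar R}) (m2 : {finite_measure set T2 -> \bar R}).

(** Tonelli for the indicator of [A]. It is used to pass from exceptional points y depending on z to
    an exceptional set of y alone. *)
Lemma ae_prod_swap (A : set (T1 * T2)) : measurable A ->
  {ae m1, forall x, {ae m2, forall y, ~ A (x, y)}} ->
  {ae m2, forall y, {ae m1, forall x, ~ A (x, y)}}.
Proof.
move=> mA h; pose f z : \bar R := (\1_A z)%:E.
have mf : measurable_fun setT f by apply/measurable_EFinP; exact: measurable_indic.
have f0 z : (0 <= f z)%E by rewrite lee_fin.
have fx x : measurable_fun setT (fun y => f (x, y)).
  by apply: measurableT_comp => //; exact: measurable_pair1.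
have fy y : measurable_fun setT (fun x => f (x, y)).
  by apply: measurableT_comp => //; exact: measurable_pair2.
have mF := measurable_fun_fubini_tonelli_F (m2 := m2) f mf f0.
have mG := measurable_fun_fubini_tonelli_G (m1 := m1) f mf f0.
have : (\int[m2]_y \int[m1]_x f (x, y) <= 0)%E.
  rewrite -(fubini_tonelli (m1 := m1) (m2 := m2))//.
  rewrite (@ae_eq_integral _ _ _ m1 setT (cst 0%E))//; first by rewrite integral0.
  apply: filterS h => x h _ /=.
  rewrite (@ae_eq_integral _ _ _ m2 setT (cst 0%E))//; first by rewrite integral0.
  apply: filterS h => y h _ /=; rewrite /f indicE memNset//.
move=> /(ge0_integral_eq0_ae mG) h2.
have {}h2 : {ae m2, forall y, (\int[m1]_x f (x, y) = 0)%E}.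
  by apply: h2 => y; exact: integral_ge0.
apply: filterS h2 => y hy.
have : {ae m1, forall x, f (x, y) = 0%E}.
  by apply: ge0_integral_eq0_ae => //; rewrite hy.
apply: filterS => x; rewrite /f indicE => -[] + Axy; rewrite mem_set//.
by move/eqP; rewrite oner_eq0.
Qed.

End ae_prod.

Section oscillation.
Context {R : realType} {dX : measure_display} {X : measurableType dX}.
Variables (rho : X -> X -> R) (mu : {finite_measure set X -> \bar R}) (C c d : R).
Variables (lam : nat -> R) (u : nat -> X -> R) (p : R -> X -> X -> R) (eta : R).
Hypothesis DS : dirichlet_setting rho mu C c d lam u p eta.
Variables (N : set X) (K : R).
Hypothesis SD : spectral_data mu d lam u N K.
Hypothesis hN : forall x m j, ~ N x ->
    dot mu (u j) (p (2^-1 ^+ m) x) = expR (- (2^-1 ^+ m * lam j)) * u j x.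

Let rho_metric : is_metric rho. Proof. by case: DS => -[]. Qed.
Let rho_borel : rborel rho. Proof. by case: DS => -[]. Qed.
Let C0 : 0 < C. Proof. by case: DS => _ []. Qed.
Let c0 : 0 < c. Proof. by case: DS => _ []. Qed.
Let d0 : 0 < d. Proof. by case: DS => _ []. Qed.
Let eta0 : 0 < eta. Proof. by case: DS => _ []. Qed.
Let ah : ahlfors rho mu C c d. Proof. by case: DS. Qed.
Let ES : eigen_system mu lam u. Proof. by case: DS. Qed.
Let mN : measurable N. Proof. by case: SD. Qed.
Let muN : mu N = 0%E. Proof. by case: SD. Qed.
Let mu_ j : measurable_fun setT (u j). Proof. by case: (eigen_L2 ES j). Qed.

Lemma ae_notin_null : {ae mu, forall x, ~ N x}.
Proof. by exists N; split => // x /= /contrapT. Qed.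

Variable m : nat.
Let t : R := 2^-1 ^+ m.
Let t01 : 0 < t <= 1. Proof. by rewrite exprn_gt0//= exprn_ile1 ?invr_ge0 ?invf_le1 ?ler1n. Qed.
Let t0 : 0 < t. Proof. by case/andP: t01. Qed.
Let Lp x : L2 mu (p t x). Proof. by have [K' _ /(_ t x t01) []] := heat_L2 DS. Qed.

Lemma heat_kernel_series x : ~ N x -> {ae mu, forall y, p t x y = heat_cov lam u t x y}.
Proof.
move=> Nx; apply: (L2_eq_lim ES (Lp x)).
apply: filterS ae_notin_null => y Ny.
have := heat_cov_cvg SD ES Nx Ny t0; apply: cvg_trans; apply: near_eq_cvg.
by apply: nearW => n; apply: eq_bigr => j _; rewrite /coef hN.
Qed.

Variables (xk : X) (del : R).
Hypothesis del0 : 0 < del.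
Hypothesis del1 : del <= 1 / 2.
Let r := del * Num.sqrt t.
Let B := rball rho xk r.
Let mB : measurable B. Proof. exact: measurable_rball. Qed.
Let s01 := sqrt_le1 t01.
Let s0 : 0 < Num.sqrt t. Proof. by case/andP: s01. Qed.
Let r01 : 0 < r <= 1.
Proof.
have /andP[_ s1] := s01; have del1' : del <= 1 by apply: (le_trans del1); lra.
by rewrite mulr_gt0//= mulr_ile1// ltW.
Qed.

Definition osc_kernel (b : R) (z : X) : R := expR (- (b * rho xk z ^+ 2 / t)) / t `^ (d / 2).

Definition osc_const : R := C / c * expR c * (2 * del) `^ eta.

(** Moving the centre of the Gaussian from y to [xk] halves its rate and costs a factor expR c,
    because r^2 <= t. The Hoelder factor (2 del)^eta is what later makes the oscillation small. *)
Lemma heat_osc z y y' : B y -> B y' ->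
  `|p t z y - p t z y'| <= osc_const * osc_kernel (c / 2) z.
Proof.
move=> By By'; have tri := rho_tri rho_metric.
have ryy' : rho y y' <= 2 * r.
  have := tri xk y y'; rewrite (rhoC rho_metric y xk); move: By By'; rewrite /B /rball/=; lra.
have h2r : 2 * r <= Num.sqrt t.
  have d1 : 2 * del <= 1 by move: del1; rewrite ler_pdivlMr// mulrC.
  by rewrite /r mulrA ler_piMl// ltW.
have := heat_holder DS z t01 (le_trans ryy' h2r).
rewrite sqrt_powR ?(ltW t0)//; move/le_trans; apply.
rewrite /osc_const /osc_kernel mulrA ler_pM2r ?invr_gt0 ?powR_gt0//.
rewrite -!(mulrA (C / c)) ler_pM2l ?divr_gt0// (mulrC (expR c)) -[leRHS]mulrA.
apply: ler_pM; rewrite ?powR_ge0 ?expR_ge0//.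
  apply: ge0_ler_powR; rewrite ?nnegrE ?(ltW eta0)// ?divr_ge0 ?(rho_ge0 rho_metric)//.
    by rewrite mulr_ge0// ltW.
  by rewrite ler_pdivrMr// -mulrA.
rewrite -expRD ler_expR.
have h1 : rho xk z <= rho z y + r.
  have := tri y xk z; rewrite (rhoC rho_metric y z); move: By; rewrite /B /rball/=; lra.
have h2 : rho xk z ^+ 2 <= 2 * rho z y ^+ 2 + 2 * r ^+ 2.
  have := sqr_ge0 (rho z y - r); have := rho_ge0 rho_metric z y; have := rho_ge0 rho_metric xk z.
  by move: h1; case/andP: r01 => + _; nra.
have h3 : r ^+ 2 / t <= 1.
  rewrite /r exprMn sqr_sqrtr ?(ltW t0)// mulfK ?gt_eqF//.
  by apply: exprn_ile1; [exact: ltW|apply: (le_trans del1); lra].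
have h4 : rho xk z ^+ 2 / t <= 2 * (rho z y ^+ 2 / t) + 2 * (r ^+ 2 / t).
  have tV : 0 <= t^-1 by rewrite invr_ge0 ltW.
  by apply: le_trans (ler_wpM2r tV h2) _; rewrite mulrDl !mulrA.
have h5 : rho xk z ^+ 2 / t <= 2 * (rho z y ^+ 2 / t) + 2 by lra.
have h6 := ler_wpM2l (ltW c0) h5; rewrite -!mulrA; lra.
Qed.

Let b0 : 0 < fine (mu B).
Proof.
have /andP[h _] := ah xk r01; rewrite -lte_fin -mu_fin//; apply: lt_le_trans h.
by rewrite lte_fin mulr_gt0// powR_gt0; case/andP: r01.
Qed.

Let LB : L2 mu (\1_B : X -> R).
Proof.
split; first exact: measurable_indic.
apply: eq_integrable (integrable_indic mu mB) => // x _.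
by rewrite indicE; case: (_ \in _); rewrite ?expr1n ?expr0n.
Qed.

Let avg z := dot mu (p t z) \1_B / fine (mu B).

Let avg_osc z y : B y -> `|p t z y - avg z| <= osc_const * osc_kernel (c / 2) z.
Proof.
move=> By; have mp : measurable_fun setT (p t z) by case: (Lp z).
set o := osc_const * _.
have mIB : measurable_fun setT (\1_B : X -> R) by exact: measurable_indic.
have dotB : dot mu \1_B \1_B = fine (mu B).
  rewrite /dot /Rintegral; congr fine; rewrite -[in RHS](setIT B) -integral_indic//.
  by apply: eq_integral => x _; rewrite indicE; case: (_ \in _); rewrite ?mulr1 ?mulr0.
have cB k : L2 mu (fun x => k * (\1_B x : R)) by exact: (L2Z k LB).
have LpB : L2 mu (fun x => p t z x - p t z y * \1_B x) by exact: L2B.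
rewrite distrC; have -> : avg z - p t z y = dot mu (fun x => p t z x - p t z y * \1_B x) \1_B / fine (mu B).
  by rewrite /avg dotBl// dotZl// dotB mulrBl mulfK// gt_eqF.
rewrite normrM normfV (gtr0_norm b0) ler_pdivrMr//.
have o0 : 0 <= o.
  by rewrite /o /osc_const /osc_kernel !mulr_ge0 ?expR_ge0 ?powR_ge0 ?invr_ge0 ?powR_ge0 ?(ltW C0) ?(ltW c0).
rewrite -dotB -dotZl//; apply: le_trans (le_normr_Rintegral _ _) _ => //.
  exact: L2_mul_integrable.
apply: le_Rintegral => //.
- by apply: integrable_norm => //; exact: L2_mul_integrable.
- exact: L2_mul_integrable.
- move=> x _; rewrite indicE; have [xB|] := boolP (x \in B); last by rewrite !mulr0 normr0.
  by rewrite !mulr1 /o; apply: heat_osc => //; rewrite inE in xB.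
Qed.

Let cE j : R := expR (- (t * lam j)).
Let bj j : R := dot mu (u j) \1_B / fine (mu B).

Let avg_series z : ~ N z -> (fun n => \sum_(j < n) cE j * u j z * bj j) @ \oo --> avg z.
Proof.
move=> Nz; have LB' := LB.
have E n : \sum_(j < n) cE j * u j z * bj j =
    dot mu (lcomb u (coef mu u (p t z)) n) \1_B / fine (mu B).
  rewrite (lcomb_dotl ES)// mulr_suml; apply: eq_bigr => j _.
  by rewrite /coef hN// /bj !mulrA.
under eq_fun do rewrite E.
apply: cvgM; last exact: cvg_cst.
have L n : L2 mu (fun x => p t z x - lcomb u (coef mu u (p t z)) n x).
  by apply: L2B => //; exact: (lcomb_L2 ES).
apply/cvgrPdist_lt => /= e e0.
have dB : 0 < dot mu \1_B \1_B + 1 by rewrite ltr_wpDl// dot_ge0.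
have : 0 < e ^+ 2 / (dot mu \1_B \1_B + 1) by rewrite divr_gt0// exprn_gt0.
have /cvgr0_norm_lt hh := cvg_dot_proj ES (Lp z).
move=> /hh; apply: filterS => n.
rewrite ger0_norm ?dot_ge0// -dotBl//; last exact: (lcomb_L2 ES).
move=> h; have := dot_CS (L n) LB' => /le_lt_trans => h2.
have {}h2 : dot mu (fun x => p t z x - lcomb u (coef mu u (p t z)) n x) \1_B ^+ 2 < e ^+ 2.
  apply: h2; move: h; rewrite ltr_pdivlMr// => /le_lt_trans; apply.
  by rewrite ler_wpM2l ?dot_ge0// lerDl.
by rewrite -(ltr_pXn2r (n := 2))// ?nnegrE ?(ltW e0)// real_normK ?num_real.
Qed.

(** A jointly measurable version of the kernel minus its mean over [B]: [p] is assumed measurable in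
    its second variable only, whereas the eigenfunction series is measurable in both. *)
Let D (z : X * X) : R := (\1_(~` N) z.1 * \1_(~` N) z.2) *
  limn (fun n => \sum_(j < n) cE j * u j z.1 * (u j z.2 - bj j)).

Let D_cvg z y : ~ N z -> ~ N y ->
  (fun n => \sum_(j < n) cE j * u j z * (u j y - bj j)) @ \oo --> heat_cov lam u t z y - avg z.
Proof.
move=> Nz Ny; have h1 := heat_cov_cvg SD ES Nz Ny t0; have h2 := avg_series Nz.
have -> : (fun n => \sum_(j < n) cE j * u j z * (u j y - bj j)) = (fun n =>
    \sum_(j < n) cE j * u j z * u j y - \sum_(j < n) cE j * u j z * bj j).
  by apply/funext => n; rewrite -sumrB; apply: eq_bigr => j _; rewrite mulrBr.
exact: cvgB.
Qed.

Let D_E z y : ~ N z -> ~ N y -> D (z, y) = heat_cov lam u t z y - avg z.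
Proof.
move=> Nz Ny; rewrite /D/= !indicE !mem_set// !mul1r.
by apply: cvg_lim => //; exact: D_cvg.
Qed.

Let mD : measurable_fun setT D.
Proof.
pose h n (z : X * X) : R := (\1_(~` N) z.1 * \1_(~` N) z.2) *
  (\sum_(j < n) cE j * u j z.1 * (u j z.2 - bj j)).
have mI : measurable_fun setT (\1_(~` N) : X -> R) by apply: measurable_indic; exact: measurableC.
apply: (@measurable_fun_cvg _ _ _ setT h) => [n|z _].
  apply: measurable_funM.
    by apply: measurable_funM; [exact: (measurableT_comp mI measurable_fst)|
                                exact: (measurableT_comp mI measurable_snd)].
  apply: measurable_sum => j; apply: measurable_funM.
    by apply: measurable_funM => //; exact: (measurableT_comp (mu_ j) measurable_fst).
  by apply: measurable_funB => //; exact: (measurableT_comp (mu_ j) measurable_snd).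
rewrite /h /D; case: (pselect (N z.1)) => Nz.
  rewrite !indicE memNset// !mul0r; under eq_fun do rewrite mul0r.
  exact: cvg_cst.
case: (pselect (N z.2)) => Ny.
  rewrite !indicE (memNset (u := z.2))// mulr0 mul0r; under eq_fun do rewrite mul0r.
  exact: cvg_cst.
apply: cvgM; first exact: cvg_cst.
by apply/cvg_ex; eexists; exact: D_cvg.
Qed.

Let G z := osc_const * osc_kernel (c / 2) z.

Lemma measurable_osc_kernel b : measurable_fun setT (osc_kernel b).
Proof.
apply: measurable_funM => //; apply/measurable_EFinP.
by have := measurable_gauss_rho DS b t xk.
Qed.

Let mG : measurable_fun setT G.
Proof. by apply: measurable_funM => //; exact: measurable_osc_kernel. Qed.

Let ae_osc : {ae mu, forall y, B y -> {ae mu, forall z, `|D (z, y)| <= G z}}.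
Proof.
pose A := [set zy : X * X | B zy.2 /\ G zy.1 < `|D zy|].
have mA : measurable A.
  have -> : A = (snd @^-1` B) `&` [set zy | G zy.1 < `|D zy|].
    by apply/seteqP; split.
  apply: measurableI.
    by rewrite -[X in measurable X]setTI; exact: measurable_snd.
  have mG1 : measurable_fun setT (fun zy : X * X => G zy.1).
    exact: (measurableT_comp mG measurable_fst).
  have mD1 : measurable_fun setT (fun zy : X * X => `|D zy|) by exact: measurableT_comp.
  have := measurable_fun_ltr mG1 mD1 => /(_ measurableT [set true] I).
  by rewrite setTI; congr measurable; apply/seteqP; split => x /=.
have : {ae mu, forall z, {ae mu, forall y, ~ A (z, y)}}.
  apply: filterS ae_notin_null => z Nz.
  have := heat_kernel_series Nz; apply: filterS2 ae_notin_null => y Ny Ey [/= By].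
  by rewrite D_E// -Ey ltNge avg_osc.
move=> /(ae_prod_swap mA); apply: filterS => y h By.
by apply: filterS h => z /= h; rewrite leNgt; apply/negP => h2; apply: h.
Qed.

Let avgL (w : X -> R) := dot mu (fun z => \1_(~` N) z * avg z) w.

(* Key point: the exceptional set does not depend on the combination of eigenfunctions. *)
Lemma lcomb_osc : {ae mu, forall y, B y -> forall (cc : nat -> R) J,
  (forall j, (j < J)%N -> lam j <= t^-1) ->
  `|lcomb u cc J y - avgL (lcomb u (fun j => cc j * expR (t * lam j)) J)| <=
    dot mu G (fun z => `|lcomb u (fun j => cc j * expR (t * lam j)) J z|)}.
Proof.
have [K' K'0 hK'] := heat_bounds DS.
have mAvg : measurable_fun setT (fun z => \1_(~` N) z * avg z).
  have mI : measurable_fun setT (\1_(~` N) : X -> R) by apply: measurable_indic; exact: measurableC.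
  apply: (@measurable_fun_cvg _ _ _ setT (fun n z => \1_(~` N) z * \sum_(j < n) cE j * u j z * bj j)).
    move=> n; apply: measurable_funM => //; apply: measurable_sum => j.
    by apply: measurable_funM => //; apply: measurable_funM.
  move=> z _; rewrite indicE; case: (pselect (N z)) => Nz.
    by rewrite memNset// mul0r; under eq_fun do rewrite mul0r; exact: cvg_cst.
  by apply: cvgM; [exact: cvg_cst|exact: avg_series].
apply: filterS2 ae_notin_null ae_osc => y Ny h By cc J hJ; have {}h := h By.
set w := lcomb u (fun j => cc j * expR (t * lam j)) J.
have Lw : L2 mu w by exact: (lcomb_L2 ES).
have mw : measurable_fun setT w by case: Lw.
(* The combination is the heat semigroup at time t applied to [w]. Since lam <= 1 / t below J, [w]
   has coefficients larger by a factor e at most. *)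
have Ev : lcomb u cc J y = dot mu (p t y) w.
  rewrite dotC (lcomb_dotl ES)//; apply: eq_bigr => j _.
  by rewrite hN// mulrA -(mulrA (cc j)) -expRD subrr expR0 mulr1.
have hp := heat_kernel_series Ny.
(* Symmetry is read off the series; the hypotheses on [p] do not state it. *)
have symm z : heat_cov lam u t z y = heat_cov lam u t y z.
  rewrite /heat_cov; congr (limn _); apply/funext => n; apply: eq_bigr => j _.
  by rewrite mulrAC.
have pG : {ae mu, forall z, `|p t y z - \1_(~` N) z * avg z| <= G z}.
  have := hp; apply: filterS3 h ae_notin_null => z hz Nz Ez.
  by rewrite Ez -symm indicE mem_set// mul1r -D_E.
have LG : L2 mu G.
  apply: (@L2_bounded _ _ _ mu G (osc_const / t `^ (d / 2))) => // z.
  have o0 : 0 <= osc_const.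
    by rewrite /osc_const !mulr_ge0 ?expR_ge0 ?powR_ge0 ?invr_ge0 ?(ltW C0) ?(ltW c0).
  rewrite /G /osc_kernel ger0_norm; last by rewrite mulr_ge0// divr_ge0 ?expR_ge0 ?powR_ge0.
  rewrite ler_wpM2l// ler_piMl ?invr_ge0 ?powR_ge0//.
  by rewrite -[leRHS]expR0 ler_expR oppr_le0 divr_ge0 ?(ltW t0)// mulr_ge0 ?sqr_ge0// divr_ge0// ltW.
have LA : L2 mu (fun z => \1_(~` N) z * avg z).
  apply: (@L2_dom _ _ _ mu _ (fun z => `|p t y z| + G z)) => //.
    by apply: L2D => //; exact: L2_abs.
  apply: filterS pG => z hz; have G0 : 0 <= G z by apply: le_trans hz.
  rewrite [leRHS]ger0_norm ?addr_ge0//.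
  rewrite -[X in `|X|](subKr (p t y z)); apply: (le_trans (ler_normB _ _)).
  by rewrite lerD2l.
have -> : lcomb u cc J y - avgL w = dot mu (fun z => p t y z - \1_(~` N) z * avg z) w.
  by rewrite dotBl// Ev.
by apply: dot_abs_le => //; exact: L2B.
Qed.
End oscillation.

(** * Lower bound for the empirical Gram matrix *)

Section gram.
Context {R : realType} {dX : measure_display} {X : measurableType dX}.
Variables (rho : X -> X -> R) (mu : {finite_measure set X -> \bar R}) (C c d : R).
Variables (lam : nat -> R) (u : nat -> X -> R) (p : R -> X -> X -> R) (eta : R).
Hypothesis DS : dirichlet_setting rho mu C c d lam u p eta.
Variables (N : set X) (K : R).
Hypothesis SD : spectral_data mu d lam u N K.
Hypothesis hN : forall x m j, ~ N x ->
    dot mu (u j) (p (2^-1 ^+ m) x) = expR (- (2^-1 ^+ m * lam j)) * u j x.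

Let rho_metric : is_metric rho. Proof. by case: DS => -[]. Qed.
Let rho_borel : rborel rho. Proof. by case: DS => -[]. Qed.
Let C0 : 0 < C. Proof. by case: DS => _ []. Qed.
Let c0 : 0 < c. Proof. by case: DS => _ []. Qed.
Let d0 : 0 < d. Proof. by case: DS => _ []. Qed.
Let eta0 : 0 < eta. Proof. by case: DS => _ []. Qed.
Let ah : ahlfors rho mu C c d. Proof. by case: DS. Qed.
Let ES : eigen_system mu lam u. Proof. by case: DS. Qed.
Let t01 m : 0 < (2^-1 ^+ m : R) <= 1.
Proof. by rewrite exprn_gt0//= exprn_ile1 ?invr_ge0 ?invf_le1 ?ler1n. Qed.

(** The row and column bounds for a Schur test. For the sum over centres, the kernel at a centre is
    dominated on its ball by a wider Gaussian centred at z; summing the indicators with overlap [D]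
    leaves one Gaussian integral. *)
Lemma osc_kernel_sum : exists2 C2, 0 < C2 & forall m del (s : seq X) D,
  0 < del -> del <= 1 -> 0 <= D ->
  (forall x, \sum_(y <- s) (\1_(rball rho y (del * Num.sqrt (2^-1 ^+ m))) x : R) <= D) ->
  (forall y, dot mu (osc_kernel rho d m y (c / 2)) (fun=> 1) <= C2) /\
  forall z, \sum_(y <- s) fine (mu (rball rho y (del * Num.sqrt (2^-1 ^+ m)))) *
    osc_kernel rho d m y (c / 2) z <= C2 * D.
Proof.
have c20 : 0 < c / 2 by rewrite divr_gt0.
have c40 : 0 < c / 4 by rewrite divr_gt0.
have [K1 K10 hK1] := gauss_integral_le rho_metric rho_borel C0 d0 ah c20.
have [K2 K20 hK2] := gauss_integral_le rho_metric rho_borel C0 d0 ah c40.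
exists (K1 + expR c * K2) => [|m del s D del0 del1 D0 hD].
  by rewrite addr_gt0// mulr_gt0 ?expR_gt0.
set t : R := 2^-1 ^+ m; have /andP[t0 t1] := t01 m; rewrite -/t in t0 t1.
have s0 : 0 < Num.sqrt t by rewrite sqrtr_gt0.
have V0 : 0 < t `^ (d / 2) by rewrite powR_gt0.
have KeK : K1 <= K1 + expR c * K2 by rewrite lerDl mulr_ge0 ?expR_ge0// ltW.
split=> [y|z].
  apply: le_trans KeK; rewrite /dot -lee_fin.
  have mg := measurable_gauss_rho DS (c / 2) t y.
  have -> : (\int[mu]_x (osc_kernel rho d m y (c / 2) x * 1))%:E =
    ((t `^ (d / 2))^-1%:E * \int[mu]_x (expR (- (c / 2 * rho y x ^+ 2 / t)))%:E)%E.
    rewrite -ge0_integralZl_EFin ?invr_ge0 ?powR_ge0//.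
    rewrite /Rintegral fineK; last first.
      rewrite ge0_fin_numE; last by apply: integral_ge0 => x _; rewrite lee_fin mulr1 divr_ge0 ?expR_ge0 ?powR_ge0.
      have -> : (\int[mu]_x (osc_kernel rho d m y (c / 2) x * 1)%:E =
       \int[mu]_x ((t `^ (d / 2))^-1%:E * (expR (- (c / 2 * rho y x ^+ 2 / t)))%:E))%E.
        by apply: eq_integral => x _; rewrite -EFinM mulr1 [in RHS]mulrC.
      rewrite ge0_integralZl_EFin ?invr_ge0 ?powR_ge0//.
      apply: (le_lt_trans (lee_wpmul2l _ (hK1 t y t0))); first by rewrite lee_fin invr_ge0 powR_ge0.
      by rewrite -EFinM ltry.
    by apply: eq_integral => x _; rewrite -EFinM mulr1 [in RHS]mulrC.
  apply: (le_trans (lee_wpmul2l _ (hK1 t y t0))); first by rewrite lee_fin invr_ge0 powR_ge0.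
  by rewrite -EFinM lee_fin sqrt_powR ?(ltW t0)// mulrC mulfK// gt_eqF.
set r := del * Num.sqrt t.
have mB y : measurable (rball rho y r) by exact: measurable_rball.
have mI y : measurable_fun setT (\1_(rball rho y r) : X -> R) by exact: measurable_indic.
pose g x := (expR (- (c / 4 * rho z x ^+ 2 / t)))%:E.
have mg : measurable_fun setT g := measurable_gauss_rho DS (c / 4) t z.
have mIg y : measurable_fun setT (fun x => (\1_(rball rho y r) x : R)%:E * g x)%E.
  by apply: emeasurable_funM => //; apply/measurable_EFinP.
have g0 x : (0 <= g x)%E by rewrite lee_fin expR_ge0.
rewrite -lee_fin -sumEFin.
apply: (@le_trans _ _ (\sum_(y <- s) ((expR c / t `^ (d / 2))%:E * \int[mu]_x ((\1_(rball rho y r) x : R)%:E * g x)))%E).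
  apply: lee_sum => y _; rewrite EFinM -mu_fin//.
  rewrite -[X in (mu X * _)%E]setIT -integral_indic//.
  rewrite -ge0_integralZr//; [|exact/measurable_EFinP|by rewrite lee_fin divr_ge0 ?expR_ge0 ?powR_ge0].
  rewrite -ge0_integralZl_EFin//; last 2 first.
  - by move=> x _; rewrite mule_ge0// lee_fin.
  - by rewrite divr_ge0 ?expR_ge0 ?powR_ge0.
  apply: ge0_le_integral => //.
  - by move=> x _; rewrite mule_ge0// lee_fin// divr_ge0 ?expR_ge0 ?powR_ge0.
  - by apply: emeasurable_funM => //; apply/measurable_EFinP.
  - by apply: measurable_funeM.
  - move=> x _; rewrite /g -!EFinM lee_fin indicE; have [xB|] := boolP (x \in _); last first.
      by rewrite !mul0r mulr0.
    rewrite !mul1r /osc_kernel [leRHS]mulrAC.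
    apply: ler_wpM2r; first by rewrite invr_ge0 powR_ge0.
    rewrite -expRD ler_expR.
    rewrite inE /rball/= in xB.
    have h1 : rho z x <= rho y z + r.
      by have := rho_tri rho_metric y z x; rewrite (rhoC rho_metric z y); lra.
    have r0 : 0 <= r by rewrite /r mulr_ge0 ?sqrtr_ge0// ltW.
    have h2 : rho z x ^+ 2 <= 2 * rho y z ^+ 2 + 2 * r ^+ 2.
      have := sqr_ge0 (rho y z - r); have := rho_ge0 rho_metric z x; have := rho_ge0 rho_metric y z.
      move: h1 r0; nra.
    have h3 : r ^+ 2 / t <= 1.
      rewrite /r exprMn sqr_sqrtr ?(ltW t0)// mulfK ?gt_eqF//.
      by apply: exprn_ile1 => //; exact: ltW.
    have tV : 0 <= t^-1 by rewrite invr_ge0 ltW.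
    have h4 : rho z x ^+ 2 / t <= 2 * (rho y z ^+ 2 / t) + 2 * (r ^+ 2 / t).
      by apply: le_trans (ler_wpM2r tV h2) _; rewrite mulrDl !mulrA.
    have h5 : rho z x ^+ 2 / t <= 2 * (rho y z ^+ 2 / t) + 2 by lra.
    have := ler_wpM2l (ltW c0) h5.
    rewrite -!(mulrA (c / _)); lra.
rewrite -ge0_sume_distrr; last by move=> y _; apply: integral_ge0 => x _; rewrite mule_ge0// lee_fin.
rewrite -ge0_integral_sum//; last by move=> y x _; rewrite mule_ge0// lee_fin.
apply: (@le_trans _ _ ((expR c / t `^ (d / 2))%:E * \int[mu]_x (D%:E * g x))%E).
  apply: lee_wpmul2l; first by rewrite lee_fin divr_ge0 ?expR_ge0 ?powR_ge0.
  apply: ge0_le_integral => //.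
  - by move=> x _; apply: sume_ge0 => y _; rewrite mule_ge0// lee_fin.
  - exact: emeasurable_sum.
  - by apply: measurable_funeM.
  - move=> x _; rewrite -ge0_sume_distrl; last by move=> y _; rewrite lee_fin.
    by apply: lee_wpmul2r => //; rewrite sumEFin lee_fin; exact: hD.
rewrite ge0_integralZl_EFin//.
apply: (le_trans (lee_wpmul2l _ (lee_wpmul2l _ (hK2 t z t0)))).
- by rewrite lee_fin divr_ge0 ?expR_ge0 ?powR_ge0.
- by rewrite lee_fin.
rewrite -!EFinM lee_fin sqrt_powR ?(ltW t0)//.
apply: (@le_trans _ _ (expR c * K2 * D)).
  by rewrite le_eqVlt; apply/orP; left; apply/eqP; field; rewrite gt_eqF.
by rewrite ler_wpM2r// lerDr ltW.
Qed.

Lemma osc_kernel_L2 m y b : 0 < b -> L2 mu (osc_kernel rho d m y b).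
Proof.
move=> b0; have /andP[t0 _] := t01 m.
apply: (@L2_bounded _ _ _ mu _ ((2^-1 ^+ m) `^ (d / 2))^-1).
  exact: (measurable_osc_kernel DS).
move=> x; rewrite /osc_kernel ger0_norm ?divr_ge0 ?expR_ge0 ?powR_ge0//.
rewrite ler_piMl ?invr_ge0 ?powR_ge0// -[leRHS]expR0 ler_expR oppr_le0.
by rewrite divr_ge0 ?(ltW t0)// mulr_ge0 ?sqr_ge0// ltW.
Qed.

(* Schur test for the local oscillation operator. *)
Lemma osc_schur : exists2 C3, 0 < C3 & forall m del (s : seq X) D (w : X -> R),
  0 < del -> del <= 1 -> 0 <= D -> L2 mu w ->
  (forall x, \sum_(y <- s) (\1_(rball rho y (del * Num.sqrt (2^-1 ^+ m))) x : R) <= D) ->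
  \sum_(y <- s) fine (mu (rball rho y (del * Num.sqrt (2^-1 ^+ m)))) *
    dot mu (osc_kernel rho d m y (c / 2)) (fun z => `|w z|) ^+ 2 <= C3 * D * dot mu w w.
Proof.
have [C2 C20 hC2] := osc_kernel_sum.
have c20 : 0 < c / 2 by rewrite divr_gt0.
exists (C2 * C2) => [|m del s D w del0 del1 D0 Lw hD]; first exact: mulr_gt0.
have [h1 h2] := hC2 m del s D del0 del1 D0 hD.
pose g y := osc_kernel rho d m y (c / 2).
have g0 y z : 0 <= g y z by rewrite /g /osc_kernel divr_ge0 ?expR_ge0 ?powR_ge0.
have mg y : measurable_fun setT (g y) by exact: (measurable_osc_kernel DS).
have mw : measurable_fun setT w by case: Lw.
pose h y z := Num.sqrt (g y z).
have hh y z : h y z * h y z = g y z by rewrite -expr2 sqr_sqrtr.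
have mh y : measurable_fun setT (h y).
  by apply: measurableT_comp => //; apply: continuous_measurable_fun; exact: sqrt_continuous.
have hB y z : h y z ^+ 2 <= ((2^-1 ^+ m) `^ (d / 2))^-1.
  rewrite expr2 hh /g /osc_kernel ler_piMl ?invr_ge0 ?powR_ge0// -[leRHS]expR0 ler_expR oppr_le0.
  by have /andP[t0 _] := t01 m; rewrite divr_ge0 ?(ltW t0)// mulr_ge0 ?sqr_ge0// ltW.
have L1 : L2 mu (fun=> 1 : R).
  by apply: (@L2_bounded _ _ _ mu _ 1) => // x; rewrite normr1.
have B0 : 0 <= ((2^-1 ^+ m : R) `^ (d / 2))^-1 by rewrite invr_ge0 powR_ge0.
have Lh y : L2 mu (h y).
  have [+ _] := L2_weight (mh y) L1 B0 (aeW mu (hB y)).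
  by congr L2; apply/funext => z; rewrite mulr1.
have Lhw y : L2 mu (fun z => h y z * `|w z|).
  by have [+ _] := L2_weight (mh y) (L2_abs Lw) B0 (aeW mu (hB y)).
pose q y := fine (mu (rball rho y (del * Num.sqrt (2^-1 ^+ m)))).
have q0 y : 0 <= q y by exact: fine_ge0.
have CS y : dot mu (g y) (fun z => `|w z|) ^+ 2 <=
    C2 * dot mu (fun z => h y z * `|w z|) (fun z => h y z * `|w z|).
  have -> : dot mu (g y) (fun z => `|w z|) = dot mu (h y) (fun z => h y z * `|w z|).
    by apply: eq_Rintegral => z _; rewrite mulrA hh.
  apply: (le_trans (dot_CS (Lh y) (Lhw y))); apply: ler_wpM2r; first exact: dot_ge0.
  apply: le_trans (h1 y); rewrite le_eqVlt; apply/orP; left; apply/eqP.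
  by apply: eq_Rintegral => z _; rewrite mulr1 hh.
apply: (@le_trans _ _ (C2 * \sum_(y <- s) q y * dot mu (fun z => h y z * `|w z|) (fun z => h y z * `|w z|))).
  rewrite mulr_sumr; apply: ler_sum => y _; rewrite [leRHS]mulrCA; apply: ler_wpM2l; [exact: q0|exact: CS].
rewrite -!mulrA ler_pM2l// mulrA -lee_fin.
have mw2 : measurable_fun setT (fun z => (w z ^+ 2)%:E).
  by apply/measurable_EFinP; exact: measurable_funX.
have mgw y : measurable_fun setT (fun z => (q y * g y z * w z ^+ 2)%:E).
  apply/measurable_EFinP; apply: measurable_funM; last exact: measurable_funX.
  exact: measurable_funM.
have gw0 y z : (0 <= (q y * g y z * w z ^+ 2)%:E)%E.
  by rewrite lee_fin; apply: mulr_ge0 (sqr_ge0 _); apply: mulr_ge0; [exact: q0|exact: g0].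
rewrite -sumEFin; apply: (@le_trans _ _ (\sum_(y <- s) \int[mu]_z (q y * g y z * w z ^+ 2)%:E)%E).
  apply: lee_sum => y _; rewrite EFinM -dot2E//.
  rewrite -ge0_integralZl_EFin//; last 2 first.
  - by move=> z _; rewrite lee_fin sqr_ge0.
  - by apply/measurable_EFinP; apply: measurable_funX; case: (Lhw y).
  rewrite le_eqVlt; apply/orP; left; apply/eqP; apply: eq_integral => z _.
  by rewrite -EFinM exprMn real_normK ?num_real// expr2 hh mulrA.
rewrite -ge0_integral_sum// EFinM -dot2E// -ge0_integralZl_EFin ?mulr_ge0 ?(ltW C20)//; last first.
  by move=> z _; rewrite lee_fin sqr_ge0.
apply: ge0_le_integral => //.
- by move=> z _; exact: sume_ge0.
- exact: emeasurable_sum.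
- exact: measurable_funeM.
- move=> z _; rewrite sumEFin -EFinM lee_fin -mulr_suml ler_wpM2r ?sqr_ge0//.
  exact: h2.
Qed.

Lemma ler_sum_in (I : eqType) (s : seq I) (f g : I -> R) :
  (forall i, i \in s -> f i <= g i) -> \sum_(i <- s) f i <= \sum_(i <- s) g i.
Proof.
elim: s => [|i s ih] h; first by rewrite !big_nil.
rewrite !big_cons lerD ?h ?mem_head// ih// => j js; apply: h.
by rewrite in_cons js orbT.
Qed.

(** At a point of the ball of y, v^2 is at least a^2 / 2 - b^2; the sum over balls counts each point
    at most [D] times. *)
Lemma count_lower (I : eqType) (T : eqType) (s : seq I) (xs : seq T) (F : I -> T -> R) (v : T -> R)
    (a b mq : I -> R) (q D : R) :
  (forall x, x \in xs -> \sum_(y <- s) F y x <= D) -> 0 <= q ->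
  (forall y x, F y x = 0 \/ F y x = 1) ->
  (forall y x, y \in s -> x \in xs -> F y x = 1 -> `|v x - a y| <= b y) ->
  (forall y, y \in s -> q * mq y <= \sum_(x <- xs) F y x) ->
  (forall y, 0 <= mq y) ->
  q * \sum_(y <- s) mq y * (2^-1 * a y ^+ 2 - b y ^+ 2) <= D * \sum_(x <- xs) v x ^+ 2.
Proof.
move=> hD q0 F01 hv hq mq0.
have F0 y x : 0 <= F y x by case: (F01 y x) => ->.
apply: (@le_trans _ _ (\sum_(x <- xs) \sum_(y <- s) F y x * v x ^+ 2)); last first.
  rewrite mulr_sumr; apply: ler_sum_in => x xs_.
  by rewrite -mulr_suml ler_wpM2r ?sqr_ge0// hD.
rewrite exchange_big/= mulr_sumr; apply: ler_sum_in => y ys.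
(* The count of points is bounded from below only, so the quantity it multiplies must be made
   nonnegative first. *)
pose M := Num.max 0 (2^-1 * a y ^+ 2 - b y ^+ 2).
have M0 : 0 <= M by rewrite le_max lexx.
apply: (@le_trans _ _ (q * mq y * M)).
  rewrite mulrA; apply: ler_wpM2l; first by rewrite mulr_ge0.
  by rewrite le_max lexx orbT.
apply: (@le_trans _ _ ((\sum_(x <- xs) F y x) * M)).
  by apply: ler_wpM2r => //; exact: hq.
rewrite mulr_suml; apply: ler_sum_in => x xxs.
have [->|F1] := F01 y x; first by rewrite !mul0r.
apply: ler_wpM2l => //; rewrite ge_max sqr_ge0/=.
have := hv y x ys xxs F1; rewrite ler_norml => /andP[h1 h2].
have := sqr_ge0 (v x - a y / 2).
have : (v x - a y) ^+ 2 <= b y ^+ 2.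
  by rewrite -real_normK ?num_real// lerXn2r ?nnegrE// ?(le_trans _ (hv y x ys xxs F1))// hv.
have := sqr_ge0 (2 * v x - a y).
nra.
Qed.

Lemma exists_scale (e : R) : 0 < e -> exists del, 0 < del <= 1 / 2 /\ (2 * del) `^ eta <= e.
Proof.
move=> e0; exists (Num.min 1 (e `^ eta^-1) / 2); split.
  have : 0 < e `^ eta^-1 by rewrite powR_gt0.
  have : Num.min 1 (e `^ eta^-1) <= 1 by rewrite ge_min lexx.
  have : 0 < Num.min 1 (e `^ eta^-1) by rewrite lt_min ltr01 powR_gt0.
  by move=> h1 h2 h3; rewrite divr_gt0//= ler_pM2r// invr_gt0.
rewrite mulrC divfK//; have e1 : (e `^ eta^-1) `^ eta = e.
  by rewrite -powRrM mulVf ?gt_eqF// powRr1// ltW.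
rewrite -[leRHS]e1; apply: ge0_ler_powR; rewrite ?nnegrE ?powR_ge0//; first exact: ltW.
  by rewrite le_min ler01 powR_ge0.
by rewrite ge_min lexx orbT.
Qed.

(** Functions of frequency below 1 / t are nearly constant on the balls of the cover, so design
    points that fill these balls in proportion to their measure see a fixed share of the L2 norm.
    The null set [N'] depends on the scale only, not on the coefficients. *)
Lemma gram_lower : exists kap D, [/\ 0 < kap, 0 < D &
  forall m, exists (s : seq X) (r : R) (N' : set X),
  [/\ (size s)%:R <= D / (2^-1 ^+ m) `^ (d / 2),
      forall y, D^-1 * (2^-1 ^+ m) `^ (d / 2) <= fine (mu (rball rho y r)),
      measurable N' /\ mu N' = 0%E, N `<=` N'
    & forall J (cc : nat -> R) (xs : seq X) (q : R),
      (forall j, (j < J)%N -> lam j <= 2^-1 ^- m) -> 0 <= q ->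
      (forall x, x \in xs -> ~ N' x) ->
      (forall y, y \in s ->
        q * fine (mu (rball rho y r)) <= \sum_(x <- xs) (\1_(rball rho y r) x : R)) ->
      kap * q * \sum_(j < J) cc j ^+ 2 <= \sum_(x <- xs) lcomb u cc J x ^+ 2]].
Proof.
have [D D0 hD] := ball_cover rho_metric rho_borel C0 c0 d0 ah.
have [C3 C30 hC3] := osc_schur.
(* The price of undoing the heat semigroup at time t on frequencies up to 1 / t, in squared norm. *)
pose e2 := expR 1 ^+ 2 : R.
pose L := C / c * expR c.
have L0 : 0 < L by rewrite !mulr_gt0 ?invr_gt0 ?expR_gt0.
have e20 : 0 < e2 by rewrite exprn_gt0 ?expR_gt0.
pose Q := L ^+ 2 * C3 * D * e2.
have Q0 : 0 < Q by rewrite /Q; repeat (apply: mulr_gt0 => //); rewrite exprn_gt0.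
(* With I the sum of squared coefficients, the 12 bounds the oscillation energy SB by I / 12.
   Together with I <= 2 SA + 2 SB this yields SA / 2 - SB >= I / 8, the origin of [kap]. *)
pose eps := Num.min 1 ((12 * Q)^-1).
have eps0 : 0 < eps by rewrite lt_min ltr01 invr_gt0 mulr_gt0.
have [del [/andP[del0 del1] hdel]] := exists_scale eps0.
have del1' : del <= 1 by apply: (le_trans del1); lra.
have oc : osc_const C c eta del ^+ 2 * C3 * D * e2 <= 12^-1.
  rewrite /osc_const -/L exprMn.
  have h1 : ((2 * del) `^ eta) ^+ 2 <= eps.
    apply: (@le_trans _ _ (eps ^+ 2)); first by rewrite lerXn2r ?nnegrE ?powR_ge0// ltW.
    by rewrite expr2 ler_piMl ?(ltW eps0)// ge_min lexx.
  have h2 : eps <= (12 * Q)^-1 by rewrite ge_min lexx orbT.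
  have -> : L ^+ 2 * ((2 * del) `^ eta) ^+ 2 * C3 * D * e2 = Q * ((2 * del) `^ eta) ^+ 2.
    by rewrite /Q; ring.
  apply: (@le_trans _ _ (Q * (12 * Q)^-1)); first by rewrite ler_pM2l// (le_trans h1).
  by rewrite invfM mulrCA divff ?gt_eqF// mulr1.
exists (8 * D)^-1, (D / del `^ d + (c * del `^ d)^-1); split.
- by rewrite invr_gt0 mulr_gt0.
- by rewrite addr_gt0 ?divr_gt0 ?invr_gt0 ?mulr_gt0 ?powR_gt0.
move=> m; have /andP[t0 t1] := t01 m; set t : R := 2^-1 ^+ m in t0 t1 *.
have /andP[s0 s1] := sqrt_le1 (t01 m).
pose r := del * Num.sqrt t.
have r01 : 0 < r <= 1 by rewrite mulr_gt0//= mulr_ile1// ltW.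
have /andP[r0 r1] := r01.
have rd : r `^ d = del `^ d * t `^ (d / 2).
  by rewrite /r powRM ?sqrtr_ge0 ?(ltW del0)// sqrt_powR// ltW.
have [s [hs cov ovl]] := hD r r01.
have mB y : measurable (rball rho y r) by exact: measurable_rball.
have := @lcomb_osc _ _ _ rho mu C c d lam u p eta DS N K SD hN m _ del del0 del1.
rewrite -/t -/r => H0.
pose a y (w : X -> R) : R := dot mu (fun z => \1_(~` N) z *
  (dot mu (p t z) \1_(rball rho y r) / fine (mu (rball rho y r)))) w.
pose b y (w : X -> R) : R := dot mu (fun z => osc_const C c eta del * osc_kernel rho d m y (c / 2) z)
  (fun z => `|w z|).
pose W cc J := lcomb u (fun j => cc j * expR (t * lam j)) J.
have H : {ae mu, forall x, forall i, rball rho (nth point s i) r x -> forall cc J,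
   (forall j, (j < J)%N -> lam j <= t^-1) ->
   `|lcomb u cc J x - a (nth point s i) (W cc J)| <= b (nth point s i) (W cc J)}.
  by apply: ae_foralln => i; exact: H0.
have [N1 [mN1 N10 hN1]] := H.
have mN : measurable N by case: SD. have muN : mu N = 0%E by case: SD.
exists s, r, (N `|` N1); split.
- apply: (le_trans hs); rewrite rd invfM mulrA ler_wpM2r ?invr_ge0 ?powR_ge0//.
  by rewrite lerDl invr_ge0 mulr_ge0 ?powR_ge0// ltW.
- move=> y; have h : c * r `^ d <= fine (mu (rball rho y r)).
    by have /andP[h _] := ah y r01; rewrite -lee_fin -(mu_fin mu (mB y)).
  apply: le_trans h.
  rewrite rd mulrA ler_wpM2r ?powR_ge0// -[leRHS]invrK lef_pV2 ?posrE ?invr_gt0 ?mulr_gt0 ?powR_gt0//.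
    by rewrite lerDr divr_ge0 ?powR_ge0// ltW.
  by rewrite addr_gt0 ?divr_gt0 ?invr_gt0 ?mulr_gt0 ?powR_gt0.
- by split; [exact: measurableU|apply: null_set_setU].
- exact: subsetUl.
move=> J cc xs q hJ q0 hxs hcount.
set w := W cc J; set v := lcomb u cc J.
have hx x : ~ N1 x -> forall y, y \in s -> rball rho y r x ->
    `|v x - a y w| <= b y w.
  move=> N1x y ys Byx.
  have Hx : forall i, rball rho (nth point s i) r x -> forall cc J,
     (forall j, (j < J)%N -> lam j <= t^-1) ->
     `|lcomb u cc J x - a (nth point s i) (W cc J)| <= b (nth point s i) (W cc J).
    by apply: contrapT => h; apply: N1x; apply: hN1.
  have := Hx (index y s); rewrite nth_index// => /(_ Byx cc J); apply.
  by move=> j jJ; have := hJ j jJ.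
pose mq y := fine (mu (rball rho y r)).
have mq0 y : 0 <= mq y by exact: fine_ge0.
have Lv : L2 mu v by exact: (lcomb_L2 ES).
have Lw : L2 mu w by exact: (lcomb_L2 ES).
have vv : dot mu v v = \sum_(j < J) cc j ^+ 2 by rewrite (lcomb_dot ES).
have ww : dot mu w w <= e2 * \sum_(j < J) cc j ^+ 2.
  rewrite (lcomb_dot ES)// mulr_sumr; apply: ler_sum => j _.
  rewrite -expr2 exprMn mulrC ler_wpM2r ?sqr_ge0// lerXn2r ?nnegrE ?expR_ge0// ler_expR.
  by have := hJ j (ltn_ord j); rewrite -/t -(ler_pM2l t0) divff ?gt_eqF.
have B2 : \sum_(y <- s) mq y * b y w ^+ 2 <= 12^-1 * \sum_(j < J) cc j ^+ 2.
  have := hC3 m del s D w del0 del1' (ltW D0) Lw ovl; rewrite -/t -/r => h.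
  have -> : \sum_(y <- s) mq y * b y w ^+ 2 = osc_const C c eta del ^+ 2 *
     \sum_(y <- s) mq y * dot mu (osc_kernel rho d m y (c / 2)) (fun z => `|w z|) ^+ 2.
    rewrite mulr_sumr; apply: eq_bigr => y _.
    have -> : b y w = osc_const C c eta del * dot mu (osc_kernel rho d m y (c / 2)) (fun z => `|w z|).
      by apply: dotZl; [apply: osc_kernel_L2; rewrite divr_gt0|exact: L2_abs].
    by rewrite exprMn mulrCA.
  apply: (le_trans (ler_wpM2l (sqr_ge0 _) h)).
  apply: (le_trans (ler_wpM2l (sqr_ge0 _) (ler_wpM2l (mulr_ge0 (ltW C30) (ltW D0)) ww))).
  rewrite !mulrA; apply: ler_wpM2r => //; first by apply: sumr_ge0 => j _; exact: sqr_ge0.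
  by move: oc; rewrite /e2 expr2 !mulrA.
have mv : measurable_fun setT v by case: Lv.
(* The balls cover the space, and v^2 <= 2 a^2 + 2 b^2 almost everywhere on each of them. *)
have A2 : \sum_(j < J) cc j ^+ 2 <= \sum_(y <- s) mq y * (2 * a y w ^+ 2 + 2 * b y w ^+ 2).
  rewrite -vv -lee_fin -dot2E// -sumEFin.
  have mv2 : measurable_fun setT (fun x => (v x ^+ 2)%:E).
    by apply/measurable_EFinP; exact: measurable_funX.
  have mI y : measurable_fun setT (fun x => (\1_(rball rho y r) x : R)%:E).
    by apply/measurable_EFinP; exact: measurable_indic.
  apply: (@le_trans _ _ (\int[mu]_x \sum_(y <- s) (2 * a y w ^+ 2 + 2 * b y w ^+ 2)%:E * (\1_(rball rho y r) x : R)%:E)%E); last first.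
    rewrite ge0_integral_sum//; last first.
    - by move=> y x _; rewrite -EFinM lee_fin mulr_ge0// addr_ge0// mulr_ge0 ?sqr_ge0.
    - by move=> y; exact: measurable_funeM.
    apply: lee_sum => y _; rewrite ge0_integralZl_EFin//; last by rewrite addr_ge0// mulr_ge0 ?sqr_ge0.
    by rewrite integral_indic// setIT EFinM muleC /mq -(mu_fin mu (mB y)).
  apply: ae_ge0_le_integral => //.
  - by move=> x _; rewrite lee_fin sqr_ge0.
  - move=> x _; apply: sume_ge0 => y _.
    by rewrite -EFinM lee_fin mulr_ge0// addr_ge0// mulr_ge0 ?sqr_ge0.
  - by apply: emeasurable_sum => y; exact: measurable_funeM.
  exists N1; split => //; move=> x /= hneg; apply: contrapT => N1x; apply: hneg => _.
  have [y ys yx] := cov x.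
  have := hx x N1x y ys yx; set A := a y w; set Bw := b y w => hv.
  have Iy : x \in rball rho y r by exact: mem_set.
  rewrite (big_rem y ys) indicE Iy mule1.
  apply: (@le_trans _ _ (2 * A ^+ 2 + 2 * Bw ^+ 2)%:E).
    rewrite lee_fin; have : (v x - A) ^+ 2 <= Bw ^+ 2.
      by rewrite -real_normK ?num_real// lerXn2r ?nnegrE// (le_trans _ hv).
    by have := sqr_ge0 (v x - 2 * A); nra.
  rewrite leeDl//; apply: sume_ge0 => z _.
  by rewrite -EFinM lee_fin mulr_ge0// addr_ge0// mulr_ge0 ?sqr_ge0.
have := @count_lower _ _ s xs (fun y x => \1_(rball rho y r) x : R) v (fun y => a y w) (fun y => b y w) mq q D
  (fun x _ => ovl x) q0.
have h1 : forall y x, (\1_(rball rho y r) x : R) = 0 \/ (\1_(rball rho y r) x : R) = 1.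
  by move=> y x; rewrite indicE; case: (x \in _); [right|left].
have h2 : forall y x, y \in s -> x \in xs -> (\1_(rball rho y r) x : R) = 1 -> `|v x - a y w| <= b y w.
  move=> y x ys xxs I1; apply: hx => //; first by move=> hN1x; apply: (hxs x xxs); right.
  apply: contrapT => nyx; move: I1; rewrite indicE memNset// => /eqP.
  by rewrite eq_sym oner_eq0.
move=> /(_ h1 h2 hcount mq0) hfin.
set I := \sum_(j < J) cc j ^+ 2 in B2 A2 *.
set S := \sum_(x <- xs) _ in hfin *.
move: A2 B2 hfin; set SA := \sum_(y <- s) mq y * a y w ^+ 2.
set SB := \sum_(y <- s) mq y * b y w ^+ 2.
have -> : \sum_(y <- s) mq y * (2 * a y w ^+ 2 + 2 * b y w ^+ 2) = 2 * SA + 2 * SB.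
  by rewrite !mulr_sumr -big_split/=; apply: eq_bigr => y _; lra.
have -> : \sum_(y <- s) mq y * (2^-1 * a y w ^+ 2 - b y w ^+ 2) = 2^-1 * SA - SB.
  rewrite mulr_sumr -sumrB; apply: eq_bigr => y _; lra.
move=> A2 B2 hfin.
have h3 : 8^-1 * I <= 2^-1 * SA - SB by lra.
rewrite invfM -!mulrA mulrCA ler_pdivrMl// mulrCA.
by apply: le_trans hfin; apply: ler_wpM2l.
Qed.
End gram.

(** * Product laws and Gaussian integrals *)

Lemma integral_prob_cst (R : realType) d (T : measurableType d) (P : probability T R) (k : \bar R) :
  (\int[P]_y k = k)%E.
Proof.
rewrite integral_cst//; transitivity (k * 1)%E; last by rewrite mule1.
congr (_ * _)%E; exact: probability_setT.
Qed.

Section npow.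
Fixpoint nd (d0 : measure_display) n : measure_display :=
  if n is n'.+1 then measure_prod_display (d0, nd d0 n') else d0.

(* [npow T n] carries a dummy last coordinate, so that it is a measurable type for n = 0 too. *)
Fixpoint npow d0 (T : measurableType d0) n : measurableType (nd d0 n) :=
  if n is n'.+1 then (T * npow T n')%type else T.

Fixpoint npr (R : realType) d0 (T : measurableType d0) (P : probability T R) n :
    probability (npow T n) R :=
  if n is n'.+1 then (P \x npr P n')%E : probability _ R else P.

Fixpoint nlist d0 (T : measurableType d0) n : npow T n -> seq T :=
  match n return npow T n -> seq T with
  | 0%N => fun=> [::]
  | n'.+1 => fun z => z.1 :: nlist z.2
  end.

Lemma size_nlist d0 (T : measurableType d0) n (z : npow T n) : size (nlist z) = n.
Proof. by elim: n z => //= n ih z; rewrite ih. Qed.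

Context {R : realType} {d0} {T : measurableType d0}.

Lemma measurable_nlist_prod d1 (A : measurableType d1) (g : A -> T -> R) n :
  measurable_fun setT (fun z : A * T => g z.1 z.2) ->
  measurable_fun setT (fun z : A * npow T n => \prod_(y <- nlist z.2) g z.1 y).
Proof.
move=> mg; elim: n => [|n ih] /=; first by under eq_fun do rewrite big_nil; exact: measurable_cst.
under eq_fun do rewrite big_cons.
have m1 : measurable_fun setT (fun z : A * (T * npow T n) => (z.1, z.2.1)).
  apply: measurable_fun_pair; first exact: measurable_fst.
  exact: measurableT_comp measurable_fst measurable_snd.
have m2 : measurable_fun setT (fun z : A * (T * npow T n) => (z.1, z.2.2)).
  apply: measurable_fun_pair; first exact: measurable_fst.
  exact: measurableT_comp measurable_snd measurable_snd.
by apply: measurable_funM; [exact: measurableT_comp mg m1|exact: measurableT_comp ih m2].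
Qed.

Lemma measurable_nlist_sum1 (g : T -> R) n : measurable_fun setT g ->
  measurable_fun setT (fun z : npow T n => \sum_(y <- nlist z) g y).
Proof.
move=> mg; elim: n => [|n ih] /=; first by under eq_fun do rewrite big_nil; exact: measurable_cst.
under eq_fun do rewrite big_cons.
by apply: measurable_funD; [exact: measurableT_comp mg measurable_fst|exact: measurableT_comp ih measurable_snd].
Qed.

Lemma measurable_nlist_prod1 (g : T -> R) n : measurable_fun setT g ->
  measurable_fun setT (fun z : npow T n => \prod_(y <- nlist z) g y).
Proof.
move=> mg; elim: n => [|n ih] /=; first by under eq_fun do rewrite big_nil; exact: measurable_cst.
under eq_fun do rewrite big_cons.
by apply: measurable_funM; [exact: measurableT_comp mg measurable_fst|exact: measurableT_comp ih measurable_snd].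
Qed.

Variable P : probability T R.

Lemma npr_succ n (F : npow T n.+1 -> \bar R) : measurable_fun setT F -> (forall z, 0 <= F z)%E ->
  (\int[npr P n.+1]_z F z = \int[P]_y \int[npr P n]_z F (y, z))%E.
Proof. by move=> mF F0; rewrite /= fubini_tonelli1. Qed.

Lemma npr_prod (g : T -> R) c n : measurable_fun setT g -> (forall y, 0 <= g y) ->
  (\int[P]_y (g y)%:E = c%:E)%E ->
  (\int[npr P n]_z (\prod_(y <- nlist z) g y)%:E = (c ^+ n)%:E)%E.
Proof.
move=> mg g0 gc; elim: n => [|n ih] /=.
  under eq_integral do rewrite big_nil.
  exact: (integral_prob_cst P).
have mp := @measurable_nlist_prod1 g n.+1 mg.
have p0 m (z : npow T m) : 0 <= \prod_(y <- nlist z) g y by apply: prodr_ge0.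
rewrite fubini_tonelli1//; [|exact/measurable_EFinP|by move=> z; rewrite lee_fin; exact: (p0 n.+1 z)].
rewrite /fubini_F.
under eq_integral => x _.
  under eq_integral do rewrite /= big_cons EFinM.
  rewrite ge0_integralZl_EFin//; last 2 first.
  - by move=> z _; rewrite lee_fin (p0 n z).
  - by apply/measurable_EFinP; exact: (@measurable_nlist_prod1 g n).
  rewrite ih.
  over.
rewrite ge0_integralZr ?gc ?exprS//.
- exact/measurable_EFinP.
- by move=> x _; rewrite lee_fin.
by rewrite lee_fin exprn_ge0// -lee_fin -gc; apply: integral_ge0 => y _; rewrite lee_fin.
Qed.

Lemma npr_sum (g : T -> R) c n : measurable_fun setT g -> (forall y, 0 <= g y) ->
  (\int[P]_y (g y)%:E = c%:E)%E ->
  (\int[npr P n]_z (\sum_(y <- nlist z) g y)%:E = (n%:R * c)%:E)%E.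
Proof.
move=> mg g0 gc; elim: n => [|n ih] /=.
  by under eq_integral do rewrite big_nil; rewrite (@integral0 _ _ _ P) mul0r.
have mp m := @measurable_nlist_sum1 g m mg.
have p0 m (z : npow T m) : 0 <= \sum_(y <- nlist z) g y by apply: sumr_ge0.
rewrite fubini_tonelli1//; [|by apply/measurable_EFinP; exact: (mp n.+1)|by move=> z; rewrite lee_fin; exact: (p0 n.+1 z)].
rewrite /fubini_F.
under eq_integral => x _.
  under eq_integral do rewrite /= big_cons EFinD.
  rewrite ge0_integralD//; last 3 first.
  - by move=> z _; rewrite lee_fin.
  - by move=> z _; rewrite lee_fin.
  - by apply/measurable_EFinP; exact: mp.
  rewrite ih integral_prob_cst.
  over.
rewrite ge0_integralD//; last 3 first.
- by move=> y _; rewrite lee_fin.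
- exact/measurable_EFinP.
- move=> y _; rewrite lee_fin mulr_ge0// -lee_fin -gc.
  by apply: integral_ge0 => z _; rewrite lee_fin.
rewrite gc integral_prob_cst -EFinD; congr EFin.
by rewrite -[n.+1]addn1 natrD mulrDl mul1r addrC.
Qed.

(** Variances of independent centred terms add up; this is the source of all Chebyshev bounds on the
    data. *)
Lemma npr_sum_sqr (g : T -> R) n : L2 P g -> dot P g (fun=> 1) = 0 ->
  (\int[npr P n]_z ((\sum_(y <- nlist z) g y) ^+ 2)%:E = (n%:R * dot P g g)%:E)%E.
Proof.
move=> Lg g0; have mg : measurable_fun setT g by case: Lg.
have L1 k : L2 P (fun=> k : R).
  by split; [exact: measurable_cst|exact: finite_measure_integrable_cst].
elim: n => [|n ih] /=.
  by under eq_integral do rewrite big_nil expr0n/=; rewrite (@integral0 _ _ _ P) mul0r.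
have mp m : measurable_fun setT (fun z : npow T m => ((\sum_(y <- nlist z) g y) ^+ 2)%:E).
  by apply/measurable_EFinP; apply: measurable_funX; exact: measurable_nlist_sum1.
rewrite fubini_tonelli2//; [|exact: (mp n.+1)|by move=> z; rewrite lee_fin sqr_ge0].
rewrite /fubini_G.
under eq_integral => z _.
  under eq_integral do rewrite /= big_cons.
  rewrite dot2E ?dotD2//; [|exact: L2D].
  have -> : dot P g (fun=> \sum_(j <- nlist z) g j) = 0.
    by rewrite -[RHS](mulr0 (\sum_(j <- nlist z) g j)) -g0 -dotZr//; congr dot; apply/funext => y; rewrite mulr1.
  rewrite mulr0 addr0.
  have -> : dot P (fun=> \sum_(j <- nlist z) g j) (fun=> \sum_(j <- nlist z) g j) = (\sum_(j <- nlist z) g j) ^+ 2.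
    by rewrite /dot /Rintegral integral_prob_cst.
  rewrite EFinD.
  over.
rewrite ge0_integralD//; last 2 first.
- by move=> z _; rewrite lee_fin dot_ge0.
- by move=> z _; rewrite lee_fin sqr_ge0.
by rewrite ih integral_prob_cst -EFinD -[n.+1]addn1 natrD mulrDl mul1r addrC.
Qed.

End npow.

(** * Integration against a density and Gaussian integrals *)

Section density.
Import HBNNSimple.
Context {R : realType} {d} {T : measurableType d}.
Variables (m nu : {measure set T -> \bar R}) (g : T -> R).
Hypothesis mg : measurable_fun setT g.
Hypothesis g0 : forall x, 0 <= g x.
Hypothesis nuE : forall A, measurable A -> (nu A = \int[m]_(x in A) (g x)%:E)%E.

Lemma ge0_integral_density (f : T -> \bar R) : measurable_fun setT f -> (forall x, 0 <= f x)%E ->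
  (\int[nu]_x f x = \int[m]_x ((g x)%:E * f x))%E.
Proof.
move=> mf f0; have mgE : measurable_fun setT (EFin \o g) by exact/measurable_EFinP.
have ind E : measurable E -> (\int[nu]_x (\1_E x)%:E = \int[m]_x ((g x)%:E * (\1_E x)%:E))%E.
  move=> mE; rewrite integral_indic// setIT nuE// [LHS]integral_mkcond.
  apply: eq_integral => x _; rewrite patchE indicE; case: (x \in E).
    by rewrite mule1.
  by rewrite mule0.
have sim (h : {nnsfun T >-> R}) : (\int[nu]_x (h x)%:E = \int[m]_x ((g x)%:E * (h x)%:E))%E.
  under [LHS]eq_integral do rewrite fimfunE -fsumEFin//.
  rewrite [LHS]ge0_integral_fsum//; last 2 first.
    - by move=> r; exact/measurable_EFinP/measurableT_comp.
    - by move=> n x _; rewrite EFinM nnfun_muleindic_ge0.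
  under [RHS]eq_integral.
    move=> x xD; rewrite fimfunE -fsumEFin// ge0_mule_fsumr; last first.
      by move=> r; rewrite EFinM nnfun_muleindic_ge0.
    over.
  rewrite [RHS]ge0_integral_fsum//; last 2 first.
    - by move=> r; apply: emeasurable_funM => //; exact/measurable_EFinP/measurableT_comp.
    - by move=> n x _; apply: mule_ge0; [rewrite lee_fin|rewrite EFinM nnfun_muleindic_ge0].
  apply: eq_fsbigr => r _.
  have [r0|r0] := leP 0 r; last first.
    have -> : h @^-1` [set r] = set0.
      by apply/seteqP; split => // x /= hx; have := r0; rewrite -hx ltNge fun_ge0.
    under eq_integral do rewrite indic0 mulr0.
    under [RHS]eq_integral do rewrite indic0 mulr0 mule0.
    by rewrite !integral0.
  under eq_integral do rewrite EFinM.
  under [RHS]eq_integral do rewrite EFinM muleCA.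
  rewrite !ge0_integralZl_EFin ?ind//; first [by apply: emeasurable_funM => //; exact/measurable_EFinP/measurable_indic
             |by exact/measurable_EFinP/measurable_indic
             |by move=> x _; rewrite lee_fin indicE ler0n
             |by move=> x _; rewrite -EFinM lee_fin mulr_ge0// indicE ler0n].
pose f_ := nnsfun_approx measurableT mf.
have l x : (f_ n x)%:E @[n --> \oo] --> f x by exact: cvg_nnsfun_approx.
have nd x : {homo (fun n => (f_ n x)%:E) : a b / (a <= b)%N >-> (a <= b)%E}.
  by move=> a b ab; rewrite lee_fin; exact/lefP/nd_nnsfun_approx.
transitivity (limn (fun n => \int[nu]_x (f_ n x)%:E))%E.
  rewrite -monotone_convergence//=.
  - by apply: eq_integral => x _; apply/esym/cvg_lim.
  - by move=> n; exact/measurable_EFinP.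
  - by move=> n x _; rewrite lee_fin.
transitivity (limn (fun n => \int[m]_x ((g x)%:E * (f_ n x)%:E)))%E.
  by congr (lim (_ @ \oo)%E); apply/funext => n; exact: sim.
rewrite -monotone_convergence//=.
- apply: eq_integral => x _; apply/cvg_lim => //.
  by apply: cvgeZl => //; exact: l.
- by move=> n; apply: emeasurable_funM => //; exact/measurable_EFinP.
- by move=> n x _; rewrite mule_ge0// lee_fin.
- by move=> x _ a b ab; rewrite lee_wpmul2l ?lee_fin//; exact: nd.
Qed.
End density.

Section normal.
Context {R : realType}.
Notation leb := (@lebesgue_measure R).

Lemma ge0_integral_normal (m s : R) (f : R -> \bar R) : measurable_fun setT f -> (forall x, 0 <= f x)%E ->
  (\int[normal_prob m s]_x f x = \int[leb]_x ((normal_pdf m s x)%:E * f x))%E.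
Proof.
move=> mf f0; apply: ge0_integral_density => //; first exact: measurable_normal_pdf.
by move=> x; exact: normal_pdf_ge0.
Qed.

Lemma normal_pdf_expE (m s x : R) : s != 0 ->
  normal_pdf m s x = normal_peak s * expR (- (x - m) ^+ 2 / (2 * s ^+ 2)).
Proof. by move=> s0; rewrite normal_pdfE// /normal_fun mulr_natl. Qed.

Lemma normal_pdf_tilt (s h x : R) : s != 0 ->
  normal_pdf 0 s x * expR (h * x / s ^+ 2) = expR (h ^+ 2 / (2 * s ^+ 2)) * normal_pdf h s x.
Proof.
move=> s0; rewrite !normal_pdf_expE// -[LHS]mulrA -expRD [RHS]mulrCA -expRD; congr (_ * expR _).
by field.
Qed.

Lemma normal_peak_div (s k : R) : 0 < k -> normal_peak (s / k) = k * normal_peak s.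
Proof.
move=> k0; rewrite /normal_peak.
have : 0 <= s ^+ 2 * pi *+ 2 by rewrite mulrn_wge0// mulr_ge0 ?sqr_ge0// pi_ge0.
have -> : (s / k) ^+ 2 * pi *+ 2 = (s ^+ 2 * pi *+ 2) * k^-1 ^+ 2.
  rewrite expr_div_n exprVn mulrAC; by rewrite mulrnAl.
move: (_ *+ 2) => q q0.
by rewrite sqrtrM// sqrtr_sqr normfV (gtr0_norm k0) invfM invrK mulrC.
Qed.

(* Completing the square. *)
Lemma normal_pdf_quad (s al be ga x w : R) : s != 0 -> w = 1 + 2 * ga * s ^+ 2 -> 0 < w ->
  normal_pdf 0 s x * expR (- (al - 2 * be * x + ga * x ^+ 2)) =
  (Num.sqrt w)^-1 * expR (- al + 2 * be ^+ 2 * s ^+ 2 / w) *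
    normal_pdf (2 * be * s ^+ 2 / w) (s / Num.sqrt w) x.
Proof.
move=> s0 wE w0; have sw0 : 0 < Num.sqrt w by rewrite sqrtr_gt0.
have sw : Num.sqrt w ^+ 2 = w by rewrite sqr_sqrtr// ltW.
have s'0 : s / Num.sqrt w != 0 by rewrite mulf_neq0// invr_eq0 gt_eqF.
rewrite !normal_pdf_expE// normal_peak_div// -[LHS]mulrA -expRD.
move: (normal_peak s) => pk.
rewrite -[RHS]mulrA (mulrCA (expR _)) -expRD -(mulrA (Num.sqrt w)) mulKf ?gt_eqF//; congr (_ * expR _).
rewrite expr_div_n sw subr0.
have -> : ga = (w - 1) / (2 * s ^+ 2) by rewrite wE; field.
by field; rewrite s0 gt_eqF.
Qed.

Lemma integral_normal_quad (s al be ga w : R) : s != 0 -> w = 1 + 2 * ga * s ^+ 2 -> 0 < w ->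
  (\int[normal_prob 0 s]_x (expR (- (al - 2 * be * x + ga * x ^+ 2)))%:E =
   ((Num.sqrt w)^-1 * expR (- al + 2 * be ^+ 2 * s ^+ 2 / w))%:E)%E.
Proof.
move=> s0 wE w0.
rewrite ge0_integral_normal//; last first.
  apply/measurable_EFinP; apply: measurableT_comp => //; apply: measurableT_comp => //.
  apply: measurable_funD; first by apply: measurable_funB => //; exact: measurable_funM.
  by apply: measurable_funM => //; exact: measurable_funX.
under eq_integral do rewrite -EFinM (normal_pdf_quad _ _ _ s0 wE w0) EFinM.
rewrite ge0_integralZl_EFin ?integral_normal_pdf ?mule1//.
- by move=> x _; rewrite lee_fin normal_pdf_ge0.
- by apply/measurable_EFinP; exact: measurable_normal_pdf.
Qed.

Lemma integral_normal_expR (s h : R) : s != 0 ->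
  (\int[normal_prob 0 s]_x (expR (h * x))%:E = (expR (h ^+ 2 * s ^+ 2 / 2))%:E)%E.
Proof.
move=> s0; have w1 : 1 = 1 + 2 * 0 * s ^+ 2 by ring.
have := @integral_normal_quad s 0 (h / 2) 0 1 s0 w1 ltr01.
rewrite sqrtr1 invr1 mul1r => e; transitivity (\int[normal_prob 0 s]_x (expR (- (0 - 2 * (h / 2) * x + 0 * x ^+ 2)))%:E)%E.
  by apply: eq_integral => x _; congr (expR _)%:E; field.
by rewrite e; congr (expR _)%:E; field.
Qed.

(** One-dimensional Cameron-Martin formula: the tilt turns N(0, s^2) into a multiple of N(h, s^2),
    which a translation brings back to the centre. *)
Lemma ge0_integral_normal_shift (s h : R) (f : R -> R) : s != 0 -> continuous f -> (forall x, 0 <= f x) ->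
  (\int[normal_prob 0 s]_x (f x * expR (h * x / s ^+ 2))%:E =
   (expR (h ^+ 2 / (2 * s ^+ 2)))%:E * \int[normal_prob 0 s]_x (f (x + h))%:E)%E.
Proof.
move=> s0 cf f0.
have mf : measurable_fun setT f by exact: continuous_measurable_fun.
have ms : measurable_fun setT (fun x : R => f (x + h)).
  by apply: (measurableT_comp mf); exact: measurable_funD.
rewrite (@ge0_integral_normal 0 s (fun x => (f (x + h))%:E)); last 2 first.
- exact/measurable_EFinP.
- by move=> x; rewrite lee_fin.
rewrite ge0_integral_normal; last 2 first.
- apply/measurable_EFinP; apply: measurable_funM => //; apply: measurableT_comp => //.
  by apply: measurable_funM => //; exact: measurable_funM.
- by move=> x; rewrite lee_fin mulr_ge0 ?expR_ge0.
under eq_integral do rewrite -EFinM mulrCA (normal_pdf_tilt _ _ s0) mulrCA EFinM.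
have mp : measurable_fun setT (fun x => (f x * normal_pdf h s x)%:E).
  by apply/measurable_EFinP; apply: measurable_funM => //; exact: measurable_normal_pdf.
have p0 x : (0 <= (f x * normal_pdf h s x)%:E)%E by rewrite lee_fin mulr_ge0// normal_pdf_ge0.
rewrite ge0_integralZl_EFin ?expR_ge0//; congr (_ * _)%E.
have dF (x : R) : is_derive x 1 (fun y : R => y + h : R^o) (1 : R^o).
  by apply: is_derive_eq; rewrite addr0.
have F'E : derive1 (fun y : R => y + h : R^o) = cst (1 : R^o).
  by apply/funext => x; rewrite derive1E; exact: derive_val.
rewrite (@increasing_ge0_integration_by_substitutionT _ (fun y => y + h))//.
- apply: eq_integral => x _; rewrite F'E -EFinM; congr EFin.
  transitivity (f (x + h) * normal_pdf h s (x + h) * 1) => //.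
  by rewrite mulr1 mulrC !normal_pdf_expE// addrK subr0.
- by move=> x y xy; rewrite ltrD2r.
- by rewrite F'E; exact: cst_continuous.
- by rewrite F'E; exact: is_cvg_cst.
- by rewrite F'E; exact: is_cvg_cst.
- exact: cvg_addrr_Ny.
- exact: cvg_addrr.
- by move=> x; apply: cvgM; [exact: cf|exact: continuous_normal_pdf].
Qed.

End normal.

(** * Characteristic function and moments of the normal law *)

Section charfun.
Context {R : realType}.

Lemma integrableD_EFin d (Y : measurableType d) (m : {measure set Y -> \bar R}) (f g : Y -> R) :
  m.-integrable setT (EFin \o f) -> m.-integrable setT (EFin \o g) ->
  m.-integrable setT (EFin \o (fun x => f x + g x)).
Proof. by move=> h1 h2; exact: (integrableD measurableT h1 h2). Qed.

Lemma is_derive_under_integral d (Y : measurableType d) (m : {measure set Y -> \bar R})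
    (f f' : R -> Y -> R) (G : Y -> R) (a : R) :
  (forall x, m.-integrable setT (EFin \o f x)) ->
  (forall x y, is_derive x (1 : R) (fun x : R => f x y) (f' x y)) ->
  (forall y, 0 <= G y) -> m.-integrable setT (EFin \o G) ->
  (forall x y, a - 1 < x < a + 1 -> `|f' x y| <= G y) ->
  is_derive a (1 : R) (fun x => \int[m]_y f x y) (\int[m]_y f' a y).
Proof.
move=> intf df G0 intG hG.
have d1 x y : partial1of2 f x y = f' x y.
  by rewrite partial1of2E; have [_ ->] := df x y.
have Ia : `]a - 1, a + 1[%classic a by rewrite /= in_itv/= gtrBl ltrDl !ltr01.
have der x y : `]a - 1, a + 1[%classic x -> setT y -> derivable (f^~ y) x 1.
  by move=> _ _; have [] := df x y.
have ub x y : `]a - 1, a + 1[%classic x -> setT y -> `|partial1of2 f x y| <= G y.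
  by move=> xI _; rewrite d1; apply: hG; move: xI; rewrite /= in_itv.
apply: DeriveDef.
  exact: (derivable_under_integral measurableT Ia (fun x _ => intf x) der G0 intG ub).
rewrite -derive1E (differentiation_under_integral measurableT Ia (fun x _ => intf x) der G0 intG ub).
by apply: eq_Rintegral => y _; rewrite d1.
Qed.

Variable s : R.
Hypothesis s0 : s != 0.
Let N : {measure set _ -> \bar R} := normal_prob 0 s.

Let prob_bounded_integrable (f : R -> R) B : measurable_fun setT f -> (forall x, `|f x| <= B) ->
  N.-integrable setT (EFin \o f).
Proof.
move=> mf fB; apply: (@le_integrable _ _ _ N setT measurableT _ (EFin \o cst B)).
- exact/measurable_EFinP.
- by move=> x _; rewrite lee_fin; apply: (le_trans (fB x)); exact: ler_norm.
- exact: finite_measure_integrable_cst.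
Qed.

Let expR_integrable h : N.-integrable setT (EFin \o (fun x => expR (h * x))).
Proof.
apply/integrableP; split.
  by apply/measurable_EFinP; apply: measurableT_comp => //; exact: measurable_funM.
under eq_integral do rewrite /= ger0_norm ?expR_ge0//.
by rewrite [X in (X < _)%E](integral_normal_expR h s0) ltry.
Qed.

Let k := (s ^+ 2)^-1.
Let k0 : 0 < k. Proof. by rewrite invr_gt0 exprn_even_gt0. Qed.
(** An integrable envelope for the derivatives in h of the tilted integrands with |h| < 1, and for
    functions of linear growth. *)
Let G x := expR (2 * k * x) + expR (- (2 * k) * x).
Let G0 x : 0 <= G x. Proof. by rewrite addr_ge0// expR_ge0. Qed.
Let intG : N.-integrable setT (EFin \o G).
Proof.
by apply: integrableD_EFin; exact: expR_integrable.
Qed.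

Let G_ub x h : -1 < h < 1 -> `|k * x| * expR (h * x * k) <= G x.
Proof.
move=> /andP[h1 h2].
have e1 : `|k * x| <= expR `|k * x|.
  by have := expR_ge1Dx `|k * x|; lra.
have e2 : expR (h * x * k) <= expR `|k * x|.
  rewrite ler_expR -mulrA mulrC (mulrC x); apply: (le_trans (ler_norm _)).
  by rewrite normrM ler_piMr// ler_norml; lra.
apply: (@le_trans _ _ (expR `|k * x| * expR `|k * x|)).
  by apply: ler_pM => //; exact: expR_ge0.
rewrite -expRD /G; have [x0|x0] := leP 0 x.
  rewrite ger0_norm ?(mulr_ge0 (ltW k0))//.
  have -> : k * x + k * x = 2 * k * x by lra.
  by rewrite lerDl expR_ge0.
rewrite ltr0_norm ?pmulr_rlt0//.
have -> : - (k * x) + - (k * x) = - (2 * k) * x by lra.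
by rewrite lerDr expR_ge0.
Qed.

Let csin c x : continuous (fun g : R => sin (c + x * g)).
Proof.
move=> g; apply: continuous_comp; last exact: continuous_sin.
apply: cvgD; first exact: cvg_cst.
by apply: cvgM; [exact: cvg_cst|exact: cvg_id].
Qed.

Let ccos c x : continuous (fun g : R => cos (c + x * g)).
Proof.
move=> g; apply: continuous_comp; last exact: continuous_cos.
apply: cvgD; first exact: cvg_cst.
by apply: cvgM; [exact: cvg_cst|exact: cvg_id].
Qed.

Let msin c x : measurable_fun setT (fun g : R => sin (c + x * g)).
Proof. by apply: continuous_measurable_fun; exact: csin. Qed.
Let mcos c x : measurable_fun setT (fun g : R => cos (c + x * g)).
Proof. by apply: continuous_measurable_fun; exact: ccos. Qed.
Let sin_bd (x : R) : `|sin x| <= 1. Proof. by rewrite ler_norml sin_geN1 sin_le1. Qed.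
Let cos_bd (x : R) : `|cos x| <= 1. Proof. by rewrite ler_norml cos_geN1 cos_le1. Qed.
Let S c x := \int[N]_g sin (c + x * g).
Let F c x := \int[N]_g cos (c + x * g).

Let isin c x : N.-integrable setT (EFin \o (fun g => sin (c + x * g))).
Proof. by apply: (@prob_bounded_integrable _ 1) => //; exact: msin. Qed.
Let icos c x : N.-integrable setT (EFin \o (fun g => cos (c + x * g))).
Proof. by apply: (@prob_bounded_integrable _ 1) => //; exact: mcos. Qed.

Let isinexp c x h : N.-integrable setT (EFin \o (fun g => sin (c + x * g) * expR (h * g * k))).
Proof.
apply: (@le_integrable _ _ _ N setT measurableT _ (EFin \o (fun g => expR (h * k * g)))).
- apply/measurable_EFinP; apply: measurable_funM; first exact: msin.
  by apply: measurableT_comp => //; apply: measurable_funM => //; exact: measurable_funM.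
- move=> g _; rewrite lee_fin normrM mulrAC.
  by rewrite ler_piMl.
- exact: expR_integrable.
Qed.

(* Translating the Gaussian by h multiplies its density by exp(h g / s^2 - h^2 / (2 s^2)). *)
Let shift_sin c x h : \int[N]_g (sin (c + x * g) * expR (h * g * k)) =
  expR (h ^+ 2 / (2 * s ^+ 2)) * (cos (x * h) * S c x + sin (x * h) * F c x).
Proof.
(* Adding 1 makes the sine nonnegative, as the shift formula requires; the constant is removed again
   at the end. *)
have cf : continuous (fun g : R => 1 + sin (c + x * g)).
  by move=> g; apply: cvgD; [exact: cvg_cst|exact: csin].
have f0 g : 0 <= 1 + sin (c + x * g) by have := sin_geN1 (c + x * g); lra.
have := @ge0_integral_normal_shift _ s h _ s0 cf f0.
have ie : N.-integrable setT (EFin \o (fun g => expR (h * g * k))).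
  by have := expR_integrable (h * k); congr (_.-integrable _ (_ \o _)); apply/funext => g; rewrite mulrAC.
have iE c' : N.-integrable setT (EFin \o (fun g => 1 + sin (c' + x * g))).
  apply: (@integrableD_EFin _ _ _ (cst 1)); last exact: isin.
  exact: finite_measure_integrable_cst.
have -> : (\int[normal_prob 0 s]_g ((1 + sin (c + x * g)) * expR (h * g / s ^+ 2))%:E =
    (\int[N]_g expR (h * g * k) + \int[N]_g (sin (c + x * g) * expR (h * g * k)))%:E)%E.
  rewrite -RintegralD// /Rintegral fineK.
    by apply: eq_integral => g _; rewrite mulrDl mul1r.
  apply: integrable_fin_num => //.
  exact: integrableD_EFin.
have -> : (\int[normal_prob 0 s]_g (1 + sin (c + x * (g + h)))%:E = (1 + (cos (x * h) * S c x + sin (x * h) * F c x))%:E)%E.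
  have e g : sin (c + x * (g + h)) = cos (x * h) * sin (c + x * g) + sin (x * h) * cos (c + x * g).
    by rewrite mulrDr addrA sinD; ring.
  have i1 : N.-integrable setT (EFin \o (fun g => cos (x * h) * sin (c + x * g))).
    by have := integrableZl measurableT (cos (x * h)) (isin c x).
  have i2 : N.-integrable setT (EFin \o (fun g => sin (x * h) * cos (c + x * g))).
    by have := integrableZl measurableT (sin (x * h)) (icos c x).
  have i3 : N.-integrable setT (EFin \o cst (1 : R)) by exact: finite_measure_integrable_cst.
  rewrite /S /F -!RintegralZl// -RintegralD//.
  have E1 : 1 = \int[N]_g (cst (1 : R) g) by rewrite /Rintegral [X in fine X](integral_prob_cst (normal_prob 0 s : probability _ _) 1%:E).
  rewrite [in RHS]E1 -RintegralD//; last first.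
    exact: integrableD_EFin.
  rewrite /Rintegral fineK.
    by apply: eq_integral => g _; rewrite e.
  apply: integrable_fin_num => //.
  have := iE (c + x * h); congr (_.-integrable _ _); apply/funext => g /=.
  by rewrite -e mulrDr; congr (1 + sin _)%:E; lra.
rewrite -EFinM => -[e].
have : \int[N]_g expR (h * g * k) = expR (h ^+ 2 / (2 * s ^+ 2)).
  have := integral_normal_expR (h * k) s0.
  rewrite /Rintegral => e'; transitivity (fine (\int[normal_prob 0 s]_g (expR (h * k * g))%:E)).
    by congr fine; apply: eq_integral => g _; rewrite mulrAC.
  by rewrite e' /k; congr expR; field.
move: e; rewrite mulrDr mulr1 => e e2; move: e; rewrite e2 => /addrI; exact.
Qed.

(** Gaussian integration by parts, obtained by differentiating both sides of [shift_sin] at h =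
    0. *)
Let stein c x : \int[N]_g (g * k * sin (c + x * g)) = x * F c x.
Proof.
have D2 : is_derive (0 : R) (1 : R) (fun h : R => expR (h ^+ 2 / (2 * s ^+ 2)) * (cos (x * h) * S c x + sin (x * h) * F c x)) (x * F c x).
  move: (S c x) (F c x) => A B; apply: is_derive_eq; rewrite /GRing.scale/=.
  by rewrite !mulr0 sin0 cos0 expr0n/= !mul0r expR0; ring.
have D1 := @is_derive_under_integral _ _ N (fun h g => sin (c + x * g) * expR (h * g * k))
  (fun h g => sin (c + x * g) * (g * k * expR (h * g * k))) G 0 (isinexp c x).
have d1 h g : is_derive h (1 : R) (fun h : R => sin (c + x * g) * expR (h * g * k))
    (sin (c + x * g) * (g * k * expR (h * g * k))).
  by apply: is_derive_eq; rewrite scaler0 add0r; rewrite /GRing.scale/=; ring.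
have ub h g : 0 - 1 < h < 0 + 1 -> `|sin (c + x * g) * (g * k * expR (h * g * k))| <= G g.
  rewrite sub0r add0r => hh; rewrite normrM (le_trans _ (G_ub g hh))//.
  rewrite normrM (ger0_norm (expR_ge0 _)) (mulrC g).
  by rewrite ler_piMl// mulr_ge0// expR_ge0.
have {}D1 := D1 d1 G0 intG ub.
have eF : (fun h => \int[N]_g (sin (c + x * g) * expR (h * g * k))) =
  (fun h => expR (h ^+ 2 / (2 * s ^+ 2)) * (cos (x * h) * S c x + sin (x * h) * F c x)).
  by apply/funext => h; exact: shift_sin.
rewrite eF in D1.
have [_ e1] := D1; have [_ e2] := D2.
rewrite -e2 e1; apply: eq_Rintegral => g _; by rewrite !mul0r expR0 mulr1 mulrC.
Qed.

Let dF c y : is_derive y (1 : R) (F c) (- (s ^+ 2 * (y * F c y))).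
Proof.
have s2 : 0 < s ^+ 2 by rewrite exprn_even_gt0.
have ub z g : y - 1 < z < y + 1 -> `|- (g * sin (c + z * g))| <= s ^+ 2 * G g.
  move=> _; rewrite normrN normrM.
  apply: (@le_trans _ _ `|g|); first by rewrite ler_piMr.
  have := @G_ub g 0; rewrite !mul0r expR0 mulr1 normrM (ger0_norm (ltW k0)) => /(_ _).
  rewrite oppr_lt0 ltr01 => /(_ isT).
  by rewrite -(ler_pM2l s2) mulrA divff ?mul1r// gt_eqF.
have igs : N.-integrable setT (EFin \o (fun g => g * k * sin (c + y * g))).
  apply: (@le_integrable _ _ _ N setT measurableT _ (EFin \o G)) => //.
  - apply/measurable_EFinP; apply: measurable_funM; last exact: msin.
    exact: measurable_funM.
  - move=> g _; rewrite lee_fin (ger0_norm (G0 g)) normrM.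
    apply: (@le_trans _ _ `|g * k|); first by rewrite ler_piMr.
    have := @G_ub g 0; rewrite !mul0r expR0 mulr1 mulrC => /(_ _).
    by rewrite oppr_lt0 ltr01 => /(_ isT).
have -> : - (s ^+ 2 * (y * F c y)) = \int[N]_g (- (g * sin (c + y * g))).
  rewrite -stein -mulNr -RintegralZl//; apply: eq_Rintegral => g _.
  by rewrite /k; field.
apply: (@is_derive_under_integral _ _ N (fun y g => cos (c + y * g)) (fun y g => - (g * sin (c + y * g)))
    (fun g => s ^+ 2 * G g)).
- exact: icos.
- by move=> z g; apply: is_derive_eq; rewrite scaler0 add0r /GRing.scale/=; ring.
- by move=> g; rewrite mulr_ge0// ltW.
- exact: (integrableZl measurableT (s ^+ 2) intG).
- exact: ub.
Qed.

(** By [dF] the function F solves y' = - s^2 x y, so its product with exp(x^2 s^2 / 2) is constant.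
    The phase c lets cosines alone play the role of complex exponentials. *)
Lemma integral_normal_cos c x :
  \int[normal_prob 0 s]_g cos (c + x * g) = cos c * expR (- (x ^+ 2 * s ^+ 2 / 2)).
Proof.
have dC (y : R) : is_derive y (1 : R) (fun y => F c y * expR (y ^+ 2 * s ^+ 2 / 2)) 0.
  by have h := dF c y; apply: is_derive_eq; rewrite /GRing.scale/=; field.
have F0 : F c 0 = cos c.
  rewrite /F /Rintegral (eq_integral (fun=> (cos c)%:E)); first by rewrite [X in fine X](integral_prob_cst (normal_prob 0 s : probability _ _) (cos c)%:E).
  by move=> g _; rewrite mul0r addr0.
have := is_derive_0_is_cst x 0 dC.
rewrite F0 expr0n/= !mul0r expR0 mulr1 => <-.
by rewrite -[RHS]mulrA -expRD subrr expR0 mulr1.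
Qed.

(** The identity [stein] at x = 0 with phase pi / 2, where the sine is 1. *)
Lemma integral_normal_id : \int[normal_prob 0 s]_g g = 0.
Proof.
have igk : N.-integrable setT (EFin \o (fun g : R => g)).
  apply: (@le_integrable _ _ _ N setT measurableT _ (EFin \o (fun g => s ^+ 2 * G g))).
  - exact/measurable_EFinP.
  - move=> g _; rewrite lee_fin [leRHS]ger0_norm; last by rewrite mulr_ge0 ?sqr_ge0.
    have := @G_ub g 0; rewrite !mul0r expR0 mulr1 normrM (ger0_norm (ltW k0)) => /(_ _).
    rewrite oppr_lt0 ltr01 => /(_ isT) h.
    by rewrite -[leLHS](mulKf (lt0r_neq0 k0)) /k invrK ler_wpM2l ?sqr_ge0.
  - exact: (integrableZl measurableT (s ^+ 2) intG).
have := stein (pi / 2) 0; rewrite mul0r => e.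
have e2 : \int[N]_g (k * g) = k * \int[N]_g g by exact: (RintegralZl k measurableT igk).
apply: (mulfI (lt0r_neq0 k0)); rewrite mulr0; transitivity (\int[N]_g (k * g)); first by rewrite e2.
rewrite -[RHS]e; apply: eq_Rintegral => g _.
by rewrite mul0r addr0 sin_pihalf mulr1 mulrC.
Qed.

(** Derivative at x = 0 of both sides of [stein] with phase 0. *)
Lemma integral_normal_sqr : (\int[normal_prob 0 s]_g (g ^+ 2)%:E = (s ^+ 2)%:E)%E.
Proof.
have s2 : 0 < s ^+ 2 by rewrite exprn_even_gt0.
have sqr_ub g : `|g * k| ^+ 2 <= 4 * G g.
  have := @G_ub g 0; rewrite !mul0r expR0 mulr1 mulrC => _.
  have e1 : 1 + `|g * k| / 2 <= expR (`|g * k| / 2) by exact: expR_ge1Dx.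
  have e2 : expR (`|g * k| / 2) ^+ 2 <= G g.
    rewrite expr2 -expRD -splitr /G; have [g0|g0] := leP 0 g.
      rewrite ger0_norm ?(mulr_ge0 g0 (ltW k0))//.
      rewrite -[leLHS]addr0 lerD ?expR_ge0// ler_expR.
      by have := mulr_ge0 g0 (ltW k0); lra.
    have gk : g * k < 0 by rewrite nmulr_rlt0.
    rewrite ltr0_norm//; rewrite -[leLHS]add0r lerD ?expR_ge0// ler_expR; lra.
  have : 0 <= `|g * k| by [].
  move: e1 e2; set y := `|g * k|; set e := expR _ => e1 e2 y0.
  apply: (@le_trans _ _ (4 * e ^+ 2)); last by rewrite ler_pM2l.
  by nra.
have mid : measurable_fun setT (fun g : R => g ^+ 2) by exact: measurable_funX.
have i2 : N.-integrable setT (EFin \o (fun g : R => g ^+ 2)).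
  apply: (@le_integrable _ _ _ N setT measurableT _ (EFin \o (fun g => s ^+ 4 * (4 * G g)))).
  - exact/measurable_EFinP.
  - move=> g _; rewrite lee_fin (ger0_norm (sqr_ge0 _)) ger0_norm; last first.
      by rewrite mulr_ge0 ?exprn_even_ge0// mulr_ge0.
    apply: le_trans (ler_wpM2l (exprn_even_ge0 s _) (sqr_ub g)) => //.
    rewrite real_normK ?num_real// exprMn /k exprVn -exprM mulrCA divff ?mulr1//.
    by rewrite expf_neq0.
  - exact: (integrableZl measurableT (s ^+ 4) (integrableZl measurableT 4 intG)).
have igs y : N.-integrable setT (EFin \o (fun g => g * k * sin (0 + y * g))).
  apply: (@le_integrable _ _ _ N setT measurableT _ (EFin \o G)) => //.
  - apply/measurable_EFinP; apply: measurable_funM; last exact: msin.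
    exact: measurable_funM.
  - move=> g _; rewrite lee_fin (ger0_norm (G0 g)) normrM.
    apply: (@le_trans _ _ `|g * k|); first by rewrite ler_piMr.
    have := @G_ub g 0; rewrite !mul0r expR0 mulr1 mulrC => /(_ _).
    by rewrite oppr_lt0 ltr01 => /(_ isT).
have D1 : is_derive (0 : R) (1 : R) (fun x => \int[N]_g (g * k * sin (0 + x * g))) (\int[N]_g (g * k * (g * cos (0 + 0 * g)))).
  apply: (@is_derive_under_integral _ _ N (fun x g => g * k * sin (0 + x * g)) (fun x g => g * k * (g * cos (0 + x * g)))
    (fun g => k * g ^+ 2)) => //.
  - by move=> x g; apply: is_derive_eq; rewrite scaler0 add0r /GRing.scale/=; ring.
  - by move=> g; rewrite mulr_ge0 ?sqr_ge0// ltW.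
  - exact: (integrableZl measurableT k i2).
  - move=> x g _; rewrite mulrA normrM; apply: (@le_trans _ _ `|g * k * g|); first by rewrite ler_piMr.
    by rewrite mulrAC -expr2 mulrC ger0_norm// mulr_ge0 ?sqr_ge0// ltW.
have D2 : is_derive (0 : R) (1 : R) (fun x => x * F 0 x) 1.
  have h := dF 0 0; apply: is_derive_eq; rewrite /GRing.scale/= mul0r add0r mulr1.
  rewrite /F /Rintegral (eq_integral (fun=> 1%E)).
    by rewrite [X in fine X](integral_prob_cst (normal_prob 0 s : probability _ _) 1%:E).
  by move=> g _; rewrite mul0r addr0 cos0.
have eF : (fun x => \int[N]_g (g * k * sin (0 + x * g))) = (fun x => x * F 0 x).
  by apply/funext => x; exact: stein.
rewrite eF in D1; have [_ e1] := D1; have [_ e2] := D2.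
have : k * \int[N]_g g ^+ 2 = 1.
  rewrite -RintegralZl// -e2 e1; apply: eq_Rintegral => g _.
  by rewrite mul0r addr0 cos0 mulr1 expr2; ring.
have f2 : (\int[N]_g (g ^+ 2)%:E)%E \is a fin_num by exact: integrable_fin_num.
move=> e; rewrite -[LHS]fineK//; congr EFin.
by apply: (mulfI (lt0r_neq0 k0)); rewrite [LHS]e /k mulVf// gt_eqF.
Qed.

End charfun.

(** * Bounding the data expectation by integrals over the noise *)

Section data_expectation.
Context {R : realType} {dX} {X : measurableType dX}.
Variables (mu0 : probability X R) (f0 : X -> R) (sigma : R).

Lemma E0_ge0 n (G : seq (X * R) -> R) : (forall s, 0 <= G s) -> (0 <= E0 mu0 f0 sigma n G)%E.
Proof.
elim: n G => [|n ih] G G0 /=; first by rewrite lee_fin.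
apply: integral_ge0 => x _; apply: integral_ge0 => e _.
by rewrite mule_ge0 ?lee_fin ?normal_pdf_ge0// ih.
Qed.

Definition obs (y : X * measurableTypeR R) : X * R := (y.1, f0 y.1 + y.2).

Definition noise : probability (X * measurableTypeR R)%type R :=
  (mu0 \x (normal_prob 0 sigma : probability (measurableTypeR R) R))%E.

Lemma integral_noise (F : X * measurableTypeR R -> \bar R) : measurable_fun setT F -> (forall z, 0 <= F z)%E ->
  (\int[noise]_z F z = \int[mu0]_x \int[@lebesgue_measure R]_e ((normal_pdf 0 sigma e)%:E * F (x, e)))%E.
Proof.
move=> mF F0; rewrite /noise fubini_tonelli1//; apply: eq_integral => x _.
rewrite /fubini_F; apply: ge0_integral_normal => //.
exact: (measurableT_comp mF (measurable_pair1 x)).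
Qed.

(** [E0] iterates integrals of functions that need not be measurable. A measurable majorant on the
    product space is enough, and Tonelli applies to the majorant. *)
Lemma E0_le n (G : seq (X * R) -> R) (F : npow (X * measurableTypeR R)%type n -> \bar R) :
  (forall s, 0 <= G s) -> measurable_fun setT F -> (forall z, 0 <= F z)%E ->
  (forall z : npow (X * measurableTypeR R)%type n, (G (map obs (nlist z)))%:E <= F z)%E ->
  (E0 mu0 f0 sigma n G <= \int[npr noise n]_z F z)%E.
Proof.
elim: n G F => [|n ih] G F G0 mF F0 GF /=.
  have c z : ((G [::])%:E <= F z)%E by exact: GF.
  rewrite -[leLHS](integral_prob_cst noise).
  by apply: le_lower_integral => z _; rewrite ?lee_fin.
have mI : measurable_fun setT (fun y => \int[npr noise n]_z F (y, z))%E.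
  exact: measurable_fun_fubini_tonelli_F.
have I0 y : (0 <= \int[npr noise n]_z F (y, z))%E by exact: integral_ge0.
have e1 := npr_succ noise mF F0.
have e2 := integral_noise mI I0.
apply: (@le_trans _ _ (\int[noise]_y \int[npr noise n]_z F (y, z))%E); last by rewrite -e1.
rewrite e2; apply: le_lower_integral => x _.
  by apply: integral_ge0 => e _; rewrite mule_ge0 ?lee_fin ?normal_pdf_ge0// E0_ge0.
apply: le_lower_integral => e _; first by rewrite mule_ge0 ?lee_fin ?normal_pdf_ge0// E0_ge0.
rewrite lee_wpmul2l ?lee_fin ?normal_pdf_ge0//.
apply: ih => //.
- exact: (measurableT_comp mF (measurable_pair1 (x, e))).
- by move=> z; exact: (GF ((x, e), z)).
Qed.

End data_expectation.

Lemma bounded_integrable {R : realType} {dO} {Om : measurableType dO} (P : probability Om R) (f : Om -> R) B : measurable_fun setT f -> (forall x, `|f x| <= B) ->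
  P.-integrable setT (EFin \o f).
Proof.
move=> mf fB; apply: (@le_integrable _ _ _ P setT measurableT _ (EFin \o cst B)).
- exact/measurable_EFinP.
- by move=> x _; rewrite lee_fin; apply: (le_trans (fB x)); exact: ler_norm.
- exact: finite_measure_integrable_cst.
Qed.

(** * Functionals of a single Gaussian variable *)

Section gauss_law.
Context {R : realType} {dO} {Om : measurableType dO} (P : probability Om R).

Lemma gauss_law_integral (Z : Om -> R) v (f : R -> \bar R) : measurable_fun setT Z -> 0 <= v ->
  (forall A, measurable A -> P [set om | A (Z om)] = gauss_law v A) ->
  measurable_fun setT f -> (forall x, 0 <= f x)%E ->
  (\int[P]_om f (Z om) = if v == 0%R then f 0%R else \int[normal_prob 0 (Num.sqrt v)]_x f x)%E.
Proof.
move=> mZ v0 lawZ mf f0.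
have mZ' : measurable_fun setT (Z : Om -> measurableTypeR R) by [].
have mf' : measurable_fun setT (f : measurableTypeR R -> \bar R) by [].
rewrite -(@ge0_integral_pushforward _ _ _ _ _ _ mZ' P setT f)//.
case: ifPn => v00.
  rewrite (eq_measure_integral (\d_(0 : measurableTypeR R))); last first.
    move=> A mA _; transitivity (gauss_law v A); first exact: lawZ.
    by rewrite /gauss_law v00 /= /dirac indicE.
  by rewrite integral_dirac// diracT mul1e.
apply: eq_measure_integral => A mA _.
transitivity (gauss_law v A); last by rewrite /gauss_law (negbTE v00).
exact: lawZ.
Qed.

Lemma gauss_law_sqr (Z : Om -> R) v : measurable_fun setT Z -> 0 <= v ->
  (forall A, measurable A -> P [set om | A (Z om)] = gauss_law v A) ->
  (\int[P]_om (Z om ^+ 2)%:E = v%:E)%E.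
Proof.
move=> mZ v0 lawZ; rewrite (gauss_law_integral (f := fun x => (x ^+ 2)%:E) mZ v0 lawZ); last 2 first.
- by apply/measurable_EFinP; exact: measurable_funX.
- by move=> x; rewrite lee_fin sqr_ge0.
case: eqVneq => [->|vn0]; first by rewrite expr0n.
by rewrite integral_normal_sqr ?sqr_sqrtr// sqrtr_eq0 -ltNge lt_neqAle eq_sym vn0.
Qed.

(** The exact value is (1 - 2 b v)^(-1/2), and 4 b v <= 1 keeps 1 - 2 b v above 1/2. *)
Lemma gauss_law_expR (Z : Om -> R) v b : measurable_fun setT Z -> 0 <= v ->
  (forall A, measurable A -> P [set om | A (Z om)] = gauss_law v A) ->
  0 <= b -> 4 * b * v <= 1 ->
  (\int[P]_om (expR (b * Z om ^+ 2))%:E <= 2%:E)%E.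
Proof.
move=> mZ v0 lawZ b0 bv; rewrite (gauss_law_integral (f := fun x => (expR (b * x ^+ 2))%:E) mZ v0 lawZ); last 2 first.
- apply/measurable_EFinP; apply: measurableT_comp => //.
  by apply: measurable_funM => //; exact: measurable_funX.
- by move=> x; rewrite lee_fin expR_ge0.
case: eqVneq => [_|vn0]; first by rewrite expr0n/= mulr0 expR0 lee_fin; lra.
have sv : Num.sqrt v != 0 by rewrite sqrtr_eq0 -ltNge lt_neqAle eq_sym vn0.
pose w := 1 + 2 * (- b) * Num.sqrt v ^+ 2.
have wh : 2^-1 <= w by rewrite /w sqr_sqrtr//; lra.
have w0 : 0 < w by lra.
have e := @integral_normal_quad _ _ 0 0 (- b) w sv erefl w0.
rewrite (_ : (\int[_]_x _)%E = ((Num.sqrt w)^-1 * expR (- 0 + 2 * 0 ^+ 2 * Num.sqrt v ^+ 2 / w))%:E); last first.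
  by rewrite -e; apply: eq_integral => x _; congr (expR _)%:E; lra.
rewrite expr0n/= !(mulr0, mul0r) oppr0 addr0 expR0 mulr1 lee_fin.
rewrite invf_ple ?posrE ?sqrtr_gt0//.
rewrite -[leLHS]ger0_norm ?invr_ge0// -sqrtr_sqr ler_wsqrtr//.
by apply: le_trans wh; rewrite exprVn; apply: (@le_trans _ _ (4^-1)); lra.
Qed.

Lemma gauss_law_cos (Z : Om -> R) v c : measurable_fun setT Z -> 0 <= v ->
  (forall A, measurable A -> P [set om | A (Z om)] = gauss_law v A) ->
  \int[P]_om cos (c + Z om) = cos c * expR (- (v / 2)).
Proof.
move=> mZ v0 lawZ.
have mc : measurable_fun setT (fun x : R => cos (c + 1 * x)).
  apply: continuous_measurable_fun => x; apply: continuous_comp; last exact: continuous_cos.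
  by apply: cvgD; [exact: cvg_cst|apply: cvgM; [exact: cvg_cst|exact: cvg_id]].
have cb (x : R) : `|cos x| <= 1 by rewrite ler_norml cos_geN1 cos_le1.
have h := gauss_law_integral (f := fun x => (1 + cos (c + 1 * x))%:E) mZ v0 lawZ.
have {}h := h _ _.
have iZ : P.-integrable setT (EFin \o (fun om => cos (c + 1 * Z om))).
  by apply: (@bounded_integrable _ _ _ P _ 1) => //; exact: (measurableT_comp mc mZ).
have i1 d' (T' : measurableType d') (Q : probability T' R) : Q.-integrable setT (EFin \o cst (1 : R)).
  exact: finite_measure_integrable_cst.
have add1 d' (T' : measurableType d') (Q : probability T' R) (g : T' -> R) : Q.-integrable setT (EFin \o g) ->
    (\int[Q]_x (1 + g x)%:E = (1 + \int[Q]_x g x)%:E)%E.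
  move=> ig; have e1 : \int[Q]_x cst 1 x = 1 by exact: (congr1 fine (integral_prob_cst Q 1%:E)).
  rewrite -[X in (X + _)%:E]e1 -RintegralD//; last exact: i1.
  rewrite /Rintegral fineK//; apply: (@integrable_fin_num _ _ _ Q _ measurableT).
  by apply: (@integrableD_EFin _ _ _ Q (cst 1)); [exact: i1|exact: ig].
have -> : \int[P]_om cos (c + Z om) = \int[P]_om cos (c + 1 * Z om).
  by apply: eq_Rintegral => om _; rewrite mul1r.
have [mf f0] : measurable_fun setT (fun x : R => (1 + cos (c + 1 * x))%:E) /\ forall x : R, (0 <= (1 + cos (c + 1 * x))%:E)%E.
  split; first by apply/measurable_EFinP; exact: measurable_funD.
  by move=> x; rewrite lee_fin; have := cos_geN1 (c + 1 * x); lra.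
move: (h mf f0); rewrite add1//.
case: eqVneq => [->|vn0].
  by rewrite mulr0 addr0 => -[/addrI ->]; rewrite mul0r oppr0 expR0 mulr1.
have sv : Num.sqrt v != 0 by rewrite sqrtr_eq0 -ltNge lt_neqAle eq_sym vn0.
rewrite (add1 _ _ (normal_prob 0 (Num.sqrt v))); last first.
  by apply: (@bounded_integrable _ _ _ (normal_prob 0 (Num.sqrt v) : probability _ R) _ 1).
by move=> -[/addrI ->]; rewrite (integral_normal_cos sv) expr1n mul1r sqr_sqrtr.
Qed.

End gauss_law.

(** * Fourier representation of Gaussian likelihood integrals *)

Section bounded_fubini.
Context {R : realType} {d1 d2} {T1 : measurableType d1} {T2 : measurableType d2}.
Variables (P1 : probability T1 R) (P2 : probability T2 R) (f : T1 * T2 -> R) (B : R).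
Hypothesis mf : measurable_fun setT f.
Hypothesis fB : forall z, `|f z| <= B.

Let intf : (P1 \x P2)%E.-integrable setT (EFin \o f).
Proof. exact: (@bounded_integrable _ _ _ (P1 \x P2)%E f B mf fB). Qed.

Let i2 x : P2.-integrable setT (EFin \o (fun y => f (x, y))).
Proof. by apply: (@bounded_integrable _ _ _ P2 _ B) => //; exact: (measurableT_comp mf (measurable_pair1 x)). Qed.

Let i1 y : P1.-integrable setT (EFin \o (fun x => f (x, y))).
Proof. by apply: (@bounded_integrable _ _ _ P1 _ B) => //; exact: (measurableT_comp mf (measurable_pair2 y)). Qed.

Lemma bounded_fubini1 : \int[(P1 \x P2)%E]_z f z = \int[P1]_x \int[P2]_y f (x, y).
Proof.
rewrite /Rintegral -integral12_prod_meas1//; congr fine; apply: eq_integral => x _.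
by rewrite /fubini_F fineK//; apply: integrable_fin_num => //; exact: i2.
Qed.

Lemma bounded_fubini2 : \int[(P1 \x P2)%E]_z f z = \int[P2]_y \int[P1]_x f (x, y).
Proof.
rewrite /Rintegral -integral21_prod_meas1//; congr fine; apply: eq_integral => y _.
by rewrite /fubini_G fineK//; apply: integrable_fin_num => //; exact: i1.
Qed.

Lemma bounded_fubini : \int[P1]_x \int[P2]_y f (x, y) = \int[P2]_y \int[P1]_x f (x, y).
Proof. by rewrite -bounded_fubini1 bounded_fubini2. Qed.

End bounded_fubini.

Section zip_sum.
Context {R : realType}.
Notation RR := (measurableTypeR R).

Lemma measurable_zip_sum dA (A : measurableType dA) (I : Type) (D : seq I) (h : I -> A -> R) n :
  (forall i, measurable_fun setT (h i)) ->
  measurable_fun setT (fun z : A * npow RR n => \sum_(p <- zip D (nlist z.2)) h p.1 z.1 * p.2).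
Proof.
move=> mh; elim: n D => [|n ih] [|i D] /=.
- by under eq_fun do rewrite big_nil; exact: measurable_cst.
- by under eq_fun do rewrite big_nil; exact: measurable_cst.
- by under eq_fun do rewrite big_nil; exact: measurable_cst.
under eq_fun do rewrite big_cons.
have m2 : measurable_fun setT (fun z : A * (RR * npow RR n) => (z.1, z.2.2)).
  apply: measurable_fun_pair; first exact: measurable_fst.
  exact: measurableT_comp measurable_snd measurable_snd.
apply: measurable_funD; last exact: measurableT_comp (ih D) m2.
apply: measurable_funM; first exact: measurableT_comp (mh i) measurable_fst.
exact: measurableT_comp measurable_fst measurable_snd.
Qed.

Lemma measurable_zip_sum1 (D : seq R) n :
  measurable_fun setT (fun z : npow RR n => \sum_(p <- zip D (nlist z)) p.1 * p.2).
Proof.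
have := @measurable_zip_sum _ unit _ D (fun y _ => y) n (fun _ => measurable_cst _).
by move=> h; exact: (measurableT_comp h (measurable_pair1 tt)).
Qed.

Lemma continuous_measurable_comp dA (A : measurableType dA) (g : R -> R) (f : A -> R) :
  continuous g -> measurable_fun setT f -> measurable_fun setT (fun x => g (f x)).
Proof. by move=> cg mf; apply: (measurableT_comp _ mf); exact: continuous_measurable_fun. Qed.

Lemma cos_bounded (x : R) : `|cos x| <= 1.
Proof. by rewrite ler_norml cos_geN1 cos_le1. Qed.

Lemma sum_zip_map (I : Type) (h : I -> R) (D : seq I) (s : seq R) :
  \sum_(p <- zip [seq h i | i <- D] s) p.1 * p.2 = \sum_(p <- zip D s) h p.1 * p.2.
Proof. by elim: D s => [|i D ih] [|y s] /=; rewrite ?big_nil// !big_cons ih. Qed.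

Lemma npr_cos (s : R) (ys : seq R) c n : s != 0 -> size ys = n ->
  \int[npr (normal_prob 0 s : probability RR R) n]_g cos (c + \sum_(p <- zip ys (nlist g)) p.1 * p.2) =
  cos c * expR (- (s ^+ 2 / 2 * \sum_(y <- ys) y ^+ 2)).
Proof.
move=> s0 <-; elim: ys c => [|y ys ih] c /=.
  under eq_Rintegral do rewrite big_nil addr0.
  rewrite big_nil mulr0 oppr0 expR0 mulr1.
  exact: (congr1 fine (integral_prob_cst (normal_prob 0 s : probability RR R) (cos c)%:E)).
rewrite (@bounded_fubini1 _ _ _ _ _ _ _ _ 1); last 2 first.
- apply: continuous_measurable_comp; first exact: continuous_cos.
  by apply: measurable_funD => //; exact: (@measurable_zip_sum1 (y :: ys) (size ys).+1).
- by move=> z; exact: cos_bounded.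
under eq_Rintegral => g _.
  under eq_Rintegral do rewrite /= big_cons addrA /=.
  rewrite ih.
  over.
rewrite /= big_cons; set E := expR (- (_ * \sum_(j <- ys) _)).
under eq_Rintegral do rewrite mulrC.
rewrite RintegralZl//; last first.
  apply: (@bounded_integrable _ _ _ (normal_prob 0 s : probability RR R) _ 1).
    apply: continuous_measurable_comp; first exact: continuous_cos.
    by apply: measurable_funD => //; exact: measurable_funM.
  by move=> x; exact: cos_bounded.
rewrite (integral_normal_cos s0) mulrCA /E -expRD; congr (_ * expR _).
lra.
Qed.

Definition quad_form X (k : X -> X -> R) (s : seq (X * R)) : R :=
  \sum_(p <- s) \sum_(q <- s) p.2 * q.2 * k p.1 q.1.

(** The linear combination of field values that enters the phase once the frequencies g are fixed;
    the sign comes from response minus field. *)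
Definition freq X (D : seq (X * R)) (g : seq R) : seq (X * R) := [seq (p.1.1, - p.2) | p <- zip D g].

(* The Gaussian likelihood is a mixture over frequencies g of cosines of the process. *)
Lemma lik_charfun dO (Om : measurableType dO) (P : probability Om R) (X : Type) (W : Om -> X -> R)
    (k : X -> X -> R) (sg : R) (D : seq (X * R)) : 0 < sg ->
  (forall x, measurable_fun setT (W ^~ x)) ->
  (forall c g, \int[P]_om cos (c + \sum_(p <- freq D g) p.2 * W om p.1) =
     cos c * expR (- (quad_form k (freq D g) / 2))) ->
  \int[P]_om lik sg (W om) D =
  \int[npr (normal_prob 0 sg^-1 : probability RR R) (size D)]_g
    (cos (\sum_(p <- zip D (nlist g)) p.1.2 * p.2) * expR (- (quad_form k (freq D (nlist g)) / 2))).
Proof.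
move=> sg0 mW hW; set N := npr _ _.
have sV : sg^-1 != 0 by rewrite invr_eq0 gt_eqF.
pose f om (g : npow RR (size D)) := cos (\sum_(p <- zip D (nlist g)) (p.1.2 - W om p.1.1) * p.2).
transitivity (\int[P]_om \int[N]_g f om g).
  apply: eq_Rintegral => om _.
  (* As a function of y, exp(- y^2 / (2 sg^2)) is the characteristic function of N(0, sg^-2), hence
     the frequency law with deviation [sg^-1]. *)
  have := @npr_cos _ [seq z.2 - W om z.1 | z <- D] 0 _ sV (size_map _ _); rewrite -/N cos0 mul1r => h.
  transitivity (expR (- (sg^-1 ^+ 2 / 2 * \sum_(y <- [seq z.2 - W om z.1 | z <- D]) y ^+ 2))).
    rewrite /lik -expR_sum big_map; congr expR; rewrite sumrN; congr (- _).
    by rewrite mulr_sumr; apply: eq_bigr => z _; field; rewrite gt_eqF.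
  rewrite -h; apply: eq_Rintegral => g _; rewrite add0r /f.
  by rewrite sum_zip_map.
rewrite (@bounded_fubini _ _ _ _ _ P N (fun z => f z.1 z.2) 1); last 2 first.
- apply: continuous_measurable_comp; first exact: continuous_cos.
  apply: (@measurable_zip_sum _ _ _ D (fun (z : X * R) om => z.2 - W om z.1)) => z.
  exact: measurable_funB.
- by move=> z; exact: cos_bounded.
apply: eq_Rintegral => g _; rewrite -hW; apply: eq_Rintegral => om _.
rewrite /f /freq big_map -big_split/=; congr cos; apply: eq_bigr => p _ /=; lra.
Qed.

End zip_sum.

(** * Finite Gaussian series and the lower bound on their evidence *)

Section gauss_series.
Context {R : realType} {dX} {X : measurableType dX}.
Notation RR := (measurableTypeR R).
Variable sg : R.
Hypothesis sg0 : 0 < sg.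
Notation N01 := (normal_prob 0 1 : probability RR R).

Definition Wf (b : nat -> X -> R) (js : seq nat) n (xi : npow RR n) (x : X) : R :=
  \sum_(p <- zip js (nlist xi)) p.2 * b p.1 x.

Definition kf (b : nat -> X -> R) (js : seq nat) (x y : X) : R := \sum_(j <- js) b j x * b j y.

Lemma lik_ge0 (f : X -> R) D : 0 <= lik sg f D.
Proof. by apply: prodr_ge0 => z _; exact: expR_ge0. Qed.

Lemma lik_le1 (f : X -> R) D : lik sg f D <= 1.
Proof.
rewrite /lik -expR_sum -[leRHS]expR0 ler_expR sumrN oppr_le0.
by apply: sumr_ge0 => z _; rewrite mulr_ge0 ?sqr_ge0// invr_ge0 mulr_ge0 ?sqr_ge0.
Qed.

Lemma likE (f : X -> R) D : lik sg f D = expR (- ((\sum_(z <- D) (z.2 - f z.1) ^+ 2) / (2 * sg ^+ 2))).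
Proof. by rewrite /lik -expR_sum sumrN mulr_suml. Qed.

Lemma measurable_lik dA (A : measurableType dA) (f : A -> X -> R) D :
  (forall x, measurable_fun setT (f ^~ x)) -> measurable_fun setT (fun a => lik sg (f a) D).
Proof.
move=> mf; under eq_fun do rewrite likE.
apply: measurableT_comp => //; apply: measurableT_comp => //; apply: measurable_funM => //.
by apply: measurable_sum => z; apply: measurable_funX; exact: measurable_funB.
Qed.

Lemma measurable_Wf b js n x : measurable_fun setT (fun xi : npow RR n => Wf b js xi x).
Proof.
have h := @measurable_zip_sum _ _ unit _ js (fun j _ => b j x) n (fun _ => measurable_cst _).
have := measurableT_comp h (measurable_pair1 tt).
by congr (measurable_fun _ _); apply/funext => xi /=; apply: eq_bigr => p _; rewrite mulrC.
Qed.

(** The same mixture formula as for a Gaussian field, with [kf] as covariance: expected likelihoods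
    differ only through the quadratic form. *)
Lemma Wf_lik b js D n : size js = n ->
  \int[npr N01 n]_xi lik sg (Wf b js xi) D =
  \int[npr (normal_prob 0 sg^-1 : probability RR R) (size D)]_g
    (cos (\sum_(p <- zip D (nlist g)) p.1.2 * p.2) *
     expR (- (quad_form (kf b js) (freq D (nlist g)) / 2))).
Proof.
move=> sz; apply: lik_charfun => //; first by move=> x; exact: measurable_Wf.
move=> c g; set s := freq D g.
have n10 : (1 : R) != 0 by exact: oner_neq0.
have := @npr_cos _ 1 [seq \sum_(q <- s) q.2 * b j q.1 | j <- js] c n n10.
rewrite size_map => /(_ sz) h.
transitivity (cos c * expR (- (1 ^+ 2 / 2 * \sum_(y <- [seq \sum_(q <- s) q.2 * b j q.1 | j <- js]) y ^+ 2))).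
  rewrite -h; apply: eq_Rintegral => xi _; congr (cos (c + _)).
  rewrite sum_zip_map /Wf; under eq_bigr do rewrite mulr_sumr.
  rewrite exchange_big/=; apply: eq_bigr => p _.
  by rewrite mulr_suml; apply: eq_bigr => q _; rewrite mulrCA mulrC.
congr (_ * expR (- _)); rewrite expr1n div1r mulrC; congr (_ / _).
rewrite big_map /quad_form /kf.
under [RHS]eq_bigr => p _ do under eq_bigr => q _ do rewrite mulr_sumr.
under [RHS]eq_bigr => p _ do rewrite exchange_big.
rewrite [RHS]exchange_big/=; apply: eq_bigr => j _.
rewrite expr2 mulr_suml; apply: eq_bigr => p _.
by rewrite mulr_sumr; apply: eq_bigr => q _; ring.
Qed.

(** The Kullback-Leibler divergence of N(a, tau^2) from N(0, 1). *)
Definition klg (a tau : R) : R := (tau ^+ 2 - 1 - ln (tau ^+ 2) + a ^+ 2) / 2.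

Lemma ln_leB1 (x : R) : 0 < x -> ln x <= x - 1.
Proof.
move=> x0; rewrite -ler_expR lnK ?posrE//.
by apply: le_trans (expR_ge1Dx _); lra.
Qed.

(* Jensen's inequality for N(a, tau^2) against N(0,1), from the closed form of both sides. *)
Lemma gauss_lower (al be ga a tau : R) : 0 <= ga -> 0 < tau ->
  ((expR (- (al - 2 * be * a + ga * (a ^+ 2 + tau ^+ 2)) - klg a tau))%:E <=
   \int[N01]_x (expR (- (al - 2 * be * x + ga * x ^+ 2)))%:E)%E.
Proof.
move=> ga0 tau0; have n10 : (1 : R) != 0 by exact: oner_neq0.
have w0 : 0 < 1 + 2 * ga by lra.
have wE : 1 + 2 * ga = 1 + 2 * ga * 1 ^+ 2 :> R by rewrite expr1n mulr1.
rewrite (@integral_normal_quad _ 1 al be ga (1 + 2 * ga) n10 wE w0) lee_fin.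
set w := 1 + 2 * ga in w0 wE *.
have -> : (Num.sqrt w)^-1 = expR (- (ln w / 2)).
  rewrite expRN; congr (_^-1).
  have : expR (ln w / 2) ^+ 2 = w by rewrite -expRM_natl -mulr_natl mulrC divfK// lnK.
  by move=> {1}<-; rewrite sqrtr_sqr ger0_norm ?expR_ge0.
rewrite -expRD ler_expR expr1n mulr1 /klg.
have h1 : ln (w * tau ^+ 2) <= w * tau ^+ 2 - 1 by apply: ln_leB1; rewrite mulr_gt0// exprn_gt0.
rewrite lnM ?posrE ?exprn_gt0// in h1.
have h2 : 2 * be * a - w / 2 * a ^+ 2 <= 2 * be ^+ 2 / w.
  rewrite ler_pdivlMr//; have := sqr_ge0 (w * a - 2 * be); rewrite /GRing.exp/=; nra.
have gE : ga = (w - 1) / 2 by rewrite /w; lra.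
rewrite gE; move: h1 h2; set A := a ^+ 2; set T := tau ^+ 2; set L := ln T; set Lw := ln w; set B := _ / w.
move=> h1 h2; nra.
Qed.

(** Jensen one coordinate at a time: the induction bounds the integral over the later coordinates
    for a shifted mean [m], the exponent stays quadratic in the first coordinate, and [gauss_lower]
    treats that one. *)
Lemma evidence_lower (b : nat -> X -> R) (a tau : nat -> R) js D n (m : X -> R) : size js = n ->
  (forall j, 0 < tau j) ->
  ((expR (- ((\sum_(z <- D) (z.2 - m z.1 - \sum_(j <- js) a j * b j z.1) ^+ 2) / (2 * sg ^+ 2) +
      \sum_(j <- js) (tau j ^+ 2 * (\sum_(z <- D) b j z.1 ^+ 2) / (2 * sg ^+ 2) + klg (a j) (tau j)))))%:E
   <= \int[npr N01 n]_xi (lik sg (fun x => m x + Wf b js xi x)%R D)%:E)%E.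
Proof.
move=> <- tau0; elim: js m => [|j js ih] m.
  rewrite big_nil addr0.
  under eq_integral.
    move=> xi _; rewrite (_ : lik _ _ _ = lik sg m D); last first.
      by congr lik; apply/funext => x; rewrite /Wf big_nil addr0.
    over.
  rewrite [leRHS](integral_prob_cst N01) lee_fin likE.
  by under eq_bigr do rewrite big_nil subr0.
have e1 := @npr_succ _ _ _ N01 (size js) (fun xi => (lik sg (fun x => m x + Wf b (j :: js) xi x) D)%:E) _ _.
rewrite [leRHS]e1; last 2 first.
- apply/measurable_EFinP; apply: measurable_lik => x.
  by apply: measurable_funD => //; exact: (measurable_Wf b (j :: js) (n := (size js).+1)).
- by move=> z; rewrite lee_fin lik_ge0.
pose S z := z.2 - m z.1 - \sum_(j <- js) a j * b j z.1.
pose C := \sum_(j <- js) (tau j ^+ 2 * (\sum_(z <- D) b j z.1 ^+ 2) / (2 * sg ^+ 2) + klg (a j) (tau j)).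
have s20 : 2 * sg ^+ 2 != 0 by rewrite mulf_neq0// ?expf_neq0 ?gt_eqF.
apply: (@le_trans _ _ (\int[N01]_g (expR (- ((\sum_(z <- D) (S z - g * b j z.1) ^+ 2) / (2 * sg ^+ 2) + C)))%:E)%E); last first.
  apply: le_lower_integral => g _; first by rewrite lee_fin expR_ge0.
  have -> : (fun xi : npow RR (size js) => (lik sg (fun x => m x + @Wf b (j :: js) (size js).+1 (g, xi) x) D)%:E) =
      (fun xi : npow RR (size js) => (lik sg (fun x => m x + g * b j x + Wf b js xi x) D)%:E).
    by apply/funext => xi; congr (lik sg _ D)%:E; apply/funext => x; rewrite /Wf /= big_cons addrA.
  apply: le_trans (ih (fun x => m x + g * b j x)).
  have s2V : 0 <= (2 * sg ^+ 2)^-1 by rewrite invr_ge0; apply: mulr_ge0 (sqr_ge0 _).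
  rewrite lee_fin ler_expR lerN2 -/C lerD2r ler_wpM2r//.
  rewrite le_eqVlt; apply/orP; left; apply/eqP; apply: eq_bigr => z _.
  by congr (_ ^+ 2); rewrite /S; lra.
pose al := (\sum_(z <- D) S z ^+ 2) / (2 * sg ^+ 2) + C.
pose be := (\sum_(z <- D) S z * b j z.1) / (2 * sg ^+ 2).
pose ga := (\sum_(z <- D) b j z.1 ^+ 2) / (2 * sg ^+ 2).
have quad g : (\sum_(z <- D) (S z - g * b j z.1) ^+ 2) / (2 * sg ^+ 2) + C = al - 2 * be * g + ga * g ^+ 2.
  have -> : \sum_(z <- D) (S z - g * b j z.1) ^+ 2 =
     \sum_(z <- D) S z ^+ 2 - 2 * g * \sum_(z <- D) S z * b j z.1 + g ^+ 2 * \sum_(z <- D) b j z.1 ^+ 2.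
    rewrite !mulr_sumr -sumrB -big_split/=; apply: eq_bigr => z _; ring.
  by rewrite /al /be /ga; field; rewrite gt_eqF.
under eq_integral do rewrite quad.
have ga0 : 0 <= ga.
  apply: mulr_ge0; last by rewrite invr_ge0; apply: mulr_ge0 (sqr_ge0 _).
  by apply: sumr_ge0 => z _; exact: sqr_ge0.
apply: le_trans (gauss_lower al be (a j) ga0 (tau0 j)).
rewrite lee_fin ler_expR -opprD lerN2 le_eqVlt; apply/orP; left; apply/eqP.
rewrite mulrDr addrA -quad big_cons /ga -/C.
have -> : \sum_(z <- D) (z.2 - m z.1 - \sum_(j0 <- j :: js) a j0 * b j0 z.1) ^+ 2 = \sum_(z <- D) (S z - a j * b j z.1) ^+ 2.
  by apply: eq_bigr => z _; rewrite big_cons /S; congr (_ ^+ 2); lra.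
by field; rewrite gt_eqF.
Qed.

End gauss_series.

(** * Approximating the prior by finite expansions *)

Section gp.
Context {R : realType} {dX} {X : measurableType dX} {dO} {Om : measurableType dO}.
Variables (mu : {finite_measure set X -> \bar R}) (d : R) (lam : nat -> R) (u : nat -> X -> R).
Variables (N : set X) (K : R).
Hypothesis SD : spectral_data mu d lam u N K.
Hypothesis ES : eigen_system mu lam u.
Variables (P : probability Om R) (W : R -> Om -> X -> R).
Hypothesis GP : forall t, 0 < t -> centered_GP P (W t) (heat_cov lam u t).
Notation RR := (measurableTypeR R).
Notation N01 := (normal_prob 0 1 : probability RR R).

Definition hb (t : R) (j : nat) (x : X) : R := expR (- (t * lam j / 2)) * u j x.

Lemma hb_mul t j x y : hb t j x * hb t j y = expR (- (t * lam j)) * u j x * u j y.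
Proof.
rewrite /hb mulrACA -expRD mulrA; congr (expR _ * _ * _); lra.
Qed.

Lemma hb_sqr t j x : hb t j x ^+ 2 = expR (- (t * lam j)) * u j x ^+ 2.
Proof. by rewrite expr2 hb_mul -mulrA. Qed.

Let good (s : seq (X * R)) := forall p, p \in s -> ~ N p.1.

Let kfE t n x y : kf (hb t) (iota 0 n) x y = \sum_(j < n) expR (- (t * lam j)) * u j x * u j y.
Proof.
rewrite /kf (_ : iota 0 n = index_iota 0 n) ?big_mkord; last by rewrite /index_iota subn0.
by apply: eq_bigr => j _; rewrite hb_mul.
Qed.

Lemma cvg_sum_seq (I : eqType) (s : seq I) (f : nat -> I -> R) (l : I -> R) :
  (forall i, i \in s -> f ^~ i @ \oo --> l i) ->
  (fun n => \sum_(i <- s) f n i) @ \oo --> \sum_(i <- s) l i.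
Proof.
elim: s => [|i s ih] h.
  by under eq_fun do rewrite big_nil; rewrite big_nil; exact: cvg_cst.
under eq_fun do rewrite big_cons; rewrite big_cons; apply: cvgD.
  by apply: h; rewrite mem_head.
by apply: ih => j js; apply: h; rewrite in_cons js orbT.
Qed.

Lemma mem_zip_l (I J : eqType) (s : seq I) (r : seq J) p : p \in zip s r -> p.1 \in s.
Proof.
elim: s r => [|i s ih] [|j r] //=; rewrite !in_cons => /orP[/eqP -> /=|/ih ->]; first by rewrite eqxx.
by rewrite orbT.
Qed.

Lemma quad_form_cvg t s : 0 < t -> good s ->
  (fun n => quad_form (kf (hb t) (iota 0 n)) s) @ \oo --> quad_form (heat_cov lam u t) s.
Proof.
move=> t0 gs; apply: cvg_sum_seq => p ps; apply: cvg_sum_seq => q qs.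
apply: cvgM; first exact: cvg_cst.
under eq_fun do rewrite kfE.
by apply: (heat_cov_cvg SD ES) => //; exact: gs.
Qed.

Lemma quad_form_kfE b js (s : seq (X * R)) :
  quad_form (kf b js) s = \sum_(j <- js) (\sum_(q <- s) q.2 * b j q.1) ^+ 2.
Proof.
rewrite /quad_form /kf.
under eq_bigr => p _ do under eq_bigr => q _ do rewrite mulr_sumr.
under eq_bigr => p _ do rewrite exchange_big.
rewrite exchange_big/=; apply: eq_bigr => j _.
rewrite expr2 mulr_suml; apply: eq_bigr => p _.
by rewrite mulr_sumr; apply: eq_bigr => q _; ring.
Qed.

Lemma quad_form_kf_ge0 b js (s : seq (X * R)) : 0 <= quad_form (kf b js) s.
Proof. by rewrite quad_form_kfE; apply: sumr_ge0 => j _; exact: sqr_ge0. Qed.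

Lemma quad_form_heat_ge0 t s : 0 < t -> good s -> 0 <= quad_form (heat_cov lam u t) s.
Proof.
move=> t0 gs; have h := quad_form_cvg t0 gs.
rewrite -(cvg_lim _ h)//; apply: limr_ge; first by apply/cvg_ex; eexists; exact: h.
by near=> n; exact: quad_form_kf_ge0.
Unshelve. all: by end_near. Qed.

Lemma gp_law t s A : 0 < t -> measurable A ->
  P [set om | A (\sum_(p <- s) p.2 * W t om p.1)] = gauss_law (quad_form (heat_cov lam u t) s) A.
Proof.
move=> t0 mA; have [_ h] := GP t0.
have := h (size s) (fun i => (tnth (in_tuple s) i).1) (fun i => (tnth (in_tuple s) i).2) A mA.
rewrite /quad_form (big_tnth _ _ s).
under [X in _ = gauss_law X A -> _]eq_bigr => i _.
  rewrite -(big_tnth _ _ s xpredT (fun q => (tnth (in_tuple s) i).2 * q.2 * heat_cov lam u t (tnth (in_tuple s) i).1 q.1)).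
  over.
move=> <-; congr (P _); apply/seteqP; split => om /=; by rewrite (big_tnth _ _ s).
Qed.

Lemma gp_measurable t : 0 < t -> measurable_fun setT (fun z : Om * X => W t z.1 z.2).
Proof. by move=> /GP[]. Qed.

Lemma gp_measurable_om t x : 0 < t -> measurable_fun setT (fun om => W t om x).
Proof. by move=> t0; exact: (measurableT_comp (gp_measurable t0) (measurable_pair2 x)). Qed.

Lemma gp_measurable_comb t (s : seq (X * R)) : 0 < t ->
  measurable_fun setT (fun om => \sum_(p <- s) p.2 * W t om p.1).
Proof.
move=> t0; apply: measurable_sum => p; apply: measurable_funM => //.
exact: gp_measurable_om.
Qed.

Variable sg : R.
Hypothesis sg0 : 0 < sg.

(** No coupling between series and field is needed: both expectations are integrals over frequencies
    of functions bounded by 1, and the covariances converge at design points off [N]. *)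
Lemma lik_heat_cvg t (D : seq (X * R)) : 0 < t -> (forall z, z \in D -> ~ N z.1) ->
  (fun n => \int[npr N01 n]_xi lik sg (Wf (hb t) (iota 0 n) xi) D) @ \oo --> \int[P]_om lik sg (W t om) D.
Proof.
move=> t0 gD.
have gf g : good (freq D g).
  by move=> p /mapP[q qs ->] /=; apply: gD; exact: (mem_zip_l qs).
under eq_fun do rewrite (@Wf_lik _ _ _ _ sg0 _ _ _ _ (size_iota _ _)).
rewrite (@lik_charfun _ _ _ P _ (W t) (heat_cov lam u t) sg D sg0 (fun x => gp_measurable_om x t0)); last first.
  move=> c g; apply: gauss_law_cos.
  - exact: gp_measurable_comb.
  - by apply: quad_form_heat_ge0.
  - by move=> A mA; exact: gp_law.
set Q := npr _ _.
pose cg (g : npow RR (size D)) := cos (\sum_(p <- zip D (nlist g)) p.1.2 * p.2).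
pose F n (g : npow RR (size D)) := cg g * expR (- (quad_form (kf (hb t) (iota 0 n)) (freq D (nlist g)) / 2)).
pose F' (g : npow RR (size D)) := cg g * expR (- (quad_form (heat_cov lam u t) (freq D (nlist g)) / 2)).
have F1 n g : `|F n g| <= 1.
  rewrite /F normrM mulr_ile1// ?cos_bounded// ger0_norm ?expR_ge0// -[leRHS]expR0 ler_expR oppr_le0.
  by rewrite divr_ge0// quad_form_kf_ge0.
have mcg : measurable_fun setT cg.
  apply: continuous_measurable_comp; first exact: continuous_cos.
  have h := @measurable_zip_sum _ _ unit _ D (fun z _ => z.2) (size D) (fun _ => measurable_cst _).
  exact: (measurableT_comp h (measurable_pair1 tt)).
have mF n : measurable_fun setT (F n).
  apply: measurable_funM => //; apply: measurableT_comp => //; apply: measurableT_comp => //.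
  apply: measurable_funM => //; under eq_fun do rewrite quad_form_kfE.
  apply: measurable_sum => j; apply: measurable_funX.
  have h := @measurable_zip_sum _ _ unit _ D (fun z _ => - hb t j z.1) (size D) (fun _ => measurable_cst _).
  have := measurableT_comp h (measurable_pair1 tt).
  congr (measurable_fun _ _); apply/funext => g /=.
  by rewrite /freq big_map; apply: eq_bigr => p _ /=; ring.
have FF' g : F n g @[n --> \oo] --> F' g.
  apply: cvgM; first exact: cvg_cst.
  have c : - (quad_form (kf (hb t) (iota 0 n)) (freq D (nlist g)) / 2) @[n --> \oo] -->
      - (quad_form (heat_cov lam u t) (freq D (nlist g)) / 2).
    by apply: cvgN; apply: cvgM; [exact: quad_form_cvg|exact: cvg_cst].
  by apply: (cvg_comp _ _ c); exact: continuous_expR.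
have := @dominated_cvg _ _ _ Q setT measurableT (fun n g => (F n g)%:E) (fun g => (F' g)%:E) (fun=> 1%:E).
move=> /(_ (fun n => proj2 (measurable_EFinP _ _) (mF n))) h.
have {}h : (\int[Q]_x (F n x)%:E)%E @[n --> \oo] --> (\int[Q]_x (F' x)%:E)%E.
  apply: h => //.
  - by move=> g _; apply: cvg_EFin; [exact: nearW|exact: FF'].
  - exact: finite_measure_integrable_cst.
  - by move=> n g _; rewrite lee_fin F1.
have mF' : measurable_fun setT F' by apply: (measurable_fun_cvg mF) => g _; exact: FF'.
have F'1 g : `|F' g| <= 1.
  have := FF' g => /cvg_norm h1; rewrite -(cvg_lim _ h1)//.
  apply: limr_le; first by apply/cvg_ex; eexists; exact: h1.
  by near=> n; exact: F1.
apply: fine_cvg; rewrite fineK//.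
apply: integrable_fin_num => //; exact: (@bounded_integrable _ _ _ Q F' 1).
Unshelve. all: by end_near. Qed.

(** Joint measurability in the scale and the data is available for finite series, as nothing is
    assumed on how [W t] depends on t. *)
Lemma gp_lik_measurable (js : seq nat) n (f0 : X -> R) :
  measurable_fun setT f0 -> (forall j, measurable_fun setT (u j)) ->
  measurable_fun setT (fun z : RR * npow (X * RR)%type n =>
    \int[npr N01 (size js)]_xi (lik sg (Wf (hb z.1) js xi) (map (obs f0) (nlist z.2)))%:E)%E.
Proof.
move=> mf0 mu_.
pose g (a : RR * npow RR (size js)) (y : X * RR) :=
  expR (- ((((obs f0 y).2 - Wf (hb a.1) js a.2 y.1) ^+ 2) / (2 * sg ^+ 2))).
have mWf : measurable_fun setT (fun z : (RR * npow RR (size js)) * (X * RR) => Wf (hb z.1.1) js z.1.2 z.2.1).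
  have mhb j : measurable_fun setT (fun z : RR * X => hb z.1 j z.2).
    apply: measurable_funM; last exact: measurableT_comp (mu_ j) measurable_snd.
    apply: measurableT_comp => //; apply: measurableT_comp => //; apply: measurable_funM => //.
    by apply: measurable_funM => //; exact: measurable_fst.
  have h := @measurable_zip_sum _ _ (RR * X)%type _ js (fun j z => hb z.1 j z.2) (size js) mhb.
  have sw : measurable_fun setT (fun z : (RR * npow RR (size js)) * (X * RR) => ((z.1.1, z.2.1), z.1.2)).
    apply: measurable_fun_pair; last exact: measurableT_comp measurable_snd measurable_fst.
    apply: measurable_fun_pair; first exact: measurableT_comp measurable_fst measurable_fst.
    exact: measurableT_comp measurable_fst measurable_snd.
  have := measurableT_comp h sw.
  congr (measurable_fun _ _); apply/funext => z /=; rewrite /Wf.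
  by apply: eq_bigr => p _; rewrite mulrC.
have mg : measurable_fun setT (fun z : (RR * npow RR (size js)) * (X * RR) => g z.1 z.2).
  apply: measurableT_comp => //; apply: measurableT_comp => //; apply: measurable_funM => //.
  apply: measurable_funX; apply: measurable_funB => //.
  rewrite /obs /=; apply: measurable_funD.
    exact: measurableT_comp mf0 (measurableT_comp measurable_fst measurable_snd).
  exact: measurableT_comp measurable_snd measurable_snd.
have mp := @measurable_nlist_prod _ _ _ _ _ g n mg.
have sw : measurable_fun setT (fun z : (RR * npow (X * RR)%type n) * npow RR (size js) => ((z.1.1, z.2), z.1.2)).
  apply: measurable_fun_pair; last exact: measurableT_comp measurable_snd measurable_fst.
  apply: measurable_fun_pair; last exact: measurable_snd.
  exact: measurableT_comp measurable_fst measurable_fst.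
have mL : measurable_fun setT (fun z : (RR * npow (X * RR)%type n) * npow RR (size js) =>
    (lik sg (Wf (hb z.1.1) js z.2) (map (obs f0) (nlist z.1.2)))%:E).
  apply/measurable_EFinP; have := measurableT_comp mp sw.
  by congr (measurable_fun _ _); apply/funext => z /=; rewrite /lik big_map.
have := @measurable_fun_fubini_tonelli_F _ _ _ _ _ (npr N01 (size js)) _ mL.
by apply => z; rewrite lee_fin lik_ge0.
Qed.

End gp.

(** * The high-frequency part of the field *)

Lemma integral_cst_fin {R : realType} {dX} {X : measurableType dX} (mu : {finite_measure set X -> \bar R}) (c : R) :
  (\int[mu]_x c%:E = (c * fine (mu setT))%:E)%E.
Proof.
rewrite integral_cst//; have h := mu_fin mu measurableT.
by transitivity (c%:E * (fine (mu setT))%:E)%E => //; congr (_ * _)%E; exact: h.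
Qed.

Section measurable_Rintegral.
Context {R : realType} {d1 d2} {T1 : measurableType d1} {T2 : measurableType d2}.
Variable f : T1 * T2 -> R.
Hypothesis mf : measurable_fun setT f.
Let mfE : measurable_fun setT (EFin \o f). Proof. exact/measurable_EFinP. Qed.

Lemma measurable_Rintegral2 (m2 : {sigma_finite_measure set T2 -> \bar R}) :
  measurable_fun setT (fun x => \int[m2]_y f (x, y)).
Proof.
rewrite /Rintegral; apply: measurableT_comp => //.
under eq_fun do rewrite integralE.
apply: emeasurable_funB.
- have := measurable_fun_fubini_tonelli_F (m2 := m2) _ (measurable_funepos mfE) (funepos_ge0 _).
  by congr (measurable_fun _ _); apply/funext => x; apply: eq_integral => y _; rewrite !funeposE.
- have := measurable_fun_fubini_tonelli_F (m2 := m2) _ (measurable_funeneg mfE) (funeneg_ge0 _).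
  by congr (measurable_fun _ _); apply/funext => x; apply: eq_integral => y _; rewrite !funenegE.
Qed.

Lemma measurable_Rintegral1 (m1 : {sigma_finite_measure set T1 -> \bar R}) :
  measurable_fun setT (fun y => \int[m1]_x f (x, y)).
Proof.
rewrite /Rintegral; apply: measurableT_comp => //.
under eq_fun do rewrite integralE.
apply: emeasurable_funB.
- have := measurable_fun_fubini_tonelli_G (m1 := m1) _ (measurable_funepos mfE) (funepos_ge0 _).
  by congr (measurable_fun _ _); apply/funext => x; apply: eq_integral => y _; rewrite !funeposE.
- have := measurable_fun_fubini_tonelli_G (m1 := m1) _ (measurable_funeneg mfE) (funeneg_ge0 _).
  by congr (measurable_fun _ _); apply/funext => x; apply: eq_integral => y _; rewrite !funenegE.
Qed.
End measurable_Rintegral.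

Section gp_field.
Context {R : realType} {dX} {X : measurableType dX} {dO} {Om : measurableType dO}.
Variables (mu : {finite_measure set X -> \bar R}) (d : R) (lam : nat -> R) (u : nat -> X -> R).
Variables (N : set X) (K : R).
Hypothesis SD : spectral_data mu d lam u N K.
Hypothesis ES : eigen_system mu lam u.
Variables (P : probability Om R) (W : R -> Om -> X -> R).
Hypothesis GP : forall t, 0 < t -> centered_GP P (W t) (heat_cov lam u t).
Variable t : R.
Hypothesis t0 : 0 < t.

Let k := heat_cov lam u t.
Let kn n x y := \sum_(j < n) expR (- (t * lam j)) * u j x * u j y.
Let Kt := K / (Num.min t 1) `^ (d / 2).
Let mW : measurable_fun setT (fun z : Om * X => W t z.1 z.2) := gp_measurable GP t0.
Let w y om := W t om y.
Let mw y : measurable_fun setT (w y). Proof. exact: (measurableT_comp mW (measurable_pair2 y)). Qed.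
Let mN : measurable N. Proof. by case: SD. Qed.
Let muN : mu N = 0%E. Proof. by case: SD. Qed.

Definition comb (s : seq (X * R)) (om : Om) : R := \sum_(p <- s) p.2 * W t om p.1.
Let good (s : seq (X * R)) := forall p, p \in s -> ~ N p.1.

Lemma heat_cov_sym x y : k x y = k y x.
Proof.
rewrite /k /heat_cov; congr (lim (_ @ \oo)); apply/funext => n.
by apply: eq_bigr => j _; rewrite mulrAC.
Qed.

Lemma kn_diag_le n x : ~ N x -> \sum_(j < n) expR (- (t * lam j)) * u j x ^+ 2 <= Kt.
Proof. by move=> Nx; exact: (spectral_sum_le SD ES). Qed.

Lemma kn_le n x y : ~ N x -> ~ N y -> `|kn n x y| <= Kt.
Proof.
move=> Nx Ny; apply: (le_trans (ler_norm_sum _ _ _)).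
apply: (@le_trans _ _ (\sum_(j < n) (expR (- (t * lam j)) * u j x ^+ 2 + expR (- (t * lam j)) * u j y ^+ 2) / 2)).
  apply: ler_sum => j _; rewrite -mulrA normrM (ger0_norm (expR_ge0 _)) -mulrDr -mulrA.
  rewrite ler_wpM2l ?expR_ge0// normrM.
  have := sqr_ge0 (`|u j x| - `|u j y|); rewrite sqrrB !real_normK ?num_real//; lra.
rewrite -mulr_suml big_split/=.
by have := kn_diag_le n Nx; have := kn_diag_le n Ny; lra.
Qed.

Lemma kn_cvg x y : ~ N x -> ~ N y -> kn n x y @[n --> \oo] --> k x y.
Proof. by move=> Nx Ny; exact: (heat_cov_cvg SD ES Nx Ny t0). Qed.

Lemma k_diag_le x : ~ N x -> k x x <= Kt.
Proof.
move=> Nx; have h := kn_cvg Nx Nx; rewrite -(cvg_lim _ h)//.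
apply: limr_le; first by apply/cvg_ex; eexists; exact: h.
by near=> n; apply: le_trans (ler_norm _) (kn_le _ Nx Nx).
Unshelve. all: by end_near. Qed.

Lemma comb_sqr s : good s -> (\int[P]_om (comb s om ^+ 2)%:E = (quad_form k s)%:E)%E.
Proof.
move=> gs; apply: gauss_law_sqr; first exact: (gp_measurable_comb GP).
  exact: (quad_form_heat_ge0 SD ES t0 gs).
by move=> A mA; exact: (gp_law GP).
Qed.

Lemma comb_L2 s : good s -> L2 P (comb s).
Proof.
move=> gs; have mc : measurable_fun setT (comb s) by exact: (gp_measurable_comb GP).
split => //; apply/integrableP; split; first by apply/measurable_EFinP; exact: measurable_funX.
under eq_integral do rewrite /= ger0_norm ?sqr_ge0//.
by rewrite comb_sqr// ltry.
Qed.

Lemma comb_dot s : good s -> dot P (comb s) (comb s) = quad_form k s.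
Proof. by move=> gs; have := comb_sqr gs; rewrite dot2E; [case|exact: comb_L2]. Qed.

Lemma comb1 y a : comb [:: (y, a)] = (fun om => a * w y om).
Proof. by apply/funext => om; rewrite /comb big_seq1. Qed.

Lemma good1 y a : ~ N y -> good [:: (y, a)].
Proof. by move=> Ny p; rewrite inE => /eqP ->. Qed.

Lemma w_L2 y : ~ N y -> L2 P (w y).
Proof.
move=> Ny; have := comb_L2 (@good1 y 1 Ny); rewrite comb1; congr L2.
by apply/funext => om; rewrite mul1r.
Qed.

Lemma w_dot x y : ~ N x -> ~ N y -> dot P (w x) (w y) = k x y.
Proof.
move=> Nx Ny; have kk z : ~ N z -> dot P (w z) (w z) = k z z.
  move=> Nz; have := comb_dot (@good1 z 1 Nz); rewrite comb1 /quad_form !big_seq1 /= !mul1r => <-.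
  by congr dot; apply/funext => om; rewrite mul1r.
have g2 : good [:: (x, 1); (y, 1)].
  by move=> p; rewrite !inE => /orP[] /eqP ->.
have := comb_dot g2; rewrite /quad_form !big_cons !big_nil /= !mul1r !addr0.
have -> : comb [:: (x, 1); (y, 1)] = (fun om => w x om + w y om).
  by apply/funext => om; rewrite /comb !big_cons big_nil /= !mul1r addr0.
rewrite dotD2 ?kk//; [|exact: w_L2|exact: w_L2].
by rewrite (heat_cov_sym y x); lra.
Qed.

Let m2 : {measure set _ -> \bar R} := (P \x mu)%E.

Lemma ae_notN : {ae mu, forall y, ~ N y}.
Proof. by exists N; split => // y /= /contrapT. Qed.

Lemma W_L2_prod : L2 m2 (fun z : Om * X => W t z.1 z.2).
Proof.
split => //; apply/integrableP; split; first by apply/measurable_EFinP; exact: measurable_funX.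
under eq_integral do rewrite /= ger0_norm ?sqr_ge0//.
rewrite /m2 fubini_tonelli2//; last 2 first.
- by apply/measurable_EFinP; exact: measurable_funX.
- by move=> z; rewrite lee_fin sqr_ge0.
apply: (@le_lt_trans _ _ (\int[mu]_y Kt%:E)%E); last first.
  by rewrite integral_cst_fin ltry.
have Kt0 : 0 <= Kt.
  by case: SD => _ _ K0 _ _; rewrite divr_ge0 ?powR_ge0// ltW.
apply: ae_ge0_le_integral => //.
- by move=> y _; apply: integral_ge0 => om _; rewrite lee_fin sqr_ge0.
- apply: measurable_fun_fubini_tonelli_G; first by apply/measurable_EFinP; exact: measurable_funX.
  by move=> z; rewrite lee_fin sqr_ge0.
- apply: filterS ae_notN => y Ny _; rewrite /fubini_G /=.
  have -> : (\int[P]_om (W t om y ^+ 2)%:E = (dot P (w y) (w y))%:E)%E.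
    by rewrite -dot2E//; exact: w_L2.
  by rewrite lee_fin w_dot// k_diag_le.
Qed.

Lemma W_sqr_integral : (\int[P]_om \int[mu]_y (W t om y ^+ 2)%:E <= (Kt * fine (mu setT))%:E)%E.
Proof.
have mW2 : measurable_fun setT (fun z : Om * X => (W t z.1 z.2 ^+ 2)%:E).
  by apply/measurable_EFinP; exact: measurable_funX.
have W20 z : (0 <= (W t z.1 z.2 ^+ 2)%:E :> \bar R)%E by rewrite lee_fin sqr_ge0.
have := @fubini_tonelli _ _ _ _ _ P mu (fun z => (W t z.1 z.2 ^+ 2)%:E) mW2 W20 => /= ->.
have Kt0 : 0 <= Kt.
  by case: SD => _ _ K0 _ _; rewrite divr_ge0 ?powR_ge0// ltW.
apply: (@le_trans _ _ (\int[mu]_y Kt%:E)%E); last first.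
  by rewrite integral_cst_fin.
apply: ae_ge0_le_integral => //.
- by move=> y _; apply: integral_ge0 => om _; rewrite lee_fin sqr_ge0.
- exact: (measurable_fun_fubini_tonelli_G (m1 := P) _ mW2 W20).
- apply: filterS ae_notN => y Ny _.
  have -> : (\int[P]_om (W t om y ^+ 2)%:E = (dot P (w y) (w y))%:E)%E.
    by rewrite -dot2E//; exact: w_L2.
  by rewrite lee_fin w_dot// k_diag_le.
Qed.

(** The expected squared norm of a path is finite by Tonelli and the diagonal bound. *)
Lemma ae_W_L2 : {ae P, forall om, L2 mu (W t om)}.
Proof.
have mW2 : measurable_fun setT (fun z : Om * X => (W t z.1 z.2 ^+ 2)%:E).
  by apply/measurable_EFinP; exact: measurable_funX.
have W20 z : (0 <= (W t z.1 z.2 ^+ 2)%:E :> \bar R)%E by rewrite lee_fin sqr_ge0.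
have mF := measurable_fun_fubini_tonelli_F (m2 := mu) _ mW2 W20.
have iF : P.-integrable setT (fun om => \int[mu]_y (W t om y ^+ 2)%:E)%E.
  apply/integrableP; split => //.
  under eq_integral.
    move=> om _; rewrite gee0_abs; last by apply: integral_ge0 => y _; rewrite lee_fin sqr_ge0.
    over.
  by apply: le_lt_trans W_sqr_integral _; rewrite ltry.
have := integrable_ae measurableT iF; apply: filterS => om /(_ I) fin.
split; first exact: (measurableT_comp mW (measurable_pair1 om)).
apply/integrableP; split.
  by apply/measurable_EFinP; apply: measurable_funX; exact: (measurableT_comp mW (measurable_pair1 om)).
under eq_integral do rewrite /= ger0_norm ?sqr_ge0//.
move: fin; rewrite ge0_fin_numE//.
by apply: integral_ge0 => y _; rewrite lee_fin sqr_ge0.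
Qed.

Section field_functional.
Variable g : X -> R.
Hypothesis Lg : L2 mu g.
Let mg : measurable_fun setT g. Proof. by case: Lg. Qed.
Let V om := dot mu g (W t om).

Lemma measurable_field_dot : measurable_fun setT V.
Proof.
have mF : measurable_fun setT (fun z : Om * X => g z.2 * W t z.1 z.2).
  by apply: measurable_funM => //; exact: measurableT_comp mg measurable_snd.
exact: (measurable_Rintegral2 mF mu).
Qed.

Lemma field_dot_L2 : L2 P V.
Proof.
have mV := measurable_field_dot; split => //.
apply/integrableP; split; first by apply/measurable_EFinP; exact: measurable_funX.
have mF : measurable_fun setT (fun om => \int[mu]_y (W t om y ^+ 2)%:E)%E.
  apply: (measurable_fun_fubini_tonelli_F (m2 := mu) (fun z : Om * X => (W t z.1 z.2 ^+ 2)%:E)).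
    by apply/measurable_EFinP; exact: measurable_funX.
  by move=> z; rewrite lee_fin sqr_ge0.
apply: (@le_lt_trans _ _ (\int[P]_om ((dot mu g g)%:E * \int[mu]_y (W t om y ^+ 2)%:E))%E); last first.
  rewrite ge0_integralZl_EFin ?dot_ge0//; last first.
    by move=> om _; apply: integral_ge0 => y _; rewrite lee_fin sqr_ge0.
  apply: (le_lt_trans (lee_wpmul2l _ W_sqr_integral)); first by rewrite lee_fin dot_ge0.
  by rewrite -EFinM ltry.
apply: ae_ge0_le_integral => //.
- by apply: measurableT_comp => //; apply/measurable_EFinP; exact: measurable_funX.
- move=> om _; apply: mule_ge0; first by rewrite lee_fin dot_ge0.
  by apply: integral_ge0 => y _; rewrite lee_fin sqr_ge0.
- exact: measurable_funeM.
- apply: filterS ae_W_L2 => om LW _.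
  by rewrite dot2E// -EFinM /= lee_fin ger0_norm ?sqr_ge0// dot_CS.
Qed.

Lemma field_dot_fubini r : L2 P r ->
  mu.-integrable setT (EFin \o (fun y => g y * dot P r (w y))) /\
  dot P r V = \int[mu]_y (g y * dot P r (w y)).
Proof.
move=> Lr; have mr : measurable_fun setT r by case: Lr.
have mV := measurable_field_dot.
pose rg (z : Om * X) := r z.1 * g z.2.
have mrg : measurable_fun setT rg.
  by apply: measurable_funM; [exact: measurableT_comp mr measurable_fst|exact: measurableT_comp mg measurable_snd].
have Lrg : L2 m2 rg.
  split => //; apply/integrableP; split; first by apply/measurable_EFinP; exact: measurable_funX.
  under eq_integral do rewrite /= ger0_norm ?sqr_ge0//.
  rewrite /m2 fubini_tonelli1//; last 2 first.
  - by apply/measurable_EFinP; exact: measurable_funX.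
  - by move=> z; rewrite lee_fin sqr_ge0.
  rewrite /fubini_F (eq_integral (fun om => (dot mu g g * r om ^+ 2)%:E)).
    under eq_integral do rewrite EFinM.
    rewrite ge0_integralZl_EFin ?dot_ge0//.
    - by rewrite dot2E// -EFinM ltry.
    - by move=> om _; rewrite lee_fin sqr_ge0.
    - by apply/measurable_EFinP; exact: measurable_funX.
  move=> om _; rewrite mulrC EFinM -dot2E// -ge0_integralZl_EFin ?sqr_ge0//; last 2 first.
  - by move=> y _; rewrite lee_fin sqr_ge0.
  - by apply/measurable_EFinP; exact: measurable_funX.
  by apply: eq_integral => y _; rewrite /rg /= exprMn EFinM.
have iF := L2_mul_integrable Lrg W_L2_prod.
have e1 := Fubini iF.
have mdw : measurable_fun setT (fun y => dot P r (w y)).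
  have mF : measurable_fun setT (fun z : Om * X => r z.1 * W t z.1 z.2).
    by apply: measurable_funM => //; exact: measurableT_comp mr measurable_fst.
  exact: (measurable_Rintegral1 mF P).
have Ldw : L2 mu (fun y => dot P r (w y)).
  apply: (@L2_dom _ _ _ mu _ (fun=> Num.sqrt (dot P r r * Kt))) => //.
    split; first exact: measurable_cst.
    exact: finite_measure_integrable_cst.
  apply: filterS ae_notN => y Ny.
  rewrite [leRHS]ger0_norm ?sqrtr_ge0// -sqrtr_sqr ler_wsqrtr//.
  apply: (le_trans (dot_CS Lr (w_L2 Ny))).
  by rewrite ler_wpM2l ?dot_ge0// w_dot// k_diag_le.
split; first exact: L2_mul_integrable.
rewrite {1}/dot /Rintegral; congr fine.
transitivity (\int[P]_om \int[mu]_y (rg (om, y) * W t om y)%:E)%E.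
  apply: ae_eq_integral => //.
  - by apply/measurable_EFinP; exact: measurable_funM.
  - exact: measurable_int (integrable_fubini_F iF).
  - apply: filterS ae_W_L2 => om LW _ /=.
    under [RHS]eq_integral do rewrite /rg /= -mulrA EFinM.
    rewrite integralZl//; last exact: L2_mul_integrable.
    by rewrite dotE.
rewrite [LHS](Fubini iF); apply: ae_eq_integral => //.
- exact: (measurable_fubini_G iF).
- by apply/measurable_EFinP; exact: measurable_funM.
- apply: filterS ae_notN => y Ny _ /=.
  rewrite /rg /=; under [LHS]eq_integral do rewrite (mulrAC (r _)) mulrC EFinM.
  rewrite integralZl//; last exact: (L2_mul_integrable Lr (w_L2 Ny)).
  by rewrite dotE//; exact: w_L2.
Qed.
End field_functional.
(** The covariance operator is diagonal in the eigenbasis. The truncated kernels act exactly as soon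
    as n >= J, and dominated convergence passes to the full kernel. *)
Lemma field_kernel y (cc : nat -> R) J : ~ N y ->
  \int[mu]_z (lcomb u cc J z * dot P (w y) (w z)) = \sum_(i < J) cc i * (expR (- (t * lam i)) * u i y).
Proof.
move=> Ny; set g := lcomb u cc J.
have Lg : L2 mu g by exact: (lcomb_L2 ES).
have mg : measurable_fun setT g by case: Lg.
have [iG _] := field_dot_fubini Lg (w_L2 Ny).
have knE n : kn n y = lcomb u (fun j => expR (- (t * lam j)) * u j y) n by [].
have Lkn n : L2 mu (kn n y) by rewrite knE; exact: (lcomb_L2 ES).
have mkn n : measurable_fun setT (kn n y) by case: (Lkn n).
have dn n : (J <= n)%N -> dot mu g (kn n y) = \sum_(i < J) cc i * (expR (- (t * lam i)) * u i y).
  move=> Jn; rewrite (lcomb_dotl ES)//; apply: eq_bigr => i _; congr (_ * _).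
  by rewrite knE (lcomb_dot_u ES) (leq_trans (ltn_ord i)).
have L1 : L2 mu (fun=> Kt : R).
  by split; [exact: measurable_cst|exact: finite_measure_integrable_cst].
have iK : mu.-integrable setT (EFin \o (fun z => `|g z| * Kt)).
  exact: (L2_mul_integrable (L2_abs Lg) L1).
have ptw : {ae mu, forall z, setT z -> (g z * kn n y z)%:E @[n --> \oo] --> (EFin \o (fun z => g z * dot P (w y) (w z))) z}.
  apply: filterS ae_notN => z Nz _ /=; apply: cvg_EFin; first exact: nearW.
  by apply: cvgM; [exact: cvg_cst|rewrite w_dot//; exact: kn_cvg].
have dom : {ae mu, forall z n, setT z -> (`|(g z * kn n y z)%R%:E| <= (EFin \o (fun z => (`|g z| * Kt)%R)) z)%E}.
  apply: filterS ae_notN => z Nz n _ /=; rewrite lee_fin normrM ler_wpM2l//.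
  exact: kn_le.
have [_ _ h] := dominated_convergence measurableT
  (fun n => proj2 (measurable_EFinP _ _) (measurable_funM mg (mkn n)))
  (measurable_int _ iG) ptw iK dom.
have c1 : dot mu g (kn n y) @[n --> \oo] --> \int[mu]_z (g z * dot P (w y) (w z)).
  rewrite /dot /Rintegral; apply: fine_cvg; rewrite fineK; last exact: (integrable_fin_num measurableT iG).
  exact: h.
have c2 : dot mu g (kn n y) @[n --> \oo] --> \sum_(i < J) cc i * (expR (- (t * lam i)) * u i y).
  apply: (@cvg_near_cst _ _ _ _ _); exists J => // n /= Jn; exact: dn.
by rewrite -(cvg_lim _ c1)// -(cvg_lim _ c2).
Qed.

Section residual.
Variables (x : X) (J : nat).
Hypothesis Nx : ~ N x.
Let cc j := - u j x.
Let g := lcomb u cc J.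
Let Lg : L2 mu g. Proof. exact: (lcomb_L2 ES). Qed.

(* The value at x of the part of the field orthogonal to the first J eigenfunctions. *)
Definition resid (om : Om) : R := W t om x + dot mu g (W t om).

Let V om := dot mu g (W t om).
Let LV : L2 P V. Proof. exact: field_dot_L2. Qed.
Let Lx : L2 P (w x). Proof. exact: w_L2. Qed.

Lemma resid_L2 : L2 P resid.
Proof. exact: L2D. Qed.

Lemma resid_dot r : L2 P r -> dot P r resid = dot P r (w x) + \int[mu]_y (g y * dot P r (w y)).
Proof.
move=> Lr; have [_ <-] := field_dot_fubini Lg Lr.
by rewrite /resid dotDr.
Qed.

Lemma resid_var : dot P resid resid = k x x - \sum_(j < J) expR (- (t * lam j)) * u j x ^+ 2.
Proof.
pose S y := \sum_(j < J) cc j * (expR (- (t * lam j)) * u j y).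
have h y : ~ N y -> dot P resid (w y) = k x y + S y.
  move=> Ny; rewrite dotC resid_dot; last exact: w_L2.
  by rewrite w_dot// field_kernel// heat_cov_sym.
rewrite resid_dot; last exact: resid_L2.
rewrite h//.
have LS : L2 mu S by have := lcomb_L2 ES (fun j => cc j * expR (- (t * lam j))) J; congr L2; apply/funext => y; apply: eq_bigr => j _; rewrite mulrA.
have mg : measurable_fun setT g by case: Lg.
have [iG _] := field_dot_fubini Lg resid_L2.
have [iG' _] := field_dot_fubini Lg (w_L2 Nx).
have iS := L2_mul_integrable Lg LS.
have -> : \int[mu]_y (g y * dot P resid (w y)) = \int[mu]_y (g y * dot P (w x) (w y) + g y * S y).
  rewrite /Rintegral; congr fine; apply: ae_eq_integral => //.
  - exact: measurable_int iG.
  - by have := measurable_int _ (integrableD_EFin iG' iS).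
  - apply: filterS ae_notN => y Ny _ /=.
    by rewrite h// w_dot// mulrDr.
rewrite RintegralD// field_kernel//.
have -> : \int[mu]_y (g y * S y) = \sum_(j < J) cc j * (cc j * expR (- (t * lam j))).
  have -> : \int[mu]_y (g y * S y) = dot mu g (lcomb u (fun j => cc j * expR (- (t * lam j))) J).
    apply: eq_Rintegral => y _; congr (_ * _); apply: eq_bigr => j _; exact: mulrA.
  by rewrite (lcomb_dot ES).
rewrite /S -!addrA; congr (_ + _); rewrite -!big_split -sumrN/=; apply: eq_bigr => j _.
by rewrite /cc; ring.
Qed.

Lemma comb_cat s s' c om :
  comb (s ++ [seq (p.1, c * p.2) | p <- s']) om = comb s om + c * comb s' om.
Proof.
rewrite /comb big_cat big_map mulr_sumr/=; congr (_ + _).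
by apply: eq_bigr => p _; rewrite mulrA.
Qed.

Let Z := resid.
Let LZ : L2 P Z. Proof. exact: resid_L2. Qed.
Let r s om := Z om - comb s om.
Let Lr s : good s -> L2 P (r s). Proof. by move=> gs; apply: L2B => //; exact: comb_L2. Qed.

(* Near-minimality of comb s makes the remainder almost orthogonal to all combinations. *)
Lemma near_min e : 0 < e -> exists s, [/\ good s, dot P (r s) (r s) <= dot P Z Z + e &
  forall s', good s' -> dot P (r s) (comb s') ^+ 2 <= e * dot P (comb s') (comb s')].
Proof.
move=> e0; pose E := [set v | exists2 s, good s & v = dot P (r s) (r s)].
have lbE : lbound E 0 by move=> _ [s gs ->]; exact: dot_ge0.
have infE : has_inf E.
  by split; [exists (dot P (r [::]) (r [::])), [::] => // p|exists 0].
have [_ [s gs ->] hs] := inf_adherent e0 infE.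
have infle s' : good s' -> inf E <= dot P (r s') (r s').
  by move=> gs'; apply: ge_inf; [exists 0|exists s'].
exists s; split => //.
  have : inf E <= dot P Z Z.
    have -> : Z = r [::] by apply/funext => om; rewrite /r /comb big_nil subr0.
    by apply: infle => p.
  lra.
move=> s' gs'; set b := dot P (comb s') (comb s'); set e1 := dot P (r s) (comb s').
have b0 : 0 <= b by exact: dot_ge0.
have q c : 0 <= e - 2 * c * e1 + c ^+ 2 * b.
  have gc : good (s ++ [seq (p.1, c * p.2) | p <- s']).
    move=> p; rewrite mem_cat => /orP[/gs//|/mapP[p' p's ->]].
    by have := gs' _ p's.
  have := infle _ gc; have -> : r (s ++ [seq (p.1, c * p.2) | p <- s']) = (fun om => r s om + (- c) * comb s' om).
    by apply/funext => om; rewrite /r comb_cat; lra.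
  rewrite dotD2; [|exact: Lr|by apply: L2Z; exact: comb_L2].
  have Lc := comb_L2 gs'; have Lrs := Lr gs.
  rewrite dotZr// dotZl//; last exact: L2Z.
  rewrite dotZr// -/e1 -/b; move: hs; set v := dot P (r s) (r s); set i := inf E.
  by move=> h1 h2; rewrite expr2; lra.
have [b00|bn0] := eqVneq b 0.
  have [->|e10] := eqVneq e1 0; first by rewrite expr0n/= mulr_ge0// ltW.
  by have := q (e / e1); rewrite b00 mulr0 addr0 -!mulrA mulVf// mulr1; lra.
have bp : 0 < b by rewrite lt_neqAle eq_sym bn0.
have := q (e1 / b); rewrite expr2.
have -> : e - 2 * (e1 / b) * e1 + e1 / b * (e1 / b) * b = e - e1 ^+ 2 / b by field.
by rewrite subr_ge0 ler_pdivrMr.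
Qed.

(** The residual contains an integral of the field, while Gaussianity is given for finite
    combinations of values. For a near-minimal [s] the remainder is almost orthogonal to every field
    value, hence by Fubini to the residual, and also to [comb s]; so it is almost orthogonal to
    itself. *)
Lemma comb_close del : 0 < del -> exists2 s, good s & dot P (r s) (r s) <= del.
Proof.
move=> del0.
have Kt0 : 0 <= Kt by case: SD => _ _ K0 _ _; rewrite divr_ge0 ?powR_ge0// ltW.
pose A := dot mu (fun=> 1) (fun y => `|g y|).
have L1 c : L2 mu (fun=> c : R).
  by split; [exact: measurable_cst|exact: finite_measure_integrable_cst].
have A0 : 0 <= A by apply: Rintegral_ge0 => y _; rewrite mul1r.
pose v := dot P Z Z; have v0 : 0 <= v by exact: dot_ge0.
pose C := Num.sqrt Kt * (1 + A) + Num.sqrt (4 * v + 4) + 1.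
have C0 : 0 < C.
  by rewrite ltr_wpDl// addr_ge0 ?sqrtr_ge0// mulr_ge0 ?sqrtr_ge0// addr_ge0.
pose q := Num.min 1 (del / C); have q0 : 0 < q by rewrite lt_min ltr01 divr_gt0.
have q1 : q <= 1 by rewrite ge_min lexx.
have [s [gs hv hs]] := near_min (exprn_gt0 2 q0); exists s => //.
have Lrs := Lr gs; have Lc := comb_L2 gs.
have hw y : ~ N y -> `|dot P (r s) (w y)| <= q * Num.sqrt Kt.
  move=> Ny; have := hs _ (@good1 y 1 Ny).
  have -> : comb [:: (y, 1)] = w y by rewrite comb1; apply/funext => om; rewrite mul1r.
  rewrite w_dot// => h.
  rewrite -[leRHS]ger0_norm ?mulr_ge0 ?sqrtr_ge0 ?(ltW q0)//.
  rewrite -ler_sqr ?nnegrE// !real_normK ?num_real// exprMn sqr_sqrtr//.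
  by apply: (le_trans h); rewrite ler_wpM2l ?sqr_ge0// k_diag_le.
have [iG _] := field_dot_fubini Lg Lrs.
have mdw : measurable_fun setT (fun y => dot P (r s) (w y)).
  have mr : measurable_fun setT (r s) by case: Lrs.
  have mF : measurable_fun setT (fun z : Om * X => r s z.1 * W t z.1 z.2).
    by apply: measurable_funM => //; exact: measurableT_comp mr measurable_fst.
  exact: (measurable_Rintegral1 mF P).
have ae_dw : {ae mu, forall y, `|dot P (r s) (w y)| <= q * Num.sqrt Kt}.
  by apply: filterS ae_notN => y Ny; exact: hw.
have Ldw : L2 mu (fun y => dot P (r s) (w y)).
  apply: (@L2_dom _ _ _ mu _ (fun=> q * Num.sqrt Kt)) => //.
  apply: filterS ae_dw => y h; apply: le_trans h _; exact: ler_norm.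
have h1 : `|\int[mu]_y (g y * dot P (r s) (w y))| <= q * Num.sqrt Kt * A.
  have -> : \int[mu]_y (g y * dot P (r s) (w y)) = dot mu (fun y => dot P (r s) (w y)) g.
    by rewrite dotC.
  apply: (le_trans (dot_abs_le Ldw (L1 _) Lg ae_dw)).
  rewrite -dotZl//; last exact: L2_abs.
  by rewrite /dot le_eqVlt; apply/orP; left; apply/eqP; apply: eq_Rintegral => y _; rewrite mulr1.
have h2 : `|dot P (r s) Z| <= q * (Num.sqrt Kt * (1 + A)).
  rewrite resid_dot//; apply: (le_trans (ler_normD _ _)).
  by have := hw _ Nx; rewrite !mulrDr mulr1 mulrA => h; apply: lerD.
have h3 : `|dot P (r s) (comb s)| <= q * Num.sqrt (4 * v + 4).
  rewrite -[leRHS]ger0_norm ?mulr_ge0 ?sqrtr_ge0 ?(ltW q0)//.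
  have v4 : 0 <= 4 * v + 4 by lra.
  rewrite -ler_sqr ?nnegrE// !real_normK ?num_real// exprMn sqr_sqrtr//.
  apply: (le_trans (hs _ gs)); rewrite ler_wpM2l ?sqr_ge0//.
  have -> : comb s = (fun om => Z om - r s om) by apply/funext => om; rewrite /r; lra.
  apply: (le_trans (dotB2_le LZ Lrs)); rewrite -/v.
  have q2 : q ^+ 2 <= 1 by rewrite exprn_ile1// ltW.
  by move: hv; rewrite -/v; lra.
have -> : dot P (r s) (r s) = dot P (r s) Z - dot P (r s) (comb s).
  by rewrite -dotBr.
apply: (@le_trans _ _ (q * C)).
  have := ler_norm (dot P (r s) Z); have := ler_norm (- dot P (r s) (comb s)); rewrite normrN.
  by rewrite /C; move: h2 h3; lra.
by apply: (@le_trans _ _ (del / C * C)); [rewrite ler_wpM2r ?(ltW C0)// ge_min lexx orbT|rewrite divfK// gt_eqF].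
Qed.

(** L2 approximation does not control exponentials, so the integrand is truncated at M v, the event
    where the remainder exceeds v is paid by M times its square, and M tends to infinity. The
    approximants have variance at most 4 v and appear with exponent 2 b, so [gauss_law_expR] asks
    for 32 b v <= 1. *)
Lemma resid_expR (b v : R) : 0 <= b -> 0 < v -> dot P Z Z <= v -> 32 * b * v <= 1 ->
  (\int[P]_om (expR (b * Z om ^+ 2))%:E <= 4%:E)%E.
Proof.
move=> b0 v0 Zv bv; have mZ : measurable_fun setT Z by case: LZ.
pose F om := 2^-1 * expR (b * Z om ^+ 2).
have mF : measurable_fun setT F.
  apply: measurable_funM => //; apply: measurableT_comp => //.
  by apply: measurable_funM => //; exact: measurable_funX.
have F0 om : 0 <= F om by rewrite mulr_ge0 ?expR_ge0.
pose f (M : nat) om := Num.min (F om) (M%:R * v).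
have mf M : measurable_fun setT (f M) by apply: measurable_minr.
have f0 M om : 0 <= f M om by rewrite le_min F0 mulr_ge0// ltW.
have e2 : expR (2 * b * v) <= 2.
  have h : 2 * b * v <= 2^-1 by lra.
  have : 1 + - (2 * b * v) <= expR (- (2 * b * v)) by exact: expR_ge1Dx.
  rewrite expRN => h2; rewrite -[leRHS]invrK -[leLHS]invrK lef_pV2 ?posrE ?invr_gt0 ?expR_gt0//.
  lra.
have fM M : (\int[P]_om (f M om)%:E <= 2%:E)%E.
  apply/lee_addgt0Pr => e e0.
  pose del := Num.min v (e / (M%:R + 1)).
  have M1 : 0 < M%:R + 1 :> R by rewrite ltr_wpDl.
  have del0 : 0 < del by rewrite lt_min v0 divr_gt0.
  have [s gs hs] := comb_close del0.
  have Lc := comb_L2 gs; have Lrs := Lr gs.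
  have mc : measurable_fun setT (comb s) by case: Lc.
  have mr : measurable_fun setT (r s) by case: Lrs.
  have dv : del <= v by rewrite ge_min lexx.
  have vA : quad_form k s <= 4 * v.
    rewrite -comb_dot//.
    have -> : comb s = (fun om => Z om - r s om) by apply/funext => om; rewrite /r; lra.
    by apply: (le_trans (dotB2_le LZ Lrs)); lra.
  have gA : (\int[P]_om (expR (2 * b * comb s om ^+ 2))%:E <= 2%:E)%E.
    apply: (@gauss_law_expR _ _ _ P (comb s) (quad_form k s)) => //.
    - exact: (quad_form_heat_ge0 SD ES t0 gs).
    - by move=> B mB; exact: (gp_law GP).
    - by rewrite mulr_ge0.
    - by have := ler_wpM2l b0 vA; lra.
  apply: (@le_trans _ _ (\int[P]_om ((expR (2 * b * comb s om ^+ 2))%:E + (M%:R * r s om ^+ 2)%:E))%E).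
    apply: ge0_le_integral => //.
    - by move=> om _; rewrite lee_fin.
    - exact/measurable_EFinP.
    - apply: emeasurable_funD; apply/measurable_EFinP.
        by apply: measurableT_comp => //; apply: measurable_funM => //; exact: measurable_funX.
      by apply: measurable_funM => //; exact: measurable_funX.
    move=> om _; rewrite -EFinD lee_fin /f.
    have [rv|rv] := leP (r s om ^+ 2) v.
      rewrite ge_min; apply/orP; left; rewrite -[leLHS]addr0; apply: lerD; last by rewrite mulr_ge0 ?sqr_ge0.
      rewrite /F ler_pdivrMl//; apply: (@le_trans _ _ (expR (2 * b * v) * expR (2 * b * comb s om ^+ 2))).
        rewrite -expRD ler_expR.
        have Z2 : Z om ^+ 2 <= 2 * comb s om ^+ 2 + 2 * r s om ^+ 2.
          have := sqr_ge0 (comb s om - r s om).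
          have -> : Z om = comb s om + r s om by rewrite /r; lra.
          rewrite !expr2; lra.
        have := ler_wpM2l b0 Z2; have := ler_wpM2l b0 rv; lra.
      by rewrite ler_wpM2r// expR_ge0.
    rewrite ge_min; apply/orP; right; rewrite -[leLHS]add0r; apply: lerD; first exact: expR_ge0.
    by rewrite ler_wpM2l// ltW.
  rewrite ge0_integralD//; first last.
  all: first [by apply/measurable_EFinP; apply: measurable_funM => //; exact: measurable_funX
    |by move=> om _; rewrite lee_fin mulr_ge0 ?sqr_ge0
    |by apply/measurable_EFinP; apply: measurableT_comp => //; apply: measurable_funM => //; exact: measurable_funX
    |idtac].
  apply: leeD => //.
  under eq_integral do rewrite EFinM.
  rewrite ge0_integralZl_EFin//; last 2 first.
  - by move=> om _; rewrite lee_fin sqr_ge0.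
  - by apply/measurable_EFinP; exact: measurable_funX.
  rewrite dot2E// -EFinM lee_fin.
  apply: (@le_trans _ _ (M%:R * (e / (M%:R + 1)))).
    by rewrite ler_wpM2l// (le_trans hs)// ge_min lexx orbT.
  by rewrite mulrCA ler_piMr ?(ltW e0)// ler_pdivrMr// mul1r lerDl.
have ndf om : {homo (fun M => (f M om)%:E) : a c / (a <= c)%N >-> (a <= c)%E}.
  move=> a c ac; rewrite lee_fin /f le_min ge_min lexx /= ge_min; apply/orP; right.
  by rewrite ler_wpM2r ?(ltW v0)// ler_nat.
have := @cvg_monotone_convergence _ _ _ P setT measurableT (fun M om => (f M om)%:E)
  (fun M => proj2 (measurable_EFinP _ _) (mf M)) (fun M om _ => f0 M om) (fun om _ => ndf om).
have -> : (\int[P]_om limn (fun M => (f M om)%:E) = \int[P]_om (F om)%:E)%E.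
  apply: eq_integral => om _; apply/cvg_lim => //.
  apply: cvg_EFin; first exact: nearW.
  apply: cvg_near_cst; exists (Num.truncn (F om / v)).+1 => // M /= hM.
  rewrite /f; apply/min_idPl; rewrite -ler_pdivrMr//.
  by apply/ltW; apply: (lt_le_trans (truncnS_gt _)); rewrite ler_nat.
move=> h; have le2 : (\int[P]_om (F om)%:E <= 2%:E)%E.
  rewrite -(cvg_lim _ h)//; apply: lime_le; first by apply/cvg_ex; eexists; exact: h.
  by apply: nearW => M; exact: fM.
have -> : (\int[P]_om (expR (b * Z om ^+ 2))%:E = 2%:E * \int[P]_om (F om)%:E)%E.
  rewrite -ge0_integralZl_EFin//; last 2 first.
  - by move=> om _; rewrite lee_fin.
  - exact/measurable_EFinP.
  by apply: eq_integral => om _; rewrite -EFinM; congr EFin; rewrite /F; lra.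
have -> : (4%:E = 2%:E * 2%:E :> \bar R)%E by rewrite -EFinM; congr EFin; lra.
by apply: lee_wpmul2l => //; rewrite lee_fin.
Qed.

(** Half of the exponent t lam is used for the decay beyond L, the other half keeps the series
    summable. *)
Lemma resid_var_le L : (forall j, (J <= j)%N -> L <= lam j) ->
  dot P Z Z <= expR (- (t * L / 2)) * (K / (Num.min (t / 2) 1) `^ (d / 2)).
Proof.
move=> hL; rewrite /Z resid_var.
have h : (fun n => kn n x x - \sum_(j < J) expR (- (t * lam j)) * u j x ^+ 2) @ \oo -->
    k x x - \sum_(j < J) expR (- (t * lam j)) * u j x ^+ 2.
  by apply: cvgB; [exact: kn_cvg|exact: cvg_cst].
rewrite -(cvg_lim _ h)//; apply: limr_le; first by apply/cvg_ex; eexists; exact: h.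
near=> n; have Jn : (J <= n)%N by near: n; exact: nbhs_infty_ge.
have t20 : 0 < t / 2 by rewrite divr_gt0.
apply: le_trans (ler_wpM2l (expR_ge0 _) (spectral_sum_le SD ES n Nx t20)).
rewrite /kn.
have -> : \sum_(j < n) expR (- (t * lam j)) * u j x * u j x = \sum_(0 <= j < n) expR (- (t * lam j)) * u j x ^+ 2.
  by rewrite big_mkord; apply: eq_bigr => j _; rewrite expr2 mulrA.
rewrite (big_cat_nat (leq0n J) Jn)//= big_mkord [leLHS]addrC addKr.
rewrite mulr_sumr -(big_mkord xpredT (fun j => expR (- (t * L / 2)) * (expR (- (t / 2 * lam j)) * u j x ^+ 2))).
rewrite [leRHS](big_cat_nat (leq0n J) Jn)//= -[leLHS]add0r; apply: lerD.
  by apply: sumr_ge0 => j _; apply: mulr_ge0 (expR_ge0 _) _; apply: mulr_ge0 (expR_ge0 _) (sqr_ge0 _).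
rewrite big_nat_cond [leRHS]big_nat_cond; apply: ler_sum => j /andP[/andP[Jj _] _].
rewrite mulrA ler_wpM2r ?sqr_ge0// -expRD ler_expR.
have := ler_wpM2l (ltW t0) (hL j Jj); lra.
Unshelve. all: by end_near. Qed.

End residual.

Lemma residE x J om : L2 mu (W t om) ->
  resid x J om = W t om x - \sum_(j < J) coef mu u (W t om) j * u j x.
Proof.
move=> LW; rewrite /resid (lcomb_dotl ES)// -sumrN; congr (_ + _); apply: eq_bigr => j _.
by rewrite /coef mulNr mulrC.
Qed.

Lemma measurable_resid J : measurable_fun setT (fun z : Om * X => resid z.2 J z.1).
Proof.
rewrite /resid; apply: measurable_funD => //.
have mu_ j : measurable_fun setT (u j) by case: (eigen_L2 ES j).
have mf : measurable_fun setT (fun q : (Om * X) * X => lcomb u (fun j => - u j q.1.2) J q.2 * W t q.1.1 q.2).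
  apply: measurable_funM.
    rewrite /lcomb; apply: measurable_sum => j; apply: measurable_funM.
      apply: measurableT_comp => //.
      exact: measurableT_comp (mu_ j) (measurableT_comp measurable_snd measurable_fst).
    exact: measurableT_comp (mu_ j) measurable_snd.
  have sw : measurable_fun setT (fun q : (Om * X) * X => (q.1.1, q.2)).
    by apply: measurable_fun_pair; [exact: measurableT_comp measurable_fst measurable_fst|exact: measurable_snd].
  exact: (measurableT_comp mW sw).
exact: (measurable_Rintegral2 mf mu).
Qed.

End gp_field.

(** * Likelihood gap and noise moments *)

Section lik_gap.
Context {R : realType} {dX} {X : measurableType dX}.
Notation RR := (measurableTypeR R).

Lemma sum_young (I : Type) (r : seq I) (Q : pred I) (a b : I -> R) eta : 0 < eta ->
  2 * \sum_(i <- r | Q i) a i * b i <=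
  eta * \sum_(i <- r | Q i) a i ^+ 2 + eta^-1 * \sum_(i <- r | Q i) b i ^+ 2.
Proof.
move=> eta0; rewrite !mulr_sumr -big_split/=; apply: ler_sum => i _.
have h : 0 <= eta^-1 * (eta * a i - b i) ^+ 2 by rewrite mulr_ge0 ?sqr_ge0// invr_ge0 ltW.
rewrite -subr_ge0; apply: le_trans h _; rewrite le_eqVlt; apply/orP; left; apply/eqP.
by field; rewrite gt_eqF.
Qed.

Variables (u : nat -> X -> R) (f0 : X -> R) (zs : seq (X * RR)).
Variables (J0 J2 : nat) (c th : nat -> R) (f h r0 : X -> R) (eps2 ka C3 n : R).
Hypothesis J02 : (J0 <= J2)%N.
Hypothesis fE : forall x, f x = lcomb u c J2 x + h x.
Hypothesis f0E : forall x, f0 x = lcomb u th J0 x + r0 x.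
Hypothesis n1 : 1 <= n.
Hypothesis eps0 : 0 < eps2.
Hypothesis eps1 : eps2 <= 1.
Hypothesis ka0 : 0 < ka.
Hypothesis hE2 : \sum_(j < J2) (\sum_(z <- zs) z.2 * u j z.1) ^+ 2 <= n ^+ 2 * eps2.
Hypothesis hE3 : \sum_(z <- zs) r0 z.1 ^+ 2 <= C3 * n * eps2.
Hypothesis hE3' : `|\sum_(z <- zs) z.2 * r0 z.1| <= n * eps2.
Hypothesis hE4 : \sum_(z <- zs) z.2 ^+ 2 <= n ^+ 2.
Hypothesis hGR : forall cc : nat -> R, ka * n * \sum_(j < J2) cc j ^+ 2 <= \sum_(z <- zs) lcomb u cc J2 z.1 ^+ 2.
Hypothesis hh : \sum_(z <- zs) h z.1 ^+ 2 <= eps2 ^+ 2.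

(** The expansion of f0 stops at J0 while f is expanded up to J2, so the coefficients of f0 are
    padded with zeros. *)
Definition gap_coef j := c j - (if (j < J0)%N then th j else 0).

Lemma f_gap x : f x - f0 x = lcomb u gap_coef J2 x + (h x - r0 x).
Proof.
rewrite fE f0E; suff -> : lcomb u gap_coef J2 x = lcomb u c J2 x - lcomb u th J0 x by lra.
have -> : lcomb u th J0 x = \sum_(j < J2) (if (j < J0)%N then th j else 0) * u j x.
  rewrite /lcomb (big_ord_widen _ (fun j => th j * u j x) J02) big_mkcond/=.
  by apply: eq_bigr => j _; case: ifP => //; rewrite mul0r.
by rewrite /lcomb -sumrB; apply: eq_bigr => j _; rewrite mulrBl.
Qed.

(** Basic inequality of least squares. The Gram bound yields ka n / 2 times the squared
    coefficients; Young's inequality spends half of this on the noise in the span, leaving 4 / ka.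
    The 6 adds 2 for the empirical norm of h, 2 for noise against h and 2 for noise against r0. *)
Lemma lik_gap :
  4^-1 * ka * n * (\sum_(j < J2) gap_coef j ^+ 2) - (6 + 2 * C3 + 4 / ka) * n * eps2 <=
  \sum_(y <- map (obs f0) zs) (y.2 - f y.1) ^+ 2 - \sum_(y <- map (obs f0) zs) (y.2 - f0 y.1) ^+ 2.
Proof.
have n0 : 0 < n := lt_le_trans ltr01 n1.
rewrite !big_map /=.
pose v := lcomb u gap_coef J2.
have -> : \sum_(z <- zs) (f0 z.1 + z.2 - f z.1) ^+ 2 - \sum_(z <- zs) (f0 z.1 + z.2 - f0 z.1) ^+ 2 =
    \sum_(z <- zs) (f z.1 - f0 z.1) ^+ 2 - 2 * \sum_(z <- zs) z.2 * (f z.1 - f0 z.1).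
  rewrite mulr_sumr -!sumrB; apply: eq_bigr => z _; ring.
set A := \sum_(j < J2) _.
have A0 : 0 <= A by apply: sumr_ge0 => j _; exact: sqr_ge0.
have h1 : 2^-1 * \sum_(z <- zs) v z.1 ^+ 2 - 2 * \sum_(z <- zs) h z.1 ^+ 2 - 2 * \sum_(z <- zs) r0 z.1 ^+ 2
    <= \sum_(z <- zs) (f z.1 - f0 z.1) ^+ 2.
  rewrite !mulr_sumr -!sumrB; apply: ler_sum => z _; rewrite f_gap -/(v z.1).
  have := sqr_ge0 (v z.1 + 2 * (h z.1 - r0 z.1)); have := sqr_ge0 (h z.1 + r0 z.1).
  rewrite !expr2; lra.
have e1 : \sum_(z <- zs) z.2 * (f z.1 - f0 z.1) =
    \sum_(j < J2) gap_coef j * (\sum_(z <- zs) z.2 * u j z.1) + \sum_(z <- zs) z.2 * h z.1 - \sum_(z <- zs) z.2 * r0 z.1.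
  under [X in _ = X + _ - _]eq_bigr do rewrite mulr_sumr.
  rewrite exchange_big -big_split -sumrB/=; apply: eq_bigr => z _.
  rewrite f_gap mulrDr mulrBr addrA; congr (_ + _ - _).
  by rewrite /lcomb mulr_sumr; apply: eq_bigr => j _; rewrite mulrCA.
have kn0 : 0 < ka * n / 4 by rewrite divr_gt0// mulr_gt0.
have h2 : 2 * \sum_(j < J2) gap_coef j * (\sum_(z <- zs) z.2 * u j z.1) <= ka * n / 4 * A + 4 / ka * n * eps2.
  apply: (le_trans (sum_young _ _ _ _ kn0)); rewrite lerD2l.
  have -> : 4 / ka * n * eps2 = (ka * n / 4)^-1 * (n ^+ 2 * eps2) by field; rewrite !gt_eqF.
  by rewrite ler_wpM2l// invr_ge0 ltW.
have en0 : 0 < eps2 / n by rewrite divr_gt0.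
have h3 : 2 * \sum_(z <- zs) z.2 * h z.1 <= 2 * n * eps2.
  apply: (le_trans (sum_young _ _ _ _ en0)).
  have -> : 2 * n * eps2 = eps2 / n * n ^+ 2 + (eps2 / n)^-1 * eps2 ^+ 2 by field; rewrite !gt_eqF.
  by apply: lerD; rewrite ler_wpM2l// ?invr_ge0 ltW.
have h4 : - (2 * \sum_(z <- zs) z.2 * r0 z.1) <= 2 * n * eps2.
  have := ler_norm (- \sum_(z <- zs) z.2 * r0 z.1); rewrite normrN; move: hE3'; lra.
have h5 : \sum_(z <- zs) h z.1 ^+ 2 <= n * eps2.
  apply: (le_trans hh); by rewrite expr2 ler_wpM2r ?(ltW eps0)// (le_trans eps1).
have := hGR gap_coef; rewrite -/A -/v => h6.
rewrite e1 !mulrDr mulrN; move: h1 h2 h3 h4 h5 h6 hE3.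
set SV := \sum_(z <- zs) v z.1 ^+ 2; set SH := \sum_(z <- zs) h z.1 ^+ 2; set SR := \sum_(z <- zs) r0 z.1 ^+ 2.
move=> *; lra.
Qed.

End lik_gap.

(** * Moments under the design and the noise *)

Section design_integral.
Context {R : realType} {dX} {X : measurableType dX}.
Variables (mu : {finite_measure set X -> \bar R}) (mu0 : probability X R) (pp : R).
Hypothesis pp0 : 0 < pp.
Hypothesis hle : forall A, measurable A -> (mu0 A <= (pp * fine (mu A))%:E)%E.

Lemma design_integral_le (f : X -> \bar R) : measurable_fun setT f -> (forall x, 0 <= f x)%E ->
  (\int[mu0]_x f x <= pp%:E * \int[mu]_x f x)%E.
Proof.
move=> mf f0; pose k : {nonneg R} := NngNum (ltW pp0).
have -> : (pp%:E * \int[mu]_x f x = \int[mscale k mu]_x f x)%E.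
  by rewrite ge0_integral_mscale.
apply: ge0_le_measure_integral => // A mA.
by apply: (le_trans (hle mA)); rewrite EFinM -(mu_fin mu mA).
Qed.

Lemma design_L2 f : L2 mu f -> L2 mu0 f /\ dot mu0 f f <= pp * dot mu f f.
Proof.
move=> Lf; have mf : measurable_fun setT f by case: Lf.
have mf2 : measurable_fun setT (fun x => (f x ^+ 2)%:E) by apply/measurable_EFinP; exact: measurable_funX.
have h : (\int[mu0]_x (f x ^+ 2)%:E <= (pp * dot mu f f)%:E)%E.
  apply: (le_trans (design_integral_le mf2 _)); first by move=> x; rewrite lee_fin sqr_ge0.
  by rewrite dot2E// EFinM.
have L0 : L2 mu0 f.
  split => //; apply/integrableP; split => //.
  under eq_integral do rewrite /= ger0_norm ?sqr_ge0//.
  by apply: le_lt_trans h _; rewrite ltry.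
by split => //; move: h; rewrite dot2E// lee_fin.
Qed.

End design_integral.
Section noise_moments.
Context {R : realType} {dX} {X : measurableType dX}.
Notation RR := (measurableTypeR R).
Variables (mu0 : probability X R) (sigma : R).
Hypothesis sg0 : sigma != 0.
Notation Q := (noise mu0 sigma).
Notation NS := (normal_prob 0 sigma : probability RR R).

Lemma noise_mul (f : X -> R) (h : RR -> R) H : measurable_fun setT f -> measurable_fun setT h ->
  (forall x, 0 <= f x) -> (forall e, 0 <= h e) -> (\int[NS]_e (h e)%:E = H%:E)%E ->
  (\int[Q]_z (h z.2 * f z.1)%:E = H%:E * \int[mu0]_x (f x)%:E)%E.
Proof.
move=> mf mh f0 h0 hH.
have H0 : 0 <= H by rewrite -lee_fin -hH; apply: integral_ge0 => e _; rewrite lee_fin.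
rewrite integral_noise; last 2 first.
- apply/measurable_EFinP; apply: measurable_funM.
    exact: measurableT_comp mh measurable_snd.
  exact: measurableT_comp mf measurable_fst.
- by move=> z; rewrite lee_fin mulr_ge0.
rewrite -ge0_integralZl_EFin//; last 2 first.
- by move=> x _; rewrite lee_fin.
- exact/measurable_EFinP.
apply: eq_integral => x _.
have mhE : measurable_fun setT (fun e : RR => (h e)%:E) by exact/measurable_EFinP.
have h0E (e : RR) : (0 <= (h e)%:E)%E by rewrite lee_fin.
rewrite -hH ge0_integral_normal// -ge0_integralZr//.
- by apply: eq_integral => e _; rewrite -muleA.
- by apply: emeasurable_funM => //; apply/measurable_EFinP; exact: measurable_normal_pdf.
- by move=> e _; rewrite mule_ge0 ?lee_fin ?normal_pdf_ge0.
- by rewrite lee_fin.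
Qed.

Lemma noise_fst (f : X -> R) : measurable_fun setT f -> (forall x, 0 <= f x) ->
  (\int[Q]_z (f z.1)%:E = \int[mu0]_x (f x)%:E)%E.
Proof.
move=> mf f0; have := @noise_mul f (fun=> 1) 1 mf (measurable_cst _) f0 (fun _ => ler01) (integral_prob_cst NS 1%:E).
by rewrite mul1e => <-; apply: eq_integral => z _; rewrite mul1r.
Qed.

Lemma noise_L2 (g : X -> R) : L2 mu0 g ->
  [/\ L2 Q (fun z => z.2 * g z.1), dot Q (fun z => z.2 * g z.1) (fun=> 1) = 0 &
    dot Q (fun z => z.2 * g z.1) (fun z => z.2 * g z.1) = sigma ^+ 2 * dot mu0 g g].
Proof.
move=> Lg; have mg : measurable_fun setT g by case: Lg.
have mzg : measurable_fun setT (fun z : X * RR => z.2 * g z.1).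
  apply: measurable_funM; first exact: measurable_snd.
  exact: measurableT_comp mg measurable_fst.
have e2 : (\int[Q]_z ((z.2 * g z.1) ^+ 2)%:E = (sigma ^+ 2 * dot mu0 g g)%:E)%E.
  under eq_integral do rewrite exprMn.
  rewrite (@noise_mul (fun x => g x ^+ 2) (fun e => e ^+ 2) (sigma ^+ 2)).
  - by rewrite dot2E// EFinM.
  - exact: measurable_funX.
  - by apply: measurable_funX; exact: measurable_id.
  - by move=> x; exact: sqr_ge0.
  - by move=> x; exact: sqr_ge0.
  - exact: integral_normal_sqr.
have L : L2 Q (fun z => z.2 * g z.1).
  split => //; apply/integrableP; split; first by apply/measurable_EFinP; exact: measurable_funX.
  under eq_integral do rewrite /= ger0_norm ?sqr_ge0//.
  by rewrite e2 ltry.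
split => //; last by move: e2; rewrite dot2E// => -[].
have L1 : L2 Q (fun=> 1 : R).
  by split; [exact: measurable_cst|exact: finite_measure_integrable_cst].
rewrite /dot /Rintegral -(integral12_prod_meas1 (L2_mul_integrable L L1)).
rewrite (eq_integral (fun=> 0%E)) ?integral0// => x _.
have L1x : L2 (normal_prob 0 sigma) (fun e : RR => e : R).
  split; first exact: measurable_id.
  apply/integrableP; split; first by apply/measurable_EFinP; exact: measurable_funX.
  under eq_integral do rewrite /= ger0_norm ?sqr_ge0//.
  by rewrite [X in (X < _)%E](integral_normal_sqr sg0) ltry.
have L1' : L2 (normal_prob 0 sigma) (fun e : RR => 1 : R).
  by split; [exact: measurable_cst|exact: (@finite_measure_integrable_cst _ _ _ NS)].
have i1 := L2_mul_integrable L1x L1'.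
rewrite /fubini_F /= (eq_integral (fun e : RR => ((g x)%:E * ((e : R) * 1)%:E)%E)); last first.
  by move=> e _; rewrite -EFinM mulr1 mulr1 mulrC.
rewrite integralZl// dotE//.
have -> : dot (normal_prob 0 sigma) (fun e : RR => e : R) (fun e : RR => 1 : R) = 0.
  by rewrite -[RHS](integral_normal_id sg0); apply: eq_Rintegral => e _; rewrite mulr1.
by rewrite mule0.
Qed.

Lemma noise_fst_L2 (g : X -> R) : L2 mu0 g ->
  [/\ L2 Q (fun z => g z.1), dot Q (fun z => g z.1) (fun=> 1) = dot mu0 g (fun=> 1) &
    dot Q (fun z => g z.1) (fun z => g z.1) = dot mu0 g g].
Proof.
move=> Lg; have mg : measurable_fun setT g by case: Lg.
have mzg : measurable_fun setT (fun z : X * RR => g z.1) by exact: measurableT_comp mg measurable_fst.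
have e2 : (\int[Q]_z ((g z.1) ^+ 2)%:E = (dot mu0 g g)%:E)%E.
  rewrite (@noise_fst (fun x => g x ^+ 2)) ?dot2E//; last by move=> x; exact: sqr_ge0.
  exact: measurable_funX.
have L : L2 Q (fun z => g z.1).
  split => //; apply/integrableP; split; first by apply/measurable_EFinP; exact: measurable_funX.
  under eq_integral do rewrite /= ger0_norm ?sqr_ge0//.
  by rewrite e2 ltry.
split => //; last by move: e2; rewrite dot2E// => -[].
have L1 : L2 Q (fun=> 1 : R).
  by split; [exact: measurable_cst|exact: finite_measure_integrable_cst].
have L1x : L2 mu0 (fun=> 1 : R).
  by split; [exact: measurable_cst|exact: finite_measure_integrable_cst].
rewrite /dot /Rintegral -(integral12_prod_meas1 (L2_mul_integrable L L1)); congr fine.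
by apply: eq_integral => x _; rewrite /fubini_F /= [LHS](integral_prob_cst NS).
Qed.

(** Chernoff's bound with parameter 1: the moment generating function of one indicator is 1 - (1 -
    1/e) a <= exp(- a / 2). *)
Lemma chernoff_count (A : set X) n : measurable A ->
  (\int[npr Q n]_z (expR (- \sum_(y <- nlist z) (\1_A y.1 : R)))%:E <= (expR (- (n%:R * fine (mu0 A) / 2)))%:E)%E.
Proof.
move=> mA; pose a := fine (mu0 A).
have a0 : 0 <= a by exact: fine_ge0.
have a1 : a <= 1 by rewrite -lee_fin fineK ?probability_le1// fin_num_measure.
have mI : measurable_fun setT (\1_A : X -> R) by exact: measurable_indic.
have meI : measurable_fun setT (fun x => expR (- (\1_A x : R))).
  by apply: measurableT_comp => //; exact: measurableT_comp.
have i1 : (\int[mu0]_x (expR (- (\1_A x : R)))%:E = (1 - (1 - expR (-1)) * a)%:E)%E.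
  have iA : mu0.-integrable setT (EFin \o (\1_A : X -> R)).
    by apply: (@bounded_integrable _ _ _ mu0 _ 1) => // x; rewrite indicE; case: (_ \in _); rewrite ?normr1 ?normr0.
  have -> : (\int[mu0]_x (expR (- (\1_A x : R)))%:E = (\int[mu0]_x (cst 1 x + (expR (-1) - 1) * \1_A x))%:E)%E.
    rewrite /Rintegral fineK.
      apply: eq_integral => x _; congr EFin; rewrite indicE.
      by case: (x \in A) => /=; [lra|rewrite oppr0 expR0; lra].
    apply: (integrable_fin_num measurableT); apply: integrableD_EFin.
      exact: finite_measure_integrable_cst.
    exact: (integrableZl measurableT (expR (-1) - 1) iA).
  rewrite RintegralD//; last 2 first.
  - exact: finite_measure_integrable_cst.
  - exact: (integrableZl measurableT (expR (-1) - 1) iA).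
  rewrite RintegralZl//; congr EFin.
  have -> : \int[mu0]_x cst 1 x = 1 by exact: (congr1 fine (integral_prob_cst mu0 1%:E)).
  have -> : \int[mu0]_x (\1_A x : R) = a by rewrite /Rintegral integral_indic// setIT.
  lra.
have e1 : expR (-1) <= 2^-1 :> R.
  rewrite expRN lef_pV2 ?posrE ?expR_gt0//.
  by have := expR_ge1Dx (1 : R); lra.
have e0 : 0 <= expR (-1) :> R by exact: expR_ge0.
have mz : measurable_fun setT (fun z : X * RR => expR (- (\1_A z.1 : R))).
  exact: measurableT_comp meI measurable_fst.
have := @npr_prod _ _ _ Q (fun z => expR (- (\1_A z.1 : R))) (1 - (1 - expR (-1)) * a) n mz
   (fun _ => expR_ge0 _).
rewrite (@noise_fst (fun x => expR (- (\1_A x : R))))// => /(_ i1) h.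
rewrite (eq_integral (fun z : npow (X * RR)%type n => (\prod_(y <- nlist z) expR (- (\1_A y.1 : R)))%:E)); last first.
  by move=> z _; rewrite -expR_sum sumrN.
rewrite h lee_fin -/a.
have -> : - (n%:R * a / 2) = n%:R * (- (a / 2)) by lra.
rewrite expRM_natl; apply: lerXn2r; rewrite ?nnegrE ?expR_ge0//.
  by have : (1 - expR (-1)) * a <= 1 * 1; [apply: ler_pM => //; lra|lra].
have : (1 - 2^-1) * a <= (1 - expR (-1)) * a by apply: ler_wpM2r => //; lra.
by have := expR_ge1Dx (- (a / 2)); lra.
Qed.

End noise_moments.

(** * The evidence at a fixed scale *)

Lemma measurable_fun_limn_einf d (T : measurableType d) (R : realType) (f : (T -> \bar R)^nat) :
  (forall n, measurable_fun setT (f n)) -> measurable_fun setT (fun x => limn_einf (f ^~ x)).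
Proof.
move=> mf; under eq_fun do rewrite limn_einf_lim.
apply: (emeasurable_fun_cvg (fun n x => einfs (f ^~ x) n)).
- by move=> n; exact: measurable_fun_einfs.
- by move=> x _; exact: is_cvg_einfs.
Qed.

Section evidence.
Context {R : realType} {dX} {X : measurableType dX} {dO} {Om : measurableType dO}.
Notation RR := (measurableTypeR R).
Notation N01 := (normal_prob 0 1 : probability RR R).
Variables (mu : {finite_measure set X -> \bar R}) (d : R) (lam : nat -> R) (u : nat -> X -> R).
Variables (N : set X) (K : R).
Hypothesis SD : spectral_data mu d lam u N K.
Hypothesis ES : eigen_system mu lam u.
Variables (P : probability Om R) (W : R -> Om -> X -> R).
Hypothesis GP : forall t, 0 < t -> centered_GP P (W t) (heat_cov lam u t).
Variables (mu0 : probability X R) (sg : R) (f0 : X -> R).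
Hypothesis sg0 : 0 < sg.
Hypothesis mf0 : measurable_fun setT f0.
Let mu_ j : measurable_fun setT (u j). Proof. by case: (eigen_L2 ES j). Qed.
Let s20 : 0 < 2 * sg ^+ 2. Proof. by rewrite mulr_gt0// exprn_gt0. Qed.

Definition dat n (z : npow (X * RR)%type n) : seq (X * R) := map (obs f0) (nlist z).

Lemma measurable_lik_dat dA (A : measurableType dA) (F : A -> X -> R) n :
  measurable_fun setT (fun z : A * X => F z.1 z.2) ->
  measurable_fun setT (fun z : A * npow (X * RR)%type n => lik sg (F z.1) (dat z.2)).
Proof.
move=> mF; pose g (a : A) (y : X * RR) := expR (- (((obs f0 y).2 - F a y.1) ^+ 2 / (2 * sg ^+ 2))).
have mg : measurable_fun setT (fun z : A * (X * RR) => g z.1 z.2).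
  apply: measurableT_comp => //; apply: measurableT_comp => //; apply: measurable_funM => //.
  apply: measurable_funX; apply: measurable_funB.
    rewrite /obs /=; apply: measurable_funD.
      exact: measurableT_comp mf0 (measurableT_comp measurable_fst measurable_snd).
    exact: measurableT_comp measurable_snd measurable_snd.
  have sw : measurable_fun setT (fun z : A * (X * RR) => (z.1, z.2.1)).
    apply: measurable_fun_pair; first exact: measurable_fst.
    exact: measurableT_comp measurable_fst measurable_snd.
  exact: measurableT_comp mF sw.
have := @measurable_nlist_prod _ _ _ _ _ g n mg.
by congr (measurable_fun _ _); apply/funext => z; rewrite /lik /dat big_map.
Qed.

Definition evid (m : nat) (t : R) (D : seq (X * R)) : \bar R :=
  (\int[npr N01 m]_xi (lik sg (Wf (hb lam u t) (iota 0 m) xi) D)%:E)%E.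

(** A lower limit exists for all data, is measurable, and fits Fatou's lemma; for designs off [N] it
    is the true integrated likelihood ratio. *)
Definition evid_lim (t : R) (D : seq (X * R)) : \bar R :=
  limn_einf (fun m => evid m t D * ((lik sg f0 D)^-1)%:E)%E.

Lemma evid_ge0 m t D : (0 <= evid m t D)%E.
Proof. by apply: integral_ge0 => xi _; rewrite lee_fin lik_ge0. Qed.

Lemma measurable_evid m n :
  measurable_fun setT (fun z : RR * npow (X * RR)%type n => evid m z.1 (dat z.2)).
Proof.
have := @gp_lik_measurable _ _ _ lam u sg (iota 0 m) n f0 mf0 mu_.
by rewrite size_iota.
Qed.

Lemma lik_gt0 (f : X -> R) D : 0 < lik sg f D. Proof. by rewrite likE expR_gt0. Qed.

Lemma measurable_lik0V n : measurable_fun setT (fun z : npow (X * RR)%type n => (lik sg f0 (dat z))^-1).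
Proof.
under eq_fun do rewrite likE -expRN.
apply: measurableT_comp => //; apply: measurableT_comp => //; apply: measurableT_comp => //.
apply: measurable_funM => //; under eq_fun do rewrite /dat big_map.
apply: (@measurable_nlist_sum1 _ _ (X * RR)%type (fun y => ((obs f0 y).2 - f0 (obs f0 y).1) ^+ 2)).
apply: measurable_funX; apply: measurable_funB.
  by apply: measurable_funD; [exact: measurableT_comp mf0 measurable_fst|exact: measurable_snd].
exact: measurableT_comp mf0 measurable_fst.
Qed.

Lemma measurable_evid_ratio m n :
  measurable_fun setT (fun z : RR * npow (X * RR)%type n => evid m z.1 (dat z.2) * ((lik sg f0 (dat z.2))^-1)%:E)%E.
Proof.
apply: emeasurable_funM; first exact: measurable_evid.
apply/measurable_EFinP; exact: (measurableT_comp (@measurable_lik0V n) measurable_snd).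
Qed.

Lemma measurable_evid_lim n :
  measurable_fun setT (fun z : RR * npow (X * RR)%type n => evid_lim z.1 (dat z.2)).
Proof. by apply: measurable_fun_limn_einf => m; exact: measurable_evid_ratio. Qed.

Lemma evidE m t D : evid m t D = (\int[npr N01 m]_xi lik sg (Wf (hb lam u t) (iota 0 m) xi) D)%:E.
Proof.
rewrite /Rintegral fineK//; apply: (integrable_fin_num measurableT).
apply: (@bounded_integrable _ _ _ (npr N01 m) _ 1).
  by apply: measurable_lik => x; exact: measurable_Wf.
by move=> xi; rewrite ger0_norm ?lik_ge0 ?lik_le1.
Qed.

Lemma evid_cvg t D : 0 < t -> (forall z, z \in D -> ~ N z.1) ->
  evid m t D @[m --> \oo] --> (\int[P]_om (lik sg (W t om) D)%:E)%E.
Proof.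
move=> t0 gD.
have -> : (\int[P]_om (lik sg (W t om) D)%:E = (\int[P]_om lik sg (W t om) D)%:E)%E.
  rewrite /Rintegral fineK//; apply: (integrable_fin_num measurableT).
  apply: (@bounded_integrable _ _ _ P _ 1).
    by apply: measurable_lik => x; exact: (gp_measurable_om GP).
  by move=> om; rewrite ger0_norm ?lik_ge0 ?lik_le1.
under eq_fun do rewrite evidE.
apply: cvg_EFin; first exact: nearW.
exact: (lik_heat_cvg SD ES GP sg0 t0 gD).
Qed.

Lemma evid_limE t D : 0 < t -> (forall z, z \in D -> ~ N z.1) ->
  evid_lim t D = ((\int[P]_om (lik sg (W t om) D)%:E) * ((lik sg f0 D)^-1)%:E)%E.
Proof.
move=> t0 gD; have h : (evid m t D * ((lik sg f0 D)^-1)%:E @[m --> \oo] -->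
    (\int[P]_om (lik sg (W t om) D)%:E) * ((lik sg f0 D)^-1)%:E)%E.
  by apply: cvgeZr => //; exact: evid_cvg.
by rewrite /evid_lim; have [-> _] := cvg_limn_einf_sup h.
Qed.

(** For one observation, the ratio times the noise density is the normal density centred at f x - f0
    x, which integrates to 1. *)
Lemma lik_ratio_noise (f : X -> R) n : measurable_fun setT f ->
  (\int[npr (noise mu0 sg) n]_z (lik sg f (dat z) / lik sg f0 (dat z))%:E = 1)%E.
Proof.
move=> mf; have sgn0 : sg != 0 by rewrite gt_eqF.
pose g (y : X * RR) := expR (((obs f0 y).2 - f0 y.1) ^+ 2 / (2 * sg ^+ 2) - ((obs f0 y).2 - f y.1) ^+ 2 / (2 * sg ^+ 2)).
have mfx (h : X -> R) : measurable_fun setT h -> measurable_fun setT (fun y : X * RR => ((obs f0 y).2 - h y.1) ^+ 2 / (2 * sg ^+ 2)).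
  move=> mh; apply: measurable_funM => //; apply: measurable_funX; apply: measurable_funB.
    by apply: measurable_funD; [exact: measurableT_comp mf0 measurable_fst|exact: measurable_snd].
  exact: measurableT_comp mh measurable_fst.
have mg : measurable_fun setT g.
  by apply: measurableT_comp => //; apply: measurable_funB; exact: mfx.
have g0 y : 0 <= g y by exact: expR_ge0.
have g1 : (\int[noise mu0 sg]_y (g y)%:E = 1%:E)%E.
  rewrite integral_noise//; last exact/measurable_EFinP.
  rewrite -[RHS](integral_prob_cst mu0); apply: eq_integral => x _.
  rewrite -(integral_normal_pdf (f x - f0 x) sg).
  apply: eq_integral => e _; rewrite -EFinM; congr EFin.
  rewrite !normal_pdf_expE// /g /obs /= -mulrA -expRD; congr (_ * expR _).
  by field.
have := npr_prod n mg g0 g1; rewrite expr1n => <-.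
apply: eq_integral => z _; congr EFin.
rewrite !likE -expRN -expRD opprK -expR_sum; congr expR.
by rewrite /dat !big_map sumrB !mulr_suml addrC.
Qed.

Lemma evid_noise m t n :
  (\int[npr (noise mu0 sg) n]_z (evid m t (dat z) * ((lik sg f0 (dat z))^-1)%:E) = 1)%E.
Proof.
have mW1 x : measurable_fun setT (fun xi : npow RR m => Wf (hb lam u t) (iota 0 m) xi x) by exact: measurable_Wf.
have lp D : 0 < lik sg f0 D by exact: lik_gt0.
have mWf : measurable_fun setT (fun z : npow RR m * X => Wf (hb lam u t) (iota 0 m) z.1 z.2).
  have mhb j : measurable_fun setT (hb lam u t j) by exact: measurable_funM.
  have h := @measurable_zip_sum _ _ X _ (iota 0 m) (hb lam u t) m mhb.
  have sw : measurable_fun setT (fun z : npow RR m * X => (z.2, z.1)).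
    by apply: measurable_fun_pair; [exact: measurable_snd|exact: measurable_fst].
  have := measurableT_comp h sw.
  congr (measurable_fun _ _); apply/funext => z /=; rewrite /Wf.
  by apply: eq_bigr => p _; rewrite mulrC.
have mL := measurable_lik_dat (n := n) mWf.
pose F (z : npow RR m * npow (X * RR)%type n) :=
  (lik sg (Wf (hb lam u t) (iota 0 m) z.1) (dat z.2) / lik sg f0 (dat z.2))%:E.
have mF : measurable_fun setT F.
  apply/measurable_EFinP; apply: measurable_funM => //.
  exact: (measurableT_comp (@measurable_lik0V n) measurable_snd).
have F0 z : (0 <= F z)%E by rewrite lee_fin divr_ge0 ?lik_ge0.
rewrite (eq_integral (fun z => \int[npr N01 m]_xi F (xi, z))%E); last first.
  move=> z _; rewrite /evid /F /= -ge0_integralZr//.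
  - by apply/measurable_EFinP; apply: measurable_lik => x; exact: mW1.
  - by move=> xi _; rewrite lee_fin lik_ge0.
  - by rewrite lee_fin invr_ge0 ltW.
rewrite -(fubini_tonelli (m1 := npr N01 m) (m2 := npr (noise mu0 sg) n) _ mF F0).
rewrite -[RHS](integral_prob_cst (npr N01 m)); apply: eq_integral => xi _.
have mf : measurable_fun setT (Wf (hb lam u t) (iota 0 m) xi).
  exact: (measurableT_comp mWf (measurable_pair1 xi)).
exact: (@lik_ratio_noise _ _ mf).
Qed.

Lemma evid_lim_noise t n : (\int[npr (noise mu0 sg) n]_z evid_lim t (dat z) <= 1)%E.
Proof.
have mE m : measurable_fun setT (fun z : npow (X * RR)%type n => (evid m t (dat z) * ((lik sg f0 (dat z))^-1)%:E)%E).
  have := measurableT_comp (@measurable_evid_ratio m n) (@measurable_pair1 _ _ RR (npow (X * RR)%type n) t).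
  by apply.
apply: le_trans (fatou _ measurableT mE _) _.
  by move=> m z _; apply: mule_ge0 (evid_ge0 _ _ _) _; rewrite lee_fin invr_ge0 ltW// lik_gt0.
under eq_fun do rewrite evid_noise.
by rewrite is_cvg_limn_einfE; [rewrite lim_cst|exact: is_cvg_cst].
Qed.

(* Lower bound by the exponential of minus (residual + Kullback-Leibler) cost of
   recentring the first J0 coordinates of the prior at those of f0. *)
Lemma evid_lower t D (th tau : nat -> R) J0 (r0 : X -> R) B : 0 < t -> (forall z, z \in D -> ~ N z.1) ->
  (forall x, f0 x = lcomb u th J0 x + r0 x) -> (forall j, 0 < tau j) ->
  (forall m, (J0 <= m)%N ->
    \sum_(j < m) (tau j ^+ 2 * (\sum_(z <- D) hb lam u t j z.1 ^+ 2) / (2 * sg ^+ 2) +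
      klg (if (j < J0)%N then th j * expR (t * lam j / 2) else 0) (tau j)) <= B) ->
  ((expR (- ((\sum_(z <- D) (z.2 - f0 z.1 + r0 z.1) ^+ 2) / (2 * sg ^+ 2) + B)))%:E
    <= \int[P]_om (lik sg (W t om) D)%:E)%E.
Proof.
move=> t0 gD f0E tau0 hB; have h := evid_cvg t0 gD.
rewrite -(cvg_lim _ h)//; apply: lime_ge; first by apply/cvg_ex; eexists; exact: h.
exists J0 => // m /= Jm.
pose a j := if (j < J0)%N then th j * expR (t * lam j / 2) else 0.
have := @evidence_lower _ _ _ sg sg0 (hb lam u t) a tau (iota 0 m) D m (fun=> 0) (size_iota _ _) tau0.
have iE (F : nat -> R) : \sum_(j <- iota 0 m) F j = \sum_(j < m) F j.
  by rewrite -(big_mkord xpredT F) /index_iota subn0.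
have aE x : \sum_(j <- iota 0 m) a j * hb lam u t j x = f0 x - r0 x.
  rewrite iE f0E addrK /lcomb (big_ord_widen _ (fun j => th j * u j x) Jm) [RHS]big_mkcond/=.
  apply: eq_bigr => j _; rewrite /a; case: ifP => _; last by rewrite mul0r.
  by rewrite /hb -mulrA (mulrA (expR _)) -expRD subrr expR0 mul1r.
move=> h1; apply: le_trans (le_trans h1 _); last first.
  rewrite /evid le_eqVlt; apply/orP; left; apply/eqP; apply: eq_integral => xi _.
  by congr (lik sg _ D)%:E; apply/funext => x; rewrite add0r.
rewrite lee_fin ler_expR lerN2; apply: lerD; last by rewrite iE hB.
rewrite le_eqVlt; apply/orP; left; apply/eqP; congr (_ / _); apply: eq_bigr => z _.
by rewrite aE; congr (_ ^+ 2); lra.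
Qed.

End evidence.

(** * Upper bound for the numerator *)

Section exp_int.
Context {R : realType} {dX} {X : measurableType dX} (mu : {finite_measure set X -> \bar R}).

(** Jensen's inequality through the tangent of exp at T' = T + 1 / m, with m the total mass. The
    slack 1 / m gives m exp(T') >= exp(T) whatever the size of m. *)
Lemma exp_int (h : X -> R) b T : L2 mu h -> 0 < fine (mu setT) -> 0 < b ->
  (\int[mu]_x (expR (b * h x ^+ 2))%:E <= (expR T)%:E)%E ->
  b * dot mu h h <= fine (mu setT) * T + 1.
Proof.
move=> Lh m0 b0 hT; set m := fine (mu setT) in m0 *.
have mh : measurable_fun setT h by case: Lh.
pose T' := T + m^-1.
have mE : measurable_fun setT (fun x => expR (b * h x ^+ 2)).
  apply: measurableT_comp => //; apply: measurable_funM => //; exact: measurable_funX.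
have iE : mu.-integrable setT (EFin \o (fun x => expR (b * h x ^+ 2))).
  apply/integrableP; split; first exact/measurable_EFinP.
  under eq_integral do rewrite /= ger0_norm ?expR_ge0//.
  by apply: le_lt_trans hT _; rewrite ltry.
have i1 : mu.-integrable setT (EFin \o (fun=> expR T' * (1 - T'))) by exact: finite_measure_integrable_cst.
have i2 : mu.-integrable setT (EFin \o (fun x => expR T' * b * (h x ^+ 2))).
  by case: Lh => _ ih; exact: (integrableZl measurableT (expR T' * b) ih).
have h1 : \int[mu]_x (expR T' * (1 - T') + expR T' * b * (h x ^+ 2)) <= \int[mu]_x expR (b * h x ^+ 2).
  apply: le_Rintegral => //; first exact: integrableD_EFin.
  move=> x _; rewrite -mulrA -mulrDr.
  have := expR_ge1Dx (b * h x ^+ 2 - T').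
  rewrite -(ler_pM2l (expR_gt0 T')) -expRD (addrC T') subrK.
  by apply: le_trans; rewrite ler_pM2l ?expR_gt0//; lra.
have h2 : \int[mu]_x expR (b * h x ^+ 2) <= expR T.
  by rewrite -lee_fin /Rintegral fineK//; exact: (integrable_fin_num measurableT iE).
have i3 : mu.-integrable setT (EFin \o (fun x => h x ^+ 2)) by case: Lh.
rewrite (RintegralD measurableT i1 i2) (RintegralZl _ measurableT i3) in h1.
have e1 : \int[mu]_x (expR T' * (1 - T')) = expR T' * (1 - T') * m.
  exact: (congr1 fine (integral_cst_fin mu _)).
have e2 : \int[mu]_x h x ^+ 2 = dot mu h h by apply: eq_Rintegral => x _; rewrite expr2.
rewrite e1 e2 in h1; rewrite leNgt; apply/negP => hb.
have mT' : m * T + 1 = m * T' by rewrite /T' mulrDr divff// gt_eqF.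
rewrite mT' in hb.
have h3 : expR T' * m < expR T' * (1 - T') * m + expR T' * b * dot mu h h.
  have := expR_gt0 T'; move: hb; set E := expR T'; set dd := dot mu h h => hb E0.
  have : E * (m * T') < E * (b * dd) by rewrite ltr_pM2l.
  lra.
have h4 : expR T <= expR T' * m.
  rewrite /T' expRD -mulrA ler_peMr ?expR_ge0//.
  have := expR_ge1Dx m^-1; rewrite -(ler_pM2r m0) mulrDl mulVf ?gt_eqF// mul1r; move: m0; lra.
move: h1 h2 h3 h4; lra.
Qed.

End exp_int.

Section numerator.
Context {R : realType} {dX} {X : measurableType dX} {dO} {Om : measurableType dO}.
Notation RR := (measurableTypeR R).
Variables (mu : {finite_measure set X -> \bar R}) (d : R) (lam : nat -> R) (u : nat -> X -> R).
Variables (N : set X) (K : R).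
Hypothesis SD : spectral_data mu d lam u N K.
Hypothesis ES : eigen_system mu lam u.
Variables (P : probability Om R) (W : R -> Om -> X -> R).
Hypothesis GP : forall t, 0 < t -> centered_GP P (W t) (heat_cov lam u t).
Variables (mu0 : probability X R) (sg : R) (f0 : X -> R) (pp : R).
Hypothesis pp0 : 0 < pp.
Hypothesis hle : forall A, measurable A -> (mu0 A <= (pp * fine (mu A))%:E)%E.
Hypothesis Lf0 : L2 mu f0.
Hypothesis m0 : 0 < fine (mu setT).
Let m := fine (mu setT).

Variables (zs : seq (X * RR)) (J0 J2 : nat) (th : nat -> R) (r0 : X -> R) (eps2 ka C3 CB n : R).
Hypothesis J02 : (J0 <= J2)%N.
Hypothesis f0E : forall x, f0 x = lcomb u th J0 x + r0 x.
Hypothesis hr0 : dot mu r0 r0 <= CB * eps2.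
Hypothesis n1 : 1 <= n.
Hypothesis nE : n = (size zs)%:R.
Hypothesis eps0 : 0 < eps2.
Hypothesis eps1 : eps2 <= 1.
Hypothesis ka0 : 0 < ka.
Hypothesis hN : forall z, z \in zs -> ~ N z.1.
Hypothesis hE2 : \sum_(j < J2) (\sum_(z <- zs) z.2 * u j z.1) ^+ 2 <= n ^+ 2 * eps2.
Hypothesis hE3 : \sum_(z <- zs) r0 z.1 ^+ 2 <= C3 * n * eps2.
Hypothesis hE3' : `|\sum_(z <- zs) z.2 * r0 z.1| <= n * eps2.
Hypothesis hE4 : \sum_(z <- zs) z.2 ^+ 2 <= n ^+ 2.
Hypothesis hGR : forall cc : nat -> R, ka * n * \sum_(j < J2) cc j ^+ 2 <= \sum_(z <- zs) lcomb u cc J2 z.1 ^+ 2.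

Variables (t b v T M2 : R).
Hypothesis t0 : 0 < t.
Hypothesis b0 : 0 < b.
Hypothesis v0 : 0 < v.
Hypothesis hv : forall x, ~ N x -> dot P (resid mu u W t x J2) (resid mu u W t x J2) <= v.
Hypothesis bv : 32 * b * v <= 1.
Hypothesis hT1 : n * (T / b) <= eps2 ^+ 2.
Hypothesis hT2 : (m * T + 1) / b <= eps2.

Let h om x := resid mu u W t x J2 om.
Let mh : measurable_fun setT (fun z : Om * X => h z.1 z.2) := measurable_resid ES GP t0 J2.
Let mhE : measurable_fun setT (fun z : Om * X => (expR (b * h z.1 z.2 ^+ 2))%:E).
Proof.
apply/measurable_EFinP; apply: measurableT_comp => //; apply: measurable_funM => //.
exact: measurable_funX.
Qed.
Let mW := gp_measurable GP t0.
Let mW2 : measurable_fun setT (fun z : Om * X => (W t z.1 z.2 ^+ 2)%:E).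
Proof. by apply/measurable_EFinP; exact: measurable_funX. Qed.

(* By Markov, this exceeds exp(T) with probability at most exp(-T) times a polynomial in n;
   below that level all high-frequency terms in the likelihood are negligible. *)
Definition exp_energy (om : Om) : \bar R :=
  (\int[mu]_y (W t om y ^+ 2)%:E + \sum_(z <- zs) (expR (b * h om z.1 ^+ 2))%:E +
   \int[mu]_y (expR (b * h om y ^+ 2))%:E)%E.

Let e1_ge0 om : (0 <= \int[mu]_y (W t om y ^+ 2)%:E)%E.
Proof. by apply: integral_ge0 => y _; rewrite lee_fin sqr_ge0. Qed.
Let e2_ge0 om : (0 <= \sum_(z <- zs) (expR (b * h om z.1 ^+ 2))%:E)%E.
Proof. by apply: sume_ge0 => z _; rewrite lee_fin expR_ge0. Qed.
Let e3_ge0 om : (0 <= \int[mu]_y (expR (b * h om y ^+ 2))%:E)%E.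
Proof. by apply: integral_ge0 => y _; rewrite lee_fin expR_ge0. Qed.

Let m1 : measurable_fun setT (fun om => \int[mu]_y (W t om y ^+ 2)%:E)%E.
Proof. by apply: (measurable_fun_fubini_tonelli_F (m2 := mu) _ mW2) => z; rewrite lee_fin sqr_ge0. Qed.
Let m3 : measurable_fun setT (fun om => \int[mu]_y (expR (b * h om y ^+ 2))%:E)%E.
Proof. by apply: (measurable_fun_fubini_tonelli_F (m2 := mu) _ mhE) => z; rewrite lee_fin expR_ge0. Qed.
Let m2 : measurable_fun setT (fun om => \sum_(z <- zs) (expR (b * h om z.1 ^+ 2))%:E)%E.
Proof. by apply: emeasurable_sum => z; exact: (measurableT_comp mhE (measurable_pair2 z.1)). Qed.

Lemma exp_energy_ge0 om : (0 <= exp_energy om)%E.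
Proof. exact: adde_ge0 (adde_ge0 (e1_ge0 om) (e2_ge0 om)) (e3_ge0 om). Qed.

Lemma measurable_exp_energy : measurable_fun setT exp_energy.
Proof. by apply: emeasurable_funD => //; exact: emeasurable_funD. Qed.

Lemma integral_exp_energy : (\int[P]_om exp_energy om <= (K / (Num.min t 1) `^ (d / 2) * m + 4 * n + 4 * m)%:E)%E.
Proof.
rewrite /exp_energy ge0_integralD//; last 2 first.
- by move=> om _; rewrite adde_ge0.
- exact: emeasurable_funD.
rewrite ge0_integralD// !EFinD; apply: leeD; last first.
  have -> : (\int[P]_om \int[mu]_y (expR (b * h om y ^+ 2))%:E = \int[mu]_y \int[P]_om (expR (b * h om y ^+ 2))%:E)%E.
    by apply: (fubini_tonelli (m1 := P) (m2 := mu) _ mhE) => z; rewrite lee_fin expR_ge0.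
  rewrite -integral_cst_fin; apply: ae_ge0_le_integral => //.
  - by move=> y _; apply: integral_ge0 => om _; rewrite lee_fin expR_ge0.
  - by apply: (measurable_fun_fubini_tonelli_G (m1 := P) _ mhE) => z; rewrite lee_fin expR_ge0.
  - apply: filterS (ae_notN SD) => y Ny _.
    exact: (resid_expR SD ES GP t0 Ny (ltW b0) v0 (hv Ny) bv).
apply: leeD; first exact: (W_sqr_integral SD ES GP t0).
rewrite ge0_integral_sum//.
- rewrite nE; elim: (zs) hN => [|z s ih] hs; first by rewrite big_nil mulr0.
  rewrite big_cons /= -[(size s).+1]addn1 natrD mulrDr mulr1 EFinD addeC; apply: leeD.
    have Nz : ~ N z.1 by apply: hs; rewrite mem_head.
    exact: (resid_expR SD ES GP t0 Nz (ltW b0) v0 (hv Nz) bv).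
  by apply: ih => w ws; apply: hs; rewrite in_cons ws orbT.
- by move=> z; exact: (measurableT_comp mhE (measurable_pair2 z.1)).
Qed.

Let Bset (f : X -> R) : Prop := (M2%:E < \int[mu0]_x ((f x - f0 x) ^+ 2)%:E)%E.

(** At squared mu0-distance above [M2], the squared coefficients of f - f0 sum to at least (M2 / (2
    pp eps2) - 2 - 2 CB) eps2; this is inserted in [lik_gap]. *)
Definition num_gap : R :=
  (ka / 4 * (M2 / (2 * pp * eps2) - 2 - 2 * CB) - (6 + 2 * C3 + 4 / ka)) * n * eps2.

Let D := map (obs f0) zs.

Lemma lik_far om : (exp_energy om <= (expR T)%:E)%E -> Bset (W t om) ->
  lik sg (W t om) D <= lik sg f0 D * expR (- (num_gap / (2 * sg ^+ 2))).
Proof.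
move=> hx hB.
have x1 : (\int[mu]_y (W t om y ^+ 2)%:E <= (expR T)%:E)%E.
  by apply: (le_trans _ hx); rewrite /exp_energy -addeA leeDl// adde_ge0.
have x2 z : z \in zs -> expR (b * h om z.1 ^+ 2) <= expR T.
  move=> zz; rewrite -lee_fin; apply: (le_trans _ hx); rewrite /exp_energy (addeC (\int[mu]_y (W t om y ^+ 2)%:E)%E) -addeA.
  rewrite (big_rem z zz) -addeA leeDl//; apply: adde_ge0; last exact: adde_ge0.
  by apply: sume_ge0 => w _; rewrite lee_fin expR_ge0.
have x3 : (\int[mu]_y (expR (b * h om y ^+ 2))%:E <= (expR T)%:E)%E.
  by apply: (le_trans _ hx); rewrite /exp_energy leeDr// adde_ge0.
have mWo : measurable_fun setT (W t om) by exact: (measurableT_comp mW (measurable_pair1 om)).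
have LW : L2 mu (W t om).
  split => //; apply/integrableP; split; first by apply/measurable_EFinP; exact: measurable_funX.
  under eq_integral do rewrite /= ger0_norm ?sqr_ge0//.
  by apply: le_lt_trans x1 _; rewrite ltry.
pose c := coef mu u (W t om).
have WE x : W t om x = lcomb u c J2 x + h om x.
  by rewrite /h (residE ES x J2 LW) /lcomb addrC subrK.
have Lh : L2 mu (h om).
  have := L2B LW (lcomb_L2 ES c J2); congr L2; apply/funext => x; rewrite WE; lra.
have Lr0 : L2 mu r0.
  have := L2B Lf0 (lcomb_L2 ES th J0); congr L2; apply/funext => x; rewrite f0E; lra.
have hh2 : dot mu (h om) (h om) <= eps2.
  apply: le_trans hT2; rewrite ler_pdivlMr// mulrC.
  exact: exp_int.
have hhz : \sum_(z <- zs) h om z.1 ^+ 2 <= eps2 ^+ 2.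
  apply: le_trans hT1; rewrite nE mulrC mulr_natr.
  have hz z : z \in zs -> h om z.1 ^+ 2 <= T / b.
    by move=> zz; rewrite ler_pdivlMr// mulrC -ler_expR; exact: x2.
  elim: (zs) hz => [|z s ih] hs; first by rewrite big_nil mulr0n.
  rewrite big_cons mulrS lerD ?hs ?mem_head//.
  by apply: ih => w ws; apply: hs; rewrite in_cons ws orbT.
have gap := lik_gap J02 WE f0E n1 eps0 eps1 ka0 hE2 hE3 hE3' hE4 hGR hhz.
set A := \sum_(j < J2) _ in gap.
have Ll : L2 mu (lcomb u (gap_coef J0 c th) J2) by exact: (lcomb_L2 ES).
have AE : dot mu (lcomb u (gap_coef J0 c th) J2) (lcomb u (gap_coef J0 c th) J2) = A.
  by rewrite (lcomb_dot ES); apply: eq_bigr => j _; rewrite expr2.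
have Lhr : L2 mu (fun x => h om x - r0 x) by exact: L2B.
have dE : (fun x => W t om x - f0 x) = (fun x => lcomb u (gap_coef J0 c th) J2 x + (h om x - r0 x)).
  by apply/funext => x; exact: (f_gap J02 WE f0E).
have Ld : L2 mu (fun x => W t om x - f0 x) by exact: L2B.
have [Ld0 dle] := design_L2 pp0 hle Ld.
have hM : M2 < pp * (2 * A + 4 * eps2 + 4 * (CB * eps2)).
  move: hB; rewrite /Bset dot2E// lte_fin => /lt_le_trans; apply.
  apply: (le_trans dle); rewrite ler_pM2l// dE.
  apply: (le_trans (dotD2_le Ll Lhr)); rewrite AE.
  have := dotB2_le Lh Lr0; move: hh2 hr0; lra.
have Alow : (M2 / (2 * pp * eps2) - 2 - 2 * CB) * eps2 <= A.
  have e : M2 / (2 * pp * eps2) * eps2 = M2 / pp / 2 by field; rewrite !gt_eqF.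
  rewrite !mulrBl e; move: hM; rewrite -ltr_pdivrMl// mulrC; move: (M2 / pp) => q; lra.
have n0 : 0 < n := lt_le_trans ltr01 n1.
have gap2 : num_gap <= \sum_(y <- D) (y.2 - W t om y.1) ^+ 2 - \sum_(y <- D) (y.2 - f0 y.1) ^+ 2.
  apply: le_trans gap; rewrite /num_gap !mulrBl.
  have k4 : 0 <= 4^-1 * ka * n by rewrite !mulr_ge0// ltW.
  have := ler_wpM2l k4 Alow; rewrite !mulrBl => hA.
  rewrite lerD2r; apply: le_trans hA; rewrite le_eqVlt; apply/orP; left; apply/eqP; ring.
rewrite !likE -expRD ler_expR -opprD lerN2 -mulrDl.
have s2 : 0 <= (2 * sg ^+ 2)^-1 by rewrite invr_ge0 mulr_ge0 ?sqr_ge0.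
by rewrite ler_wpM2r//; move: gap2; lra.
Qed.

(** Paths of low energy obey [lik_far]; on the others the likelihood is at most 1, hence at most
    exp(-T) times the energy. The majorant is measurable, whatever the integrand on the left. *)
Lemma num_upper :
  (\int[P]_om ((\1_Bset (W t om) : R) * lik sg (W t om) D)%:E <=
   (lik sg f0 D * expR (- (num_gap / (2 * sg ^+ 2))) +
    expR (- T) * (K / (Num.min t 1) `^ (d / 2) * m + 4 * n + 4 * m))%:E)%E.
Proof.
set c0 := lik sg f0 D * _.
have c00 : 0 <= c0 by rewrite mulr_ge0 ?lik_ge0 ?expR_ge0.
apply: (@le_trans _ _ (\int[P]_om (c0%:E + (expR (- T))%:E * exp_energy om))%E).
  apply: le_lower_integral => om _.
    by rewrite lee_fin mulr_ge0 ?lik_ge0.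
  have [hx|hx] := leP (exp_energy om) (expR T)%:E.
    apply: (@le_trans _ _ c0%:E); last by rewrite leeDl// mule_ge0 ?lee_fin ?expR_ge0// exp_energy_ge0.
    rewrite lee_fin indicE; have [/set_mem hB|_] := boolP (_ \in _); last by rewrite mul0r.
    by rewrite mul1r; exact: lik_far.
  apply: (@le_trans _ _ 1%E).
    rewrite lee_fin indicE; case: (_ \in _); rewrite ?mul0r// mul1r; exact: lik_le1.
  apply: (@le_trans _ _ ((expR (- T))%:E * exp_energy om)%E); last by rewrite leeDr ?lee_fin.
  have -> : (1%E = (expR (- T))%:E * (expR T)%:E :> \bar R)%E by rewrite -EFinM -expRD addNr expR0.
  by apply: lee_wpmul2l; [rewrite lee_fin expR_ge0|exact: ltW].
rewrite ge0_integralD//; last 2 first.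
- by move=> om _; rewrite mule_ge0 ?lee_fin ?expR_ge0// exp_energy_ge0.
- by apply: measurable_funeM; exact: measurable_exp_energy.
rewrite integral_prob_cst EFinD leeD2l//.
rewrite ge0_integralZl_EFin ?expR_ge0//; last 2 first.
- by move=> om _; exact: exp_energy_ge0.
- exact: measurable_exp_energy.
by rewrite EFinM lee_wpmul2l ?lee_fin ?expR_ge0//; exact: integral_exp_energy.
Qed.

End numerator.

(** * The posterior for fixed n *)

Lemma le_lower_integral_sub {R : realType} {d} {T : measurableType d} (m : {measure set T -> \bar R})
    (A B : set T) (f g : T -> \bar R) : A `<=` B -> (forall x, A x -> 0 <= f x)%E ->
  (forall x, A x -> f x <= g x)%E -> (forall x, B x -> 0 <= g x)%E ->
  (\int[m]_(x in A) f x <= \int[m]_(x in B) g x)%E.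
Proof.
move=> AB f0 fg g0; rewrite [leLHS]integral_mkcond [leRHS]integral_mkcond.
apply: le_lower_integral => x _; rewrite !patchE.
  by case: ifPn => // /set_mem; exact: f0.
have [/set_mem Ax|_] := boolP (x \in A).
  by have /mem_set -> := AB _ Ax; exact: fg.
by case: ifPn => // /set_mem; exact: g0.
Qed.

Lemma fine_ratio_le1 {R : realType} (x y : \bar R) : (0 <= x)%E -> (x <= y)%E -> (y <= 1)%E ->
  0 <= fine x / fine y <= 1.
Proof.
case: x y => [x||] [y||]//=; rewrite !lee_fin => x0 xy y1.
rewrite divr_ge0 ?(le_trans x0)//=.
have [->|y0] := eqVneq y 0; first by rewrite invr0 mulr0.
by rewrite ler_pdivrMr ?mul1r// lt_def y0 (le_trans x0).
Qed.

Lemma fine_ratio_le {R : realType} (x y : \bar R) (L : R) : (0 <= x)%E -> (x <= y)%E -> (y <= 1)%E ->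
  0 < L -> (L%:E <= y)%E -> ((fine x / fine y)%:E <= (L^-1)%:E * x)%E.
Proof.
case: x y => [x||] [y||]//=; rewrite !lee_fin => x0 xy y1 L0 Ly.
by rewrite mulrC ler_wpM2r// lef_pV2// posrE (lt_le_trans L0).
Qed.

Section posterior.
Context {R : realType} {dX} {X : measurableType dX} {dO} {Om : measurableType dO}.
Notation RR := (measurableTypeR R).
Notation leb := (@lebesgue_measure R).
Variables (mu : {finite_measure set X -> \bar R}) (d : R) (lam : nat -> R) (u : nat -> X -> R).
Variables (N : set X) (K : R).
Hypothesis SD : spectral_data mu d lam u N K.
Hypothesis ES : eigen_system mu lam u.
Variables (P : probability Om R) (W : R -> Om -> X -> R).
Hypothesis GP : forall t, 0 < t -> centered_GP P (W t) (heat_cov lam u t).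
Variables (mu0 : probability X R) (sg : R) (f0 : X -> R).
Hypothesis sg0 : 0 < sg.
Hypothesis mf0 : measurable_fun setT f0.
Variables (pi1 : R -> R).
Hypothesis mpi : measurable_fun setT pi1.
Hypothesis pi0 : forall t, 0 < t -> 0 <= pi1 t.
Hypothesis pi_mass : (\int[leb]_(t in [set t : R | (0 < t)%R]) (pi1 t)%:E = 1)%E.
Let pos : set R := [set t | 0 < t].
Let mpos : measurable pos.
Proof.
have -> : pos = `]0, +oo[%classic by apply/seteqP; split => x /=; rewrite in_itv /= andbT.
exact: measurable_itv.
Qed.
Let mpiE (A : set R) : measurable_fun A (EFin \o pi1).
Proof. by apply/measurable_EFinP; exact: measurable_funTS. Qed.

Variable B : (X -> R) -> Prop.
Let den D := prior_int pi1 P W (fun f => (lik sg f D)%:E).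
Let num D := prior_int pi1 P W (fun f => ((\1_B f : R) * lik sg f D)%:E).
Let lik0 (f : X -> R) D : (0 <= (lik sg f D)%:E)%E. Proof. by rewrite lee_fin lik_ge0. Qed.
Let indlik0 (f : X -> R) D : (0 <= ((\1_B f : R) * lik sg f D)%:E)%E.
Proof. by rewrite lee_fin mulr_ge0 ?lik_ge0. Qed.

Let num_den D : (num D <= den D)%E.
Proof.
apply: le_lower_integral => t t0.
  by rewrite mule_ge0 ?lee_fin ?pi0//; apply: integral_ge0.
apply: lee_wpmul2l; first by rewrite lee_fin pi0.
apply: le_lower_integral => om _; first exact: indlik0.
by rewrite lee_fin ler_piMl ?lik_ge0// indicE; case: (_ \in _).
Qed.

Let den1 D : (den D <= 1)%E.
Proof.
rewrite -pi_mass; apply: le_lower_integral => t t0.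
  by rewrite mule_ge0 ?lee_fin ?pi0//; apply: integral_ge0 => om _; exact: lik0.
rewrite -[leRHS]mule1; apply: lee_wpmul2l; first by rewrite lee_fin pi0.
rewrite -(integral_prob_cst P 1%E); apply: le_lower_integral => om _; first exact: lik0.
by rewrite lee_fin lik_le1.
Qed.

Let num0 D : (0 <= num D)%E.
Proof.
by apply: integral_ge0 => t t0; rewrite mule_ge0 ?lee_fin ?pi0//; apply: integral_ge0.
Qed.

Lemma posterior_ge0 D : 0 <= posterior pi1 P W sg B D.
Proof. by have /andP[] := fine_ratio_le1 (num0 D) (num_den D) (den1 D). Qed.

Lemma posterior_le1 D : posterior pi1 P W sg B D <= 1.
Proof. by have /andP[] := fine_ratio_le1 (num0 D) (num_den D) (den1 D). Qed.

(* [evid_lim] replaces the integrated likelihood ratio, which is only known to be measurable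
   in t for almost every design. *)
Definition small_scale (tlow : R) n (z : npow (X * RR)%type n) : \bar R :=
  (\int[leb]_(t in [set t : R | (0 < t < tlow)%R]) ((pi1 t)%:E * evid_lim lam u sg f0 t (dat f0 z)))%E.

Let D0 tlow : set R := [set t : R | (0 < t < tlow)%R].
Let mD0 tlow : measurable (D0 tlow).
Proof.
have -> : D0 tlow = `]0, tlow[%classic by apply/seteqP; split => x /=; rewrite in_itv.
exact: measurable_itv.
Qed.

Lemma evid_lim_ge0 t D : (0 <= evid_lim lam u sg f0 t D)%E.
Proof.
rewrite /evid_lim limn_einf_lim; apply: lime_ge; first exact: is_cvg_einfs.
apply: nearW => k; apply: le_ereal_inf_tmp => _ [j _ <-].
by rewrite mule_ge0 ?evid_ge0// lee_fin invr_ge0 ltW// lik_gt0.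
Qed.

Let mEl n (z : npow (X * RR)%type n) (A : set RR) :
  measurable_fun A (fun t : RR => evid_lim lam u sg f0 t (dat f0 z)).
Proof.
apply: measurable_funTS.
exact: (measurableT_comp (measurable_evid_lim ES sg mf0 (n := n)) (measurable_pair2 z)).
Qed.

Lemma small_scale_ge0 tlow n (z : npow (X * RR)%type n) : (0 <= small_scale tlow z)%E.
Proof.
apply: integral_ge0 => t /= /andP[t0 _].
by rewrite mule_ge0 ?evid_lim_ge0// lee_fin pi0.
Qed.

(** The denominator is restricted to scales in [t1, t2]. The numerator is split at [tlow]: above,
    the hypothesis gives [gam]; below, the indicator is dropped and the likelihood ratio kept. The
    likelihood of f0 cancels. *)
Lemma posterior_upper tlow t1 t2 gam L w n (z : npow (X * RR)%type n) :
  (forall y, y \in dat f0 z -> ~ N y.1) ->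
  0 < tlow -> 0 <= gam ->
  (forall t, tlow <= t ->
    (\int[P]_om ((\1_B (W t om) : R) * lik sg (W t om) (dat f0 z))%:E <= (lik sg f0 (dat f0 z) * gam)%:E)%E) ->
  0 < t1 -> 0 < L ->
  (forall t, t1 <= t <= t2 ->
    ((lik sg f0 (dat f0 z) * L)%:E <= \int[P]_om (lik sg (W t om) (dat f0 z))%:E)%E) ->
  0 < w -> (w%:E <= \int[leb]_(t in [set t : R | (t1 <= t <= t2)%R]) (pi1 t)%:E)%E ->
  ((posterior pi1 P W sg B (dat f0 z))%:E <= ((L * w)^-1)%:E * (gam%:E + small_scale tlow z))%E.
Proof.
move=> hD tl0 g0 hA t10 L0 hE w0 hw; set D := dat f0 z in hD hA hE *.
set l0 := lik sg f0 D; have l00 : 0 < l0 by exact: lik_gt0.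
have hden : ((l0 * L * w)%:E <= den D)%E.
  rewrite EFinM; apply: (le_trans (lee_wpmul2l _ hw)); first by rewrite lee_fin mulr_ge0// ltW.
  have mD1 : measurable [set t : R | (t1 <= t <= t2)%R].
    have -> : [set t : R | (t1 <= t <= t2)%R] = `[t1, t2]%classic by apply/seteqP; split => x /=; rewrite in_itv.
    exact: measurable_itv.
  have pos1 : [set t : R | (t1 <= t <= t2)%R] `<=` pos by move=> t /= /andP[h _]; exact: lt_le_trans h.
  rewrite -ge0_integralZl//; last 3 first.
  - exact: mpiE.
  - by move=> t /pos1 ht; rewrite lee_fin pi0.
  - by rewrite lee_fin mulr_ge0// ltW.
  apply: le_lower_integral_sub => //.
  - by move=> t /pos1 ht; rewrite -EFinM lee_fin mulr_ge0 ?pi0// mulr_ge0// ltW.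
  - move=> t ht; rewrite muleC; apply: lee_wpmul2l; first by rewrite lee_fin pi0//; exact: pos1.
    exact: hE.
  - by move=> t ht; rewrite mule_ge0 ?lee_fin ?pi0//; apply: integral_ge0 => om _; exact: lik0.
have hnum : (num D <= l0%:E * (gam%:E + small_scale tlow z))%E.
  have mg : measurable_fun pos (fun t => (pi1 t * gam)%:E).
    by apply/measurable_EFinP; apply: measurable_funTS; exact: measurable_funM.
  have ig : (\int[leb]_(t in pos) (pi1 t * gam)%:E = gam%:E)%E.
    under eq_integral do rewrite mulrC EFinM.
    rewrite ge0_integralZl ?lee_fin//; first by rewrite pi_mass mule1.
      exact: mpiE.
  pose F (t : R) := ((pi1 t)%:E * evid_lim lam u sg f0 t D)%E.
  have mF A : measurable_fun A F by apply: emeasurable_funM; [exact: mpiE|exact: mEl].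
  have F0 t : pos t -> (0 <= F t)%E by move=> ht; rewrite mule_ge0 ?evid_lim_ge0// lee_fin pi0.
  have D0pos : D0 tlow `<=` pos by move=> t /= /andP[].
  have iE : small_scale tlow z = (\int[leb]_(t in pos) (F \_ (D0 tlow)) t)%E.
    by rewrite -integral_mkcondr setIidr.
  have mE : measurable_fun pos (F \_ (D0 tlow)).
    by apply/measurable_restrict => //; exact: mF.
  have E0 t : pos t -> (0 <= (F \_ (D0 tlow)) t)%E.
    by move=> ht; rewrite patchE; case: ifP => // _; exact: F0.
  rewrite iE -ig -ge0_integralD//; last by move=> t ht; rewrite lee_fin mulr_ge0 ?pi0.
  rewrite -ge0_integralZl ?lee_fin ?(ltW l00)//; last 2 first.
  - exact: emeasurable_funD.
  - by move=> t ht; rewrite adde_ge0 ?E0// lee_fin mulr_ge0 ?pi0.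
  apply: le_lower_integral => t ht.
    by rewrite mule_ge0 ?lee_fin ?pi0//; apply: integral_ge0 => om _; exact: indlik0.
  have [tl|tl] := leP tlow t.
    apply: (@le_trans _ _ (l0%:E * (pi1 t * gam)%:E)%E); last first.
      by apply: lee_wpmul2l; [rewrite lee_fin ltW|rewrite leeDl// E0].
    have -> : (l0%:E * (pi1 t * gam)%:E = (pi1 t)%:E * (l0 * gam)%:E)%E by rewrite -!EFinM mulrCA.
    by apply: lee_wpmul2l; [rewrite lee_fin pi0|exact: hA].
  apply: (@le_trans _ _ (l0%:E * F t)%E); last first.
    apply: lee_wpmul2l; first by rewrite lee_fin ltW.
    by rewrite patchE mem_set /D0/= ?ht//= leeDr// lee_fin mulr_ge0 ?pi0.
  rewrite /F (evid_limE SD ES GP f0 sg0 ht hD) muleCA (muleC l0%:E) -muleA -EFinM mulVf ?gt_eqF// mule1.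
  apply: lee_wpmul2l; first by rewrite lee_fin pi0.
  apply: le_lower_integral => om _; first exact: indlik0.
  by rewrite lee_fin ler_piMl ?lik_ge0// indicE; case: (_ \in _).
have h1 := fine_ratio_le (num0 D) (num_den D) (den1 D) (mulr_gt0 (mulr_gt0 l00 L0) w0) hden.
apply: (le_trans h1); apply: (le_trans (lee_wpmul2l _ hnum)).
  by rewrite lee_fin invr_ge0 !mulr_ge0// ltW.
rewrite muleA -EFinM -mulrA invfM mulrAC mulVf ?gt_eqF// mul1r.
exact: lexx.
Qed.

Section tonelli.
Variables (tlow : R) (n : nat).
(** The restriction to small scales is moved into an indicator, so that Tonelli applies on the whole
    product; the factor also hides scales where the prior density has no sign. *)
Let F (z : npow (X * RR)%type n * RR) : \bar R :=
  ((pi1 z.2)%:E * evid_lim lam u sg f0 z.2 (dat f0 z.1) * ((\1_(D0 tlow) z.2 : R))%:E)%E.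

Let F0 z : (0 <= F z)%E.
Proof.
rewrite /F indicE; have [/set_mem/= /andP[h _]|_] := boolP (_ \in _); last by rewrite mule0.
by rewrite mule1 mule_ge0 ?evid_lim_ge0// lee_fin pi0.
Qed.

Let mF : measurable_fun setT F.
Proof.
apply: emeasurable_funM.
  apply: emeasurable_funM.
    apply/measurable_EFinP; exact: (measurableT_comp (mpi : measurable_fun (setT : set RR) pi1) measurable_snd).
  have h := measurable_evid_lim ES sg mf0 (n := n).
  have sw : measurable_fun setT (fun z : npow (X * RR)%type n * RR => (z.2, z.1)).
    by apply: measurable_fun_pair; [exact: measurable_snd|exact: measurable_fst].
  exact: (measurableT_comp h sw).
apply/measurable_EFinP.
have mD : measurable (D0 tlow : set RR).
  have -> : D0 tlow = `]0, tlow[%classic by apply/seteqP; split => x /=; rewrite in_itv.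
  exact: measurable_itv.
exact: (measurableT_comp (@measurable_indic _ RR R setT _ mD) measurable_snd).
Qed.

Let small_scaleE z : small_scale tlow z = (\int[leb]_t F (z, t))%E.
Proof.
rewrite /small_scale integral_mkcond; apply: eq_integral => t _.
by rewrite patchE /F/= indicE; case: ifP; rewrite ?mule1 ?mule0.
Qed.

Lemma measurable_small_scale : measurable_fun setT (fun z : npow (X * RR)%type n => small_scale tlow z).
Proof.
under eq_fun do rewrite small_scaleE.
exact: (measurable_fun_fubini_tonelli_F (m2 := leb) _ mF F0).
Qed.

(** After exchanging the integrals, each scale contributes a data expectation of at most 1, and only
    the prior mass remains. *)
Lemma small_scale_noise :
  (\int[npr (noise mu0 sg) n]_z small_scale tlow z <= \int[leb]_(t in D0 tlow) (pi1 t)%:E)%E.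
Proof.
under eq_integral do rewrite small_scaleE.
rewrite (fubini_tonelli (m1 := npr (noise mu0 sg) n) (m2 := leb) _ mF F0) [leRHS]integral_mkcond.
apply: le_lower_integral => t _; first by apply: integral_ge0.
rewrite patchE; case: ifPn => [/set_mem/= /andP[h h']|h]; last first.
  by rewrite integral0_eq// => z _; rewrite /F indicE (negbTE h) mule0.
have FE z : F (z, t) = ((pi1 t)%:E * evid_lim lam u sg f0 t (dat f0 z))%E.
  by rewrite /F /= indicE mem_set /D0 /= ?h ?h'// mulr1n mule1.
under eq_integral do rewrite FE.
rewrite ge0_integralZl//; first last.
- by rewrite lee_fin pi0.
- by move=> z _; exact: evid_lim_ge0.
- exact: (measurableT_comp (measurable_evid_lim ES sg mf0 (n := n)) (measurable_pair1 t)).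
- rewrite -[leRHS]mule1; apply: lee_wpmul2l; first by rewrite lee_fin pi0.
  exact: (evid_lim_noise ES mu0 sg0 mf0).
Qed.

End tonelli.

End posterior.

(** * Probability of the bad data event *)

Section bad_event.
Context {R : realType} {dX} {X : measurableType dX}.
Notation RR := (measurableTypeR R).
Variables (mu : {finite_measure set X -> \bar R}) (lam : nat -> R) (u : nat -> X -> R).
Hypothesis ES : eigen_system mu lam u.
Variables (mu0 : probability X R) (sg : R) (pm pp : R).
Hypothesis sg0 : sg != 0.
Hypothesis pp0 : 0 < pp.
Hypothesis pm0 : 0 < pm.
Hypothesis hle : forall A, measurable A -> (mu0 A <= (pp * fine (mu A))%:E)%E.
Hypothesis hge : forall A, measurable A -> ((pm * fine (mu A))%:E <= mu0 A)%E.
Variables (N' : set X) (r0 : X -> R) (CB eps2 Br : R) (J2 : nat).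
Hypothesis mN : measurable N'.
Hypothesis muN : mu N' = 0%E.
Hypothesis Lr0 : L2 mu r0.
Hypothesis hr0 : dot mu r0 r0 <= CB * eps2.
Hypothesis hBr : forall x, ~ N' x -> r0 x ^+ 2 <= Br.
Hypothesis Br0 : 0 <= Br.
Hypothesis eps0 : 0 < eps2.
Variables (ys : seq X) (ball : X -> set X) (vmin : R).
Hypothesis mball : forall y, measurable (ball y).
Hypothesis hvmin : forall y, vmin <= fine (mu (ball y)).
Variable n : nat.
Hypothesis n0 : (0 < n)%N.
Notation Q := (noise mu0 sg).
Let nr : R := n%:R.
Let nr0 : 0 < nr. Proof. by rewrite /nr ltr0n. Qed.
Let a := dot mu0 r0 r0.

Let lin_sqr (g : X -> R) : L2 mu g ->
  (\int[npr Q n]_z ((\sum_(y <- nlist z) y.2 * g y.1) ^+ 2)%:E <= (nr * sg ^+ 2 * pp * dot mu g g)%:E)%E.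
Proof.
move=> Lg; have [Lg0 hg] := design_L2 pp0 hle Lg.
have [L1 e1 e2] := noise_L2 sg0 Lg0.
rewrite (npr_sum_sqr n L1 e1) e2 lee_fin mulrA -[leRHS]mulrA.
by rewrite ler_wpM2l// mulr_ge0 ?sqr_ge0// ltW.
Qed.

Let mlin (g : X -> R) : measurable_fun setT g ->
  measurable_fun setT (fun z : npow (X * RR)%type n => \sum_(y <- nlist z) y.2 * g y.1).
Proof.
move=> mg; apply: (measurable_nlist_sum1 (g := fun y : X * RR => y.2 * g y.1)).
apply: measurable_funM; first exact: measurable_snd.
exact: (measurableT_comp mg measurable_fst).
Qed.

Let mu_ j : measurable_fun setT (u j). Proof. by case: (eigen_L2 ES j). Qed.
Let mr0 : measurable_fun setT r0. Proof. by case: Lr0. Qed.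

Let mu0N : mu0 N' = 0%E.
Proof.
by apply/eqP; rewrite eq_le measure_ge0 andbT; have := hle mN; rewrite muN mulr0.
Qed.

Let psi2 (z : npow (X * RR)%type n) : R := (nr ^+ 2 * eps2)^-1 * \sum_(j < J2) (\sum_(y <- nlist z) y.2 * u j y.1) ^+ 2.
Let psi3 (z : npow (X * RR)%type n) : R := ((nr * eps2) ^+ 2)^-1 * (\sum_(y <- nlist z) (r0 y.1 ^+ 2 - a)) ^+ 2.
Let psi3' (z : npow (X * RR)%type n) : R := ((nr * eps2) ^+ 2)^-1 * (\sum_(y <- nlist z) y.2 * r0 y.1) ^+ 2.
Let psi4 (z : npow (X * RR)%type n) : R := (nr ^+ 2)^-1 * \sum_(y <- nlist z) y.2 ^+ 2.
(** The weight makes a term exceed 1 as soon as a ball of mu0-mass a holds fewer than n a / 4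
    points, while by Chernoff its mean is at most exp(- n a / 4). *)
Let psiG (z : npow (X * RR)%type n) : R :=
  \sum_(y <- ys) expR (nr * fine (mu0 (ball y)) / 4) * expR (- \sum_(x <- nlist z) (\1_(ball y) x.1 : R)).
(** An integer with mean 0: a value below 1 means that no design point lies in the null set. *)
Let psiN (z : npow (X * RR)%type n) : R := \sum_(x <- nlist z) (\1_N' x.1 : R).

(* Sum of Markov functionals, each at least 1 when one of the good events fails. *)
Definition bad_fun z := psi2 z + (psi3 z + (psi3' z + (psi4 z + (psiG z + psiN z)))).

Let psi2_ge0 z : 0 <= psi2 z.
Proof. by rewrite mulr_ge0 ?invr_ge0 ?mulr_ge0 ?sqr_ge0 ?(ltW eps0)//; apply: sumr_ge0 => j _; rewrite sqr_ge0. Qed.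
Let psi3_ge0 z : 0 <= psi3 z.
Proof. by rewrite mulr_ge0 ?invr_ge0 ?sqr_ge0. Qed.
Let psi3'_ge0 z : 0 <= psi3' z.
Proof. by rewrite mulr_ge0 ?invr_ge0 ?sqr_ge0. Qed.
Let psi4_ge0 z : 0 <= psi4 z.
Proof. by rewrite mulr_ge0 ?invr_ge0 ?sqr_ge0//; apply: sumr_ge0 => j _; rewrite sqr_ge0. Qed.
Let psiG_ge0 z : 0 <= psiG z.
Proof. by apply: sumr_ge0 => y _; rewrite mulr_ge0 ?expR_ge0. Qed.
Let psiN_ge0 z : 0 <= psiN z.
Proof. by apply: sumr_ge0 => y _; rewrite indicE. Qed.

Let mpsi2 : measurable_fun setT psi2.
Proof.
apply: measurable_funM => //; apply: measurable_sum => j; apply: measurable_funX; exact: mlin.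
Qed.
Let mpsi3 : measurable_fun setT psi3.
Proof.
apply: measurable_funM => //; apply: measurable_funX.
apply: (measurable_nlist_sum1 (g := fun y : X * RR => r0 y.1 ^+ 2 - a)).
apply: measurable_funB => //; apply: measurable_funX; exact: (measurableT_comp mr0 measurable_fst).
Qed.
Let mpsi3' : measurable_fun setT psi3'.
Proof. apply: measurable_funM => //; apply: measurable_funX; exact: mlin. Qed.
Let mpsi4 : measurable_fun setT psi4.
Proof.
apply: measurable_funM => //; apply: (measurable_nlist_sum1 (g := fun y : X * RR => y.2 ^+ 2)).
apply: measurable_funX; exact: measurable_snd.
Qed.
Let mind (A : set X) : measurable A ->
  measurable_fun setT (fun z : npow (X * RR)%type n => \sum_(x <- nlist z) (\1_A x.1 : R)).
Proof.
move=> mA; apply: (measurable_nlist_sum1 (g := fun y : X * RR => \1_A y.1)).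
exact: (measurableT_comp (measurable_indic mA) measurable_fst).
Qed.
Let mpsiG1 y : measurable_fun setT (fun z : npow (X * RR)%type n =>
  expR (nr * fine (mu0 (ball y)) / 4) * expR (- \sum_(x <- nlist z) (\1_(ball y) x.1 : R))).
Proof.
apply: measurable_funM => //; apply: measurableT_comp => //; apply: measurableT_comp => //.
exact: mind.
Qed.
Let mpsiG : measurable_fun setT psiG. Proof. by apply: measurable_sum => y; exact: mpsiG1. Qed.
Let mpsiN : measurable_fun setT psiN. Proof. exact: mind. Qed.

Lemma bad_fun_ge0 z : 0 <= bad_fun z.
Proof. by rewrite !addr_ge0. Qed.

Lemma measurable_bad_fun : measurable_fun setT bad_fun.
Proof. by do ! apply: measurable_funD => //. Qed.

Let ipsi2 : (\int[npr Q n]_z (psi2 z)%:E <= (sg ^+ 2 * pp * J2%:R / (nr * eps2))%:E)%E.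
Proof.
under eq_integral do rewrite EFinM -sumEFin.
rewrite ge0_integralZl_EFin ?invr_ge0 ?mulr_ge0 ?sqr_ge0 ?(ltW eps0)//; last 2 first.
- by move=> z _; apply: sume_ge0 => j _; rewrite lee_fin sqr_ge0.
- by apply: emeasurable_sum => j; apply/measurable_EFinP; apply: measurable_funX; exact: mlin.
rewrite ge0_integral_sum//; last 2 first.
- by move=> j; apply/measurable_EFinP; apply: measurable_funX; exact: mlin.
- by move=> j z _; rewrite lee_fin sqr_ge0.
apply: (@le_trans _ _ (((nr ^+ 2 * eps2)^-1)%:E * \sum_(j < J2) (nr * sg ^+ 2 * pp)%:E)%E).
  apply: lee_wpmul2l; first by rewrite lee_fin invr_ge0 mulr_ge0 ?sqr_ge0// ltW.
  apply: lee_sum => j _; have := lin_sqr (eigen_L2 ES j).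
  by rewrite (eigen_dot ES) eqxx mulr1.
rewrite sumEFin sumr_const card_ord -EFinM lee_fin -[X in _ * X]mulr_natr.
rewrite le_eqVlt; apply/orP; left; apply/eqP; field.
by rewrite !gt_eqF.
Qed.

Let a_le : a <= pp * (CB * eps2).
Proof.
have [_ h] := design_L2 pp0 hle Lr0; apply: (le_trans h).
by rewrite ler_wpM2l// ltW.
Qed.

(** The variance of r0^2 is at most its second moment, that is, at most the pointwise bound [Br]
    times the mean of r0^2. *)
Let ipsi3 : (\int[npr Q n]_z (psi3 z)%:E <= (Br * pp * CB / (nr * eps2))%:E)%E.
Proof.
under eq_integral do rewrite EFinM.
rewrite ge0_integralZl_EFin ?invr_ge0 ?sqr_ge0//; last 2 first.
- by move=> z _; rewrite lee_fin sqr_ge0.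
- apply/measurable_EFinP; apply: measurable_funX.
  apply: (measurable_nlist_sum1 (g := fun y : X * RR => r0 y.1 ^+ 2 - a)).
  apply: measurable_funB => //; apply: measurable_funX; exact: (measurableT_comp mr0 measurable_fst).
have [L0 _] := design_L2 pp0 hle Lr0.
have aeB : {ae mu0, forall x, r0 x ^+ 2 <= Br}.
  exists N'; split => // x /= h; apply: contrapT => Nx; apply: h; exact: hBr.
have [Lw hw] := L2_weight mr0 L0 Br0 aeB.
have L1 : L2 mu0 (fun=> a).
  split => //; exact: finite_measure_integrable_cst.
have one : L2 mu0 (fun=> 1).
  split => //; exact: finite_measure_integrable_cst.
have Lg : L2 mu0 (fun x => r0 x ^+ 2 - a).
  have := L2B Lw L1; congr L2; apply/funext => x; by rewrite expr2.
have [LQ e1 e2] := noise_fst_L2 sg Lg.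
pose w x := r0 x * r0 x.
have wa : dot mu0 w (fun=> a) = a * a.
  rewrite dotC -[LHS](_ : dot mu0 (fun x => a * 1) w = _); last by congr dot; apply/funext => x; rewrite mulr1.
  by rewrite (dotZl _ one Lw) dotC /a /dot; congr (_ * _); apply: eq_Rintegral => x _; rewrite mulr1.
have aa : dot mu0 (fun=> a) (fun=> a) = a * a.
  exact: (congr1 fine (integral_prob_cst mu0 (a * a)%:E)).
have w1 : dot mu0 w (fun=> 1) = a by apply: eq_Rintegral => x _; rewrite mulr1.
have a1 : dot mu0 (fun=> a) (fun=> 1) = a.
  by rewrite -[RHS](congr1 fine (integral_prob_cst mu0 a%:E)); apply: eq_Rintegral => x _; rewrite mulr1.
have gE : (fun x => r0 x ^+ 2 - a) = (fun x => w x - a) by apply/funext => x; rewrite expr2.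
have g1 : dot mu0 (fun x => r0 x ^+ 2 - a) (fun=> 1) = 0.
  by rewrite gE (dotBl Lw L1 one) w1 a1 subrr.
have g2 : dot mu0 (fun x => r0 x ^+ 2 - a) (fun x => r0 x ^+ 2 - a) <= Br * (pp * (CB * eps2)).
  rewrite gE (dotB2 Lw L1) wa aa; apply: (@le_trans _ _ (dot mu0 w w)).
    by have := sqr_ge0 a; rewrite expr2; lra.
  by apply: (le_trans hw); rewrite ler_wpM2l.
rewrite (npr_sum_sqr n LQ); last by rewrite e1.
rewrite e2 -EFinM lee_fin.
apply: (@le_trans _ _ (((nr * eps2) ^+ 2)^-1 * (nr * (Br * (pp * (CB * eps2)))))).
  by rewrite ler_wpM2l ?invr_ge0 ?sqr_ge0// ler_wpM2l// ltW.
rewrite le_eqVlt; apply/orP; left; apply/eqP; field.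
by rewrite !gt_eqF.
Qed.

Let ipsi3' : (\int[npr Q n]_z (psi3' z)%:E <= (sg ^+ 2 * pp * CB / (nr * eps2))%:E)%E.
Proof.
under eq_integral do rewrite EFinM.
rewrite ge0_integralZl_EFin ?invr_ge0 ?sqr_ge0//; last 2 first.
- by move=> z _; rewrite lee_fin sqr_ge0.
- by apply/measurable_EFinP; apply: measurable_funX; exact: mlin.
apply: (@le_trans _ _ ((((nr * eps2) ^+ 2)^-1)%:E * (nr * sg ^+ 2 * pp * (CB * eps2))%:E)%E).
  apply: lee_wpmul2l; first by rewrite lee_fin invr_ge0 sqr_ge0.
  apply: (le_trans (lin_sqr Lr0)); rewrite lee_fin ler_wpM2l//.
  by rewrite mulr_ge0 ?(ltW pp0)// mulr_ge0 ?sqr_ge0// ltW.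
rewrite -EFinM lee_fin le_eqVlt; apply/orP; left; apply/eqP; field.
by rewrite !gt_eqF.
Qed.

Let ipsi4 : (\int[npr Q n]_z (psi4 z)%:E = (sg ^+ 2 / nr)%:E)%E.
Proof.
under eq_integral do rewrite EFinM.
rewrite ge0_integralZl_EFin ?invr_ge0 ?sqr_ge0//; last 2 first.
- by move=> z _; rewrite lee_fin; apply: sumr_ge0 => y _; rewrite sqr_ge0.
- apply/measurable_EFinP; apply: (measurable_nlist_sum1 (g := fun y : X * RR => y.2 ^+ 2)).
  apply: measurable_funX; exact: measurable_snd.
rewrite (npr_sum (c := sg ^+ 2)).
- by rewrite -EFinM; congr EFin; rewrite -/nr; field; rewrite gt_eqF.
- apply: measurable_funX; exact: measurable_snd.
- by move=> y; rewrite sqr_ge0.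
have -> : (\int[Q]_y (y.2 ^+ 2)%:E = \int[Q]_y (y.2 ^+ 2 * 1)%:E)%E by apply: eq_integral => y _; rewrite mulr1.
rewrite (@noise_mul _ _ _ mu0 sg (fun=> 1) (fun e => e ^+ 2) (sg ^+ 2))//.
- by rewrite (integral_prob_cst mu0 1%E) mule1.
- by move=> e; rewrite sqr_ge0.
- exact: integral_normal_sqr.
Qed.

Let ipsiG : (\int[npr Q n]_z (psiG z)%:E <= ((size ys)%:R * expR (- (nr * (pm * vmin) / 4)))%:E)%E.
Proof.
under eq_integral do rewrite -sumEFin.
rewrite ge0_integral_sum//; last first.
  by move=> y; apply/measurable_EFinP; exact: mpsiG1.
apply: (@le_trans _ _ (\sum_(y <- ys) (expR (- (nr * (pm * vmin) / 4)))%:E)%E); last first.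
  by rewrite sumEFin lee_fin big_const_seq count_predT iter_addr addr0 mulr_natl.
apply: lee_sum => y _.
under eq_integral do rewrite EFinM.
rewrite ge0_integralZl_EFin ?expR_ge0//; last first.
  by apply/measurable_EFinP; apply: measurableT_comp => //; apply: measurableT_comp => //; exact: mind.
apply: (@le_trans _ _ ((expR (nr * fine (mu0 (ball y)) / 4))%:E * (expR (- (nr * fine (mu0 (ball y)) / 2)))%:E)%E).
  by apply: lee_wpmul2l; [rewrite lee_fin expR_ge0|exact: chernoff_count].
rewrite -EFinM -expRD lee_fin ler_expR -/nr.
have pmin : pm * vmin <= fine (mu0 (ball y)).
  apply: (@le_trans _ _ (pm * fine (mu (ball y)))); first by rewrite ler_wpM2l// ltW.
  by rewrite -lee_fin fineK ?fin_num_measure//; exact: hge.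
have := ler_wpM2l (ltW nr0) pmin; lra.
Qed.

Let ipsiN : (\int[npr Q n]_z (psiN z)%:E = 0)%E.
Proof.
rewrite (npr_sum (c := 0)) ?mulr0//.
- exact: (measurableT_comp (measurable_indic mN) measurable_fst).
- have := @noise_fst _ _ _ mu0 sg \1_N'; move=> ->//; first by rewrite integral_indic// setIT.
Qed.

Lemma integral_bad_fun : (\int[npr Q n]_z (bad_fun z)%:E <=
  (sg ^+ 2 * pp * J2%:R / (nr * eps2) + (Br * pp * CB / (nr * eps2) + (sg ^+ 2 * pp * CB / (nr * eps2) +
   (sg ^+ 2 / nr + (size ys)%:R * expR (- (nr * (pm * vmin) / 4))))))%:E)%E.
Proof.
have split (f g : npow (X * RR)%type n -> R) (bf bg : R) : measurable_fun setT f -> measurable_fun setT g ->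
    (forall z, 0 <= f z) -> (forall z, 0 <= g z) ->
    (\int[npr Q n]_z (f z)%:E <= bf%:E)%E -> (\int[npr Q n]_z (g z)%:E <= bg%:E)%E ->
    (\int[npr Q n]_z (f z + g z)%:E <= (bf + bg)%:E)%E.
  move=> mf mg f0 g0 hf hg; under eq_integral do rewrite EFinD.
  rewrite ge0_integralD//; first by rewrite EFinD leeD.
  - by move=> z _; rewrite lee_fin.
  - exact/measurable_EFinP.
  - by move=> z _; rewrite lee_fin.
  - exact/measurable_EFinP.
have md (f g : npow (X * RR)%type n -> R) : measurable_fun setT f -> measurable_fun setT g ->
  measurable_fun setT (fun z : npow (X * RR)%type n => (f z + g z : R)) by exact: measurable_funD.
have m5 := md _ _ mpsiG mpsiN; have m4 := md _ _ mpsi4 m5; have m3 := md _ _ mpsi3' m4; have m2 := md _ _ mpsi3 m3.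
have i5 : (\int[npr Q n]_z (psiG z + psiN z)%:E <= ((size ys)%:R * expR (- (nr * (pm * vmin) / 4)))%:E)%E.
  have := split _ _ _ 0 mpsiG mpsiN psiG_ge0 psiN_ge0 ipsiG; rewrite addr0; apply.
  by rewrite ipsiN.
have eq_leE (x y : \bar R) : x = y -> (x <= y)%E by move=> ->.
have i4 := split _ _ _ _ mpsi4 m5 psi4_ge0 (fun z => addr_ge0 (psiG_ge0 z) (psiN_ge0 z)) (eq_leE _ _ ipsi4) i5.
have p4 z : 0 <= psi4 z + (psiG z + psiN z) by rewrite !addr_ge0.
have i3 := split _ _ _ _ mpsi3' m4 psi3'_ge0 p4 ipsi3' i4.
have p3 z : 0 <= psi3' z + (psi4 z + (psiG z + psiN z)) by rewrite !addr_ge0.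
have i2 := split _ _ _ _ mpsi3 m3 psi3_ge0 p3 ipsi3 i3.
have p2 z : 0 <= psi3 z + (psi3' z + (psi4 z + (psiG z + psiN z))) by rewrite !addr_ge0.
exact: (split _ _ _ _ mpsi2 m2 psi2_ge0 p2 ipsi2 i2).
Qed.

Lemma bad_fun_good z : bad_fun z < 1 ->
  [/\ \sum_(j < J2) (\sum_(y <- nlist z) y.2 * u j y.1) ^+ 2 <= nr ^+ 2 * eps2,
      \sum_(y <- nlist z) r0 y.1 ^+ 2 <= (pp * CB + 1) * nr * eps2,
      `|\sum_(y <- nlist z) y.2 * r0 y.1| <= nr * eps2,
      \sum_(y <- nlist z) y.2 ^+ 2 <= nr ^+ 2 &
      (forall y, y \in ys -> nr * (pm / 4) * fine (mu (ball y)) <= \sum_(x <- nlist z) (\1_(ball y) x.1 : R))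
      /\ forall x, x \in nlist z -> ~ N' x.1].
Proof.
move=> h.
have [h2 h3 h3' h4] : [/\ psi2 z <= 1, psi3 z <= 1, psi3' z <= 1 & psi4 z <= 1].
  have := (psi2_ge0 z, psi3_ge0 z, psi3'_ge0 z, psi4_ge0 z, psiG_ge0 z, psiN_ge0 z).
  by move: h; rewrite /bad_fun => h [[[[[]]]]]; split; lra.
have [hG hNn] : psiG z < 1 /\ psiN z < 1.
  have := (psi2_ge0 z, psi3_ge0 z, psi3'_ge0 z, psi4_ge0 z, psiG_ge0 z, psiN_ge0 z).
  by move: h; rewrite /bad_fun => h [[[[[]]]]]; split; lra.
have ne : 0 < nr * eps2 by rewrite mulr_gt0.
have sq x : ((nr * eps2) ^+ 2)^-1 * x ^+ 2 <= 1 -> `|x| <= nr * eps2.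
  rewrite ler_pdivrMl ?exprn_gt0// mulr1 -[x ^+ 2]real_normK ?num_real//.
  by rewrite ler_pXn2r// nnegrE ltW.
split.
- by move: h2; rewrite /psi2 ler_pdivrMl ?mulr1// mulr_gt0// exprn_gt0.
- have := sq _ h3; rewrite ler_norml => /andP[_].
  rewrite sumrB big_const_seq count_predT iter_addr addr0 size_nlist -mulr_natr -/nr.
  have := ler_wpM2r (ltW nr0) a_le; lra.
- exact: sq.
- by move: h4; rewrite /psi4 ler_pdivrMl ?mulr1// exprn_gt0.
split.
  move=> y yy; have : expR (nr * fine (mu0 (ball y)) / 4) * expR (- \sum_(x <- nlist z) (\1_(ball y) x.1 : R)) < 1.
    apply: (le_lt_trans _ hG); rewrite /psiG (big_rem y yy) /= lerDl.
    by apply: sumr_ge0 => w _; rewrite mulr_ge0 ?expR_ge0.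
  rewrite -expRD expR_lt1 subr_lt0 => /ltW; apply: le_trans.
  have : pm * fine (mu (ball y)) <= fine (mu0 (ball y)).
    by rewrite -lee_fin fineK ?fin_num_measure//; exact: hge.
  move=> /(ler_wpM2l (ltW nr0)); lra.
move=> x xz Nx; move: hNn; rewrite /psiN (big_rem x xz) /= indicE mem_set//=.
rewrite ltNge => /negP; apply; rewrite lerDl; apply: sumr_ge0 => w _; by rewrite indicE.
Qed.

End bad_event.

(** * Cost of recentring the prior *)

Section evidence_sum.
Context {R : realType} {dX} {X : measurableType dX}.
Notation RR := (measurableTypeR R).
Variables (mu : {finite_measure set X -> \bar R}) (d : R) (lam : nat -> R) (u : nat -> X -> R).
Variables (N : set X) (K : R).
Hypothesis SD : spectral_data mu d lam u N K.
Hypothesis ES : eigen_system mu lam u.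
Hypothesis d0 : 0 < d.
Variables (sg : R) (f0 : X -> R).
Hypothesis Lf0 : L2 mu f0.
Variables (J0 J1 : nat) (L0 L1 t1 t2 tau : R).
Hypothesis hL0 : forall j, (j < J0)%N -> lam j <= L0.
Hypothesis hL1 : forall j, (J1 <= j)%N -> L1 <= lam j.
Hypothesis L10 : 0 <= L1.
Hypothesis t10 : 0 < t1.
Hypothesis t21 : t2 <= 1.
Hypothesis tau0 : 0 < tau.
Hypothesis tau1 : tau <= 1.

Let lam0 j : 0 <= lam j. Proof. exact: (eigen_lam_ge0 ES). Qed.
Let K0 : 0 < K. Proof. by case: SD. Qed.

(** The coordinates below J1 are concentrated; above J1 the heat factor already makes the prior
    negligible and the law is left unchanged, at no divergence cost. *)
Definition tau_fun (j : nat) : R := if (j < J1)%N then tau else 1.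

Lemma tau_fun_gt0 j : 0 < tau_fun j.
Proof. by rewrite /tau_fun; case: ifP. Qed.

(** First the spread of the recentred law as seen by the n data, below and above J1. Then the
    divergence: - ln tau for each concentrated coordinate, and half the squared shift, where
    dividing by the prior deviation costs exp(t lam) <= exp(t2 L0). *)
Definition evid_cost (n : R) : R :=
  n * (tau ^+ 2 * (K / t1 `^ (d / 2)) + expR (- (t1 * L1 / 2)) * (K / (t1 / 2) `^ (d / 2))) / (2 * sg ^+ 2)
  + (J1%:R * - ln tau + 2^-1 * expR (t2 * L0) * dot mu f0 f0).

Lemma evid_sum_le t (D : seq (X * R)) m : t1 <= t <= t2 -> (forall z, z \in D -> ~ N z.1) ->
  \sum_(j < m) (tau_fun j ^+ 2 * (\sum_(z <- D) hb lam u t j z.1 ^+ 2) / (2 * sg ^+ 2) +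
      klg (if (j < J0)%N then coef mu u f0 j * expR (t * lam j / 2) else 0) (tau_fun j)) <=
  evid_cost (size D)%:R.
Proof.
move=> /andP[t1t tt2] hD; have t0 : 0 < t := lt_le_trans t10 t1t.
have t1' : t <= 1 := le_trans tt2 t21.
have d2 : 0 <= d / 2 by rewrite divr_ge0// ltW.
rewrite big_split /=; apply: lerD.
  rewrite -mulr_suml; apply: ler_wpM2r; first by rewrite invr_ge0 mulr_ge0 ?sqr_ge0.
  set A := tau ^+ 2 * _ + _.
  have -> : \sum_(j < m) tau_fun j ^+ 2 * (\sum_(z <- D) hb lam u t j z.1 ^+ 2) =
      \sum_(z <- D) \sum_(j < m) tau_fun j ^+ 2 * hb lam u t j z.1 ^+ 2.
    by rewrite exchange_big /=; apply: eq_bigr => j _; rewrite mulr_sumr.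
  have hz z : z \in D -> \sum_(j < m) tau_fun j ^+ 2 * hb lam u t j z.1 ^+ 2 <= A.
    move=> zD; have Nz := hD _ zD.
    apply: (@le_trans _ _ (tau ^+ 2 * \sum_(j < m) expR (- (t * lam j)) * u j z.1 ^+ 2 +
       expR (- (t1 * L1 / 2)) * \sum_(j < m) expR (- (t / 2 * lam j)) * u j z.1 ^+ 2)).
      rewrite !mulr_sumr -big_split /=; apply: ler_sum => j _; rewrite hb_sqr /tau_fun.
      case: ltnP => hj; first by rewrite lerDl mulr_ge0 ?expR_ge0// mulr_ge0 ?expR_ge0 ?sqr_ge0.
      rewrite expr1n mul1r -[leLHS]add0r; apply: lerD; first by rewrite mulr_ge0 ?sqr_ge0// mulr_ge0 ?expR_ge0 ?sqr_ge0.
      rewrite mulrA ler_wpM2r ?sqr_ge0// -expRD ler_expR.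
      have h1 : t1 * L1 <= t * lam j by apply: ler_pM => //; [exact: ltW|exact: hL1].
      move: h1; lra.
    case: SD => _ _ _ hx _; apply: lerD.
      rewrite ler_wpM2l ?sqr_ge0//; apply: le_trans (hx z.1 t m Nz _) _; first by rewrite t0.
      by rewrite ler_wpM2l ?(ltW K0)// lef_pV2 ?posrE ?powR_gt0// ge0_ler_powR// nnegrE ltW.
    rewrite ler_wpM2l ?expR_ge0//; apply: le_trans (hx z.1 (t / 2) m Nz _) _.
      by rewrite divr_gt0//=; move: t1' t0; lra.
    rewrite ler_wpM2l ?(ltW K0)// lef_pV2 ?posrE ?powR_gt0 ?divr_gt0// ge0_ler_powR ?nnegrE ?divr_ge0 ?(ltW t0) ?(ltW t10) ?(ltW d0)//.
    by rewrite ler_pM2r.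
  elim: (D) hz => [|z s ih] hs; first by rewrite big_nil mul0r.
  rewrite big_cons /= -[(size s).+1]add1n natrD mulrDl mul1r lerD ?hs ?mem_head//.
  by apply: ih => w ws; apply: hs; rewrite in_cons ws orbT.
have lt0 : 0 <= - ln tau by rewrite oppr_ge0 ln_le0.
apply: (@le_trans _ _ (\sum_(j < m) (if (j < J1)%N then - ln tau else 0) +
   \sum_(j < m) 2^-1 * expR (t2 * L0) * coef mu u f0 j ^+ 2)).
  rewrite -big_split /=; apply: ler_sum => j _; rewrite /klg /tau_fun.
  set a := (if (j < J0)%N then _ else _).
  have ha : a ^+ 2 <= expR (t2 * L0) * coef mu u f0 j ^+ 2.
    rewrite /a; case: ifP => hj; last by rewrite expr0n /= mulr_ge0 ?expR_ge0 ?sqr_ge0.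
    rewrite exprMn mulrC ler_wpM2r ?sqr_ge0// expr2 -expRD ler_expR -splitr.
    by apply: ler_pM => //; [exact: ltW|exact: hL0].
  have e1 : ln (tau ^+ 2) = 2 * ln tau by rewrite lnXn// mulr_natl.
  have : tau ^+ 2 <= 1 by rewrite exprn_ile1// ltW.
  rewrite -[2^-1 * _ * _]mulrA; move: ha lt0; set q := expR _ * _; set a2 := a ^+ 2.
  by case: ifP => hj; rewrite ?expr1n ?ln1 ?e1; move: (ln tau) => l; lra.
apply: lerD.
  apply: (@le_trans _ _ ((minn m J1)%:R * - ln tau)); last by rewrite ler_wpM2r// ler_nat geq_minr.
  elim: m => [|m ih]; first by rewrite big_ord0 min0n mul0r.
  rewrite big_ord_recr /=; apply: (le_trans (lerD ih (lexx _))).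
  case: ltnP => hm; last by rewrite addr0 (minn_idPr (leqW hm)).
  by rewrite (minn_idPl hm) -addn1 natrD mulrDl mul1r.
rewrite -mulr_sumr; apply: ler_wpM2l; first by rewrite mulr_ge0 ?expR_ge0 ?invr_ge0.
exact: (bessel ES).
Qed.

End evidence_sum.

(** * Posterior risk at a fixed sample size *)

Section risk.
Context {R : realType} {dX} {X : measurableType dX} {dO} {Om : measurableType dO}.
Notation RR := (measurableTypeR R).
Notation leb := (@lebesgue_measure R).
Variables (mu : {finite_measure set X -> \bar R}) (d : R) (lam : nat -> R) (u : nat -> X -> R).
Variables (N : set X) (K : R).
Hypothesis SD : spectral_data mu d lam u N K.
Hypothesis ES : eigen_system mu lam u.
Hypothesis d0 : 0 < d.
Variables (P : probability Om R) (W : R -> Om -> X -> R).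
Hypothesis GP : forall t, 0 < t -> centered_GP P (W t) (heat_cov lam u t).
Variables (mu0 : probability X R) (sg : R) (f0 : X -> R) (pm pp : R).
Hypothesis sg0 : 0 < sg.
Hypothesis pp0 : 0 < pp.
Hypothesis pm0 : 0 < pm.
Hypothesis hle : forall A, measurable A -> (mu0 A <= (pp * fine (mu A))%:E)%E.
Hypothesis hge : forall A, measurable A -> ((pm * fine (mu A))%:E <= mu0 A)%E.
Hypothesis mf0 : measurable_fun setT f0.
Hypothesis Lf0 : L2 mu f0.
Hypothesis m0 : 0 < fine (mu setT).
Let m := fine (mu setT).
Variables (pi1 : R -> R).
Hypothesis mpi : measurable_fun setT pi1.
Hypothesis pi0 : forall t, 0 < t -> 0 <= pi1 t.
Hypothesis pi_mass : (\int[leb]_(t in [set t : R | (0 < t)%R]) (pi1 t)%:E = 1)%E.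

Variables (n J0 J1 J2 : nat) (eps2 CB Br M2 : R).
Hypothesis n0 : (0 < n)%N.
Hypothesis eps0 : 0 < eps2.
Hypothesis eps1 : eps2 <= 1.
Let nr : R := n%:R.
Let th := coef mu u f0.
Let r0 x := f0 x - lcomb u th J0 x.
Hypothesis J02 : (J0 <= J2)%N.
Hypothesis hr0 : dot mu r0 r0 <= CB * eps2.
Hypothesis hBr : forall x, ~ N x -> r0 x ^+ 2 <= Br.
Hypothesis Br0 : 0 <= Br.

Variables (N' : set X) (ys : seq X) (ball : X -> set X) (vmin kap : R).
Hypothesis mN' : measurable N'.
Hypothesis muN' : mu N' = 0%E.
Hypothesis NN' : N `<=` N'.
Hypothesis mball : forall y, measurable (ball y).
Hypothesis hvmin : forall y, vmin <= fine (mu (ball y)).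
Hypothesis kap0 : 0 < kap.
Hypothesis gram : forall (cc : nat -> R) (xs : seq X) (q : R), 0 <= q ->
  (forall x, x \in xs -> ~ N' x) ->
  (forall y, y \in ys -> q * fine (mu (ball y)) <= \sum_(x <- xs) (\1_(ball y) x : R)) ->
  kap * q * \sum_(j < J2) cc j ^+ 2 <= \sum_(x <- xs) lcomb u cc J2 x ^+ 2.

Variables (tlow L2' T v : R).
Hypothesis tlow0 : 0 < tlow.
Hypothesis hL2 : forall j, (J2 <= j)%N -> L2' <= lam j.
Hypothesis L20 : 0 <= L2'.
Hypothesis hv : expR (- (tlow * L2' / 2)) * (K / (Num.min (tlow / 2) 1) `^ (d / 2)) <= v.
Hypothesis hT1 : nr * (T * (32 * v)) <= eps2 ^+ 2.
Hypothesis hT2 : (m * T + 1) * (32 * v) <= eps2.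

Variables (L0 L1 t1 t2 tau w Pm : R).
Hypothesis hL0 : forall j, (j < J0)%N -> lam j <= L0.
Hypothesis hL1 : forall j, (J1 <= j)%N -> L1 <= lam j.
Hypothesis L10 : 0 <= L1.
Hypothesis t10 : 0 < t1.
Hypothesis t21 : t2 <= 1.
Hypothesis tau0 : 0 < tau.
Hypothesis tau1 : tau <= 1.
Hypothesis w0 : 0 < w.
Hypothesis hw : (w%:E <= \int[leb]_(t in [set t : R | (t1 <= t <= t2)%R]) (pi1 t)%:E)%E.
Hypothesis hPm : (\int[leb]_(t in [set t : R | (0 < t < tlow)%R]) (pi1 t)%:E <= Pm%:E)%E.

Let Bset (f : X -> R) : Prop := (M2%:E < \int[mu0]_x ((f x - f0 x) ^+ 2)%:E)%E.
Let C3 := pp * CB + 1.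
Let ka := kap * (pm / 4).

Definition evid_loss : R :=
  (2 + C3) * nr * eps2 / (2 * sg ^+ 2) + evid_cost mu d K sg f0 J1 L0 L1 t1 t2 tau nr.

(** The term nr^2 / (2 sg^2) appears because the bound is relative to the likelihood of f0, which on
    the good event is at least exp(- nr^2 / (2 sg^2)). *)
Definition num_loss : R :=
  expR (- (num_gap pp eps2 ka C3 CB nr M2 / (2 * sg ^+ 2))) +
  expR (nr ^+ 2 / (2 * sg ^+ 2) - T) * (K / (Num.min tlow 1) `^ (d / 2) * m + 4 * nr + 4 * m).

Definition bad_loss : R :=
  sg ^+ 2 * pp * J2%:R / (nr * eps2) + (Br * pp * CB / (nr * eps2) + (sg ^+ 2 * pp * CB / (nr * eps2) +
   (sg ^+ 2 / nr + (size ys)%:R * expR (- (nr * (pm * vmin) / 4))))).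

Let K0 : 0 < K. Proof. by case: SD. Qed.
Let Lr0 : L2 mu r0. Proof. by apply: L2B => //; exact: (lcomb_L2 ES). Qed.
Let f0E x : f0 x = lcomb u th J0 x + r0 x. Proof. by rewrite /r0 addrC subrK. Qed.
Let nr1 : 1 <= nr. Proof. by rewrite /nr ler1n. Qed.
Let ka0 : 0 < ka. Proof. by rewrite !mulr_gt0. Qed.
Let v0 : 0 < v.
Proof.
by apply: lt_le_trans hv; rewrite mulr_gt0 ?expR_gt0// divr_gt0// powR_gt0// lt_min ltr01 andbT divr_gt0.
Qed.
Let hBr' x : ~ N' x -> r0 x ^+ 2 <= Br. Proof. by move=> h; apply: hBr => /NN'. Qed.

Let bad := bad_fun u mu0 N' r0 eps2 J2 ys ball.

Let lik0E (z : npow (X * RR)%type n) :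
  lik sg f0 (dat f0 z) = expR (- ((\sum_(y <- nlist z) y.2 ^+ 2) / (2 * sg ^+ 2))).
Proof.
have e : \sum_(y <- dat f0 z) (y.2 - f0 y.1) ^+ 2 = \sum_(y <- nlist z) y.2 ^+ 2.
  by rewrite /dat big_map; apply: eq_bigr => y _; rewrite /obs /= addrC addKr.
by rewrite likE e.
Qed.

Let resid_le t x : tlow <= t -> ~ N x -> dot P (resid mu u W t x J2) (resid mu u W t x J2) <= v.
Proof.
move=> ht Nx; have t0 : 0 < t := lt_le_trans tlow0 ht.
have h := resid_var_le SD ES GP t0 Nx hL2.
apply: le_trans hv; apply: (le_trans h); apply: ler_pM; rewrite ?expR_ge0//.
- by rewrite divr_ge0 ?powR_ge0// ltW.
- by rewrite ler_expR lerN2 ler_pM2r// ler_wpM2r.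
rewrite ler_wpM2l ?(ltW K0)// lef_pV2 ?posrE ?powR_gt0 ?lt_min ?ltr01 ?andbT ?divr_gt0//.
rewrite ge0_ler_powR ?nnegrE ?le_min ?ler01 ?andbT ?divr_ge0 ?(ltW t0) ?(ltW d0) ?(ltW tlow0)//.
by rewrite !ge_min lexx orbT andbT ler_pM2r// ht.
Qed.

Let nl0 : 0 <= num_loss.
Proof.
have nr0 : 0 <= nr := le_trans ler01 nr1.
rewrite /num_loss addr_ge0 ?expR_ge0// mulr_ge0 ?expR_ge0//.
rewrite addr_ge0 ?mulr_ge0 ?(ltW m0)// addr_ge0 ?mulr_ge0 ?(ltW m0)// ?invr_ge0 ?powR_ge0//.
exact: ltW.
Qed.

(** On the bad event the posterior is at most 1, hence at most [bad z]; elsewhere [posterior_upper]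
    applies. Both cases are merged into one measurable majorant. *)
Lemma posterior_bad_le (z : npow (X * RR)%type n) :
  ((posterior pi1 P W sg Bset (dat f0 z))%:E <=
   (bad z)%:E + ((expR (- evid_loss) * w)^-1)%:E * (num_loss%:E + small_scale lam u sg f0 pi1 tlow z))%E.
Proof.
have S0 := small_scale_ge0 lam u sg f0 pi0 tlow z.
have b0 : 0 <= bad z by exact: bad_fun_ge0.
have [hb|hb] := leP 1 (bad z).
  apply: (@le_trans _ _ 1%E); first by rewrite lee_fin (posterior_le1 _ _ _ pi0 pi_mass).
  apply: (@le_trans _ _ (bad z)%:E); first by rewrite lee_fin.
  rewrite leeDl//; apply: mule_ge0; last by rewrite adde_ge0.
  by rewrite lee_fin invr_ge0 mulr_ge0 ?expR_ge0// ltW.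
have [g2 g3 g3' g4 [gG gN]] := bad_fun_good pp0 hle hge Lr0 hr0 eps0 mball n0 hb.
have hD y : y \in dat f0 z -> ~ N y.1.
  by move=> /mapP[q qz ->] /= /NN'; exact: gN.
have hN q : q \in nlist z -> ~ N q.1 by move=> qz /NN'; exact: gN.
have hGR (cc : nat -> R) : ka * nr * \sum_(j < J2) cc j ^+ 2 <= \sum_(q <- nlist z) lcomb u cc J2 q.1 ^+ 2.
  have := gram cc (xs := map fst (nlist z)) (q := nr * (pm / 4)).
  rewrite big_map => h; apply: le_trans (h _ _ _).
  - rewrite le_eqVlt; apply/orP; left; apply/eqP; rewrite /ka; ring.
  - by rewrite !mulr_ge0 ?(le_trans ler01 nr1)// ltW.
  - by move=> x /mapP[q qz ->]; exact: gN.
  - by move=> y ys'; rewrite big_map; exact: gG.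
apply: (le_trans _ (leeDr _ _)); last by rewrite lee_fin.
apply: (posterior_upper SD ES GP sg0 mf0 mpi pi0 pi_mass hD tlow0 nl0 _ t10 (expR_gt0 _) _ w0 hw).
  move=> t ht; have t0 : 0 < t := lt_le_trans tlow0 ht.
  (* The largest b allowed by the exponential moment of the residual. *)
  have b0' : 0 < (32 * v)^-1 by rewrite invr_gt0 mulr_gt0.
  have nE : nr = (size (nlist z))%:R by rewrite size_nlist.
  have bv : 32 * (32 * v)^-1 * v <= 1.
    by rewrite le_eqVlt; apply/orP; left; apply/eqP; field; rewrite gt_eqF.
  have := num_upper SD ES GP sg pp0 hle Lf0 m0 J02 f0E hr0 nr1 nE eps0 eps1 ka0 hN g2 g3 g3' g4 hGR M2 t0 b0' v0
    (fun x => resid_le ht (x := x)) bv (T := T).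
  rewrite invrK => h; apply: (le_trans (h hT1 hT2)).
  rewrite lee_fin -/(dat f0 z) /num_loss [leRHS]mulrDr; apply: lerD; first exact: lexx.
  have n20 : 0 < 2 * sg ^+ 2 by rewrite mulr_gt0// exprn_gt0.
  rewrite mulrA; apply: ler_pM; rewrite ?expR_ge0//.
  - rewrite addr_ge0 ?mulr_ge0 ?(ltW m0)// addr_ge0 ?mulr_ge0 ?(ltW m0)// ?invr_ge0 ?powR_ge0 ?(ltW K0)//.
  - by rewrite lik0E -expRD ler_expR addrA lerDr addrC subr_ge0 ler_pM2r// invr_gt0.
  rewrite !lerD2r ler_wpM2r ?(ltW m0)// ler_wpM2l ?(ltW K0)// lef_pV2 ?posrE ?powR_gt0 ?lt_min ?ltr01 ?andbT//.
  rewrite ge0_ler_powR ?nnegrE ?le_min ?ler01 ?andbT ?divr_ge0 ?(ltW t0) ?(ltW d0) ?(ltW tlow0)//.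
  by rewrite !ge_min lexx orbT andbT ht.
move=> t ht; have t0 : 0 < t by case/andP: ht => h _; exact: lt_le_trans h.
have hS := fun m' => evid_sum_le SD ES d0 sg Lf0 hL0 hL1 L10 t10 t21 tau0 tau1 m' ht hD.
have := evid_lower SD ES GP sg0 t0 hD f0E (tau_fun_gt0 J1 tau0) (fun m' _ => hS m').
apply: le_trans; rewrite lee_fin lik0E -expRD ler_expR /evid_loss.
have -> : size (dat f0 z) = n by rewrite size_map size_nlist.
have -> : \sum_(q <- dat f0 z) (q.2 - f0 q.1 + r0 q.1) ^+ 2 =
    \sum_(y <- nlist z) (y.2 ^+ 2 + 2 * (y.2 * r0 y.1) + r0 y.1 ^+ 2).
  rewrite /dat big_map; apply: eq_bigr => y _.
  by rewrite /obs /= [f0 _ + _]addrC addrK sqrrD mulr_natl.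
rewrite -/nr -[leLHS]opprD lerN2 [leRHS]addrA lerD2r -mulrDl; apply: ler_wpM2r.
  by rewrite invr_ge0 mulr_ge0 ?sqr_ge0.
rewrite !big_split /= -mulr_sumr -addrA lerD2l.
move: g3 g3'; rewrite ler_norml => g3 /andP[_ g3']; move: g3 g3'; rewrite /C3; lra.
Qed.

Lemma posterior_risk_le :
  (E0 mu0 f0 sg n (posterior pi1 P W sg Bset) <=
   (bad_loss + (expR (- evid_loss) * w)^-1 * (num_loss + Pm))%:E)%E.
Proof.
set G := posterior _ _ _ _ _.
pose c := (expR (- evid_loss) * w)^-1.
have c0 : 0 <= c by rewrite invr_ge0 mulr_ge0 ?expR_ge0// ltW.
have S0 (z : npow (X * RR)%type n) := small_scale_ge0 lam u sg f0 pi0 tlow z.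
have b0 (z : npow (X * RR)%type n) : 0 <= bad z by exact: bad_fun_ge0.
have mS : measurable_fun setT (fun z : npow (X * RR)%type n => small_scale lam u sg f0 pi1 tlow z).
  exact: (measurable_small_scale ES sg mf0 mpi pi0).
have mb : measurable_fun setT (fun z : npow (X * RR)%type n => (bad z)%:E).
  by apply/measurable_EFinP; exact: (measurable_bad_fun ES mu0 eps2 J2 mN' Lr0 ys mball).
have mS2 : measurable_fun setT (fun z : npow (X * RR)%type n => (num_loss%:E + small_scale lam u sg f0 pi1 tlow z)%E).
  by apply: emeasurable_funD.
have mS3 : measurable_fun setT (fun z : npow (X * RR)%type n => (c%:E * (num_loss%:E + small_scale lam u sg f0 pi1 tlow z))%E).
  by apply: measurable_funeM.
have p3 (z : npow (X * RR)%type n) : (0 <= c%:E * (num_loss%:E + small_scale lam u sg f0 pi1 tlow z))%E.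
  by apply: mule_ge0; [rewrite lee_fin|rewrite adde_ge0].
pose F (z : npow (X * RR)%type n) := ((bad z)%:E + c%:E * (num_loss%:E + small_scale lam u sg f0 pi1 tlow z))%E.
apply: (@le_trans _ _ (\int[npr (noise mu0 sg) n]_z F z)%E).
  apply: E0_le.
  - by move=> s; exact: posterior_ge0.
  - exact: emeasurable_funD.
  - by move=> z; rewrite /F adde_ge0 ?lee_fin.
  - exact: posterior_bad_le.
rewrite ge0_integralD//; last by move=> z _; rewrite lee_fin.
rewrite -/c [leRHS]EFinD; apply: leeD.
  exact: (integral_bad_fun ES (lt0r_neq0 sg0) pp0 pm0 hle hge J2 mN' muN' Lr0 hr0 hBr' Br0 eps0 ys mball hvmin n0).
rewrite ge0_integralZl//; last by move=> z _; rewrite adde_ge0 ?lee_fin.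
rewrite EFinM; apply: lee_wpmul2l; first by rewrite lee_fin.
rewrite ge0_integralD//.
rewrite [leRHS]EFinD; apply: leeD; first by rewrite integral_prob_cst.
exact: le_trans (small_scale_noise ES mu0 sg0 mf0 mpi pi0 tlow n) hPm.
Qed.

End risk.

(** * Asymptotics *)

Section rates.
Context {R : realType}.
Variables (s d l : R).
Hypothesis s0 : 0 < s.
Hypothesis d0 : 0 < d.
Let D := 2 * s + d.
Let kp := d / D.
(** With l = ln n this is ln (n / ln n). In the notation of the overview, [cutoff] is Lam, [sqrate]
    is eps_n^2, [budget] is n eps_n^2, and [scale del] is the t with t Lam = del ln n. Written as
    exponentials in l, they compare through linear inequalities. *)
Definition log_ratio : R := l - ln l.
Let y := log_ratio.
Definition cutoff : R := expR (2 * y / D).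
Definition sqrate : R := expR (- (2 * s * y / D)).
Definition budget : R := expR l * sqrate.
Definition scale (del : R) : R := del * l / cutoff.
Definition prior_exponent (t : R) : R := t `^ (- (d / 2)) * (ln (t^-1)) `^ (1 + d / 2).

Hypothesis l1 : 1 <= l.
Hypothesis hl : ln l <= l / (2 * D).
Hypothesis hl2 : ln l <= l / 2.

Let l0 : 0 < l. Proof. exact: lt_le_trans ltr01 l1. Qed.
Let D0 : 0 < D. Proof. by rewrite addr_gt0// mulr_gt0. Qed.
Let kp0 : 0 < kp. Proof. by rewrite divr_gt0. Qed.
Let kp1 : kp < 1. Proof. by rewrite ltr_pdivrMr// mul1r ltrDr mulr_gt0. Qed.
Let lnl0 : 0 <= ln l. Proof. by rewrite ln_ge0. Qed.
Let y_le : y <= l. Proof. by rewrite gerBl. Qed.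
Let y_ge : l / 2 <= y. Proof. by move: hl2; rewrite /y /log_ratio; lra. Qed.
Let y0 : 0 < y. Proof. by apply: lt_le_trans y_ge; rewrite divr_gt0. Qed.
Let d20 : 0 <= d / 2. Proof. by rewrite divr_ge0// ltW. Qed.

Lemma cutoff_gt0 : 0 < cutoff. Proof. exact: expR_gt0. Qed.

Lemma cutoff_ge1 : 1 <= cutoff.
Proof. by rewrite -expR0 ler_expR divr_ge0 ?mulr_ge0// ltW. Qed.

(** The balance that fixes the rate: n Lam^-s = ln n Lam^(d/2). *)
Lemma budgetE : budget = l * expR (kp * y).
Proof.
rewrite -[X in X * _](@lnK _ l) ?posrE// -expRD /budget /sqrate -expRD; congr expR.
rewrite /kp /y /log_ratio /D; field; rewrite gt_eqF//; exact: D0.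
Qed.

Lemma cutoff_pow : cutoff `^ (d / 2) = expR (kp * y).
Proof.
rewrite -expRM; congr expR; rewrite /kp; field; rewrite gt_eqF//; exact: D0.
Qed.

Lemma cutoff_powN : cutoff `^ (- s) = sqrate.
Proof.
rewrite -expRM; congr expR; field; rewrite gt_eqF//; exact: D0.
Qed.

Lemma sqrate_le1 : sqrate <= 1.
Proof. by rewrite expR_le1 oppr_le0 divr_ge0 ?mulr_ge0// ltW. Qed.

Lemma sqrate_ge : expR (- l) <= sqrate.
Proof.
rewrite ler_expR lerN2 ler_pdivrMr//; apply: (@le_trans _ _ (y * D)).
  by rewrite mulrC ler_wpM2l ?(ltW y0)// /D lerDl ltW.
by rewrite ler_wpM2r// ltW.
Qed.

Lemma expR_kpy_ge1 : 1 <= expR (kp * y).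
Proof. by rewrite -expR0 ler_expR mulr_ge0// ltW. Qed.

Lemma budget_ge : l <= budget.
Proof. by rewrite budgetE ler_peMr ?expR_kpy_ge1// ltW. Qed.

Lemma kpy_le_budget : expR (kp * y) <= budget.
Proof. by rewrite budgetE ler_peMl// expR_ge0. Qed.

Lemma budget_le : budget <= expR l.
Proof. by rewrite /budget ler_piMr ?expR_ge0 ?sqrate_le1. Qed.

(** This selects del = kp as the upper scale for the evidence: there the shift cost exp(t Lam)
    equals n^kp. *)
Lemma expR_kpl_le : expR (kp * l) <= budget.
Proof.
have -> : budget = expR (ln l + kp * y) by rewrite budgetE expRD lnK ?posrE.
rewrite ler_expR; have : kp * ln l <= ln l by rewrite ler_piMl// ltW.
by rewrite /y /log_ratio mulrBr; lra.
Qed.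

Lemma kpy_lin : kp * l / 2 <= expR (kp * y).
Proof.
apply: le_trans (expR_ge1Dx _); apply: (@le_trans _ _ (kp * y)); last by rewrite lerDr.
by rewrite -mulrA ler_wpM2l// ltW.
Qed.

Section scale.
Variable del : R.
Hypothesis del0 : 0 < del.

Lemma scale_gt0 : 0 < scale del.
Proof. by rewrite divr_gt0 ?mulr_gt0// cutoff_gt0. Qed.

Lemma scale_powV : ((scale del) `^ (d / 2))^-1 = (del `^ (d / 2))^-1 * (l `^ (d / 2))^-1 * expR (kp * y).
Proof.
rewrite /scale powRM ?invr_ge0 ?(ltW cutoff_gt0) ?mulr_ge0 ?(ltW l0) ?(ltW del0)//.
rewrite powRM ?(ltW l0) ?(ltW del0)// powR_invl ?cutoff_gt0// cutoff_pow invfM invfM invrK.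
by [].
Qed.

Lemma scale_powV_le : ((scale del) `^ (d / 2))^-1 <= (del `^ (d / 2))^-1 * budget.
Proof.
rewrite scale_powV -mulrA ler_wpM2l ?invr_ge0 ?powR_ge0//.
apply: le_trans kpy_le_budget; rewrite ler_piMl ?expR_ge0// invf_le1 ?powR_gt0//.
exact: powR_ge1.
Qed.

Lemma ln_scale : ln ((scale del)^-1) = 2 * y / D - ln l - ln del.
Proof.
rewrite lnV ?posrE ?scale_gt0// /scale lnM ?posrE ?mulr_gt0 ?invr_gt0 ?cutoff_gt0//.
rewrite lnM ?posrE// lnV ?posrE ?cutoff_gt0// expRK; lra.
Qed.

Lemma ln_scale_le : - ln del <= l -> ln ((scale del)^-1) <= (2 / D + 1) * l.
Proof.
move=> h; rewrite ln_scale.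
have : 2 / D * y <= 2 / D * l by rewrite ler_wpM2l// divr_ge0// ltW.
by have := lnl0; rewrite mulrDl mul1r mulrAC; lra.
Qed.

Hypothesis del1 : del <= 1.

(** The scale is n^(-2/D) up to logarithms, so ln (1/t) has the order of ln n. *)
Lemma ln_scale_ge : l / (2 * D) <= ln ((scale del)^-1).
Proof.
rewrite ln_scale.
have h1 : ln del <= 0 by rewrite ln_le0.
have h2 : D^-1 * (l / 2) <= D^-1 * y by rewrite ler_wpM2l// invr_ge0 ltW.
by move: hl h1 h2; rewrite invfM; move: (ln del) (ln l) => q q'; lra.
Qed.

Lemma scale_lt1 : scale del < 1.
Proof.
have : 0 < ln ((scale del)^-1) by apply: lt_le_trans ln_scale_ge; rewrite divr_gt0// mulr_gt0.
rewrite lnV ?posrE ?scale_gt0// oppr_gt0 => h.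
by rewrite ltNge; apply/negP => h1; move: h; rewrite ltNge ln_ge0.
Qed.

Let powS (x : R) : 0 < x -> (l * x) `^ (1 + d / 2) = l `^ (d / 2) * (l * x `^ (1 + d / 2)).
Proof.
move=> x0; rewrite powRM ?(ltW l0) ?(ltW x0)// powRD ?(gt_eqF l0) ?implybT// powRr1 ?(ltW l0)//.
ring.
Qed.

(** The power t^(-d/2) gives Lam^(d/2) l^(-d/2), and the logarithm gives l^(1 + d/2): the hyperprior
    is shaped so that its exponent at these scales has the order of the budget. *)
Lemma prior_exponent_le : - ln del <= l ->
  prior_exponent (scale del) <= (del `^ (d / 2))^-1 * (2 / D + 1) `^ (1 + d / 2) * budget.
Proof.
move=> h; have x0 : 0 < 2 / D + 1 by rewrite addr_gt0// divr_gt0.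
apply: (@le_trans _ _ (((scale del) `^ (d / 2))^-1 * ((2 / D + 1) * l) `^ (1 + d / 2))).
  rewrite /prior_exponent powRN ler_wpM2l ?invr_ge0 ?powR_ge0//.
  rewrite ge0_ler_powR ?addr_ge0 ?nnegrE ?ln_scale_le//.
    by apply: le_trans ln_scale_ge; rewrite divr_ge0 ?mulr_ge0// ltW.
  by rewrite mulr_ge0// ltW.
rewrite scale_powV [_ * l]mulrC powS// budgetE le_eqVlt; apply/orP; left; apply/eqP.
by field; rewrite !gt_eqF ?powR_gt0.
Qed.

Lemma prior_exponent_ge :
  (del `^ (d / 2))^-1 * ((2 * D)^-1) `^ (1 + d / 2) * budget <= prior_exponent (scale del).
Proof.
have x0 : 0 < (2 * D)^-1 by rewrite invr_gt0 mulr_gt0.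
apply: (@le_trans _ _ (((scale del) `^ (d / 2))^-1 * (l / (2 * D)) `^ (1 + d / 2))); last first.
  rewrite /prior_exponent powRN ler_wpM2l ?invr_ge0 ?powR_ge0//.
  rewrite ge0_ler_powR ?addr_ge0 ?nnegrE ?ln_scale_ge//.
    by rewrite mulr_ge0// ltW.
  by apply: le_trans ln_scale_ge; rewrite mulr_ge0// ltW.
rewrite scale_powV powS// budgetE le_eqVlt; apply/orP; left; apply/eqP.
by field; rewrite !gt_eqF ?powR_gt0.
Qed.

Lemma scale_ratio_ge : ((2 * D)^-1) `^ (d / 2) * (kp * l / 2) <=
  (scale del) `^ (- (d / 2)) * (ln ((scale del)^-1)) `^ (d / 2).
Proof.
have x0 : 0 < (2 * D)^-1 by rewrite invr_gt0 mulr_gt0.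
apply: (@le_trans _ _ (((scale del) `^ (d / 2))^-1 * (l / (2 * D)) `^ (d / 2))); last first.
  rewrite powRN ler_wpM2l ?invr_ge0 ?powR_ge0//.
  rewrite ge0_ler_powR ?nnegrE ?ln_scale_ge//.
    by rewrite mulr_ge0// ltW.
  by apply: le_trans ln_scale_ge; rewrite mulr_ge0// ltW.
rewrite scale_powV powRM ?(ltW l0) ?(ltW x0)//.
have -> : (del `^ (d / 2))^-1 * (l `^ (d / 2))^-1 * expR (kp * y) * (l `^ (d / 2) * ((2 * D)^-1) `^ (d / 2)) =
  ((2 * D)^-1) `^ (d / 2) * ((del `^ (d / 2))^-1 * expR (kp * y)).
  by field; rewrite !gt_eqF ?powR_gt0.
rewrite ler_wpM2l ?powR_ge0//; apply: (le_trans kpy_lin); rewrite ler_peMl ?expR_ge0//.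
have h1 : del `^ (d / 2) <= 1 `^ (d / 2) by rewrite ge0_ler_powR ?nnegrE// ltW.
by rewrite invf_ge1 ?powR_gt0//; rewrite powR1 in h1.
Qed.

End scale.
End rates.

(** * Prior mass of intervals of scales *)

Section prior_bounds.
Context {R : realType}.
Notation leb := (@lebesgue_measure R).
Variables (d : R) (pi1 : R -> R) (c1 c2 a : R).
Hypothesis d0 : 0 < d.
Hypothesis PD : prior_density d pi1 c1 c2 a.

Let d20 : 0 < d / 2. Proof. by rewrite divr_gt0. Qed.
Let mpi : measurable_fun setT pi1. Proof. by case: PD. Qed.
Let c10 : 0 < c1. Proof. by case: PD => _ _ _ [? [? ?]]. Qed.
Let c20 : 0 < c2. Proof. by case: PD => _ _ _ [? [? ?]]. Qed.
Let a0 : 0 < a. Proof. by case: PD => _ _ _ [? [? ?]]. Qed.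

Let lnV_ge0 (t : R) : 0 < t < 1 -> 0 <= ln (t^-1).
Proof. by move=> /andP[t0 t1]; rewrite ln_ge0// invf_ge1// ltW. Qed.

Let lnV_le (t t' : R) : 0 < t -> t <= t' -> ln (t'^-1) <= ln (t^-1).
Proof.
move=> t0 tt; have t0' : 0 < t' := lt_le_trans t0 tt.
by rewrite ler_ln ?posrE ?invr_gt0// lef_pV2.
Qed.

Let powN_le (t t' : R) : 0 < t -> t <= t' -> t' `^ (- (d / 2)) <= t `^ (- (d / 2)).
Proof.
move=> t0 tt; have t0' : 0 < t' := lt_le_trans t0 tt.
by rewrite !powRN lef_pV2 ?posrE ?powR_gt0// ge0_ler_powR ?nnegrE ?(ltW d20) ?(ltW t0) ?(ltW t0').
Qed.

Lemma prior_exponent_homo (t t' : R) : 0 < t -> t <= t' -> t' < 1 -> prior_exponent d t' <= prior_exponent d t.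
Proof.
move=> t0 tt t1; have t0' : 0 < t' := lt_le_trans t0 tt.
have h0 : 0 <= ln (t'^-1) by rewrite lnV_ge0// t0'.
apply: ler_pM; rewrite ?powR_ge0//; first exact: powN_le.
rewrite ge0_ler_powR ?nnegrE ?lnV_le//; first by rewrite addr_ge0// ltW.
exact: le_trans h0 (lnV_le t0 tt).
Qed.

Lemma prior_mass_ge (t1 t2 : R) : 0 < t1 -> t1 <= t2 -> t2 < 1 ->
  ((c1 * expR (- prior_exponent d t1) * (t2 - t1))%:E <= \int[leb]_(t in [set t : R | (t1 <= t <= t2)%R]) (pi1 t)%:E)%E.
Proof.
move=> t10 t12 t21.
have E : [set t : R | (t1 <= t <= t2)%R] = `[t1, t2]%classic by apply/seteqP; split => x /=; rewrite in_itv.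
have -> : ((c1 * expR (- prior_exponent d t1) * (t2 - t1))%:E =
    \int[leb]_(t in [set t : R | (t1 <= t <= t2)%R]) (c1 * expR (- prior_exponent d t1))%:E)%E.
  rewrite E integral_cst//; have := @lebesgue_measure_itv R `[t1, t2]; rewrite /= lte_fin => ->.
  case: ltP => [_|h]; first by rewrite -EFinB.
  by rewrite mule0; congr EFin; have -> : t2 = t1; [apply/eqP; rewrite eq_le h t12|rewrite subrr mulr0].
apply: le_lower_integral => t /= /andP[h1 h2]; first by rewrite lee_fin mulr_ge0 ?expR_ge0// ltW.
have t0 : 0 < t := lt_le_trans t10 h1; have tl1 : t < 1 := le_lt_trans h2 t21.
have t01 : 0 < t < 1 by rewrite t0.
case: PD => _ _ _ _ /(_ t t01) /= /andP[h _]; rewrite lee_fin; apply: le_trans h.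
rewrite ler_wpM2l ?(ltW c10)//; apply: (@le_trans _ _ (1 * expR (- prior_exponent d t))).
  by rewrite mul1r ler_expR lerN2 prior_exponent_homo.
rewrite ler_wpM2r ?expR_ge0// powRN invf_ge1 ?powR_gt0//.
have h3 : t `^ a <= 1 `^ a by rewrite ge0_ler_powR ?nnegrE ?(ltW a0) ?(ltW t0) ?(ltW tl1).
by rewrite powR1 in h3.
Qed.

(** The factor t^-a is exp(a ln (1/t)). The hypothesis makes the exponent at least 2 a ln (1/t) for
    all t below t3, so half of it absorbs this factor and the other half remains. *)
Lemma prior_mass_le (t3 : R) : 0 < t3 -> t3 < 1 ->
  2 * a <= t3 `^ (- (d / 2)) * (ln (t3^-1)) `^ (d / 2) ->
  (\int[leb]_(t in [set t : R | (0 < t < t3)%R]) (pi1 t)%:E <= (c2 * expR (- (prior_exponent d t3 / 2)))%:E)%E.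
Proof.
move=> t30 t31 h3.
have E : [set t : R | (0 < t < t3)%R] = `]0, t3[%classic by apply/seteqP; split => x /=; rewrite in_itv.
apply: (@le_trans _ _ (\int[leb]_(t in [set t : R | (0 < t < t3)%R]) (c2 * expR (- (prior_exponent d t3 / 2)))%:E)%E).
  apply: le_lower_integral => t /= /andP[t0 tt]; first by case: PD => _ h _ _ _; rewrite lee_fin h.
  have t1 : t < 1 := lt_trans tt t31; have t01 : 0 < t < 1 by rewrite t0.
  case: PD => _ _ _ _ /(_ t t01) /= /andP[_ h]; rewrite lee_fin; apply: (le_trans h).
  rewrite ler_wpM2l ?(ltW c20)// -/(prior_exponent d t).
  have Et : prior_exponent d t3 <= prior_exponent d t by rewrite prior_exponent_homo// ltW.
  have ln0 := lnV_ge0 t01.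
  have key : 2 * a * ln (t^-1) <= prior_exponent d t.
    rewrite /prior_exponent powRD; last first.
      by apply/implyP; rewrite gt_eqF// addr_gt0.
    rewrite powRr1// mulrCA [leRHS]mulrC; apply: ler_wpM2r => //; apply: (le_trans h3).
    apply: ler_pM; rewrite ?powR_ge0 ?powN_le ?(ltW tt)//.
    rewrite ge0_ler_powR ?nnegrE ?lnV_le ?(ltW tt) ?(ltW d20)//.
    by rewrite lnV_ge0// t30.
  have -> : t `^ (- a) = expR (a * ln (t^-1)).
    by rewrite powRN -powR_invl// /powR gt_eqF ?invr_gt0.
  by rewrite -expRD ler_expR; move: key Et; rewrite -/(prior_exponent d t); lra.
rewrite E integral_cst//; have := @lebesgue_measure_itv R `]0, t3[; rewrite /= lte_fin t30 => ->.
rewrite -EFinB subr0 lee_fin.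
by rewrite ler_piMr ?mulr_ge0 ?expR_ge0 ?(ltW c20)// ltW.
Qed.

End prior_bounds.

Lemma sum_mul_sqr_le {R : realType} (J : nat) (a b : nat -> R) (B : R) : 0 < B ->
  \sum_(j < J) b j ^+ 2 <= B -> (\sum_(j < J) a j * b j) ^+ 2 <= (\sum_(j < J) a j ^+ 2) * B.
Proof.
move=> B0 hB; set S := \sum_(j < J) a j * b j.
have h := sum_young (index_enum 'I_J) xpredT (fun j : 'I_J => a j) (fun j : 'I_J => S * b j) B0.
have e1 : \sum_(j < J) a j * (S * b j) = S * S by rewrite {3}/S mulr_sumr; apply: eq_bigr => j _; ring.
have e2 : \sum_(j < J) (S * b j) ^+ 2 = S ^+ 2 * \sum_(j < J) b j ^+ 2.
  by rewrite mulr_sumr; apply: eq_bigr => j _; rewrite exprMn.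
rewrite e1 e2 in h.
have h2 : B^-1 * (S ^+ 2 * \sum_(j < J) b j ^+ 2) <= S ^+ 2.
  by rewrite ler_pdivrMl// mulrC ler_wpM2r ?sqr_ge0.
move: h h2; rewrite [B * _]mulrC expr2; lra.
Qed.

Lemma expR_sqr_ge {R : realType} (x : R) : 0 <= x -> x ^+ 2 / 4 <= expR x.
Proof.
move=> x0; have -> : expR x = expR (x / 2) ^+ 2 by rewrite expr2 -expRD -splitr.
have -> : x ^+ 2 / 4 = (x / 2) ^+ 2 by rewrite exprMn exprVn -natrX.
rewrite ler_pXn2r ?nnegrE ?expR_ge0 ?divr_ge0//.
by apply: le_trans (expR_ge1Dx _); rewrite lerDr.
Qed.

(** * Losses measured against the budget *)

Section constants.
Context {R : realType} {dX} {X : measurableType dX} {dO} {Om : measurableType dO}.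
Notation leb := (@lebesgue_measure R).
Variables (mu : {finite_measure set X -> \bar R}) (s d : R) (lam : nat -> R) (u : nat -> X -> R).
Variables (N : set X) (K : R).
Hypothesis SD : spectral_data mu d lam u N K.
Hypothesis ES : eigen_system mu lam u.
Hypothesis d0 : 0 < d.
Hypothesis s0 : 0 < s.
Variables (f0 : X -> R) (CB B0 : R).
Hypothesis Lf0 : L2 mu f0.
Hypothesis CB0 : 0 < CB.
Hypothesis f0B : forall x, `|f0 x| <= B0.
Hypothesis tail : forall (L : R) (J n : nat), 1 <= L -> (forall j, (J <= j)%N -> L < lam j) ->
  \sum_(J <= j < n) coef mu u f0 j ^+ 2 <= CB * L `^ (- s).
Let kp := d / (2 * s + d).
Let F2 := dot mu f0 f0.
Let K0 : 0 < K. Proof. by case: SD. Qed.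
Let D0 : 0 < 2 * s + d. Proof. by rewrite addr_gt0// mulr_gt0. Qed.
Let kp0 : 0 < kp. Proof. by rewrite divr_gt0. Qed.
Let kp1 : kp < 1. Proof. by rewrite ltr_pdivrMr// mul1r ltrDr mulr_gt0. Qed.
Let F20 : 0 <= F2. Proof. exact: dot_ge0. Qed.
Let B00 : 0 <= B0 ^+ 2. Proof. exact: sqr_ge0. Qed.
Let d20 : 0 < d / 2. Proof. by rewrite divr_gt0. Qed.

Variable l : R.
Hypothesis l1 : 1 <= l.
Hypothesis hl : ln l <= l / (2 * (2 * s + d)).
Hypothesis hl2 : ln l <= l / 2.
Let y := log_ratio l.
Let Lam := cutoff s d l.
Let e2 := sqrate s d l.
Let N2 := budget s d l.
Let l0 : 0 < l. Proof. exact: lt_le_trans ltr01 l1. Qed.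
Let Lam1 : 1 <= Lam. Proof. exact: cutoff_ge1. Qed.
Let Lam0 : 0 < Lam. Proof. exact: cutoff_gt0. Qed.
Let N20 : 0 < N2. Proof. exact: lt_le_trans l0 (budget_ge s0 d0 l1 hl2). Qed.
Let Ey0 : 0 < expR (kp * y). Proof. exact: expR_gt0. Qed.
Let EyN : expR (kp * y) = N2 / l. Proof. by rewrite /N2 budgetE// -/kp -/y; field; rewrite gt_eqF. Qed.

Lemma count_le k J : 1 <= k -> (forall j, (j < J)%N -> lam j <= k * Lam) ->
  J%:R <= expR 1 * K * k `^ (d / 2) * expR (kp * y).
Proof.
move=> k1 hJ; have kL : 1 <= k * Lam by rewrite -[leLHS]mulr1; apply: ler_pM.
apply: (le_trans (eigen_count_le SD kL hJ)).
rewrite powRM ?(le_trans ler01 k1) ?(ltW Lam0)// /Lam cutoff_pow// mulrA; exact: lexx.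
Qed.

Lemma resid_proj_le J0 : (forall j, (J0 <= j)%N -> Lam < lam j) ->
  dot mu (fun x => f0 x - lcomb u (coef mu u f0) J0 x) (fun x => f0 x - lcomb u (coef mu u f0) J0 x) <= CB * e2.
Proof.
move=> hJ; apply: (dot_proj_le ES Lf0) => n _.
by rewrite /e2 -cutoff_powN//; apply: tail.
Qed.

(** Cauchy-Schwarz with the pointwise bound on the eigenfunctions. Growth like Lam^(d/2) is
    harmless: the bound enters only a variance, which is divided by n eps_n^2. *)
Lemma resid_sup_le J0 x : (forall j, (j < J0)%N -> lam j <= Lam) -> ~ N x ->
  (f0 x - lcomb u (coef mu u f0) J0 x) ^+ 2 <= (2 * B0 ^+ 2 + 2 * F2 * (expR 1 * K)) * expR (kp * y).
Proof.
move=> hJ Nx.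
have hu := eigen_sup_le SD Nx Lam1 hJ.
rewrite /Lam cutoff_pow// -/kp -/y in hu.
have hB : 0 < expR 1 * K * expR (kp * y) by rewrite !mulr_gt0 ?expR_gt0.
have h1 := sum_mul_sqr_le (coef mu u f0) (b := fun j => u j x) hB hu.
have h2 : \sum_(j < J0) coef mu u f0 j ^+ 2 <= F2 by exact: (bessel ES).
have h3 : lcomb u (coef mu u f0) J0 x ^+ 2 <= F2 * (expR 1 * K * expR (kp * y)).
  by apply: (le_trans h1); rewrite ler_wpM2r// ltW.
have h4 : f0 x ^+ 2 <= B0 ^+ 2 * expR (kp * y).
  apply: (@le_trans _ _ (B0 ^+ 2)); last by rewrite ler_peMr// expR_kpy_ge1.
  by rewrite -[f0 x ^+ 2]real_normK ?num_real// ler_pXn2r ?nnegrE ?(le_trans (normr_ge0 _) (f0B x)).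
have := sqr_ge0 (f0 x + lcomb u (coef mu u f0) J0 x).
rewrite sqrrD sqrrB mulrDl; move: h3 h4; move: (lcomb _ _ _ _) => q; rewrite !mulrA.
move: (f0 x) => p; lra.
Qed.

Section bad.
Variables (sg pm pp b1 Dq K2 vmin n Br sz : R) (J2 : nat).
Hypothesis pm0 : 0 < pm.
Hypothesis pp0 : 0 < pp.
Hypothesis Dq0 : 0 < Dq.
Hypothesis K21 : 1 <= K2.
Hypothesis nE : n = expR l.
Hypothesis hJ2 : forall j, (j < J2)%N -> lam j <= K2 * Lam.
Hypothesis BrE : Br = b1 * expR (kp * y).
Hypothesis sz0 : 0 <= sz.
Hypothesis hsz : sz <= Dq * expR (kp * y).
Hypothesis hv : Dq^-1 / expR (kp * y) <= vmin.
Hypothesis hlD : 32 * Dq / (pm * (1 - kp) ^+ 2) <= l.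

Definition bad_const : R :=
  sg ^+ 2 * pp * (expR 1 * K * K2 `^ (d / 2)) + (b1 * pp * CB + (sg ^+ 2 * pp * CB + (sg ^+ 2 + Dq))).

(** Since n eps_n^2 = l exp(kp y), the terms with numerator of order Lam^(d/2) = exp(kp y) are
    exactly of order 1 / l, and the remaining terms are no larger. *)
Lemma bad_loss_budget :
  sg ^+ 2 * pp * J2%:R / (n * e2) + (Br * pp * CB / (n * e2) + (sg ^+ 2 * pp * CB / (n * e2) +
   (sg ^+ 2 / n + sz * expR (- (n * (pm * vmin) / 4))))) <= bad_const / l.
Proof.
have nE2 : n * e2 = l * expR (kp * y) by rewrite nE; exact: budgetE.
have hn : l <= n by rewrite nE; apply: le_trans (expR_ge1Dx _); rewrite lerDr.
have n0 : 0 < n := lt_le_trans l0 hn.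
have le0 : 0 < l * expR (kp * y) by rewrite mulr_gt0.
rewrite nE2 /bad_const !(mulrDl _ _ l^-1); do 3 ? apply: lerD.
- apply: (@le_trans _ _ (sg ^+ 2 * pp * (expR 1 * K * K2 `^ (d / 2) * expR (kp * y)) / (l * expR (kp * y)))).
    apply: ler_wpM2r; first by rewrite invr_ge0 ltW.
    apply: ler_wpM2l; first by rewrite mulr_ge0 ?sqr_ge0 ?(ltW pp0).
    exact: (count_le K21 hJ2).
  by rewrite le_eqVlt; apply/orP; left; apply/eqP; field; rewrite !gt_eqF.
- by rewrite BrE le_eqVlt; apply/orP; left; apply/eqP; field; rewrite !gt_eqF.
- apply: ler_wpM2l; first by rewrite mulr_ge0 ?(ltW CB0)// mulr_ge0 ?sqr_ge0 ?(ltW pp0).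
  by rewrite lef_pV2 ?posrE// ler_peMr ?(ltW l0)// expR_kpy_ge1.
apply: lerD; first by rewrite ler_wpM2l ?sqr_ge0// lef_pV2 ?posrE.
have k1 : 0 < 1 - kp by rewrite subr_gt0.
have yl : y <= l by rewrite /y /log_ratio gerBl ln_ge0.
have h1 : ((1 - kp) * l) ^+ 2 / 4 <= n / expR (kp * y).
  rewrite nE -expRN -expRD; apply: (le_trans (expR_sqr_ge _)); first by rewrite mulr_ge0// ltW.
  rewrite ler_expR mulrBl mul1r lerD2l lerN2 ler_wpM2l// ltW//.
(* Each ball expects about n / Lam^(d/2) >= n^(1 - kp) points, far more than ln n. This yields a
   factor n^-2 against at most Dq n balls. *)
have h2 : 2 * l <= n * (pm * vmin) / 4.
  have h3 : n / expR (kp * y) * Dq^-1 <= n * vmin.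
    by rewrite -mulrA ler_wpM2l ?(ltW n0)// mulrC.
  have h4 : ((1 - kp) * l) ^+ 2 / 4 / Dq <= n * vmin.
    by apply: le_trans h3; rewrite ler_wpM2r// invr_ge0 ltW.
  have h5 : 2 * l <= pm * (((1 - kp) * l) ^+ 2 / 4 / Dq) / 4.
    move: hlD; rewrite ler_pdivrMr ?mulr_gt0 ?exprn_gt0// => h6.
    rewrite ler_pdivlMr// mulrA ler_pdivlMr// mulrA ler_pdivlMr//.
    have := ler_wpM2l (ltW l0) h6; rewrite exprMn; move: (Dq) (pm) ((1 - kp) ^+ 2) => q p k; rewrite expr2; lra.
  by apply: (le_trans h5); rewrite ler_pM2r// [leRHS]mulrCA ler_wpM2l// ltW.
have h3 : expR (- (n * (pm * vmin) / 4)) <= n ^- 2.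
  have -> : n ^- 2 = expR (- (2 * l)) by rewrite nE -expRM_natl expRN.
  by rewrite ler_expR lerN2.
have h4 : sz <= Dq * n.
  apply: (le_trans hsz); rewrite ler_wpM2l ?(ltW Dq0)// nE ler_expR.
  by apply: le_trans yl; rewrite ler_piMl ?(ltW kp1)//; move: hl2 l0; rewrite /y /log_ratio; lra.
apply: (@le_trans _ _ (Dq * n * n ^- 2)); first by apply: ler_pM; rewrite ?expR_ge0.
have -> : Dq * n * n ^- 2 = Dq / n by field; rewrite gt_eqF.
by rewrite ler_wpM2l ?(ltW Dq0)// lef_pV2 ?posrE.
Qed.
End bad.

Section evidence.
Variables (sg C3 : R) (J1 : nat).
Hypothesis sg0 : 0 < sg.
(** Chosen so that t1 K3 Lam / 2 = l: beyond this frequency the heat factor at the smallest scale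
    used is 1 / n. *)
Let K3 := 4 / kp.
Hypothesis hJ1 : forall j, (j < J1)%N -> lam j <= K3 * Lam.
Let t1 := scale s d l (kp / 2).
Let t2 := scale s d l kp.

Definition evid_const : R :=
  ((2 + C3) + (K / (kp / 2) `^ (d / 2) + K / (kp / 4) `^ (d / 2))) / (2 * sg ^+ 2) +
  (expR 1 * K * K3 `^ (d / 2) + 2^-1 * F2).

Let t1E : t1 = t2 / 2. Proof. by rewrite /t1 /t2 /scale; ring. Qed.
Let t1E4 : t1 / 2 = scale s d l (kp / 4).
Proof. rewrite /t1 /scale; field; rewrite gt_eqF//; exact: Lam0. Qed.

Let s20 : 0 < 2 * sg ^+ 2. Proof. by rewrite mulr_gt0// exprn_gt0. Qed.

Let K31 : 1 <= K3.
Proof. by rewrite ler_pdivlMr// mul1r; move: kp1; lra. Qed.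

(** The deviation tau = 1 / n makes the spread negligible, and its cost ln n for each of the
    O(Lam^(d/2)) coordinates is of the order of the budget. *)
Lemma evid_loss_le (n : R) : n = expR l ->
  (2 + C3) * n * e2 / (2 * sg ^+ 2) + evid_cost mu d K sg f0 J1 Lam (K3 * Lam) t1 t2 (expR (- l)) n <=
  evid_const * N2.
Proof.
move=> nE.
have eL : t2 * Lam = kp * l by rewrite /t2 /scale divfK// gt_eqF.
have eL1 : t1 * (K3 * Lam) / 2 = l.
  by rewrite t1E /K3 [X in _ = X](_ : l = (kp * l) / kp); [rewrite -eL; field; rewrite gt_eqF|field; rewrite gt_eqF].
rewrite /evid_cost eL eL1 expRK opprK nE.
have p1 := scale_powV_le s0 d0 l1 (divr_gt0 kp0 (ltr0n R 2)).
have p2 := scale_powV_le s0 d0 l1 (divr_gt0 kp0 (ltr0n R 4)).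
rewrite -/t1 -/N2 in p1; rewrite -t1E4 -/N2 in p2.
have pk := expR_kpl_le s0 d0 l1; rewrite -/kp -/N2 in pk.
have hJ := count_le K31 hJ1; rewrite EyN in hJ.
have nn : expR l * expR (- l) = 1 by rewrite -expRD subrr expR0.
have q1 : expR l * (expR (- l) ^+ 2 * (K / t1 `^ (d / 2))) <= K / (kp / 2) `^ (d / 2) * N2.
  rewrite expr2 -mulrA mulrA nn mul1r; apply: (@le_trans _ _ (K / t1 `^ (d / 2))).
    by rewrite ler_piMl ?mulr_ge0 ?invr_ge0 ?powR_ge0 ?(ltW K0)// expR_le1 oppr_le0 ltW.
  by rewrite -[leRHS]mulrA ler_wpM2l// ltW.
have q2 : expR l * (expR (- l) * (K / (t1 / 2) `^ (d / 2))) <= K / (kp / 4) `^ (d / 2) * N2.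
  by rewrite mulrA nn mul1r -[leRHS]mulrA ler_wpM2l// ltW.
have q3 : J1%:R * l <= expR 1 * K * K3 `^ (d / 2) * N2.
  by rewrite -ler_pdivlMr// -[leRHS]mulrA.
have q4 : 2^-1 * expR (kp * l) * F2 <= 2^-1 * F2 * N2.
  by rewrite mulrAC ler_wpM2l ?mulr_ge0.
rewrite /evid_const [leRHS]mulrDl [leLHS]addrA; apply: lerD; last first.
  by rewrite [leRHS]mulrDl; exact: lerD q3 q4.
rewrite -mulrDl [leRHS]mulrAC; apply: ler_wpM2r; first by rewrite invr_ge0 ltW.
rewrite mulrDr -mulrA [leRHS]mulrDl [X in _ <= _ + X]mulrDl.
by apply: lerD => //; exact: lerD q1 q2.
Qed.

Variables (pi1 : R -> R) (c1 c2 a : R).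
Hypothesis PD : prior_density d pi1 c1 c2 a.
Let c10 : 0 < c1. Proof. by case: PD => _ _ _ [? [? ?]]. Qed.
Hypothesis hk : - ln (kp / 2) <= l.

(** One summand each for the factor c1, the exponent of the prior density at t1, and the length t1
    of the interval. *)
Definition mass_const : R :=
  `|ln c1| + ((kp / 2) `^ (d / 2))^-1 * (2 / (2 * s + d) + 1) `^ (1 + d / 2) + (2 / (2 * s + d) + 1).

Lemma prior_mass_budget :
  ((expR (- (mass_const * N2)))%:E <= \int[leb]_(t in [set t : R | (t1 <= t <= t2)%R]) (pi1 t)%:E)%E.
Proof.
have k20 : 0 < kp / 2 by rewrite divr_gt0.
have k21 : kp / 2 <= 1 by move: kp1; lra.
have t10 : 0 < t1 by exact: scale_gt0.
have t21 : t2 < 1 by apply: scale_lt1 => //; exact: ltW.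
have t12 : t1 <= t2 by rewrite t1E ler_pdivrMr// ler_peMr ?ler1n// ltW// scale_gt0.
apply: le_trans (prior_mass_ge d0 PD t10 t12 t21); rewrite lee_fin.
have -> : t2 - t1 = t1 by rewrite t1E; lra.
have h1 : expR (- (`|ln c1| * N2)) <= c1.
  rewrite -[leRHS]lnK ?posrE// ler_expR lerNl; apply: (@le_trans _ _ `|ln c1|).
    by rewrite -normrN ler_norm.
  by rewrite ler_peMr// (le_trans l1)// budget_ge.
have h2 : expR (- ((2 / (2 * s + d) + 1) * N2)) <= t1.
  rewrite -[leRHS]lnK ?posrE// ler_expR lerNl -lnV ?posrE//.
  apply: (le_trans (ln_scale_le s0 d0 l1 k20 hk)).
  by rewrite ler_wpM2l ?budget_ge// addr_ge0 ?divr_ge0// ltW.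
have h3 := prior_exponent_le s0 d0 l1 hl hl2 k20 k21 hk; rewrite -/t1 -/N2 in h3.
rewrite /mass_const; move: h2 h3; set q := 2 / (2 * s + d) + 1; set A := _ * q `^ _ => h2 h3.
have -> : - ((`|ln c1| + A + q) * N2) = - (`|ln c1| * N2) + - (A * N2) + - (q * N2) by ring.
rewrite 2!expRD; apply: ler_pM; rewrite ?mulr_ge0 ?expR_ge0//.
by apply: ler_pM; rewrite ?expR_ge0// ler_expR lerN2.
Qed.

End evidence.
End constants.
Lemma exists_small_scale {R : realType} (d D A : R) : 0 < d -> 0 < D -> 0 < A ->
  exists del, 0 < del <= 1 /\ A <= (del `^ (d / 2))^-1 * D.
Proof.
move=> d0 D0 A0; have d20 : 0 < d / 2 by rewrite divr_gt0.
have [h|h] := leP A D.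
  by exists 1; rewrite ltr01 lexx powR1 invr1 mul1r.
have q0 : 0 < D / A by rewrite divr_gt0.
exists ((D / A) `^ (d / 2)^-1); rewrite powR_gt0//=.
have e : (D / A) `^ (d / 2)^-1 `^ (d / 2) = D / A by rewrite -powRrM mulVf ?gt_eqF// powRr1// ltW.
split; last by rewrite e invf_div divfK// gt_eqF.
have : (D / A) `^ (d / 2)^-1 <= 1 `^ (d / 2)^-1.
  by rewrite ge0_ler_powR ?nnegrE ?invr_ge0 ?(ltW d20) ?(ltW q0)// ler_pdivrMr// mul1r ltW.
by rewrite powR1.
Qed.

(** * Constants for small scales and for the numerator *)

Section numerator_constants.
Context {R : realType}.
Notation leb := (@lebesgue_measure R).
Variables (s d K m sg CB C3 ka pp A del l : R).
Hypothesis s0 : 0 < s.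
Hypothesis d0 : 0 < d.
Hypothesis K0 : 0 < K.
Hypothesis m0 : 0 < m.
Hypothesis pp0 : 0 < pp.
Hypothesis A0 : 0 <= A.
Hypothesis del0 : 0 < del.
Hypothesis del1 : del <= 1.
Hypothesis l1 : 1 <= l.
Hypothesis hl : ln l <= l / (2 * (2 * s + d)).
Hypothesis hl2 : ln l <= l / 2.
Let kp := d / (2 * s + d).
Let Lam := cutoff s d l.
Let e2 := sqrate s d l.
Let N2 := budget s d l.
Let n := expR l.
Let tlow := scale s d l del.
Let l0 : 0 < l. Proof. exact: lt_le_trans ltr01 l1. Qed.
Let n0 : 0 < n. Proof. exact: expR_gt0. Qed.
Let n1 : 1 <= n. Proof. by rewrite -expR0 ler_expR ltW. Qed.
Let nn (k : nat) : n ^+ k = expR (k%:R * l). Proof. by rewrite -expRM_natl. Qed.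
Let N20 : 0 < N2. Proof. exact: lt_le_trans l0 (budget_ge s0 d0 l1 hl2). Qed.
Let N2n : N2 <= n. Proof. exact: budget_le. Qed.
Let tl0 : 0 < tlow. Proof. exact: scale_gt0. Qed.
Let tl1 : tlow < 1. Proof. exact: scale_lt1. Qed.
Let nV : n^-1 <= e2. Proof. by rewrite -expRN; exact: sqrate_ge. Qed.

(** The exponent is asked to be twice A + 1 because [prior_mass_le] keeps only half of it. *)
Lemma small_mass_budget (pi1 : R -> R) (c1 c2 a : R) : prior_density d pi1 c1 c2 a ->
  2 * (A + 1) <= (del `^ (d / 2))^-1 * ((2 * (2 * s + d))^-1) `^ (1 + d / 2) ->
  2 * a <= ((2 * (2 * s + d))^-1) `^ (d / 2) * (kp * l / 2) ->
  (\int[leb]_(t in [set t : R | (0 < t < tlow)%R]) (pi1 t)%:E <= (c2 * expR (- ((A + 1) * N2)))%:E)%E.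
Proof.
move=> PD hA ha; have c20 : 0 < c2 by case: PD => _ _ _ [? [? ?]].
have h := le_trans ha (scale_ratio_ge s0 d0 l1 hl hl2 del0 del1).
apply: (le_trans (prior_mass_le d0 PD tl0 tl1 h)); rewrite lee_fin ler_wpM2l ?(ltW c20)// ler_expR lerN2.
have := prior_exponent_ge s0 d0 l1 hl hl2 del0 del1.
have := ler_wpM2r (ltW N20) hA; rewrite -/N2 -/tlow; lra.
Qed.

Definition far_const : R := K * (del `^ (d / 2))^-1 * m + 4 + 4 * m.

(** T = n^3 dominates the loss n^2 / (2 sg^2), the target (A + 1) N2 <= (A + 1) n, and the
    polynomial prefactor, which is absorbed in exp(n). *)
Lemma num_loss_budget (M : R) : (2 * sg ^+ 2)^-1 + A + 2 <= n ->
  A + 1 <= (ka / 4 * (M ^+ 2 / (2 * pp) - 2 - 2 * CB) - (6 + 2 * C3 + 4 / ka)) / (2 * sg ^+ 2) ->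
  expR (- (num_gap pp e2 ka C3 CB n (M ^+ 2 * e2) / (2 * sg ^+ 2))) +
  expR (n ^+ 2 / (2 * sg ^+ 2) - n ^+ 3) * (K / (Num.min tlow 1) `^ (d / 2) * m + 4 * n + 4 * m) <=
  (1 + far_const) * expR (- ((A + 1) * N2)).
Proof.
move=> hn hM; have e20 : 0 < e2 by exact: expR_gt0.
rewrite [leRHS]mulrDl mul1r; apply: lerD.
  rewrite ler_expR lerN2 /num_gap.
  have -> : M ^+ 2 * e2 / (2 * pp * e2) = M ^+ 2 / (2 * pp) by field; rewrite !gt_eqF.
  rewrite -[X in _ <= X / _]mulrA [leRHS]mulrAC; apply: ler_wpM2r => //; exact: ltW.
have -> : Num.min tlow 1 = tlow by apply/min_idPl; exact: ltW.
have h1 : K / tlow `^ (d / 2) * m + 4 * n + 4 * m <= far_const * n.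
  rewrite /far_const [leRHS]mulrDl [X in _ <= X + _]mulrDl; apply: lerD; last by rewrite ler_peMr// mulr_ge0// ltW.
  rewrite lerD2r [leRHS]mulrAC ler_wpM2r ?(ltW m0)// -[leRHS]mulrA ler_wpM2l ?(ltW K0)//.
  apply: (le_trans (scale_powV_le s0 d0 l1 del0)).
  by rewrite ler_wpM2l ?invr_ge0 ?powR_ge0.
have f0 : 0 <= far_const.
  by rewrite /far_const !addr_ge0 ?mulr_ge0 ?invr_ge0 ?powR_ge0 ?(ltW K0) ?(ltW m0).
apply: (@le_trans _ _ (expR (n ^+ 2 / (2 * sg ^+ 2) - n ^+ 3) * (far_const * n))).
  by rewrite ler_wpM2l ?expR_ge0.
rewrite mulrCA ler_wpM2l//; apply: (@le_trans _ _ (expR (n ^+ 2 / (2 * sg ^+ 2) - n ^+ 3) * expR n)).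
  by rewrite ler_wpM2l ?expR_ge0//; apply: le_trans (expR_ge1Dx _); rewrite lerDr.
rewrite -expRD ler_expR.
have h2 : (A + 1) * N2 <= (A + 1) * n by rewrite ler_wpM2l// addr_ge0.
have h3 : ((2 * sg ^+ 2)^-1 + A + 2) * n ^+ 2 <= n * n ^+ 2 by rewrite ler_wpM2r// exprn_ge0// ltW.
have h4 : (A + 2) * n <= (A + 2) * n ^+ 2 by rewrite ler_wpM2l ?addr_ge0// expr2 ler_peMr// ltW.
move: h2 h3 h4; rewrite -exprS; move: (n ^+ 3) (n ^+ 2) ((2 * sg ^+ 2)^-1) => q3 q2 q; lra.
Qed.

Definition small_var : R := n ^- 7 * (K * ((del / 2) `^ (d / 2))^-1).

(** The exponent equals 8 ln n; one power of n is lost to the diagonal bound at time tlow / 2. *)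
Lemma small_var_ge : expR (- (tlow * (16 / del * Lam) / 2)) * (K / (Num.min (tlow / 2) 1) `^ (d / 2)) <= small_var.
Proof.
have Lam0 : 0 < Lam by exact: expR_gt0.
have e1 : tlow * (16 / del * Lam) / 2 = 8 * l by rewrite /tlow /scale -/Lam; field; rewrite !gt_eqF.
have e3 : tlow / 2 = scale s d l (del / 2) by rewrite /tlow /scale -/Lam; field; rewrite gt_eqF.
have -> : Num.min (tlow / 2) 1 = tlow / 2 by apply/min_idPl; move: tl1 tl0; lra.
rewrite e1 e3 expRN -[8 * l]/(8%:R * l) -nn /small_var.
have h := scale_powV_le s0 d0 l1 (divr_gt0 del0 (ltr0n R 2)).
apply: (@le_trans _ _ ((n ^+ 8)^-1 * (K * (((del / 2) `^ (d / 2))^-1 * n)))).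
  rewrite ler_wpM2l ?invr_ge0 ?exprn_ge0 ?(ltW n0)// ler_wpM2l ?(ltW K0)//.
  by apply: (le_trans h); rewrite ler_wpM2l ?invr_ge0 ?powR_ge0.
rewrite le_eqVlt; apply/orP; left; apply/eqP.
by field; rewrite !gt_eqF ?powR_gt0 ?divr_gt0.
Qed.

(** With T = n^3 and variance of order n^-7, both left-hand sides are negative powers of n, to be
    compared with eps_n^2 >= 1 / n. *)
Lemma small_var_cond : 32 * (m + 1) * (K * ((del / 2) `^ (d / 2))^-1) <= n ->
  n * (n ^+ 3 * (32 * small_var)) <= e2 ^+ 2 /\ (m * n ^+ 3 + 1) * (32 * small_var) <= e2.
Proof.
rewrite /small_var; set q := K * _ => hq.
have q0 : 0 < q by rewrite mulr_gt0// invr_gt0 powR_gt0// divr_gt0.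
have nk k : 0 < n ^+ k by rewrite exprn_gt0.
have hq' : 32 * q <= n.
  by apply: le_trans hq; rewrite -!mulrA ler_wpM2l// ler_peMl ?(ltW q0)// lerDr ltW.
split.
  apply: (@le_trans _ _ (n^-1 ^+ 2)); last by rewrite ler_pXn2r ?nnegrE ?invr_ge0 ?expR_ge0.
  have -> : n * (n ^+ 3 * (32 * (n ^- 7 * q))) = 32 * q * n ^- 3 by field; rewrite gt_eqF.
  apply: (@le_trans _ _ (n * n ^- 3)); first by rewrite ler_wpM2r// invr_ge0 ltW.
  by rewrite le_eqVlt; apply/orP; left; apply/eqP; field; rewrite gt_eqF.
apply: le_trans nV.
have h3 : m * n ^+ 3 + 1 <= (m + 1) * n ^+ 3.
  by rewrite mulrDl mul1r lerD2l exprn_ege1.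
apply: (@le_trans _ _ ((m + 1) * n ^+ 3 * (32 * (n ^- 7 * q)))).
  apply: ler_wpM2r => //; apply: mulr_ge0 => //; apply: mulr_ge0; last exact: ltW.
  by rewrite invr_ge0 ltW.
have -> : (m + 1) * n ^+ 3 * (32 * (n ^- 7 * q)) = 32 * (m + 1) * q * n ^- 4 by field; rewrite gt_eqF.
apply: (@le_trans _ _ (n * n ^- 4)); first by rewrite ler_wpM2r// invr_ge0 ltW.
have -> : n * n ^- 4 = n ^- 3 by field; rewrite gt_eqF.
rewrite lef_pV2 ?posrE//; rewrite -[leLHS]expr1; exact: ler_weXn2l.
Qed.

End numerator_constants.

Lemma ln_le_linear {R : realType} (c l : R) : 0 < c -> 1 <= l -> 4 / c ^+ 2 <= l -> ln l <= c * l.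
Proof.
move=> c0 l1 h; have l0 : 0 < l := lt_le_trans ltr01 l1.
rewrite -ler_expR lnK ?posrE//; apply: le_trans (expR_sqr_ge _); last by rewrite mulr_ge0// ltW.
rewrite exprMn; move: h; rewrite ler_pdivrMr ?exprn_gt0// => /(ler_wpM2l (ltW l0)); rewrite expr2; move: (c ^+ 2) => q.
by rewrite [l ^+ 2]expr2; lra.
Qed.

(** * Choice of the constants and the rate *)

Section risk_rate.
Context {R : realType} {dX} {X : measurableType dX} {dO} {Om : measurableType dO}.
Notation leb := (@lebesgue_measure R).
Variables (mu : {finite_measure set X -> \bar R}) (s d : R) (lam : nat -> R) (u : nat -> X -> R).
Variables (N : set X) (K : R).
Hypothesis SD : spectral_data mu d lam u N K.
Hypothesis ES : eigen_system mu lam u.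
Hypothesis d0 : 0 < d.
Hypothesis s0 : 0 < s.
Variables (P : probability Om R) (W : R -> Om -> X -> R).
Hypothesis GP : forall t, 0 < t -> centered_GP P (W t) (heat_cov lam u t).
Variables (mu0 : probability X R) (sg : R) (f0 : X -> R) (pm pp : R).
Hypothesis sg0 : 0 < sg.
Hypothesis pp0 : 0 < pp.
Hypothesis pm0 : 0 < pm.
Hypothesis hle : forall A, measurable A -> (mu0 A <= (pp * fine (mu A))%:E)%E.
Hypothesis hge : forall A, measurable A -> ((pm * fine (mu A))%:E <= mu0 A)%E.
Hypothesis mf0 : measurable_fun setT f0.
Hypothesis Lf0 : L2 mu f0.
Hypothesis m0 : 0 < fine (mu setT).
Let m := fine (mu setT).
Variables (pi1 : R -> R) (c1 c2 a : R).
Hypothesis PD : prior_density d pi1 c1 c2 a.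
Variables (CB B0 : R).
Hypothesis CB0 : 0 < CB.
Hypothesis f0B : forall x, `|f0 x| <= B0.
Hypothesis tail : forall (L : R) (J n : nat), 1 <= L -> (forall j, (J <= j)%N -> L < lam j) ->
  \sum_(J <= j < n) coef mu u f0 j ^+ 2 <= CB * L `^ (- s).
Variables (rho : X -> X -> R) (kap Dg : R).
Hypothesis mball : forall y r, measurable (rball rho y r).
Hypothesis kap0 : 0 < kap.
Hypothesis Dg0 : 0 < Dg.
Hypothesis gram : forall k : nat, exists (ys : seq X) (r : R) (N' : set X),
  [/\ (size ys)%:R <= Dg / (2^-1 ^+ k) `^ (d / 2),
      forall y, Dg^-1 * (2^-1 ^+ k) `^ (d / 2) <= fine (mu (rball rho y r)),
      measurable N' /\ mu N' = 0%E, N `<=` N'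
    & forall J (cc : nat -> R) (xs : seq X) (q : R),
      (forall j, (j < J)%N -> lam j <= 2^-1 ^- k) -> 0 <= q ->
      (forall x, x \in xs -> ~ N' x) ->
      (forall y, y \in ys ->
        q * fine (mu (rball rho y r)) <= \sum_(x <- xs) (\1_(rball rho y r) x : R)) ->
      kap * q * \sum_(j < J) cc j ^+ 2 <= \sum_(x <- xs) lcomb u cc J x ^+ 2].

Let D := 2 * s + d.
Let kp := d / D.
Let C3 := pp * CB + 1.
Let ka := kap * (pm / 4).
Let K0 : 0 < K. Proof. by case: SD. Qed.
Let D0 : 0 < D. Proof. by rewrite addr_gt0// mulr_gt0. Qed.
Let kp0 : 0 < kp. Proof. by rewrite divr_gt0. Qed.
Let kp1 : kp < 1. Proof. by rewrite ltr_pdivrMr// mul1r ltrDr mulr_gt0. Qed.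
Let ka0 : 0 < ka. Proof. by rewrite !mulr_gt0. Qed.
Let c20 : 0 < c2. Proof. by case: PD => _ _ _ [? [? ?]]. Qed.
Let d20 : 0 < d / 2. Proof. by rewrite divr_gt0. Qed.

(** The exponent, in units of the budget, that the denominator may lose. The numerator has to beat
    it by one unit, hence [A + 1] throughout. *)
Let A := `|evid_const mu s d K f0 sg C3| + `|mass_const s d c1|.
Let A0 : 0 <= A. Proof. by rewrite addr_ge0. Qed.
Let x0 : 0 < (2 * D)^-1. Proof. by rewrite invr_gt0 mulr_gt0. Qed.

Let rateE n l : n%:R = expR l :> R -> 0 < l -> rate s d n ^+ 2 = sqrate s d l.
Proof.
move=> nE l0; rewrite /rate nE expRK; have q0 : 0 < l / expR l by rewrite divr_gt0 ?expR_gt0.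
rewrite -[l / expR l](@lnK _ (l / expR l)) ?posrE// -expRM -expRM_natl /sqrate; congr expR.
rewrite ln_div ?posrE ?expR_gt0// expRK /log_ratio; field; rewrite gt_eqF//; exact: D0.
Qed.

(** The value of M^2 for which the inequality of [M_large] is an equality. *)
Let Q := 2 * pp * (4 / ka * ((A + 1) * (2 * sg ^+ 2) + (6 + 2 * C3 + 4 / ka)) + 2 + 2 * CB).

Let M_large M : 1 + `|Q| < M ->
  A + 1 <= (ka / 4 * (M ^+ 2 / (2 * pp) - 2 - 2 * CB) - (6 + 2 * C3 + 4 / ka)) / (2 * sg ^+ 2).
Proof.
move=> hM; have M1 : 1 <= M by apply: le_trans (ltW hM); rewrite lerDl.
have hQ : Q <= M ^+ 2.
  apply: (@le_trans _ _ M); last by rewrite expr2 ler_peMr// (le_trans ler01).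
  by apply: (le_trans (ler_norm _)); apply: (le_trans _ (ltW hM)); rewrite lerDr.
have s20 : 0 < 2 * sg ^+ 2 by rewrite mulr_gt0// exprn_gt0.
rewrite ler_pdivlMr// lerBrDr -ler_pdivrMl ?divr_gt0//.
have -> : (ka / 4)^-1 = 4 / ka by rewrite invf_div.
have h : Q / (2 * pp) <= M ^+ 2 / (2 * pp) by rewrite ler_pM2r// invr_gt0 mulr_gt0.
have e : Q / (2 * pp) = 4 / ka * ((A + 1) * (2 * sg ^+ 2) + (6 + 2 * C3 + 4 / ka)) + 2 + 2 * CB.
  by rewrite /Q; field; rewrite !gt_eqF.
by move: h; rewrite e; move: (4 / ka * _) => q; lra.
Qed.

Lemma posterior_risk_rate : exists M0 Cc l0, forall M, M0 < M -> forall n : nat, l0 <= ln (n%:R : R) ->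
  (E0 mu0 f0 sg n (posterior pi1 P W sg
     (fun f => ((M * rate s d n) ^+ 2)%:E < \int[mu0]_x ((f x - f0 x) ^+ 2)%:E)%E) <= (Cc / ln (n%:R : R))%:E)%E.
Proof.
have A1 : 0 < 2 * (A + 1) by rewrite mulr_gt0// ltr_wpDl.
have [del [/andP[del0 del1] hdel]] := exists_small_scale d0 (powR_gt0 (1 + d / 2) x0) A1.
(* With this K2 the residual variance is at most a multiple of exp(-8 ln n) n = n^-7. *)
pose K2 := 16 / del.
have K21 : 1 <= K2 by rewrite ler_pdivlMr// mul1r; move: del1; lra.
pose Dq := Dg * (4 * K2) `^ (d / 2).
have Dq0 : 0 < Dq by rewrite mulr_gt0// powR_gt0// mulr_gt0// (lt_le_trans ltr01).
pose b1 := 2 * B0 ^+ 2 + 2 * dot mu f0 f0 * (expR 1 * K).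
have b10 : 0 <= b1.
  apply: addr_ge0; first by rewrite mulr_ge0 ?sqr_ge0.
  by apply: mulr_ge0; [rewrite mulr_ge0 ?dot_ge0|rewrite mulr_ge0 ?expR_ge0 ?(ltW K0)].
pose far := far_const d K m del.
have far0 : 0 <= far.
  by rewrite /far /far_const !addr_ge0 ?mulr_ge0 ?invr_ge0 ?powR_ge0 ?(ltW K0) ?(ltW m0).
exists (1 + `|Q|), (bad_const d K CB sg pp b1 Dq K2 + (1 + far + c2)),
  (* Thresholds for ln n, in this order: ln l <= l / 2, ln l <= l / (2 D), the logarithm of the
     lower evidence scale, the filling of the balls, the factor t^-a of the prior, the domination by
     T = n^3, and the variance of the high frequencies. *)
  (Num.max 16 (Num.max (4 / ((2 * D)^-1) ^+ 2) (Num.max (- ln (kp / 2)) (Num.max (32 * Dq / (pm * (1 - kp) ^+ 2))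
    (Num.max (4 * a / (((2 * D)^-1) `^ (d / 2) * kp)) (Num.max ((2 * sg ^+ 2)^-1 + A + 2)
      (32 * (m + 1) * (K / (del / 2) `^ (d / 2))))))))).
move=> M hM n; set l := ln (n%:R : R).
rewrite !ge_max => /andP[l16 /andP[lD /andP[lk /andP[lDq /andP[la /andP[lA lv]]]]]].
have l1 : 1 <= l by apply: le_trans l16; rewrite ler1n.
have l0 : 0 < l := lt_le_trans ltr01 l1.
have n0 : (0 < n)%N by rewrite lt0n; apply/negP => /eqP n0; move: l0; rewrite /l n0 ln0// ltxx.
have nE : n%:R = expR l :> R by rewrite lnK// posrE ltr0n.
have ln_l : l <= expR l by apply: le_trans (expR_ge1Dx _); rewrite lerDr.
have hl : ln l <= l / (2 * D) by rewrite mulrC; apply: ln_le_linear.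
have hl2 : ln l <= l / 2.
  by rewrite mulrC; apply: ln_le_linear => //; apply: le_trans l16; rewrite exprVn invrK -natrX -natrM ler_nat.
have lA' := le_trans lA ln_l; have lv' := le_trans lv ln_l.
have la' : 2 * a <= ((2 * D)^-1) `^ (d / 2) * (kp * l / 2).
  have aux (q k : R) : 4 * a <= l * (q * k) -> 2 * a <= q * (k * l / 2) by lra.
  apply: aux; rewrite -ler_pdivrMr; first exact: la.
  by apply: mulr_gt0; [exact: powR_gt0|exact: kp0].
pose Lam := cutoff s d l.
have Lam1 : 1 <= Lam by exact: cutoff_ge1.
have Lam0 : 0 < Lam := lt_le_trans ltr01 Lam1.
have [J0 hJ0] := eigen_count SD ES Lam.
have [J1 hJ1] := eigen_count SD ES (4 / kp * Lam).
have [J2 hJ2] := eigen_count SD ES (K2 * Lam).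
have J0l j : (j < J0)%N -> lam j <= Lam by rewrite hJ0.
have J1l j : (j < J1)%N -> lam j <= 4 / kp * Lam by rewrite hJ1.
have J2l j : (j < J2)%N -> lam j <= K2 * Lam by rewrite hJ2.
have J0g j : (J0 <= j)%N -> Lam < lam j by rewrite leqNgt hJ0 -ltNge.
have J1g j : (J1 <= j)%N -> 4 / kp * Lam <= lam j by rewrite leqNgt hJ1 -ltNge => /ltW.
have J2g j : (J2 <= j)%N -> K2 * Lam <= lam j by rewrite leqNgt hJ2 -ltNge => /ltW.
have J02 : (J0 <= J2)%N.
  rewrite leqNgt; apply/negP => h; have := J0l _ h; rewrite leNgt => /negP; apply.
  apply: (@le_lt_trans _ _ (K2 * Lam)); first by rewrite ler_peMl// ltW.
  by rewrite ltNge -hJ2 ltnn.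
have tK : 0 < (K2 * Lam)^-1 <= 1.
  have h : 1 <= K2 * Lam by rewrite -[leLHS]mulr1; apply: ler_pM.
  by rewrite invr_gt0 (lt_le_trans ltr01 h) invf_le1 ?(lt_le_trans ltr01 h).
(* The Gram bound is available at dyadic scales; this one is below 1 / (K2 Lam), so it covers all
   indices under J2, and within a factor 4 of it, so the number of balls keeps its order. *)
have [k [hk1 hk2]] := dyadic_scale tK.
have [ys [r [N' [hsz hvm [mN' muN'] NN' hgram]]]] := gram k.
have k0 : 0 < (2^-1 ^+ k : R) by rewrite exprn_gt0.
have J2k j : (j < J2)%N -> lam j <= 2^-1 ^- k.
  move=> /J2l h; apply: (le_trans h); rewrite -[leLHS]invrK lef_pV2 ?posrE//; last by case/andP: tK.
  by apply: (le_trans hk1); case/andP: tK => h1 _; rewrite ler_pdivrMr// ler_peMr ?ler1n// ltW.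
have powk : (((2^-1 ^+ k : R) `^ (d / 2))^-1) <= (4 * K2) `^ (d / 2) * expR (kp * log_ratio l).
  have K20 : 0 < K2 := lt_le_trans ltr01 K21.
  have p4 : 0 < 4 * K2 * Lam by rewrite mulr_gt0// mulr_gt0.
  have h4 : (4 * K2 * Lam)^-1 <= 2^-1 ^+ k by apply: le_trans hk2; rewrite -mulrA invfM mulrC.
  rewrite -(cutoff_pow l s0 d0) -/Lam -powRM; [|by apply: mulr_ge0 => //; exact: ltW|exact: ltW].
  rewrite -powR_invl ?exprn_gt0//; apply: ge0_ler_powR.
  - exact: ltW.
  - by rewrite nnegrE invr_ge0 ltW.
  - by rewrite nnegrE ltW.
  - by rewrite -[leRHS]invrK lef_pV2 ?posrE ?invr_gt0.
pose Ey := expR (kp * log_ratio l).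
have Ey0 : 0 < Ey by exact: expR_gt0.
have hsz' : (size ys)%:R <= Dq * Ey.
  by apply: (le_trans hsz); rewrite /Dq -mulrA ler_wpM2l// ltW.
have hvm' : Dq^-1 / Ey <= Dg^-1 * (2^-1 ^+ k) `^ (d / 2).
  rewrite /Dq invfM -mulrA ler_wpM2l ?invr_ge0 ?(ltW Dg0)// -invfM -[leRHS]invrK lef_pV2 ?posrE//.
    by rewrite mulr_gt0// powR_gt0// mulr_gt0// (lt_le_trans ltr01).
have mpi : measurable_fun setT pi1 by case: PD.
have pi0 t : 0 < t -> 0 <= pi1 t by case: PD => _ h _ _ _; exact: h.
have pi_mass : (\int[leb]_(t in [set t : R | (0 < t)%R]) (pi1 t)%:E = 1)%E by case: PD.
have gram' (cc : nat -> R) (xs : seq X) (q : R) : 0 <= q ->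
    (forall x, x \in xs -> ~ N' x) ->
    (forall y, y \in ys -> q * fine (mu (rball rho y r)) <= \sum_(x <- xs) (\1_(rball rho y r) x : R)) ->
    kap * q * \sum_(j < J2) cc j ^+ 2 <= \sum_(x <- xs) lcomb u cc J2 x ^+ 2.
  exact: hgram.
have [hT1 hT2] := small_var_cond s0 d0 K0 m0 del0 l1 hl2 lv'.
have hv := small_var_ge s0 d0 K0 del0 del1 l1 hl hl2.
have hw := prior_mass_budget d0 s0 l1 hl hl2 PD lk.
have hPm := small_mass_budget s0 d0 del0 del1 l1 hl hl2 PD hdel la'.
have t10 : 0 < scale s d l (kp / 2) by apply: scale_gt0 => //; rewrite divr_gt0.
have t21 : scale s d l kp <= 1 by apply: ltW; apply: scale_lt1 => //; exact: ltW.
have LK2 : 0 <= K2 * Lam by rewrite mulr_ge0 ?(ltW Lam0)// (le_trans ler01).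
have LK3 : 0 <= 4 / kp * Lam by rewrite mulr_ge0 ?(ltW Lam0)// divr_ge0// ltW.
have tau1 : expR (- l) <= 1 by rewrite expR_le1 oppr_le0 ltW.
have Br0 : 0 <= b1 * Ey by rewrite mulr_ge0// ltW.
have hsup x : ~ N x -> (f0 x - lcomb u (coef mu u f0) J0 x) ^+ 2 <= b1 * Ey.
  exact: (resid_sup_le SD ES d0 s0 Lf0 f0B l1 hl2 J0l).
have rk := posterior_risk_le SD ES d0 GP sg0 pp0 pm0 hle hge mf0 Lf0 m0 mpi pi0 pi_mass (M ^+ 2 * sqrate s d l) n0
  (expR_gt0 _ : 0 < sqrate s d l) (sqrate_le1 s0 d0 l1 hl2) J02 (resid_proj_le ES d0 s0 Lf0 tail l1 hl2 J0g) hsup Br0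
  mN' muN' NN' (mball^~ r) hvm kap0 gram' (scale_gt0 s d l1 del0) J2g LK2 hv.
rewrite nE in rk.
(* Here T = n^3 and tau = 1 / n. *)
have := rk J1 (expR l ^+ 3) hT1 hT2 _ _ _ _ _ _ _ J0l J1g LK3 t10 t21 (expR_gt0 (- l)) tau1 (expR_gt0 _) hw hPm.
rewrite exprMn (rateE nE l0) => h; apply: (le_trans h); rewrite lee_fin.
pose N2 := budget s d l.
have N20 : l <= N2 by exact: budget_ge.
rewrite [leRHS]mulrDl; apply: lerD.
  exact: (bad_loss_budget SD d0 s0 CB0 l1 hl2 sg pm0 pp0 Dq0 K21 nE J2l erefl (ler0n _ _) hsz' hvm' lDq).
have hev : evid_loss mu d K sg f0 pp n J1 (sqrate s d l) CB Lam (4 / kp * Lam) (scale s d l (kp / 2)) (scale s d l kp) (expR (- l))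
    <= evid_const mu s d K f0 sg C3 * N2.
  exact: (evid_loss_le SD d0 s0 f0 l1 hl2 C3 sg0 J1l nE).
have hnum : num_loss mu d K sg pm pp n (sqrate s d l) CB (M ^+ 2 * sqrate s d l) kap (scale s d l del) (expR l ^+ 3)
    <= (1 + far) * expR (- ((A + 1) * N2)).
  by rewrite /num_loss nE; exact: (num_loss_budget s0 d0 K0 m0 pp0 A0 del0 del1 l1 hl hl2 lA' (M_large hM)).
set ev := evid_loss _ _ _ _ _ _ _ _ _ _ _ _ _ _ _ in hev *.
set nl := num_loss _ _ _ _ _ _ _ _ _ _ _ _ _ in hnum *.
have hinv : (expR (- ev) * expR (- (mass_const s d c1 * N2)))^-1 <= expR (A * N2).
  rewrite -expRD -expRN ler_expR opprD [X in X + _]opprK [X in _ + X]opprK /A [leRHS]mulrDl; apply: lerD.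
    by apply: (le_trans hev); rewrite ler_wpM2r ?ler_norm// (le_trans (ltW l0)).
  by rewrite ler_wpM2r ?ler_norm// (le_trans (ltW l0)).
have g0 : 0 <= 1 + far + c2 := addr_ge0 (addr_ge0 ler01 far0) (ltW c20).
apply: (@le_trans _ _ (expR (A * N2) * ((1 + far + c2) * expR (- ((A + 1) * N2))))).
  apply: (@le_trans _ _ ((expR (- ev) * expR (- (mass_const s d c1 * N2)))^-1 * ((1 + far + c2) * expR (- ((A + 1) * N2))))).
    by rewrite ler_wpM2l ?invr_ge0 ?mulr_ge0 ?expR_ge0// [leRHS]mulrDl lerD2r.
  by apply: ler_wpM2r => //; apply: mulr_ge0 => //; exact: expR_ge0.
rewrite mulrCA -expRD; apply: ler_wpM2l => //.
have -> : A * N2 - (A + 1) * N2 = - N2 by ring.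
rewrite expRN lef_pV2 ?posrE ?expR_gt0//.
by apply: (le_trans N20); apply: le_trans (expR_ge1Dx _); rewrite lerDr.
Qed.

End risk_rate.

(** * From the risk bound to the limit *)

Lemma finite_measure_of {R : realType} {dX} {X : measurableType dX} (mu : {measure set X -> \bar R}) :
  (mu setT < +oo)%E -> exists nu : {finite_measure set X -> \bar R}, mu = nu :> {measure set X -> \bar R}.
Proof.
move=> fin; have h : fin_num_fun mu by exact: lty_fin_num_fun.
have sf : sigma_finite setT mu by apply: fin_num_fun_sigma_finite => //; rewrite measure0.
pose H1 := isFinite.Build _ _ _ _ h.
pose H2 := isSFinite.Build _ _ _ _ (sfinite_measure_sigma_finite sf).
pose H3 := isSigmaFinite.Build _ _ _ _ sf.
exists (HB.pack_for (FiniteMeasure.type X R) (Measure.sort mu) H1 H2 H3).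
exact: eq_measure.
Qed.

Lemma cvg_div_ln {R : realType} (c : R) : (fun n : nat => c / ln (n%:R : R)) @ \oo --> (0 : R).
Proof.
apply/cvgr0Pnorm_lt => e e0.
near=> n.
have h : `|c| / e + 1 <= ln (n%:R : R).
  rewrite -[leLHS]expRK ler_ln ?posrE ?expR_gt0//; first by near: n; exact: nbhs_infty_ger.
  by rewrite ltr0n; near: n; exact: nbhs_infty_gt.
have ce : 0 <= `|c| / e by rewrite divr_ge0// ltW.
have l0 : 0 < ln (n%:R : R) by apply: lt_le_trans h; rewrite ltr_wpDl.
rewrite normrM normfV (gtr0_norm l0) ltr_pdivrMr// mulrC -ltr_pdivrMr//.
by apply: lt_le_trans h; rewrite ltrDl.
Unshelve. all: by end_near. Qed.

Unset Implicit Arguments.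

Theorem theorem5 (R : realType) (dX : measure_display) (X : measurableType dX)
  (rho : X -> X -> R) (mu : {measure set X -> \bar R}) (C c d : R)
  (lam : nat -> R) (u : nat -> X -> R) (p : R -> X -> X -> R) (eta : R)
  (mu0 : probability X R) (p0 : X -> R) (pm pp : R)
  (f0 : X -> R) (s sigma : R)
  (pi1 : R -> R) (c1 c2 a : R)
  (dO : measure_display) (Om : measurableType dO) (P : probability Om R)
  (W : R -> Om -> X -> R) :
  dirichlet_setting rho mu C c d lam u p eta ->
  design_density mu u mu0 p0 pm pp ->
  0 < s -> besov rho mu lam u s f0 ->
  0 < sigma ->
  prior_density d pi1 c1 c2 a ->
  (forall t, 0 < t -> centered_GP P (W t) (heat_cov lam u t)) ->
  exists M0 : R, forall M : R, M0 < M ->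
    (fun n => E0 mu0 f0 sigma n
       (posterior pi1 P W sigma
          (fun f => ((M * rate s d n) ^+ 2)%:E < \int[mu0]_x ((f x - f0 x) ^+ 2)%:E)%E))
    @ \oo --> 0%E.
Proof.
move=> DS DD s0 BS sg0 PD GP.
have [[metric cpt borel] _ ah _ _] := DS.
have [nu E] := finite_measure_of (ahlfors_finite metric borel cpt ah).
subst mu; have [_ [_ _ d0 _] _ ES _] := DS.
have [N [mN N0 hN]] := heat_coef DS.
have [K SD] := heat_spectral_data DS mN N0 hN.
have [kap [Dg [kap0 Dg0 gram]]] := gram_lower DS SD hN.
have [uc [B0 f0B] _] := BS.
have mf0 : measurable_fun setT f0 by exact: (unif_cont_measurable borel uc).
have Lf0 : L2 nu f0.
  split => //; apply: (@le_integrable _ _ _ nu setT measurableT _ (fun=> (B0 ^+ 2)%:E)).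
  - by apply/measurable_EFinP; exact: measurable_funX.
  - move=> x _; rewrite /= lee_fin normrX [leRHS]ger0_norm ?sqr_ge0//.
    by rewrite ler_pXn2r ?nnegrE// (le_trans (normr_ge0 _) (f0B x)).
  - exact: finite_measure_integrable_cst.
have [CB CB0 tail] := besov_tail ES (lam_unbounded SD) s0 BS.
have hle := design_le ES DD.
have hge := design_ge ES DD.
have /andP[pm0 pmp] : 0 < pm <= pp by case: DD.
have pp0 : 0 < pp := lt_le_trans pm0 pmp.
(* The design law has total mass 1 and is dominated by a multiple of the reference measure. *)
have m0 : 0 < fine (nu setT).
  have := hle _ measurableT; rewrite probability_setT lee_fin => h.
  by rewrite -(pmulr_rgt0 _ pp0) (lt_le_trans ltr01).
have [M0 [Cc [l0 risk]]] := posterior_risk_rate SD ES d0 s0 GP sg0 pp0 pm0 hle hge mf0 Lf0 m0 PD CB0 f0B tail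
  (measurable_rball metric borel) kap0 Dg0 gram.
exists M0 => M hM.
have pi0 t : 0 < t -> 0 <= pi1 t by case: PD => _ h _ _ _; exact: h.
have pi_mass : (\int[@lebesgue_measure R]_(t in [set t : R | (0 < t)%R]) (pi1 t)%:E = 1)%E by case: PD.
apply: (@squeeze_cvge _ _ _ _ (cst 0%E) _ (fun n => (Cc / ln (n%:R : R))%:E)).
- near=> n; apply/andP; split.
    by apply: E0_ge0 => D; exact: posterior_ge0.
  apply: risk => //; rewrite -[leLHS]expRK ler_ln ?posrE ?expR_gt0//; first by near: n; exact: nbhs_infty_ger.
  by rewrite ltr0n; near: n; exact: nbhs_infty_gt.
- exact: cvg_cst.
- by apply: cvgr_EFin; exact: cvg_div_ln.
Unshelve. all: by end_near. Qed.
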